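(* Let $n,m\ge 1$, let $\Sigma$ be a compact $n$-dimensional (smooth) submanifold of $\mathbb{R}^{n+m}$ without boundary, and let $$d\gamma = (4\pi)^{-\frac n2}\, e^{-\frac{|x|^2}{4}}\, d\mathrm{vol}$$ denote the Gaussian measure on $\Sigma$. Let $\varphi$ be a positive smooth function on $\Sigma$. Then $$\int_\Sigma \varphi\log\varphi\, d\gamma - \int_\Sigma \frac{|\nabla^\Sigma\varphi|^2}{\varphi}\, d\gamma - \int_\Sigma \varphi\,\Big| H + \frac{x^\perp}{2}\Big|^2\, d\gamma \le \bigg(\int_\Sigma \varphi\, d\gamma\bigg)\log\bigg(\int_\Sigma\varphi\, d\gamma\bigg),$$ where $H$ denotes the mean curvature vector of $\Sigma$.
   Context: $\Sigma$ carries the Riemannian metric induced from the Euclidean metric on $\mathbb{R}^{n+m}$; $d\mathrm{vol}$ is the induced volume measure and $\nabla^\Sigma$ the induced gradient. $\Sigma$ is not assumed to be connected. For $x\in\Sigma$, regarded as a position vector in $\mathbb{R}^{n+m}$, $x^\perp$ denotes the orthogonal projection of $x$ to the normal space $T_x^\perp\Sigma$. The second fundamental form $I\!I$ is the symmetric bilinear form on tangent vectors with values in the normal space determined by $\langle I\!I(X,Y),V\rangle = \langle \bar D_X Y, V\rangle = -\langle \bar D_X V, Y\rangle$ for tangent vector fields $X,Y$ and normal vector fields $V$, where $\bar D$ is the standard flat connection on $\mathbb{R}^{n+m}$. The mean curvature vector $H$ is the trace of $I\!I$, i.e. $H=\sum_{i=1}^n I\!I(e_i,e_i)$ for an orthonormal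 basis $e_1,\dots,e_n$ of $T_x\Sigma$ (no factor $1/n$). *)

(* Defs.v *)
From HB Require Import structures.
From mathcomp Require Import all_boot all_order all_algebra.
From mathcomp Require Import all_classical all_reals all_analysis.
From mathcomp Require Import measurable_realfun.

Set Implicit Arguments.
Unset Strict Implicit.
Unset Printing Implicit Defensive.

Import Order.TTheory GRing.Theory Num.Theory.
Import numFieldNormedType.Exports.

Local Open Scope classical_set_scope.
Local Open Scope ring_scope.

Notation borelV R N := (g_sigma_algebraType (@open 'rV[R]_N)).

Section borel_row_vectors.
Context {R : realType}.

Lemma open_borel N (U : set 'rV[R]_N) :
  open U -> measurable (U : set (borelV R N)).
Proof. by move=> oU; exact: sub_sigma_algebra. Qed.

Lemma open_continuous_borel N (U : set 'rV[R]_N) (f : 'rV[R]_N -> R) :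
  open U -> (forall x, U x -> {for x, continuous f}) ->
  measurable_fun (U : set (borelV R N)) f.
Proof.
move=> oU cf; apply: (measurability _ (RGenOpens.measurableE R)).
move=> _ [_ [a [b ->] <-]]; apply: open_borel.
rewrite openE => x [Ux fx]; apply: filterI; first exact: open_nbhs_nbhs.
by apply: (cf x Ux); apply: open_nbhs_nbhs; split=> //; exact: interval_open.
Qed.

Let cube N (p : 'rV[rat]_N * rat) : set 'rV[R]_N :=
  [set x | forall i, `|x 0 i - ratr (p.1 0 i)| < ratr p.2].

Let open_bigcup_cube N (O : set 'rV[R]_N) : open O ->
  O = \bigcup_(p in [set p | cube p `<=` O]) cube p.
Proof.
move=> oO; apply/seteqP; split; last by move=> x [p]; exact.
move=> x Ox; have /nbhs_ballP[e /= e0 eO] : nbhs x O by exact: open_nbhs_nbhs.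
have [r] := @rat_in_itvoo R 0 (e / 2) (divr_gt0 e0 (ltr0Sn _ 1)).
rewrite in_itv/= => /andP[r0 re].
have /all_sig[q qP] (i : 'I_N) : {q : rat | `|x 0 i - ratr q| < ratr r}.
  apply: cid; have [|q] := @rat_in_itvoo R (x 0 i - ratr r) (x 0 i + ratr r).
    by rewrite ltrD2l (lt_trans _ r0)// oppr_lt0.
  by rewrite in_itv/= => h; exists q; rewrite ltr_distlC.
exists (\row_i q i, r) => [|i]/=; last by rewrite mxE.
move=> y /= cy; apply: eO; split=> // i j; rewrite (ord1 i) -ball_normE/=.
have := cy j; rewrite mxE => {}cy.
rewrite [ltRHS]splitr (le_lt_trans (ler_distD (ratr (q j)) _ _))//.
by rewrite ltrD ?(lt_trans (qP _) re)// distrC (lt_trans cy re).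
Qed.

Lemma measurable_fun_rV d (T : measurableType d) N (D : set T)
    (f : T -> 'rV[R]_N) :
  (forall i, measurable_fun D (fun t => f t 0 i)) ->
  measurable_fun D (f : T -> borelV R N).
Proof.
move=> mf mD; apply: (@measurability _ _ T (borelV R N) D f (@open 'rV[R]_N)) => //.
move=> _ [V oV <-]; rewrite (open_bigcup_cube oV) preimage_bigcup setI_bigcupr.
rewrite bigcup_mkcond; apply: countable_bigcupT_measurable => // p.
case: ifPn => // _.
have -> : D `&` f @^-1` cube p = D `&` \bigcap_(i : 'I_N)
    (D `&` (fun t => f t 0 i) @^-1`
       `](ratr (p.1 0 i) - ratr p.2), (ratr (p.1 0 i) + ratr p.2)[).
  apply/seteqP; split=> t [Dt h]; split=> // i.
    by move=> _; split=> //=; rewrite in_itv/= -ltr_distl; exact: h.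
  by have [_] := h i I; rewrite /= in_itv/= -ltr_distl.
apply: measurableI => //; apply: fin_bigcap_measurable => // i _.
by apply: mf => //; exact: measurable_itv.
Qed.

Lemma measurable_coord N i :
  measurable_fun [set: borelV R N] (fun x : 'rV[R]_N => x 0 i).
Proof.
by apply: open_continuous_borel => [|x _]; [exact: openT|exact: coord_continuous].
Qed.

End borel_row_vectors.

Section product_pushforward.
Context d1 d2 d (T1 : measurableType d1) (T2 : measurableType d2)
  (T : measurableType d) (R : realType).
Variables (m1 : {sigma_finite_measure set T1 -> \bar R}).
Variables (m2 : {sigma_finite_measure set T2 -> \bar R}).
Variables (f : T1 * T2 -> T) (g : T -> T1 * T2).
Hypotheses (mf : measurable_fun setT f) (mg : measurable_fun setT g).
Hypothesis fK : cancel f g.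

(* The three proofs are arguments only so that the measure instances below can
   be inferred. *)
Definition product_pushforward
    of measurable_fun setT f & measurable_fun setT g & cancel f g :=
  pushforward (m1 \x m2)%E f.

Let nu := product_pushforward mf mg fK.

HB.instance Definition _ := Measure.copy nu
  (measure_function_pushforward__canonical__measure_function_Measure
    (m1 \x m2)%E mf).

Let nu_sigma_finite : sigma_finite setT nu.
Proof.
have /sigma_finiteP[F [TF ndF Foo]] := sigma_finiteT m1.
have /sigma_finiteP[G [TG ndG Goo]] := sigma_finiteT m2.
exists (fun n => g @^-1` (F n `*` G n)).
  rewrite -preimage_bigcup -[LHS](@preimage_setT _ _ g); congr preimage.
  rewrite -setXTT TF TG predeqE => -[x y]; split.
    move=> [/= [n _ Fnx] [k _ Gky]]; exists (maxn n k) => //; split.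
    - by move: x Fnx; exact/subsetPset/ndF/leq_maxl.
    - by move: y Gky; exact/subsetPset/ndG/leq_maxr.
  by move=> [n _ []/= ? ?]; split; exists n.
move=> n; have [[mF Fn] [mG Gn]] := (Foo n, Goo n); split.
  by rewrite -[X in measurable X]setTI; apply: mg => //; exact: measurableX.
rewrite /nu /product_pushforward /pushforward -comp_preimage.
rewrite (_ : g \o f = id); last by apply/funext => x /=; exact: fK.
by rewrite preimage_id product_measure1E// lte_mul_pinfty// ge0_fin_numE.
Qed.

HB.instance Definition _ :=
  Measure_isSigmaFinite.Build _ _ _ nu nu_sigma_finite.

End product_pushforward.

Section lebesgue_rV.
Context {R : realType}.

Definition cons_rV N (p : measurableTypeR R * borelV R N) : borelV R N.+1 :=
  row_mx (const_mx p.1 : 'rV_1) (p.2 : 'rV_N).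

Lemma measurable_cons_rV N : measurable_fun setT (@cons_rV N).
Proof.
apply: measurable_fun_rV => i; rewrite /cons_rV.
case: (split_ordP (i : 'I_(1 + N))) => j ->.
  apply: (@eq_measurable_fun _ _ _ _ _ fst); last exact: measurable_fst.
  by move=> p _; apply/esym; rewrite [LHS]row_mxEl mxE.
apply: (@eq_measurable_fun _ _ _ _ _
    (fun p : measurableTypeR R * borelV R N => (p.2 : 'rV_N) 0 j)).
  by move=> p _; apply/esym; rewrite [LHS]row_mxEr.
by apply: (measurableT_comp (measurable_coord j)); exact: measurable_snd.
Qed.

Definition uncons_rV N (x : borelV R N.+1) : measurableTypeR R * borelV R N :=
  (x 0 0, rsubmx (x : 'rV_(1 + N))).

Lemma measurable_uncons_rV N : measurable_fun setT (@uncons_rV N).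
Proof.
apply: measurable_fun_pair => /=; first exact: measurable_coord.
apply: measurable_fun_rV => i.
by under eq_fun do rewrite mxE; exact: measurable_coord.
Qed.

Lemma cons_rVK N : cancel (@cons_rV N) (@uncons_rV N).
Proof.
move=> [x v]; rewrite /uncons_rV/= row_mxKr; congr pair.
by rewrite mxE; case: splitP => //= j _; rewrite mxE.
Qed.

(* lambda^(N+1) is the image of lambda (x) lambda^N under (t, v) |-> (t, v). *)
Fixpoint lebesgue_rV N : {sigma_finite_measure set (borelV R N) -> \bar R} :=
  if N is N'.+1 then
    product_pushforward (@lebesgue_measure R) (lebesgue_rV N')
      (@measurable_cons_rV N') (@measurable_uncons_rV N') (@cons_rVK N')
  else @dirac _ (borelV R 0) 0 R.

End lebesgue_rV.

(* Euclidean inner product and squared norm; the library norm `|v| on 'rV is the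
   sup norm, which is used here only through its topology. *)
Definition dot {R : realType} {N} (u v : 'rV[R]_N) : R := (u *m v^T) 0 0.

Definition sqnorm {R : realType} {N} (v : 'rV[R]_N) : R := dot v v.

Section smooth.
Context {R : realType} {n : nat} {V : normedModType R}.

Definition iter_partial (s : seq 'I_n) (f : 'rV[R]_n -> V) : 'rV[R]_n -> V :=
  foldr (fun i g => 'D_(delta_mx 0 i) g) f s.

(* C^oo on an open U: all iterated partial derivatives exist and are continuous
   on U. *)
Definition smooth_on (U : set 'rV[R]_n) (f : 'rV[R]_n -> V) :=
  forall (s : seq 'I_n) u, U u ->
    {for u, continuous (iter_partial s f)} /\
    forall i, derivable (iter_partial s f) u (delta_mx 0 i).

End smooth.

Definition partial_mx {R : realType} {n N} (f : 'rV[R]_n -> 'rV[R]_N)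
    (u : 'rV[R]_n) : 'M[R]_(n, N) :=
  \matrix_(i, j) ('D_(delta_mx 0 i) f u) 0 j.

(* A local parametrization of S: a smooth immersion of an open set of R^n that is
   a homeomorphism onto a relatively open subset of S. *)
Record chart {R : realType} (n N : nat) (S : set 'rV[R]_N) := Chart {
  chart_dom : set 'rV[R]_n ;
  chart_nbd : set 'rV[R]_N ;
  chart_par : 'rV[R]_n -> 'rV[R]_N ;
  chart_coord : 'rV[R]_N -> 'rV[R]_n ;
  chart_dom_open : open chart_dom ;
  chart_nbd_open : open chart_nbd ;
  chart_smooth : smooth_on chart_dom chart_par ;
  chart_immersion : forall u, chart_dom u -> row_free (partial_mx chart_par u) ;
  chart_image : chart_par @` chart_dom = S `&` chart_nbd ;
  chart_parK : forall u, chart_dom u -> chart_coord (chart_par u) = u ;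
  chart_coord_continuous : {within S `&` chart_nbd, continuous chart_coord} }.

(* Embedded, smooth, without boundary (chart domains are open in R^n). *)
Definition is_submanifold {R : realType} (n N : nat) (S : set 'rV[R]_N) :=
  forall x, S x -> exists c : chart n S, chart_nbd c x.

Section volume_measure.
Context {R : realType} (n N : nat) (S : set 'rV[R]_N).
Implicit Types (c : chart n S) (u : 'rV[R]_n).
Local Open Scope ereal_scope.

Definition gram c u : 'M[R]_n :=
  partial_mx (chart_par c) u *m (partial_mx (chart_par c) u)^T.

(* The measure sqrt(det g) du read in one chart, g the induced metric. *)
Definition chart_volume c (A : set (borelV R N)) : \bar R :=
  \int[lebesgue_rV n]_(u in chart_dom c `&` chart_par c @^-1` A)
    (Num.sqrt (\det (gram c u)))%:E.

Definition chart_sums (B : set (borelV R N)) : set (\bar R) :=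
  [set x | exists (I : finType) (c : I -> chart n S) (A : I -> set (borelV R N)),
    [/\ forall i, measurable (A i), trivIset setT A, forall i, A i `<=` B
      & x = \sum_i chart_volume (c i) (A i)]].

(* By the change of variables formula the chart volumes agree on overlaps; the
   supremum of the sums over finite disjoint Borel pieces, each measured in one
   chart, is the measure of B `&` S they glue to. *)
Definition riemannian_volume (B : set (borelV R N)) : \bar R :=
  ereal_sup (chart_sums B).

Let continuous_coord (f : 'rV[R]_n -> 'rV[R]_N) u j :
  {for u, continuous f} -> {for u, continuous (fun v => f v ord0 j)}.
Proof. by move=> cf; exact: (continuous_comp cf (@coord_continuous _ _ _ _ _ _)). Qed.

Let measurable_par c :
  measurable_fun (chart_dom c : set (borelV R n)) (chart_par c : _ -> borelV R N).
Proof.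
apply: measurable_fun_rV => j; apply: open_continuous_borel => [|u cu].
  exact: chart_dom_open.
exact/continuous_coord/(@chart_smooth _ _ _ _ c [::] u cu).1.
Qed.

Let measurable_dens c : measurable_fun (chart_dom c : set (borelV R n))
  (fun u => Num.sqrt (\det (gram c u))).
Proof.
have md i j : measurable_fun (chart_dom c : set (borelV R n))
    (fun u => partial_mx (chart_par c) u i j).
  rewrite (_ : (fun _ => _) =
      fun u => 'D_(delta_mx ord0 i) (chart_par c) u ord0 j).
    by apply: open_continuous_borel => [|u cu]; [exact: chart_dom_open|
      exact/continuous_coord/(@chart_smooth _ _ _ _ c [:: i] u cu).1].
  by apply/funext => u; rewrite mxE.
apply: (measurableT_comp (f := @Num.sqrt R)).
  by apply: continuous_measurable_fun; exact: sqrt_continuous.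
rewrite /determinant; apply: measurable_sum => s.
apply: measurable_funM => //; apply: measurable_prod => i _.
under eq_fun do rewrite mxE.
apply: measurable_sum => k; under eq_fun do rewrite [(_^T)%R _ _]mxE.
exact: measurable_funM.
Qed.

Let chart_volume_ge0 c A : 0 <= chart_volume c A.
Proof. by apply: integral_ge0 => u _; rewrite lee_fin sqrtr_ge0. Qed.

Let chart_volume0 c : chart_volume c set0 = 0.
Proof. by rewrite /chart_volume preimage_set0 setI0 integral_set0. Qed.

Let mdomI c (A : set (borelV R N)) : measurable A ->
  measurable (chart_dom c `&` chart_par c @^-1` A : set (borelV R n)).
Proof.
move=> mA; apply: measurable_par => //.
by apply: open_borel; exact: chart_dom_open.
Qed.

Let chart_volume_bigcup c (A : set (borelV R N)) (F : (set (borelV R N))^nat) :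
  (forall k, measurable (F k)) -> trivIset setT F -> measurable A ->
  A `<=` \bigcup_k F k ->
  chart_volume c A = \sum_(k <oo) chart_volume c (A `&` F k).
Proof.
move=> mF tF mA AF; rewrite /chart_volume.
rewrite -ge0_integral_bigcup//=.
- congr (integral _ _ _); rewrite -setI_bigcupr -preimage_bigcup -setI_bigcupr.
  by rewrite (setIidl AF).
- by move=> k; apply: mdomI; exact: measurableI.
- apply/measurable_EFinP.
  apply: (@measurable_funS _ _ (borelV R n) _ (chart_dom c)) => //.
    by apply: open_borel; exact: chart_dom_open.
  by apply: bigcup_sub => k _; exact: subIsetl.
- apply/trivIsetP => i j _ _ ij; rewrite setIACA setIid -preimage_setI setIACA.
  by move/trivIsetP: tF => ->//; rewrite setI0 preimage_set0 setI0.
Qed.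

Let chart_sums0 B : chart_sums B 0.
Proof.
exists void, (fun i : void => match i with end), (fun=> set0).
split; [by case|by apply/trivIsetP => -[]|by case|by rewrite big1// => -[]].
Qed.

Let volume0 : riemannian_volume set0 = 0.
Proof.
apply/eqP; rewrite eq_le; apply/andP; split; last exact: ereal_sup_ubound.
apply: ge_ereal_sup => _ [I [c [A [_ _ A0 ->]]]].
by rewrite big1// => i _; move: (A0 i); rewrite subset0 => ->.
Qed.

Let volume_ge0 B : 0 <= riemannian_volume B. Proof. exact: ereal_sup_ubound. Qed.

Let volumeU A B : A `&` B = set0 ->
  riemannian_volume A + riemannian_volume B <= riemannian_volume (A `|` B).
Proof.
move=> AB0.
have dAB (X Y : set (borelV R N)) : X `<=` A -> Y `<=` B -> X `&` Y = set0.
  by move=> XA YB; rewrite -subset0 -AB0; exact: setISS.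
have sumsD x y : chart_sums A x -> chart_sums B y -> chart_sums (A `|` B) (x + y).
  move=> [I [c [F [mF tF FA ->]]]] [J [d [G [mG tG GB ->]]]].
  exists (I + J)%type, (fun k => match k with inl i => c i | inr j => d j end),
    (fun k => match k with inl i => F i | inr j => G j end); split.
  - by case.
  - apply/trivIsetP => -[i|i] [j|j] _ _ ij.
    + by move/trivIsetP: tF => ->//; apply: contraNneq ij => ->.
    + exact: dAB.
    + by rewrite setIC; exact: dAB.
    + by move/trivIsetP: tG => ->//; apply: contraNneq ij => ->.
  - by case=> i z => [/FA|/GB]; [left|right].
  - by rewrite big_sumType.
have [->|Moo] := eqVneq (riemannian_volume (A `|` B)) +oo; first by rewrite leey.
have Mfin : riemannian_volume (A `|` B) \is a fin_num by rewrite ge0_fin_numE// ltey.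
have sums_ge0 C x : chart_sums C x -> 0 <= x.
  by move=> [I [c [F [_ _ _ ->]]]]; exact: sume_ge0.
have le_fin x y : 0 <= x -> 0 <= y -> x + y <= riemannian_volume (A `|` B) ->
    x \is a fin_num.
  move=> x0 y0 xy; rewrite ge0_fin_numE// (le_lt_trans _ (_ : riemannian_volume (A `|` B) < +oo))//.
    by rewrite (le_trans _ xy)// leeDl.
  by rewrite ltey.
have xM x : chart_sums A x -> x + riemannian_volume B <= riemannian_volume (A `|` B).
  move=> Ax; have x0 := sums_ge0 _ _ Ax.
  have xfin : x \is a fin_num.
    apply: (le_fin x 0) => //; apply: ereal_sup_ubound; exact: sumsD.
  rewrite addeC -leeBrDr//; apply: ge_ereal_sup => y By.
  by rewrite leeBrDr// addeC; apply: ereal_sup_ubound; exact: sumsD.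
have Bfin : riemannian_volume B \is a fin_num.
  by apply: (le_fin _ 0) => //; rewrite addeC; exact: xM.
rewrite -leeBrDr//; apply: ge_ereal_sup => x Ax.
by rewrite leeBrDr//; exact: xM.
Qed.

Let le_volume A B : A `<=` B -> riemannian_volume A <= riemannian_volume B.
Proof.
move=> AB; apply: ereal_sup_le => x [I [c [F [mF tF FA ->]]]].
by exists I, c, F; split=> // i; exact: subset_trans (FA i) AB.
Qed.

Let volume_sigma_additive : semi_sigma_additive riemannian_volume.
Proof.
move=> F mF tF mUF.
rewrite [X in _ --> X](_ : _ = \sum_(k <oo) riemannian_volume (F k)).
  exact: is_cvg_ereal_nneg_natsum.
apply/eqP; rewrite eq_le; apply/andP; split.
  apply: ge_ereal_sup => _ [I [c [A [mA tA AF ->]]]].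
  under eq_bigr do rewrite (chart_volume_bigcup _ mF tF)//.
  rewrite -nneseries_sum//; apply: lee_nneseries => [k _|k _].
    by move=> _; apply: sume_ge0.
  apply: ereal_sup_ubound; exists I, c, (fun i => A i `&` F k); split=> //.
  - by move=> i; exact: measurableI.
  - apply/trivIsetP => i j _ _ ij; rewrite setIACA.
    by move/trivIsetP: tA => ->//; rewrite set0I.
apply: lime_le; first exact: is_cvg_ereal_nneg_natsum.
apply: nearW => k; apply: (@le_trans _ _ (riemannian_volume (\big[setU/set0]_(i < k) F i))).
  elim: k => [|k ih]; first by rewrite big_geq// big_ord0 volume0.
  rewrite big_nat_recr//= big_ord_recr/=.
  apply: (le_trans _ (volumeU _)); first exact: leeD2r.
  rewrite setIC; apply/seteqP; split=> // x [Fkx].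
  rewrite -bigcup_mkord => -[i /= ik Fix].
  have /trivIsetP/(_ i k I I) := tF; rewrite (ltn_eqF ik) => /(_ isT).
  by move/seteqP => [/(_ x) + _]; apply.
by apply: le_volume; rewrite -bigcup_mkord => x [i _ Fix]; exists i.
Qed.

HB.instance Definition _ := isMeasure.Build _ _ _ riemannian_volume
  volume0 volume_ge0 volume_sigma_additive.

End volume_measure.

Section gaussian.
Context {R : realType} (n N : nat) (S : set 'rV[R]_N).

Definition gaussian_density (x : borelV R N) : R :=
  (4 * pi) `^ (- (n%:R / 2)) * expR (- (sqnorm (x : 'rV[R]_N) / 4)).

Definition gaussian_measure (B : set (borelV R N)) : \bar R :=
  (\int[riemannian_volume n S]_(x in B) (gaussian_density x)%:E)%E.

Let gaussian_density_ge0 x : 0 <= gaussian_density x.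
Proof. by rewrite mulr_ge0 ?powR_ge0// expR_ge0. Qed.

Let measurable_gaussian_density : measurable_fun setT gaussian_density.
Proof.
have msq : measurable_fun setT (fun x : borelV R N => sqnorm (x : 'rV[R]_N)).
  rewrite (_ : (fun _ => _) =
      fun x : borelV R N => \sum_i (x : 'rV_N) 0 i * (x : 'rV_N) 0 i).
    by apply: measurable_sum => i; apply: measurable_funM; exact: measurable_coord.
  apply/funext => x; rewrite /sqnorm /dot mxE.
  by apply: eq_bigr => i _; rewrite mxE.
apply: measurable_funM => //; apply: measurableT_comp => //.
by apply: measurableT_comp => //; exact: measurable_funM.
Qed.

Let gaussian0 : gaussian_measure set0 = 0%E.
Proof. exact: integral_set0. Qed.

Let gaussian_ge0 B : (0 <= gaussian_measure B)%E.
Proof. by apply: integral_ge0 => x _; rewrite lee_fin. Qed.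

Let gaussian_sigma_additive : semi_sigma_additive gaussian_measure.
Proof.
apply: semi_sigma_additive_nng_induced => [|x]; last by rewrite lee_fin.
exact/measurable_EFinP.
Qed.

HB.instance Definition _ := isMeasure.Build _ _ _ gaussian_measure
  gaussian0 gaussian_ge0 gaussian_sigma_additive.

End gaussian.

Section submanifold_geometry.
Context {R : realType} (n N : nat) (S : set 'rV[R]_N).
Implicit Types (x v w : 'rV[R]_N) (phi : 'rV[R]_N -> R).

(* Functions on S are represented by functions on the ambient space; only their
   values on S matter below. In the rest of the section, xget selects a value
   that is unique, or (for orthonormal_frame) one on whose choice the result does
   not depend, whenever S is a submanifold and x is in S. *)
Definition smooth_on_submanifold phi :=
  forall c : chart n S, smooth_on (chart_dom c) (phi \o chart_par c).

(* As in mxalgebra, subspaces are row spaces of matrices. *)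
Definition tangent_space x : 'M[R]_N :=
  xget 0 [set T | exists (c : chart n S) u,
    [/\ chart_dom c u, chart_par c u = x & T = <<partial_mx (chart_par c) u>>%MS]].

Definition normal_space x : 'M[R]_N := kermx (tangent_space x)^T.

(* Projection to the normal space along the tangent space, i.e. the orthogonal
   projection to the normal space. *)
Definition normal_part x v : 'rV[R]_N := v *m proj_mx (normal_space x) (tangent_space x).

(* The tangent vector dual to the differential of phi. *)
Definition gradient phi x : 'rV[R]_N :=
  xget 0 [set v | (v <= tangent_space x)%MS /\
    forall (c : chart n S) u a, chart_dom c u -> chart_par c u = x ->
      dot v ('D_a (chart_par c) u) = 'D_a (phi \o chart_par c) u].

(* <II(v, w), V> = <D_v Y, V> for normal V, where Y is a tangent field near x with
   Y(x) = w; the field is given through a chart c, i.e. Y here is the field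
   composed with chart_par c, so that D_v Y is 'D_a Y u for the coordinates a of
   v. *)
Definition second_fundamental_form x v w : 'rV[R]_N :=
  xget 0 [set z | (z <= normal_space x)%MS /\
    exists (c : chart n S) (u a : 'rV[R]_n) (Y : 'rV[R]_n -> 'rV[R]_N),
    [/\ chart_dom c u /\ chart_par c u = x,
        smooth_on (chart_dom c) Y,
        forall u', chart_dom c u' -> (Y u' <= tangent_space (chart_par c u'))%MS,
        'D_a (chart_par c) u = v /\ Y u = w &
        forall V, (V <= normal_space x)%MS -> dot z V = dot ('D_a Y u) V]].

Definition orthonormal_frame x : 'M[R]_(n, N) :=
  xget 0 [set E | E *m E^T = 1%:M /\ (E :=: tangent_space x)%MS].

Definition mean_curvature x : 'rV[R]_N :=
  \sum_i second_fundamental_form x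
           (row i (orthonormal_frame x)) (row i (orthonormal_frame x)).

End submanifold_geometry.

(* Main.v *)
(* Write N = n + m, let G be the centred Gaussian probability on R^N with variance 2
   in each coordinate, nu = phi gamma and M = nu(Sigma). For r^2 + s^2 = 1 let F_r be
   the density with respect to G of the law of y = r x + s z, where x has law nu and
   z has law G; its entropy E(r), the integral of F_r log F_r dG, is M log M at r = 0.
   The gradient of log F_r is a conditional expectation given y of a function of x
   and z, and by the divergence theorem on Sigma that function may be taken to be,
   up to a scalar factor,
     r (grad phi / phi + H + x^perp / 2) - (r^2 / 2s) z^perp.
   Jensen's inequality bounds the derivative of E accordingly and gives
     E(r) <= M log M + r^2 J - (m M / 2) (r^2 + 2 log s),
   where J is the integral of |grad phi / phi + H + x^perp / 2|^2 dnu, in which the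
   tangential and the normal parts are orthogonal. As s -> 0, Laplace's method yields
     log F_r(r x + s z) + m log s -> log phi(x) - |z^perp|^2 / 4,
   and since the mean of |z^perp|^2 is 2 m, Fatou's lemma turns the bound on E(r) into
   the integral of log phi dnu being at most M log M + J. *)
Require Import Defs.
From HB Require Import structures.
From mathcomp Require Import all_boot all_order all_algebra.
From mathcomp Require Import all_classical all_reals all_analysis.
From mathcomp Require Import measurable_realfun perm ring lra.

Set Implicit Arguments.
Unset Strict Implicit.
Unset Printing Implicit Defensive.

Import Order.TTheory GRing.Theory Num.Theory.
Import numFieldNormedType.Exports.

Local Open Scope classical_set_scope.
Local Open Scope ring_scope.

(** * Gaussian integrals *)

(** The entropy is never differentiated. The interpolation runs along an arc of circle, and one step
    from (r1, s1) to (r2, s2) is estimated by two convexity inequalities: Gibbs' inequality replaces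
    the density at the first angle by the one at the second, and the semiconvexity of its logarithm
    linearizes it along the rotation. The errors are quadratic in the angle and vanish when the arc
    is cut into ever shorter pieces. This part knows of Sigma only a finite measure [nu], bounded
    maps [X] and [a], projectors [Q], and [divergence_identity]. The volume is a supremum over
    pieces measured in arbitrary charts. That two charts agree on their overlap is obtained without
    the change of variables formula: a Gaussian double integral over both charts is symmetric in
    them, and its concentrated limit is, up to a constant, the volume read in either one. The same
    Laplace estimate serves again as s -> 0. The divergence theorem likewise rests on the
    translation invariance of Lebesgue measure, through difference quotients and a partition of
    unity. *)

Section density.
Local Open Scope ereal_scope.
Context d d' (T : measurableType d) (T' : measurableType d') (R : realType).
Variables (mu : {measure set T -> \bar R}) (nu : {measure set T' -> \bar R}).
Import HBNNSimple.

(** One formula for densities ([psi] the identity), for affine maps of the line and for charts. The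
    hypothesis on [nu] is restricted to subsets of [B] because the Riemannian volume is given by a
    chart only inside the neighbourhood of that chart. *)
Lemma ge0_integral_density (D : set T) (psi : T -> T') (h : T -> R) (B : set T')
    (f : T' -> \bar R) :
  measurable D -> measurable_fun D psi -> measurable_fun D h ->
  (forall x, D x -> (0 <= h x)%R) -> measurable B ->
  (forall A, measurable A -> A `<=` B ->
    nu A = \int[mu]_(x in D `&` psi @^-1` A) (h x)%:E) ->
  measurable_fun B f -> (forall y, B y -> 0 <= f y) ->
  \int[nu]_(y in B) f y =
  \int[mu]_(x in D `&` psi @^-1` B) (f (psi x) * (h x)%:E).
Proof.
move=> mD mpsi mh h0 mB nuE mf f0.
have mDB A : measurable A -> measurable (D `&` psi @^-1` A) by move=> mA; exact: mpsi.
have mE := mDB _ mB.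
have mpsi' : measurable_fun (D `&` psi @^-1` B) psi.
  by apply: (measurable_funS mD) => //; exact: subIsetl.
have mh' : measurable_fun (D `&` psi @^-1` B) h.
  by apply: (measurable_funS mD) => //; exact: subIsetl.
pose f_ := nnsfun_approx mB mf.
have mff n : measurable_fun (D `&` psi @^-1` B) (fun x => (f_ n (psi x))%:E).
  apply/measurable_EFinP; apply: (@measurableT_comp _ _ _ _ _ _ (f_ n)) => //.
transitivity (limn (fun n => \int[nu]_(x in B) (f_ n x)%:E)).
  rewrite -monotone_convergence//.
  - apply: eq_integral => y /[!inE] yD; apply/esym/cvg_lim => //.
    exact: cvg_nnsfun_approx.
  - by move=> n; exact/measurable_EFinP/measurable_funTS.
  - by move=> n y _; rewrite lee_fin.
  - by move=> y _ m n mn; rewrite lee_fin; exact/lefP/nd_nnsfun_approx.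
rewrite [X in limn X](_ : _ =
    (fun n => \int[mu]_(x in D `&` psi @^-1` B) ((f_ n (psi x))%:E * (h x)%:E))).
  rewrite -monotone_convergence//.
  - apply: eq_integral => x /[!inE] -[Dx /= Bx]; apply/cvg_lim => //.
    by apply: cvgeZr => //; exact: cvg_nnsfun_approx.
  - by move=> n; apply: emeasurable_funM => //; exact/measurable_EFinP.
  - by move=> n x [Dx _]; rewrite mule_ge0// lee_fin// h0.
  - move=> x [Dx _] m n mn; rewrite lee_wpmul2r ?lee_fin ?h0//.
    exact/lefP/nd_nnsfun_approx.
apply/funext => n.
have H0 (r : R) (x : T) : range (f_ n) r -> D x -> 
    0 <= (r * \1_(f_ n @^-1` [set r]) (psi x))%:E * (h x)%:E.
  by move=> [y _ <-] Dx; rewrite mule_ge0 ?lee_fin ?h0// mulr_ge0.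
under eq_integral do rewrite fimfunE -fsumEFin//.
rewrite ge0_integral_fsum//; last 2 first.
  - by move=> r; apply/measurable_EFinP; apply: measurable_funM.
  - by move=> r y _; exact: nnfun_muleindic_ge0.
under [RHS]eq_integral => x.
  rewrite inE => -[Dx Bx]; rewrite fimfunE -fsumEFin// ge0_mule_fsuml//; last first.
    by move=> r; exact: nnfun_muleindic_ge0.
  over.
rewrite ge0_integral_fsum//; last 2 first.
  - move=> r; apply: emeasurable_funM; last exact/measurable_EFinP.
    apply/measurable_EFinP; apply: measurable_funM => //.
    have mC : measurable (f_ n @^-1` [set r]) by exact: measurable_sfunP.
    exact: (measurableT_comp (measurable_indic mC) mpsi').
  - move=> r x [Dx Bx]; apply: mule_ge0; last by rewrite lee_fin h0.
    exact: nnfun_muleindic_ge0.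
apply: eq_fsbigr => r /[!inE] -[y _ yr].
have r0 : (0 <= r)%R by rewrite -yr.
under eq_integral do rewrite EFinM.
have mC : measurable (f_ n @^-1` [set r]) by exact: measurable_sfunP.
rewrite ge0_integralZl//; last exact/measurable_EFinP/measurable_indic.
rewrite integral_indic//.
under [RHS]eq_integral do rewrite EFinM -muleA.
rewrite ge0_integralZl//; last 2 first.
- apply: emeasurable_funM; last exact/measurable_EFinP.
  apply/measurable_EFinP.
  exact: (measurableT_comp (measurable_indic mC) mpsi').
- by move=> x [Dx Bx]; rewrite mule_ge0 ?lee_fin ?h0.
(* The level set of the simple function is cut with [B], and there the hypothesis on [nu]
   applies. *)
congr (_ * _); rewrite nuE//; last exact: measurableI.
rewrite preimage_setI setICA integral_mkcondl; apply: eq_integral => x _.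
rewrite /patch; case: ifPn => xC; rewrite indicE.
  by rewrite /= mem_set ?mul1e//; move: xC; rewrite inE.
by rewrite memNset ?mul0e//; move=> xC'; move/negP: xC; rewrite inE.
Qed.

End density.

Section measurable_rV.
Context d (T : measurableType d) (R : realType) (D : set T).

Lemma measurable_rV_coord N (f : T -> 'rV[R]_N) i :
  measurable_fun D (f : T -> borelV R N) -> measurable_fun D (fun t => f t 0 i).
Proof. exact: measurableT_comp (measurable_coord i). Qed.

Lemma measurable_rVD N (f g : T -> 'rV[R]_N) :
  measurable_fun D (f : T -> borelV R N) -> measurable_fun D (g : T -> borelV R N) ->
  measurable_fun D (fun t => (f t + g t : borelV R N)).
Proof.
move=> mf mg; apply: measurable_fun_rV => i.
under eq_fun do rewrite mxE.
by apply: measurable_funD; exact: measurable_rV_coord.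
Qed.

Lemma measurable_rVZ N (f : T -> R) (g : T -> 'rV[R]_N) :
  measurable_fun D f -> measurable_fun D (g : T -> borelV R N) ->
  measurable_fun D (fun t => (f t *: g t : borelV R N)).
Proof.
move=> mf mg; apply: measurable_fun_rV => i.
under eq_fun do rewrite mxE.
by apply: measurable_funM => //; exact: measurable_rV_coord.
Qed.

Lemma dotE N (u v : 'rV[R]_N) : dot u v = \sum_i u 0 i * v 0 i.
Proof. by rewrite /dot mxE; apply: eq_bigr => i _; rewrite mxE. Qed.

Lemma measurable_dot N (f g : T -> 'rV[R]_N) :
  measurable_fun D (f : T -> borelV R N) -> measurable_fun D (g : T -> borelV R N) ->
  measurable_fun D (fun t => dot (f t) (g t)).
Proof.
move=> mf mg; under eq_fun do rewrite dotE.
by apply: measurable_sum => i; apply: measurable_funM; exact: measurable_rV_coord.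
Qed.

End measurable_rV.

(** * Translations and dilations of Lebesgue measure *)

Section lebesgue_affine.
Local Open Scope ereal_scope.
Context {R : realType}.
Local Notation lam := (@lebesgue_measure R).

Lemma ge0_integral_affine1 (f : R -> \bar R) (a s : R) : (0 < s)%R ->
  measurable_fun setT f -> (forall x, 0 <= f x) ->
  \int[lam]_t f (a + s * t)%R = (s^-1)%:E * \int[lam]_t f t.
Proof.
move=> s0 mf f0.
pose phi := (fun t : R => a + s * t)%R.
have mphi : measurable_fun [set: measurableTypeR R] (phi : measurableTypeR R -> measurableTypeR R).
  by apply: continuous_measurable_fun => x; apply: cvgD; [exact: cvg_cst|apply: cvgMr].
have nuE A : measurable A -> lam A = s%:E * lam (phi @^-1` A).
  move=> mA.
  pose m := measure_function_pushforward__canonical__measure_function_Measure lam mphi.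
  rewrite -[RHS]/(mscale (NngNum (ltW s0)) m A).
  (* The image of Lebesgue measure under [phi], multiplied by [s], has the right value on half-open
     intervals, and these determine it. *)
  apply: lebesgue_measure_unique => // X [[x y] /= xy <-{X}].
  rewrite /mscale/= /pushforward/=.
  have -> : phi @^-1` `]x, y] = [set` Interval (BRight ((x - a) / s)%R) (BRight ((y - a) / s)%R)].
    apply/seteqP; split => t /=; rewrite !in_itv/= /phi ltr_pdivrMr// ler_pdivlMr//;
    by rewrite [(t * s)%R]mulrC ltrBlDl lerBrDl.
  rewrite !lebesgue_measure_itv/= !lte_fin ltr_pM2r ?invr_gt0// ltrD2r.
  case: ifPn => // _; last by rewrite mule0.
  rewrite -!EFinB -EFinM; congr EFin; field; exact: lt0r_neq0.
rewrite [X in _ = _ * X](@ge0_integral_density _ _ _ _ _ lam lam setT phi (cst s) setT)//.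
- rewrite preimage_setT setIid /=.
  rewrite ge0_integralZr//; last 2 first.
  + exact: (measurableT_comp mf mphi).
  + by rewrite lee_fin ltW.
  by rewrite muleC -muleA -EFinM mulfV ?mule1 ?lt0r_neq0.
- by move=> x _; rewrite ltW.
- move=> A mA _; transitivity (s%:E * lam (phi @^-1` A)); first exact: nuE.
  rewrite setTI; apply/esym/(integral_cst lam _ s%:E).
  by rewrite -[X in measurable X]setTI; exact: mphi.
Qed.

Lemma ge0_integral_rVS N (f : 'rV[R]_N.+1 -> \bar R) :
  measurable_fun setT (f : borelV R N.+1 -> _) -> (forall x, 0 <= f x) ->
  \int[lebesgue_rV N.+1]_x f x =
  \int[lam]_t \int[lebesgue_rV N]_v f (cons_rV (t, v)).
Proof.
move=> mf f0; rewrite /= /product_pushforward.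
rewrite (@ge0_integral_pushforward _ _ _ _ _ _ (@measurable_cons_rV R N))//.
rewrite preimage_setT fubini_tonelli1//; last by move=> x; exact: f0.
exact: (measurableT_comp mf (@measurable_cons_rV R N)).
Qed.

Lemma cons_rV_affine N (a : 'rV[R]_N.+1) (s t : R) (v : 'rV[R]_N) :
  (a + s *: (cons_rV (t, v) : 'rV_N.+1))%R =
  cons_rV ((uncons_rV a).1 + s * t, (uncons_rV a).2 + s *: v)%R.
Proof.
have /= {1}-> : a = cons_rV (uncons_rV a).
  apply/rowP => i; rewrite /cons_rV; case: (split_ordP (i : 'I_(1 + N))) => j ->.
    by rewrite [RHS]row_mxEl mxE ord1; congr (a _ _); exact/val_inj.
  by rewrite [RHS]row_mxEr mxE.
apply/rowP => i; rewrite /cons_rV; case: (split_ordP (i : 'I_(1 + N))) => j ->.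
  by rewrite [LHS]mxE [X in (_ + X)%R = _]mxE [RHS]row_mxEl [X in (X + _)%R]row_mxEl [X in (_ * X)%R]row_mxEl !mxE.
by rewrite [LHS]mxE [X in (_ + X)%R = _]mxE [RHS]row_mxEr [X in (X + _)%R]row_mxEr [X in (_ * X)%R]row_mxEr !mxE.
Qed.

(** Translations and dilations act on each coordinate separately, hence the induction on the
    dimension. They are the only changes of variables on R^n in the whole proof. *)
Lemma ge0_integral_affine N (f : 'rV[R]_N -> \bar R) (a : 'rV[R]_N) (s : R) :
  (0 < s)%R -> measurable_fun setT (f : borelV R N -> _) -> (forall x, 0 <= f x) ->
  \int[lebesgue_rV N]_v f (a + s *: v)%R = ((s ^+ N)^-1)%:E * \int[lebesgue_rV N]_v f v.
Proof.
move=> s0; elim: N f a => [|N IH] f a mf f0.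
  rewrite invr1 mul1e; apply: eq_integral => x _; congr f.
  by apply/rowP => -[].
rewrite !ge0_integral_rVS//; last first.
  apply: (measurableT_comp mf); apply: measurable_rVD => //.
  exact: measurable_rVZ.
have mfc : measurable_fun setT (fun p : measurableTypeR R * borelV R N => f (cons_rV p)).
  exact: (measurableT_comp mf (@measurable_cons_rV R N)).
pose G (t : measurableTypeR R) := \int[lebesgue_rV N]_v f (cons_rV (t, v)).
have mF : measurable_fun setT G.
  exact: (measurable_fun_fubini_tonelli_F (m2 := lebesgue_rV N) _ mfc (fun p => f0 (cons_rV p))).
have G0 t : 0 <= G t by exact: integral_ge0.
transitivity (\int[lam]_t ((s ^- N)%:E * G ((uncons_rV a).1 + s * t)%R)).
  apply: eq_integral => t _.
  under eq_integral do rewrite cons_rV_affine.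
  rewrite (IH (fun v => f (cons_rV ((uncons_rV a).1 + s * t, v)%R)))//.
  exact: (measurableT_comp mfc (measurable_pair1 _)).
rewrite (@ge0_integral_affine1 (fun t => (s ^- N)%:E * G t))//; last 2 first.
- exact: measurable_funeM.
- by move=> t; rewrite mule_ge0// lee_fin invr_ge0 exprn_ge0// ltW.
rewrite ge0_integralZl//; last by rewrite lee_fin invr_ge0 exprn_ge0// ltW.
by rewrite muleA -EFinM exprS invfM.
Qed.

End lebesgue_affine.

(** * Inner product and positive definite forms *)

Section dot_posdef.
Context {R : realType}.

Lemma dot_row_mx N (a b : 'rV[R]_1) (u v : 'rV[R]_N) :
  (dot (row_mx a u) (row_mx b v) = dot a b + dot u v)%R.
Proof. by rewrite /dot tr_row_mx mul_row_col mxE. Qed.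

Lemma dotC N (u v : 'rV[R]_N) : dot u v = dot v u.
Proof. by rewrite !dotE; apply: eq_bigr => i _; rewrite mulrC. Qed.

Lemma dotDl N (u v w : 'rV[R]_N) : (dot (u + v) w = dot u w + dot v w)%R.
Proof. by rewrite /dot mulmxDl mxE. Qed.

Lemma dotZl N a (u v : 'rV[R]_N) : (dot (a *: u) v = a * dot u v)%R.
Proof. by rewrite /dot -scalemxAl mxE. Qed.

Lemma dotNl N (u v : 'rV[R]_N) : (dot (- u) v = - dot u v)%R.
Proof. by rewrite -scaleN1r dotZl mulN1r. Qed.

Lemma dotBl N (u v w : 'rV[R]_N) : (dot (u - v) w = dot u w - dot v w)%R.
Proof. by rewrite dotDl dotNl. Qed.

Lemma dotDr N (u v w : 'rV[R]_N) : (dot w (u + v) = dot w u + dot w v)%R.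
Proof. by rewrite dotC dotDl !(dotC w). Qed.

Lemma dotZr N a (u v : 'rV[R]_N) : (dot v (a *: u) = a * dot v u)%R.
Proof. by rewrite dotC dotZl dotC. Qed.

Lemma dotNr N (u v : 'rV[R]_N) : (dot v (- u) = - dot v u)%R.
Proof. by rewrite dotC dotNl dotC. Qed.

Lemma dotBr N (u v w : 'rV[R]_N) : (dot w (u - v) = dot w u - dot w v)%R.
Proof. by rewrite dotDr dotNr. Qed.

Lemma dot0l N (v : 'rV[R]_N) : dot 0%R v = 0%R.
Proof. by rewrite /dot mul0mx mxE. Qed.

Lemma dot0r N (v : 'rV[R]_N) : dot v 0%R = 0%R.
Proof. by rewrite dotC dot0l. Qed.

Lemma dot_trmx N N' (u : 'rV[R]_N) (A : 'M[R]_(N, N')) (v : 'rV[R]_N') :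
  dot (u *m A) v = dot u (v *m A^T).
Proof. by rewrite /dot trmx_mul trmxK mulmxA. Qed.

Lemma sqnorm_ge0 N (v : 'rV[R]_N) : (0 <= sqnorm v)%R.
Proof. by rewrite /sqnorm dotE sumr_ge0// => i _; rewrite -expr2 sqr_ge0. Qed.

Lemma sqnorm_eq0 N (v : 'rV[R]_N) : (sqnorm v == 0) = (v == 0).
Proof.
apply/eqP/eqP => [|->]; last exact: dot0l.
rewrite /sqnorm dotE => /eqP; rewrite psumr_eq0 => [/allP h|i _]; last by rewrite -expr2 sqr_ge0.
apply/rowP => i; have := h i; rewrite mem_index_enum => /(_ isT).
by rewrite -expr2 sqrf_eq0 mxE => /eqP.
Qed.

Definition posdef N (A : 'M[R]_N) := A^T = A /\ forall v, v != 0 -> (0 < dot (v *m A) v)%R.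

Lemma dot_block N (a : 'M[R]_1) (b : 'rV[R]_N) (C : 'M[R]_N) (t : R) (v : 'rV[R]_N) :
  (dot ((row_mx (const_mx t) v : 'rV_(1 + N)) *m block_mx a b b^T C) (row_mx (const_mx t) v) =
   a 0 0 * t ^+ 2 + 2 * dot b v * t + dot (v *m C) v)%R.
Proof.
rewrite mul_row_block dot_row_mx !dotDl.
have -> : const_mx t = t%:M :> 'M[R]_1 by apply/matrixP => i j; rewrite !mxE !ord1 eqxx.
rewrite !mul_scalar_mx !dotZl.
have d1 (u w : 'rV[R]_1) : (dot u w = u 0 0 * w 0 0)%R by rewrite dotE big_ord1.
rewrite !d1 -/(dot v b) (dotC v b).
rewrite !mxE eqxx /=; ring.
Qed.

(** The form is tested on (1, 0), which gives the corner, and on (t, v) with the t that minimizes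
    it, which leaves the Schur complement at v. *)
Lemma posdef_schur N (a : 'M[R]_1) (b : 'rV[R]_N) (C : 'M[R]_N) :
  posdef (block_mx a b b^T C) ->
  (0 < a 0 0)%R /\ posdef (C - (a 0 0)^-1 *: (b^T *m b)).
Proof.
move=> [sA pA].
have a0 : (0 < a 0 0)%R.
  have := pA (row_mx (const_mx 1) 0); rewrite dot_block dot0r mul0mx dot0l => h.
  have : (0 < a 0 0 * 1 ^+ 2 + 2 * 0 * 1 + 0)%R.
    apply: h; apply/eqP => /(congr1 lsubmx); rewrite row_mxKl => /matrixP/(_ 0 0).
    by rewrite !mxE => /eqP; rewrite oner_eq0.
  by rewrite expr1n !mulr1 mulr0 !addr0.
split => //; split.
  move: sA; rewrite tr_block_mx => /eq_block_mx[_ _ _ sC].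
  by rewrite linearB linearZ/= trmx_mul trmxK sC.
move=> v v0; have := pA (row_mx (const_mx (- dot b v / a 0 0)) v).
rewrite dot_block mulmxBr dotBl -scalemxAr dotZl.
have -> : (dot (v *m (b^T *m b)) v = dot b v ^+ 2)%R.
  rewrite mulmxA [X in X *m b]mx11_scalar mul_scalar_mx dotZl -/(dot v b) (dotC v).
  by rewrite expr2.
have -> : (a 0 0 * (- dot b v / a 0 0) ^+ 2 + 2 * dot b v * (- dot b v / a 0 0) +
   dot (v *m C) v = dot (v *m C) v - (a 0 0)^-1 * dot b v ^+ 2)%R.
  by field; exact: lt0r_neq0.
apply; apply: contraNneq v0 => /(congr1 rsubmx); rewrite row_mxKr => ->.
by apply/eqP/rowP => i; rewrite !mxE.
Qed.

(** Block elimination: the left factor is lower triangular with unit diagonal. *)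
Lemma det_schur N (a : 'M[R]_1) (b : 'rV[R]_N) (C : 'M[R]_N) : a 0 0 != 0 ->
  (\det (block_mx a b b^T C) = a 0 0 * \det (C - (a 0 0)^-1 *: (b^T *m b)))%R.
Proof.
move=> a0; have -> : block_mx a b b^T C =
    block_mx 1%:M 0 ((a 0 0)^-1 *: b^T) 1%:M *m
    block_mx a b 0 (C - (a 0 0)^-1 *: (b^T *m b)).
  rewrite mulmx_block !mul1mx !mul0mx !addr0 -!scalemxAl.
  rewrite [X in _ *: (b^T *m X)]mx11_scalar mul_mx_scalar scalerA mulVf// scale1r.
  by rewrite addrC subrK.
by rewrite det_mulmx det_lblock det_ublock !det1 !mul1r {1}(mx11_scalar a) det_scalar1.
Qed.

End dot_posdef.

(** * Gaussian integrals of quadratic forms *)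

Section gaussian_integral.
Local Open Scope ereal_scope.
Context {R : realType}.
Local Notation lam := (@lebesgue_measure R).

Lemma integral_gauss_quadratic1 (a b : R) : (0 < a)%R ->
  \int[lam]_t (expR (- ((a * t ^+ 2 + 2 * b * t) / 4)))%:E =
  (Num.sqrt (4 * pi) / Num.sqrt a * expR (b ^+ 2 / a / 4))%:E.
Proof.
move=> a0; set f := fun t : R => _.
have sa0 : (0 < Num.sqrt a)%R by rewrite sqrtr_gt0.
have saE : (Num.sqrt a ^+ 2 = a)%R by rewrite sqr_sqrtr// ltW.
have mf : measurable_fun setT f.
  apply/measurable_EFinP; apply: measurableT_comp => //; apply: measurable_funN.
  apply: measurable_funM => //; apply: measurable_funD; exact: measurable_funM.
have f0 x : 0 <= f x by rewrite lee_fin expR_ge0.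
have s0 : (0 < 2 / Num.sqrt a)%R by rewrite divr_gt0.
(* Completing the square: t = - b / a + (2 / sqrt a) u turns the exponent into b^2 / (4 a) - u^2. *)
have := ge0_integral_affine1 (- b / a) s0 mf f0.
under eq_integral => t _.
  rewrite /f (_ : expR _ = expR (b ^+ 2 / a / 4) * gauss_fun t)%R; last first.
    rewrite /gauss_fun -expRD; congr expR.
    move: sa0 saE; set q := Num.sqrt a => q0 <-; field; exact: lt0r_neq0.
  rewrite EFinM; over.
rewrite ge0_integralZl//; last 2 first.
- by apply/measurable_EFinP; apply: measurableT_comp => //; apply: measurable_funN; exact: measurable_funX.
- by move=> x _; rewrite lee_fin gauss_fun_ge0.
rewrite integralT_gauss invf_div => H.
have := congr1 (fun x => (2 / Num.sqrt a)%:E * x) H.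
rewrite [in X in _ = X -> _]muleA -!EFinM (_ : 2 / Num.sqrt a * (Num.sqrt a / 2) = 1)%R; last first.
  by field; exact: lt0r_neq0.
rewrite mul1e => <-; congr EFin.
have -> : (Num.sqrt (4 * pi) = 2 * Num.sqrt pi :> R)%R.
  rewrite sqrtrM// (_ : 4 = 2 ^+ 2)%R; last by rewrite -natrX.
  by rewrite sqrtr_sqr ger0_norm.
by ring.
Qed.

Lemma measurable_expR_dot d (T : measurableType d) N (A : 'M[R]_N) (D : set T)
    (f : T -> 'rV[R]_N) :
  measurable_fun D (f : T -> borelV R N) ->
  measurable_fun D (fun t => (expR (- (dot (f t *m A) (f t) / 4)))%:E).
Proof.
move=> mf; apply/measurable_EFinP; apply: measurableT_comp => //.
apply: measurable_funN; apply: measurable_funM => //; apply: measurable_dot => //.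
apply: measurable_fun_rV => i; under eq_fun do rewrite mxE.
by apply: measurable_sum => j; apply: measurable_funM => //; exact: measurable_rV_coord.
Qed.

(** Integrating out the first coordinate leaves the integral of the Schur complement, so the
    integral and the determinant obey the same recursion. The positivity of the determinant, a
    by-product, is used later for Gram matrices. *)
Lemma integral_gauss_quadratic N (A : 'M[R]_N) : posdef A ->
  (0 < \det A)%R /\
  \int[lebesgue_rV N]_v (expR (- (dot (v *m A) v / 4)))%:E =
  (Num.sqrt (4 * pi) ^+ N / Num.sqrt (\det A))%:E.
Proof.
elim: N A => [|N IH] A.
  move=> _; rewrite det_mx00 sqrtr1; split => //.
  rewrite /= integral_dirac//.
    by rewrite diracT mul1e dot0r mul0r oppr0 expR0 expr0 divr1.
  exact: measurable_expR_dot.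
have -> : A = block_mx (ulsubmx (A : 'M[R]_(1 + N))) (ursubmx (A : 'M[R]_(1 + N)))
   (dlsubmx (A : 'M[R]_(1 + N))) (drsubmx (A : 'M[R]_(1 + N))) by rewrite submxK.
set a := ulsubmx _; set b := ursubmx _; set C := drsubmx _ => pA.
have bE : dlsubmx (A : 'M[R]_(1 + N)) = b^T.
  have : (block_mx a b (dlsubmx (A : 'M[R]_(1 + N))) C)^T =
    block_mx a b (dlsubmx (A : 'M[R]_(1 + N))) C by case: pA.
  by rewrite tr_block_mx => /eq_block_mx[].
rewrite bE in pA *.
have [a0 pC] := posdef_schur pA.
have [dC IC] := IH _ pC.
rewrite (det_schur b C) ?lt0r_neq0//; split; first exact: mulr_gt0.
rewrite ge0_integral_rVS; last 2 first.
- exact: measurable_expR_dot.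
- by move=> x; rewrite lee_fin expR_ge0.
(* The order is exchanged so that the first coordinate is integrated with the others fixed. *)
rewrite (@fubini_tonelli _ _ _ _ _ lam (lebesgue_rV N) (fun p => (expR (-
    (dot ((cons_rV p : 'rV[R]_(1 + N)) *m block_mx a b b^T C) (cons_rV p) / 4)))%:E)); last 2 first.
- exact: (measurable_expR_dot _ (@measurable_cons_rV R N)).
- by move=> x; rewrite lee_fin expR_ge0.
transitivity (\int[lebesgue_rV N]_v ((Num.sqrt (4 * pi) / Num.sqrt (a 0 0))%:E *
    (expR (- (dot (v *m (C - (a 0 0)^-1 *: (b^T *m b))) v / 4)))%:E)).
  apply: eq_integral => v _.
  transitivity (\int[lam]_t ((expR (- ((a 0 0 * t ^+ 2 + 2 * dot b v * t) / 4)))%:E *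
      (expR (- (dot (v *m C) v / 4)))%:E)).
    by apply: eq_integral => t _; rewrite /cons_rV dot_block mulrDl opprD expRD EFinM.
  rewrite ge0_integralZr//; last first.
    apply/measurable_EFinP; apply: measurableT_comp => //; apply: measurable_funN.
    apply: measurable_funM => //; apply: measurable_funD; exact: measurable_funM.
  rewrite integral_gauss_quadratic1// -!EFinM; congr EFin; rewrite -[LHS]mulrA -expRD; congr (_ * expR _)%R.
  rewrite mulmxBr dotBl -scalemxAr dotZl mulmxA [X in X *m b]mx11_scalar.
  by rewrite mul_scalar_mx dotZl -/(dot v b) (dotC v); field; exact: lt0r_neq0.
rewrite ge0_integralZl//; last exact: measurable_expR_dot.
rewrite IC -EFinM; congr EFin.
by rewrite (sqrtrM _ (ltW a0)) exprS mulf_div.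
Qed.

End gaussian_integral.

Section real_integrals.
Context d (T : measurableType d) (R : realType) (mu : {measure set T -> \bar R}).

Lemma integrable_dominated (f g : T -> R) : measurable_fun setT f ->
  mu.-integrable setT (EFin \o g) -> (forall x, `|f x| <= g x) ->
  mu.-integrable setT (EFin \o f).
Proof.
move=> mf ig fg; apply: (le_integrable measurableT _ _ ig).
  exact/measurable_EFinP.
by move=> x _ /=; rewrite lee_fin (le_trans (fg x))// ler_norm.
Qed.

Lemma measurable_integrable (f : T -> R) :
  mu.-integrable setT (EFin \o f) -> measurable_fun setT f.
Proof. by move=> /measurable_int /measurable_EFinP. Qed.

Lemma EFin_Rintegral (f : T -> R) : mu.-integrable setT (EFin \o f) ->
  (\int[mu]_x f x)%:E = (\int[mu]_x (f x)%:E)%E.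
Proof. by move=> fi; rewrite fineK//; exact: integrable_fin_num. Qed.

Lemma integrable_ge0 (f : T -> R) : measurable_fun setT f -> (forall x, 0 <= f x) ->
  (\int[mu]_x (f x)%:E < +oo)%E -> mu.-integrable setT (EFin \o f).
Proof.
move=> mf f0 h; apply/integrableP; split; first exact/measurable_EFinP.
by under eq_integral => x _ do rewrite /= ger0_norm//.
Qed.

Lemma integrable_RD (f g : T -> R) : mu.-integrable setT (EFin \o f) ->
  mu.-integrable setT (EFin \o g) -> mu.-integrable setT (EFin \o (fun x => f x + g x)).
Proof. by move=> fi gi; exact: (integrableD measurableT fi gi). Qed.

Lemma integrable_RB (f g : T -> R) : mu.-integrable setT (EFin \o f) ->
  mu.-integrable setT (EFin \o g) -> mu.-integrable setT (EFin \o (fun x => f x - g x)).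
Proof. by move=> fi gi; exact: (integrableB measurableT fi gi). Qed.

Lemma integrable_RZ (k : R) (f : T -> R) : mu.-integrable setT (EFin \o f) ->
  mu.-integrable setT (EFin \o (fun x => k * f x)).
Proof. by move=> fi; exact: (integrableZl measurableT k fi). Qed.

Lemma integrable_Rsum (I : Type) (s : seq I) (f : I -> T -> R) :
  (forall i, mu.-integrable setT (EFin \o f i)) ->
  mu.-integrable setT (EFin \o (fun x => \sum_(i <- s) f i x)).
Proof.
move=> fi; elim: s => [|i s IH].
  rewrite (_ : _ \o _ = cst 0%E); first exact: integrable0.
  by apply/funext => x /=; rewrite big_nil.
rewrite (_ : _ \o _ = EFin \o (fun x => f i x + \sum_(j <- s) f j x)).
  exact: integrable_RD.
by apply/funext => x /=; rewrite big_cons.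
Qed.

Lemma Rintegral_sum (I : Type) (s : seq I) (f : I -> T -> R) :
  (forall i, mu.-integrable setT (EFin \o f i)) ->
  \int[mu]_x (\sum_(i <- s) f i x) = \sum_(i <- s) \int[mu]_x f i x.
Proof.
move=> fi; elim: s => [|i s IH].
  rewrite big_nil; under eq_Rintegral do rewrite big_nil.
  by rewrite /Rintegral integral0_eq.
rewrite big_cons -IH -RintegralD//; last exact: integrable_Rsum.
by apply: eq_Rintegral => x _; rewrite big_cons.
Qed.

End real_integrals.

Section finite_integrals.
Context d (T : measurableType d) (R : realType) (mu : {finite_measure set T -> \bar R}).

Lemma integrable_bounded (f : T -> R) (k : R) : measurable_fun setT f ->
  (forall x, `|f x| <= k) -> mu.-integrable setT (EFin \o f).
Proof.
move=> mf fk; apply: (integrable_dominated (g := cst k)) => //.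
exact: (finite_measure_integrable_cst mu k).
Qed.

Lemma RintegralT_cst (k : R) : \int[mu]_x k = k * fine (mu setT).
Proof. exact: Rintegral_cst. Qed.

Lemma integrable_cst (k : R) : mu.-integrable setT (EFin \o cst k).
Proof. exact: (finite_measure_integrable_cst mu k). Qed.

End finite_integrals.

(** * The Gaussian probability measure and its shifts *)

Section gauss_measure.
Context {R : realType}.

Definition gauss_dens N (z : borelV R N) : R :=
  (Num.sqrt (4 * pi) ^+ N)^-1 * expR (- (sqnorm (z : 'rV[R]_N) / 4)).

Definition gauss N (A : set (borelV R N)) : \bar R :=
  (\int[lebesgue_rV N]_(z in A) (gauss_dens z)%:E)%E.

Lemma gauss_dens_ge0 N (z : borelV R N) : 0 <= gauss_dens z.
Proof. by rewrite mulr_ge0 ?expR_ge0// invr_ge0 exprn_ge0. Qed.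

Lemma measurable_sqnorm d (T : measurableType d) N (D : set T) (f : T -> 'rV[R]_N) :
  measurable_fun D (f : T -> borelV R N) -> measurable_fun D (fun t => sqnorm (f t)).
Proof. by move=> mf; exact: measurable_dot. Qed.

Lemma measurable_gauss_dens d (T : measurableType d) N (D : set T) (f : T -> 'rV[R]_N) :
  measurable_fun D (f : T -> borelV R N) ->
  measurable_fun D (fun t => gauss_dens (f t : borelV R N)).
Proof.
move=> mf; apply: measurable_funM => //; apply: measurableT_comp => //.
by apply: measurable_funN; apply: measurable_funM => //; exact: measurable_sqnorm.
Qed.

Section measure_instance.
Context (N : nat).

Let gauss0 : gauss (set0 : set (borelV R N)) = 0%E.
Proof. exact: integral_set0. Qed.

Let gauss_ge0 (B : set (borelV R N)) : (0 <= gauss B)%E.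
Proof. by apply: integral_ge0 => x _; rewrite lee_fin gauss_dens_ge0. Qed.

Let gauss_sigma_additive : semi_sigma_additive (@gauss N).
Proof.
apply: semi_sigma_additive_nng_induced => [|x]; last by rewrite lee_fin gauss_dens_ge0.
exact/measurable_EFinP/measurable_gauss_dens.
Qed.

HB.instance Definition _ := isMeasure.Build _ _ _ (@gauss N)
  gauss0 gauss_ge0 gauss_sigma_additive.

Let gaussT : gauss (setT : set (borelV R N)) = 1%E.
Proof.
have p1 : posdef (1%:M : 'M[R]_N).
  split; first exact: trmx1.
  by move=> v v0; rewrite mulmx1 lt0r sqnorm_ge0 andbT sqnorm_eq0.
have [_] := integral_gauss_quadratic p1.
rewrite det1 sqrtr1 divr1 => h.
rewrite /gauss /gauss_dens; under eq_integral do rewrite EFinM.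
rewrite ge0_integralZl//; last first.
  apply/measurable_EFinP; apply: measurableT_comp => //.
  by apply: measurable_funN; apply: measurable_funM => //; exact: measurable_sqnorm.
under eq_integral do rewrite -[X in sqnorm X]mulmx1.
rewrite (_ : (\int[_]_x _ = (Num.sqrt (4 * pi) ^+ N)%:E)%E).
  by rewrite -EFinM mulVf// expf_neq0// sqrtr_eq0 -ltNge mulr_gt0 ?pi_gt0.
by rewrite -h; apply: eq_integral => v _; rewrite !mulmx1.
Qed.

HB.instance Definition _ := Measure_isProbability.Build _ _ _ (@gauss N) gaussT.

Lemma gauss_setT : gauss (setT : set (borelV R N)) = 1%E.
Proof. exact: gaussT. Qed.

End measure_instance.

Lemma ge0_integral_gauss N (f : 'rV[R]_N -> \bar R) :
  measurable_fun setT (f : borelV R N -> _) -> (forall x, 0 <= f x)%E ->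
  (\int[@gauss N]_z f z = \int[lebesgue_rV N]_z (f z * (gauss_dens z)%:E))%E.
Proof.
move=> mf f0; rewrite (@ge0_integral_density _ _ _ _ _ (lebesgue_rV N) (@gauss N) setT id
   (@gauss_dens N) setT)//.
- by rewrite preimage_id setIid.
- exact: measurable_gauss_dens.
- by move=> x _; exact: gauss_dens_ge0.
- by move=> A mA _; rewrite setTI.
Qed.

(** The factor on the right is the quotient of two Gaussian densities, centred at [x] with scale [s]
    and at 0 with scale 1. *)
Lemma ge0_integral_gauss_affine N (f : 'rV[R]_N -> \bar R) (x : 'rV[R]_N) (s : R) :
  0 < s -> measurable_fun setT (f : borelV R N -> _) -> (forall x, 0 <= f x)%E ->
  (\int[@gauss N]_z f (x + s *: z)%R = \int[@gauss N]_y (f y *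
    ((s ^+ N)^-1 * expR ((sqnorm y - sqnorm (y - x) / s ^+ 2) / 4))%:E))%E.
Proof.
move=> s0 mf f0.
have maff : measurable_fun setT (fun z : borelV R N => (x + s *: z : borelV R N)).
  by apply: measurable_rVD => //; exact: measurable_rVZ.
rewrite ge0_integral_gauss//; last exact: (measurableT_comp mf).
have msub : measurable_fun setT (fun y : borelV R N => (y - x : borelV R N)).
  exact: measurable_rVD.
pose H (y : 'rV[R]_N) := (f y * (gauss_dens (s^-1 *: (y - x) : borelV R N))%:E)%E.
have mH : measurable_fun setT (H : borelV R N -> _).
  apply: emeasurable_funM => //; apply/measurable_EFinP/measurable_gauss_dens.
  exact: measurable_rVZ.
have H0 y : (0 <= H y)%E by rewrite mule_ge0// lee_fin gauss_dens_ge0.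
transitivity (\int[lebesgue_rV N]_v H (x + s *: v)%R)%E.
  apply: eq_integral => v _; rewrite /H addrAC subrr add0r scalerA mulVf ?scale1r//.
  by rewrite lt0r_neq0.
rewrite ge0_integral_affine// ge0_integral_gauss//; last 2 first.
- apply: emeasurable_funM => //; apply/measurable_EFinP; apply: measurable_funM => //.
  apply: measurableT_comp => //; apply: measurable_funM => //; apply: measurable_funB.
    exact: measurable_sqnorm.
  by apply: measurable_funM => //; exact: measurable_sqnorm.
- by move=> y; rewrite mule_ge0// lee_fin mulr_ge0 ?expR_ge0// invr_ge0 exprn_ge0// ltW.
rewrite -ge0_integralZl//; last by rewrite lee_fin invr_ge0 exprn_ge0// ltW.
apply: eq_integral => y _; rewrite /H muleCA -!muleA -!EFinM; congr (_ * _%:E)%E.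
rewrite /gauss_dens -mulrA; congr (_ * _); rewrite mulrCA -expRD; congr (_ * expR _).
rewrite /sqnorm dotZl dotZr; field; exact: lt0r_neq0.
Qed.

(** The Gaussian measure shifted by [2 *: h] has density exp (<y, h> - |h|^2), whose integral is
    therefore 1. *)
Lemma gauss_mgf N (h : 'rV[R]_N) :
  (\int[@gauss N]_y (expR (dot y h))%:E = (expR (sqnorm h))%:E)%E.
Proof.
have := @ge0_integral_gauss_affine N (cst 1%E) (2 *: h) 1 ltr01.
rewrite integral_cst// mul1e => /(_ (@measurable_cst _ _ _ _ _ _) (fun=> lee01)).
rewrite [X in X = _](_ : _ = 1%E); last exact: gauss_setT.
have E y : (cst 1 y * ((1 ^+ N)^-1 * expR ((sqnorm y - sqnorm (y - 2 *: h) / 1 ^+ 2) / 4))%:E =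
    (expR (- sqnorm h))%:E * (expR (dot y h))%:E)%E.
  rewrite mul1e !expr1n invr1 mul1r -EFinM -expRD; congr (expR _)%:E.
  rewrite /sqnorm dotBr !dotBl !(dotZl, dotZr) (dotC h y); by field.
under eq_integral do rewrite E.
rewrite ge0_integralZl//; last first.
  by apply/measurable_EFinP; apply: measurableT_comp => //; exact: measurable_dot.
move=> /(congr1 (fun x => (expR (sqnorm h))%:E * x)%E).
by rewrite mule1 muleA -EFinM -expRD subrr expR0 mul1e.
Qed.

(** The difference has derivative e^x + e^-x - 2 >= 0. Taken at u / 2 and squared, this gives
    [sqr_le_two_cosh], which dominates squares by exponentials, so that all Gaussian moments come
    from [gauss_mgf]. *)
Lemma two_sinh_ge (u : R) : 0 <= u -> 2 * u <= expR u - expR (- u).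
Proof.
move=> u0; pose f (x : R) := expR x - expR (- x) - 2 * x.
suff : f 0 <= f u by rewrite /f oppr0 mulr0; lra.
have df (x : R) : is_derive x 1 f (expR x + expR (- x) - 2).
  have e1 : is_derive x 1 (expR \o -%R) (- expR (- x)).
    have := @is_derive1_comp _ expR -%R x _ _ (is_derive_expR _) (is_deriveN (is_derive_id x 1)).
    by rewrite mulrN1.
  have e2 : is_derive x 1 (fun x => 2 * x) (2 : R).
    by have := is_deriveZ 2 (is_derive_id x 1); rewrite /GRing.scale/= mulr1.
  have := is_deriveB (is_deriveB (is_derive_expR x) e1) e2.
  by rewrite opprK.
apply: (@ger0_derive1_le _ f 0 (u + 1) _ _ true false) => //.
- move=> x _; rewrite derive1E; have [_ ->] := df x.
  have := expR_ge1Dx x; have := expR_ge1Dx (- x); lra.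
- by apply: continuous_subspaceT => x; apply: differentiable_continuous; apply/derivable1_diffP; have [] := df x.
- by rewrite in_itv/= lexx/=; lra.
- by rewrite in_itv/= u0/=; lra.
Qed.

Lemma sqr_le_two_cosh (u : R) : u ^+ 2 + 2 <= expR u + expR (- u).
Proof.
wlog u0 : u / 0 <= u => [h|].
  have [|/ltW u0] := leP 0 u; first exact: h.
  by have := h (- u); rewrite sqrrN opprK addrC (addrC (expR _)) oppr_ge0 addrC => ->.
have := @two_sinh_ge (u / 2) (divr_ge0 u0 (ler0n _ 2)).
have -> : expR u = expR (u / 2) * expR (u / 2) by rewrite -expRD -splitr.
have -> : expR (- u) = expR (- (u / 2)) * expR (- (u / 2)) by rewrite -expRD -opprD -splitr.
have : expR (u / 2) * expR (- (u / 2)) = 1 by rewrite -expRD subrr expR0.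
set p := expR (u / 2); set q := expR (- _) => pq h.
have : u * u <= (p - q) * (p - q) by apply: ler_pM => //; lra.
rewrite expr2 !mulrDl !mulrDr; nra.
Qed.

End gauss_measure.

(** * First and second moments of the Gaussian measure *)

Section gauss_moments.
Context {R : realType}.

Lemma integrable_expR_dot N (h : 'rV[R]_N) :
  (@gauss R N).-integrable setT (EFin \o (fun z : borelV R N => expR (dot (z : 'rV_N) h))).
Proof.
apply: integrable_ge0 => //.
- by apply: measurableT_comp => //; exact: measurable_dot.
- by rewrite gauss_mgf ltry.
Qed.

Lemma integrable_sqr_dot N (h : 'rV[R]_N) :
  (@gauss R N).-integrable setT (EFin \o (fun z : borelV R N => dot (z : 'rV_N) h ^+ 2)).
Proof.
apply: (integrable_dominated (g := fun z : borelV R N =>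
    expR (dot (z : 'rV_N) h) + expR (dot (z : 'rV_N) (- h)))).
- by apply: measurable_funX; exact: measurable_dot.
- by apply: integrable_RD; exact: integrable_expR_dot.
- move=> x; rewrite ger0_norm ?sqr_ge0// dotNr.
  by have := sqr_le_two_cosh (dot (x : 'rV_N) h); lra.
Qed.

Lemma integrable_dot N (h : 'rV[R]_N) :
  (@gauss R N).-integrable setT (EFin \o (fun z : borelV R N => dot (z : 'rV_N) h)).
Proof.
apply: (integrable_dominated (g := fun z : borelV R N => dot (z : 'rV_N) h ^+ 2 + 1)).
- exact: measurable_dot.
- apply: integrable_RD; first exact: integrable_sqr_dot.
  exact: integrable_cst.
- by move=> x; rewrite ler_norml; nra.
Qed.

Lemma expR_sub1_le (a : R) : 0 <= a -> 2 * a <= 1 -> expR a - 1 <= 2 * a.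
Proof.
move=> a0 a1; have := expR_ge1Dx (- a); have := expR_gt0 a.
have : expR a * expR (- a) = 1 by rewrite -expRD subrr expR0.
set p := expR a; set q := expR (- a); nra.
Qed.

Lemma expR_sub1_le2 (a : R) : 0 <= a -> (expR a - 1) * (1 - a) <= a.
Proof.
move=> a0; have := expR_ge1Dx (- a); have := expR_gt0 a.
have : expR a * expR (- a) = 1 by rewrite -expRD subrr expR0.
set p := expR a; set q := expR (- a); nra.
Qed.

Lemma Rintegral_expR_dot N (h : 'rV[R]_N) :
  \int[@gauss R N]_z expR (dot (z : 'rV_N) h) = expR (sqnorm h).
Proof. by rewrite /Rintegral gauss_mgf. Qed.

Lemma gauss_fineT N : fine (@gauss R N setT) = 1.
Proof. by rewrite gauss_setT. Qed.

(** From t v <= e^(t v) - 1 with v = <z, h>, the mean is at most (e^(t^2 q) - 1) / t with q = |h|^2,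
    and this tends to 0 with t. *)
Lemma gauss_mean_le N (h : 'rV[R]_N) : \int[@gauss R N]_z dot (z : 'rV_N) h <= 0.
Proof.
have q0 := sqnorm_ge0 h; set q := sqnorm h in q0.
have key t : 0 < t -> 2 * (t ^+ 2 * q) <= 1 ->
    \int[@gauss R N]_z dot (z : 'rV_N) h <= 2 * t * q.
  move=> t0 tq; have := @le_Rintegral _ _ _ (@gauss R N) setT
    (fun z => t * dot (z : 'rV_N) h) (fun z => expR (dot (z : 'rV_N) (t *: h)) - 1) measurableT.
  move=> /(_ (integrable_RZ t (integrable_dot h))
     (integrable_RB (integrable_expR_dot (t *: h)) (integrable_cst _ 1))).
  rewrite RintegralZl//; last exact: integrable_dot.
  rewrite RintegralB//; last 2 first.
  - exact: integrable_expR_dot.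
  - exact: integrable_cst.
  rewrite Rintegral_expR_dot RintegralT_cst gauss_fineT mulr1.
  have -> : sqnorm (t *: h) = t ^+ 2 * q by rewrite /sqnorm dotZl dotZr mulrA.
  have := expR_sub1_le (mulr_ge0 (sqr_ge0 t) q0) tq.
  move=> h1 h2; have {}h2 : t * \int[@gauss R N]_z dot (z : 'rV_N) h <= expR (t ^+ 2 * q) - 1.
    by apply: h2 => z _; rewrite dotZr; have := expR_ge1Dx (t * dot (z : 'rV_N) h); lra.
  by rewrite -(ler_pM2l t0); nra.
rewrite leNgt; apply/negP => E0; set E := \int[_]_z _ in E0 key.
(* The first bound gives 2 t^2 q <= 1, as [key] requires; the second makes 2 t q smaller than [E], a
   contradiction. *)
pose t := Num.min (1 / (2 * q + 1)) (E / (4 * q + 1)).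
have t0 : 0 < t by rewrite lt_min !divr_gt0//; lra.
have t1 : t * (2 * q + 1) <= 1.
  by rewrite -ler_pdivlMr; [rewrite /t ge_min lexx|lra].
have t2 : t * (4 * q + 1) <= E.
  by rewrite -ler_pdivlMr; [rewrite /t ge_min lexx orbT|lra].
have := key _ t0; rewrite expr2; nra.
Qed.

Lemma gauss_mean N (h : 'rV[R]_N) : \int[@gauss R N]_z dot (z : 'rV_N) h = 0.
Proof.
apply/eqP; rewrite eq_le gauss_mean_le/=.
have := gauss_mean_le (- h); under eq_Rintegral do rewrite dotNr -mulN1r.
by rewrite RintegralZl ?mulN1r ?oppr_le0//; exact: integrable_dot.
Qed.

(** Second moments are only ever bounded from above, so the inequality suffices. With E the
    integral, [sqr_le_two_cosh] gives t^2 E <= 2 (e^(t^2 q) - 1), and t tends to 0. *)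
Lemma gauss_second_moment N (h : 'rV[R]_N) :
  \int[@gauss R N]_z (dot (z : 'rV_N) h ^+ 2) <= 2 * sqnorm h.
Proof.
have q0 := sqnorm_ge0 h; set q := sqnorm h in q0 *.
set E := \int[_]_z _.
have key t : 0 < t -> t ^+ 2 * q <= 1 -> E * (1 - t ^+ 2 * q) <= 2 * q.
  move=> t0 tq; have := @le_Rintegral _ _ _ (@gauss R N) setT
    (fun z => t ^+ 2 * dot (z : 'rV_N) h ^+ 2)
    (fun z => expR (dot (z : 'rV_N) (t *: h)) + expR (dot (z : 'rV_N) (- t *: h)) - 2) measurableT.
  move=> /(_ (integrable_RZ _ (integrable_sqr_dot h))
     (integrable_RB (integrable_RD (integrable_expR_dot _) (integrable_expR_dot _)) (integrable_cst _ 2))).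
  rewrite RintegralZl//; last exact: integrable_sqr_dot.
  rewrite RintegralB//; last 2 first.
  - by apply: integrable_RD; exact: integrable_expR_dot.
  - exact: integrable_cst.
  rewrite RintegralD//; try exact: integrable_expR_dot.
  rewrite !Rintegral_expR_dot RintegralT_cst gauss_fineT mulr1.
  have -> : sqnorm (t *: h) = t ^+ 2 * q by rewrite /sqnorm dotZl dotZr mulrA.
  have -> : sqnorm (- t *: h) = t ^+ 2 * q by rewrite /sqnorm dotZl dotZr mulrA mulrNN.
  have a0 := mulr_ge0 (sqr_ge0 t) q0.
  have h1 := expR_sub1_le2 a0.
  rewrite -/E => h2; have {}h2 : t ^+ 2 * E <= expR (t ^+ 2 * q) + expR (t ^+ 2 * q) - 2.
    apply: h2 => z _; rewrite !dotZr mulNr.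
    by have := sqr_le_two_cosh (t * dot (z : 'rV_N) h); rewrite exprMn; lra.
  have t20 : 0 < t ^+ 2 by rewrite exprn_gt0.
  rewrite -(ler_pM2l t20); move: h1 h2 tq a0 t20; set u := t ^+ 2; nra.
have E0 : 0 <= E by apply: Rintegral_ge0 => z _; exact: sqr_ge0.
rewrite leNgt; apply/negP => Eq.
(* These bounds give t^2 q <= 1 and E t^2 q < E - 2 q, against [key]. *)
pose t := Num.min 1 (Num.min (1 / (q + 1)) ((E - 2 * q) / (2 * E * q + 1))).
have Eq0 := mulr_ge0 E0 q0.
have t0 : 0 < t by rewrite !lt_min ltr01/= !divr_gt0//; lra.
have t3 : t <= 1 by rewrite /t ge_min lexx.
have t1 : t * (q + 1) <= 1.
  by rewrite -ler_pdivlMr; [rewrite /t !ge_min lexx/= orbT|lra].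
have t2 : t * (2 * E * q + 1) <= E - 2 * q.
  by rewrite -ler_pdivlMr; [rewrite /t !ge_min lexx !orbT|lra].
have tt : t ^+ 2 <= t by rewrite expr2; nra.
have : t ^+ 2 * q <= t * q by rewrite ler_wpM2r.
move=> h3; have := key _ t0; move: h3; set u := t ^+ 2 * q => h3.
have uE : E * u <= E * (t * q) by rewrite ler_wpM2l.
nra.
Qed.

Lemma sqnorm_mulmx N N' (z : 'rV[R]_N) (Q : 'M[R]_(N, N')) :
  sqnorm (z *m Q) = \sum_j dot z (row j Q^T) ^+ 2.
Proof.
rewrite /sqnorm dotE; apply: eq_bigr => j _; rewrite expr2; congr (_ * _);
by rewrite mxE dotE; apply: eq_bigr => i _; rewrite !mxE.
Qed.

Lemma integrable_sqnorm_mulmx N N' (Q : 'M[R]_(N, N')) :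
  (@gauss R N).-integrable setT (EFin \o (fun z : borelV R N => sqnorm ((z : 'rV_N) *m Q))).
Proof.
under [X in EFin \o X]eq_fun do rewrite sqnorm_mulmx.
by apply: integrable_Rsum => j; exact: integrable_sqr_dot.
Qed.

Lemma gauss_sqnorm_mulmx N N' (Q : 'M[R]_(N, N')) :
  \int[@gauss R N]_z sqnorm ((z : 'rV_N) *m Q) <= 2 * \tr (Q^T *m Q).
Proof.
under eq_Rintegral do rewrite sqnorm_mulmx.
rewrite Rintegral_sum; last by move=> j; exact: integrable_sqr_dot.
rewrite /mxtrace mulr_sumr; apply: ler_sum => j _.
apply: (le_trans (gauss_second_moment _)); rewrite ler_pM2l// le_eqVlt; apply/orP; left.
by rewrite /sqnorm dotE !mxE; apply/eqP/eq_bigr => i _; rewrite !mxE.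
Qed.

Lemma integrable_sqnorm N :
  (@gauss R N).-integrable setT (EFin \o (fun z : borelV R N => sqnorm (z : 'rV_N))).
Proof.
have := @integrable_sqnorm_mulmx N N 1%:M.
by under [X in EFin \o X]eq_fun do rewrite mulmx1.
Qed.

Lemma gauss_sqnorm N : \int[@gauss R N]_z sqnorm (z : 'rV_N) <= 2 * N%:R.
Proof.
have := @gauss_sqnorm_mulmx N N 1%:M.
under eq_Rintegral do rewrite mulmx1.
by rewrite trmx1 mulmx1 mxtrace1.
Qed.

End gauss_moments.

Section measurable_mx.
Context d (T : measurableType d) (R : realType) (D : set T).

Lemma measurable_rVN N (f : T -> 'rV[R]_N) :
  measurable_fun D (f : T -> borelV R N) -> measurable_fun D (fun t => (- f t : borelV R N)).
Proof.
move=> mf; apply: measurable_fun_rV => i; under eq_fun do rewrite mxE.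
by apply: measurable_funN; exact: measurable_rV_coord.
Qed.

Lemma measurable_rV_mulmx N N' (f : T -> 'rV[R]_N) (A : T -> 'M[R]_(N, N')) :
  measurable_fun D (f : T -> borelV R N) ->
  (forall i j, measurable_fun D (fun t => A t i j)) ->
  measurable_fun D (fun t => (f t *m A t : borelV R N')).
Proof.
move=> mf mA; apply: measurable_fun_rV => i; under eq_fun do rewrite mxE.
by apply: measurable_sum => j; apply: measurable_funM => //; exact: measurable_rV_coord.
Qed.

End measurable_mx.

Ltac meas := repeat first
  [ done | apply: measurable_funM | apply: measurable_funD | apply: measurable_funB
  | apply: measurable_funN | apply: measurable_funX | apply: measurable_dot
  | apply: measurable_sqnorm | apply: measurable_rVD | apply: measurable_rVZ
  | apply: measurable_rVN | apply: measurable_rV_mulmx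
  | apply: (measurableT_comp (@measurable_expR _)) | apply: measurable_rV_coord ].

Section sqnorm_theory.
Context {R : realType} {N : nat}.
Implicit Types u v : 'rV[R]_N.

Lemma sqnormD u v : sqnorm (u + v) = sqnorm u + 2 * dot u v + sqnorm v.
Proof. rewrite /sqnorm dotDl !dotDr (dotC v u); ring. Qed.

Lemma sqnormZ a u : sqnorm (a *: u) = a ^+ 2 * sqnorm u.
Proof. by rewrite /sqnorm dotZl dotZr mulrA expr2. Qed.

Lemma sqnormN u : sqnorm (- u) = sqnorm u.
Proof. by rewrite /sqnorm dotNl dotNr opprK. Qed.

Lemma sqnormB u v : sqnorm (u - v) = sqnorm u - 2 * dot u v + sqnorm v.
Proof. rewrite sqnormD sqnormN dotNr; ring. Qed.

Lemma dot_le_sqnorm u v : 2 * dot u v <= sqnorm u + sqnorm v.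
Proof. by have := sqnorm_ge0 (u - v); rewrite sqnormB; lra. Qed.

Lemma dot_ge_sqnorm u v : - (sqnorm u + sqnorm v) <= 2 * dot u v.
Proof. by have := sqnorm_ge0 (u + v); rewrite sqnormD; lra. Qed.

Lemma normr_dot_le u v : `|dot u v| <= (sqnorm u + sqnorm v) / 2.
Proof.
by rewrite ler_norml; have := dot_le_sqnorm u v; have := dot_ge_sqnorm u v; lra.
Qed.

Lemma sqnormD_le u v : sqnorm (u + v) <= 2 * sqnorm u + 2 * sqnorm v.
Proof. by rewrite sqnormD; have := dot_le_sqnorm u v; lra. Qed.

Lemma sqnormB_le u v : sqnorm (u - v) <= 2 * sqnorm u + 2 * sqnorm v.
Proof. by rewrite sqnormB; have := dot_ge_sqnorm u v; lra. Qed.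

Lemma coord_le_sqnorm u i : `|u 0 i| <= 1 + sqnorm u.
Proof.
have h : u 0 i ^+ 2 <= sqnorm u.
  rewrite /sqnorm dotE (bigD1 i)//= -expr2 lerDl; apply: sumr_ge0 => j _.
  by rewrite -expr2 sqr_ge0.
by rewrite ler_norml; nra.
Qed.

End sqnorm_theory.

Lemma quadratic_bound1 (R : realFieldType) (k B z u : R) : 0 <= k -> 0 <= B -> 0 <= z ->
  u <= k * (2 * B + 2 * z) -> 1 + u <= (1 + k * (2 * B) + k * 2) * (1 + z).
Proof.
move=> k0 B0 z0 h; have := mulr_ge0 k0 z0; have := mulr_ge0 (mulr_ge0 k0 B0) z0; lra.
Qed.

Lemma quadratic_bound2 (R : realFieldType) (a b k B z u : R) :
  0 <= a -> 0 <= k -> 0 <= B -> 0 <= b -> 0 <= z -> u <= 2 * B + 2 * z ->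
  2 * a + 2 * (k * (2 * u + 2 * b)) <= (2 * a + 2 * (k * (2 * (2 * B + 2) + 2 * b))) * (1 + z).
Proof.
move=> a0 k0 B0 b0 z0 /(ler_wpM2l k0) h.
have := mulr_ge0 a0 z0; have := mulr_ge0 (mulr_ge0 k0 b0) z0.
have := mulr_ge0 (mulr_ge0 k0 B0) z0; lra.
Qed.

(** * Entropy along the Gaussian interpolation *)

Section trigonometry.
Context {R : realType}.

Lemma sin_le_id (x : R) : 0 <= x -> sin x <= x.
Proof.
move=> x0; pose f (y : R) := y - sin y.
suff : f 0 <= f x by rewrite /f sin0; lra.
have df (y : R) : is_derive y 1 f (1 - cos y).
  exact: (is_deriveB (is_derive_id y 1) (is_derive_sin y)).
apply: (@ger0_derive1_le _ f 0 (x + 1) _ _ true false) => //.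
- by move=> y _; rewrite derive1E; have [_ ->] := df y; rewrite subr_ge0 cos_le1.
- apply: continuous_subspaceT => y; apply: differentiable_continuous.
  by apply/derivable1_diffP; have [] := df y.
- by rewrite in_itv/= lexx/=; lra.
- by rewrite in_itv/= x0/=; lra.
Qed.

(** This makes the error of one interpolation step quadratic in the angle. It comes from 1 - cos x =
    2 sin^2 (x / 2). *)
Lemma one_sub_cos_le (x : R) : 0 <= x -> 1 - cos x <= x ^+ 2.
Proof.
move=> x0; have x20 : 0 <= x / 2 by rewrite divr_ge0.
have E : cos x = 1 - sin (x / 2) ^+ 2 *+ 2.
  rewrite [in LHS](splitr x) -mulr2n cos_mulr2n cos2sin2 mulrnBl -addrA (addrC _ (-1)) addrA.
  by congr (_ - _); rewrite mulr2n addrK.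
rewrite E opprB addrC subrK mulr2n.
(* Where the sine is negative, either x / 2 >= 1 and the trivial bound suffices, or x / 2 < 1, where
   the sine is also nonnegative. *)
have h1 : sin (x / 2) ^+ 2 <= (x / 2) ^+ 2.
  have [s0|/ltW s0] := leP 0 (sin (x / 2)).
    by rewrite ler_sqr ?nnegrE// sin_le_id.
  have := sin_geN1 (x / 2).
  have [x1|x1] := leP 1 (x / 2); first by nra.
  have : 0 <= sin (x / 2).
    have [->|xn] := eqVneq (x / 2) 0; first by rewrite sin0.
    by rewrite ltW// sin2_gt0// lt0r xn x20/=; lra.
  move=> s0' _; have -> : sin (x / 2) = 0 by apply/eqP; rewrite eq_le s0.
  by rewrite expr0n/= sqr_ge0.
nra.
Qed.

End trigonometry.

(** K steps of length b / K add up to an error C b^2 / K, which tends to 0. This takes the place of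
    integrating a nonpositive derivative. *)
Lemma telescoping_le (R : realType) (f : R -> R) (b C : R) : 0 <= b -> 0 <= C ->
  (forall x y, 0 <= x -> x <= y -> y <= b -> f y - f x <= C * (y - x) ^+ 2) ->
  f b <= f 0.
Proof.
move=> b0 C0 h.
have key (K : nat) : (0 < K)%N -> f b - f 0 <= C * b ^+ 2 / K%:R.
  move=> K0; have K0' : 0 < K%:R :> R by rewrite ltr0n.
  pose d := b / K%:R.
  have d0 : 0 <= d by rewrite divr_ge0// ltW.
  have st j : (j <= K)%N -> f (j%:R * d) - f 0 <= j%:R * (C * d ^+ 2).
    elim: j => [|j IH] jK; first by rewrite !mul0r subrr.
    have := h (j%:R * d) (j.+1%:R * d); rewrite -mulrBl -natrB// subSnn mul1r.
    have e1 : 0 <= j%:R * d by rewrite mulr_ge0.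
    have e2 : j%:R * d <= j.+1%:R * d by rewrite ler_wpM2r// ler_nat.
    have e3 : j.+1%:R * d <= b.
      by rewrite /d mulrCA ler_piMr// ler_pdivrMr// mul1r ler_nat.
    move=> /(_ e1 e2 e3) h1; have := IH (ltnW jK).
    rewrite -[in X in _ -> _ <= X]natr1 mulrDl mul1r; move: (f _) (f _) h1 => u v; lra.
  have := st K (leqnn K); rewrite /d mulrCA divff ?lt0r_neq0// mulr1.
  move=> h1; apply: (le_trans h1); rewrite le_eqVlt; apply/orP; left; apply/eqP.
  by field; exact: lt0r_neq0.
rewrite -subr_le0 leNgt; apply/negP => h0.
set e := f b - f 0 in h0 key.
have hK := archi_boundP (divr_ge0 (mulr_ge0 C0 (sqr_ge0 b)) (ltW h0)).
pose K := (Num.bound (C * b ^+ 2 / e)).+1.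
have {}hK : C * b ^+ 2 / e < K%:R by apply: (lt_trans hK); rewrite ltr_nat.
have := key K isT; rewrite leNgt => /negP; apply.
by rewrite ltr_pdivrMr ?ltr0n// [ltRHS]mulrC -ltr_pdivrMr.
Qed.

(** A form of Fatou's lemma for a sequence that is bounded below and need not converge: the
    truncations min (f_k, f) converge to f and are dominated by |K| + |f|. *)
Lemma ge0_fatou_real d (T : measurableType d) (R : realType)
    (mu : {measure set T -> \bar R}) (f_ : nat -> T -> R) (f K : T -> R) (b_ : nat -> R) (b : R) :
  (forall k, mu.-integrable setT (EFin \o f_ k)) ->
  mu.-integrable setT (EFin \o f) -> mu.-integrable setT (EFin \o K) ->
  (forall k x, - K x <= f_ k x) ->
  (forall x e, 0 < e -> \forall k \near \oo, f x - e <= f_ k x) ->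
  (forall k, \int[mu]_x f_ k x <= b_ k) -> b_ @ \oo --> b ->
  \int[mu]_x f x <= b.
Proof.
move=> fki fi Ki fK ff fb bb.
pose g_ k x := Num.min (f_ k x) (f x).
have mg k : measurable_fun setT (EFin \o g_ k).
  by apply/measurable_EFinP; apply: measurable_minr; apply: measurable_integrable; [exact: fki|exact: fi].
have nKi : mu.-integrable setT (EFin \o (fun x => `|K x| + `|f x|)).
  by apply: integrable_RD; exact: integrable_norm.
have gdom k x : `|g_ k x| <= `|K x| + `|f x|.
  rewrite /g_; have := fK k x; have := ler_norm (K x); have := ler_norm (f x).
  have := lerNnormlW (lexx `|f x|); have := normr_ge0 (K x).
  by rewrite ler_norml le_min ge_min => *; apply/andP; split; [apply/andP; split|apply/orP; right]; lra.
have gi k : mu.-integrable setT (EFin \o g_ k).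
  by apply: (integrable_dominated _ nKi) => //; exact/measurable_EFinP/mg.
have gcvg x : g_ ^~ x @ \oo --> f x.
  apply/cvgrPdist_le => e e0; near=> k.
  have : f x - e <= f_ k x by near: k; exact: ff.
  rewrite /g_; case: (leP (f_ k x) (f x)) => h1 h2; last by rewrite subrr normr0 ltW.
  by rewrite ger0_norm; lra.
have gcvgE x : (fun k => (g_ k x)%:E) @ \oo --> (f x)%:E.
  by apply/fine_cvgP; split; [exact: nearW|exact: gcvg].
have [_ _ h] := @dominated_convergence _ _ _ mu setT measurableT (fun k => EFin \o g_ k)
  (EFin \o f) _ mg (measurable_int _ fi)
  (aeW _ (fun x _ => gcvgE x))
  nKi (aeW _ (fun x k _ => gdom k x)).
have {}h : (fun k => \int[mu]_x g_ k x) @ \oo --> \int[mu]_x f x.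
  by move: h; rewrite -(EFin_Rintegral fi) => /fine_cvgP[_].
apply: (ler_cvg_to h bb); apply: nearW => k.
apply: le_trans (fb k); apply: le_Rintegral => // x _.
by rewrite /g_ ge_min lexx.
Unshelve. all: by end_near.
Qed.

(** The arithmetic that closes [entropy_step], with its nonlinear terms abstracted. The same holds
    of [step_arith2], and of [gap_arith] for [entropy_gap_step]. *)
Lemma step_arith1 (R : realFieldType) (d1 w z x e1 e2 kk BB k D c sg B : R) :
  c * d1 <= c * BB -> kk * D <= k * D -> k * D <= k * (2 * (e1 * x) + 2 * (e2 * z)) ->
  k * (e1 * x) <= k * (e1 * B) ->
  c * d1 + sg * w + kk * D <= c * BB + k * (2 * (e1 * B)) + sg * w + k * (2 * e2) * z.
Proof. lra. Qed.

Lemma step_arith2 (R : realFieldType) (w z BB rhs e1 e2 k c sg M B N : R) :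
  sg * w <= sg * rhs -> k * (2 * e2) * z <= k * (2 * e2) * (M * (2 * N)) ->
  k * (2 * e1) * (B * M) <= k * (2 * (2 * c)) * (B * M) ->
  k * (2 * e2) * (M * (2 * N)) <= k * (2 * (2 * c)) * (M * (2 * N)) ->
  (c * BB + k * (2 * (e1 * B))) * M + sg * w + k * (2 * e2) * z <=
  sg * rhs + c * (BB * M + k * 4 * (B * M) + k * 4 * (M * (2 * N))).
Proof. lra. Qed.

(** With r = sin x and s = cos x, [2 * s2 * r2 * J + r2 ^+ 3 * mM / s2] is the derivative in x, at
    the second point, of the comparison function r^2 J - (mM / 2) (r^2 + 2 ln s). The increment of
    this function is thus at least sin (x2 - x1) times its derivative, up to a multiple of 1 - cos
    (x2 - x1). The bound [sm] keeps the constant uniform along an arc. *)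
Lemma circle_gap (R : realType) (J mM sm r1 s1 r2 s2 : R) :
  0 < sm -> sm <= s1 -> sm <= s2 -> r1 ^+ 2 + s1 ^+ 2 = 1 -> r2 ^+ 2 + s2 ^+ 2 = 1 ->
  0 <= J -> 0 <= mM ->
  (s1 * r2 - s2 * r1) * (2 * s2 * r2 * J + r2 ^+ 3 * mM / s2) +
    (r1 ^+ 2 * J - mM / 2 * (r1 ^+ 2 + 2 * ln s1)) <=
  r2 ^+ 2 * J - mM / 2 * (r2 ^+ 2 + 2 * ln s2) +
  (6 * J + mM * (2 * (1 / sm ^+ 2 + 1 / 2) + 1)) * (1 - (r1 * r2 + s1 * s2)).
Proof.
move=> sm0 sms1 sms2 rs1 rs2 J0 mM0.
have s10 := lt_le_trans sm0 sms1; have s20 := lt_le_trans sm0 sms2.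
have [c cE] : exists c, r1 * r2 + s1 * s2 = c by eexists.
have [sg sgE] : exists sg, s1 * r2 - s2 * r1 = sg by eexists.
rewrite cE sgE.
have c1 : (r2 - r1) ^+ 2 + (s2 - s1) ^+ 2 = 2 * (1 - c).
  transitivity (r1 ^+ 2 + s1 ^+ 2 + (r2 ^+ 2 + s2 ^+ 2) - 2 * c); first by rewrite -cE; ring.
  by rewrite rs1 rs2; ring.
have c0 : 0 <= 1 - c by have := sqr_ge0 (r2 - r1); have := sqr_ge0 (s2 - s1); lra.
have sg2 : sg ^+ 2 = (1 - c) * (1 + c).
  transitivity ((r1 ^+ 2 + s1 ^+ 2) * (r2 ^+ 2 + s2 ^+ 2) - c ^+ 2); first by rewrite -sgE -cE; ring.
  by rewrite rs1 rs2; ring.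
have r21 : r2 ^+ 2 <= 1 by rewrite -rs2 lerDl sqr_ge0.
have s21 : s2 ^+ 2 <= 1 by rewrite -rs2 lerDr sqr_ge0.
have E1 : r2 ^+ 2 - r1 ^+ 2 = sg * (r2 * s1 + s2 * r1).
  transitivity (r2 ^+ 2 * (r1 ^+ 2 + s1 ^+ 2) - r1 ^+ 2 * (r2 ^+ 2 + s2 ^+ 2)); first by rewrite rs1 rs2; ring.
  by rewrite -sgE; ring.
(* The left-hand side is the product of [sg] and s2 (r2 - r1) + r2 (s2 - s1). Both factors are of
   the order of the chord, whose square is 2 (1 - c). *)
have gradJ : sg * (2 * s2 * r2) - (r2 ^+ 2 - r1 ^+ 2) <= 6 * (1 - c).
  rewrite E1 -mulrBr (_ : _ - _ = s2 * (r2 - r1) + r2 * (s2 - s1)); last by ring.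
  have h1 := sqr_ge0 (sg - (s2 * (r2 - r1) + r2 * (s2 - s1))).
  have h2 := sqr_ge0 (s2 * (r2 - r1) - r2 * (s2 - s1)).
  have h3 := ler_wpM2r (sqr_ge0 (r2 - r1)) s21; have h4 := ler_wpM2r (sqr_ge0 (s2 - s1)) r21.
  have h5 : (1 - c) * (1 + c) <= (1 - c) * 2 by rewrite ler_wpM2l//; lra.
  rewrite -sg2 in h5; move: c1 h1 h2 h3 h4 h5; move: (r2 - r1) (s2 - s1) => u v *; lra.
(* Concavity bounds the logarithms by a rational function, after which the terms with [mM] satisfy
   the exact identity [normalE]. *)
have lnE : 1 - s2 / s1 <= ln s1 - ln s2.
  rewrite -ln_div ?posrE// -[X in ln X]invf_div lnV ?posrE ?divr_gt0//.
  have := @le_ln1Dx R (s2 / s1 - 1); rewrite [1 + _]addrC subrK.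
  have h : 0 < s2 / s1 := divr_gt0 s20 s10.
  by move=> /(_ _) h1; have := h1 (ltac:(lra)); lra.
have normalE : sg * (r2 ^+ 3 / s2) + (r2 ^+ 2 - r1 ^+ 2) / 2 - (1 - s2 / s1) =
    (s2 - s1) ^+ 2 * (1 / (s1 * s2) + 1 / 2) + (1 - c) * r2 ^+ 2.
  have er2 : r2 ^+ 2 = 1 - s2 ^+ 2 by rewrite -rs2 addrK.
  have er1 : r1 ^+ 2 = 1 - s1 ^+ 2 by rewrite -rs1 addrK.
  have er3 : sg * r2 = s1 - s2 * c.
    transitivity (s1 * (r2 ^+ 2 + s2 ^+ 2) - s2 * c); first by rewrite -sgE -cE; ring.
    by rewrite rs2 mulr1.
  have -> : sg * (r2 ^+ 3 / s2) = (sg * r2) * r2 ^+ 2 / s2 by ring.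
  by rewrite er3 er2 er1; field; rewrite !lt0r_neq0.
have normal : sg * (r2 ^+ 3 / s2) + (r2 ^+ 2 - r1 ^+ 2) / 2 - (1 - s2 / s1) <=
    (2 * (1 / sm ^+ 2 + 1 / 2) + 1) * (1 - c).
  rewrite normalE.
  have i1 : 1 / (s1 * s2) <= 1 / sm ^+ 2.
    by rewrite ler_pM2l// lef_pV2 ?posrE ?mulr_gt0 ?exprn_gt0// expr2 ler_pM// ltW.
  have h1 : (s2 - s1) ^+ 2 * (1 / (s1 * s2) + 1 / 2) <= (2 * (1 - c)) * (1 / sm ^+ 2 + 1 / 2).
    apply: ler_pM => //; first exact: sqr_ge0.
    - by rewrite addr_ge0// divr_ge0// ltW// mulr_gt0.
    - by rewrite -c1 lerDr sqr_ge0.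
    - by rewrite lerD2r.
  have h2 := ler_wpM2l c0 r21; rewrite mulr1 in h2.
  by apply: (le_trans (lerD h1 h2)); rewrite le_eqVlt; apply/orP; left; apply/eqP; ring.
have h1 := ler_wpM2r J0 gradJ.
have h2 := ler_wpM2l mM0 normal.
have h4 := ler_wpM2l mM0 lnE.
rewrite (_ : sg * (2 * s2 * r2 * J + r2 ^+ 3 * mM / s2) =
  sg * (2 * s2 * r2) * J + mM * (sg * (r2 ^+ 3 / s2))); last by ring.
move: h1 h2 h4; move: (r2 ^+ 3 / s2) (s2 / s1) (1 / sm ^+ 2) (ln s1) (ln s2) => *; lra.
Qed.

Lemma gap_arith (R : realFieldType) (e1 e2 sg J m M c r1 r2 l1 l2 i K1 K2 x3 x4 : R) :
  e2 <= sg * (x4 * J + x3 * m * M / K1) + c * K2 + e1 -> forall K3, c * K2 <= c * K3 ->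
  sg * (x4 * J + x3 * (m * M) / K1) + (r1 * J - m * M / 2 * (r1 + 2 * l1)) <=
  r2 * J - m * M / 2 * (r2 + 2 * l2) + (6 * J + m * M * (2 * (i + 1 / 2) + 1)) * c ->
  e2 - (r2 * J - m / 2 * M * (r2 + 2 * l2)) <=
  (6 * J + m * M * (2 * (i + 1 / 2) + 1) + K3) * c + (e1 - (r1 * J - m / 2 * M * (r1 + 2 * l1))).
Proof. by move: (K1^-1) => k h1 K3 h2 h3; lra. Qed.

(** * Entropy of Gaussian mixtures over an abstract measure space *)

Section core.
Context {R : realType} d (T : measurableType d) (nu : {finite_measure set T -> \bar R}).
Context (N : nat) (m : R).
Variables (X a : T -> 'rV[R]_N) (Q : T -> 'M[R]_N) (B A : R).
Hypothesis mX : measurable_fun setT (X : T -> borelV R N).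
Hypothesis ma : measurable_fun setT (a : T -> borelV R N).
Hypothesis mQ : forall i j, measurable_fun setT (fun t => Q t i j).
Hypothesis XB : forall t, sqnorm (X t) <= B.
Hypothesis aA : forall t, sqnorm (a t) <= A.
Hypothesis trQ : forall t, (Q t)^T *m Q t = Q t /\ \tr (Q t) = m.
Hypothesis B0 : 0 <= B.
Local Notation G := (@gauss R N).
Local Notation M := (fine (nu setT)).
Local Notation PI := (nu \x G)%E.
Hypothesis M0 : 0 < M.

(** Since [X] and [a] are bounded, the integrands that arise on the product grow at most
    quadratically in z, uniformly in t; this one domination serves for them. *)
Lemma integrable_prod_quadratic (h : T * borelV R N -> R) (C : R) :
  measurable_fun setT h -> (forall t z, `|h (t, z)| <= C * (1 + sqnorm (z : 'rV_N))) ->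
  PI.-integrable setT (EFin \o h).
Proof.
move=> mh hC; apply: (integrable_dominated (g := fun p : T * borelV R N => C * (1 + sqnorm (p.2 : 'rV_N)))) => //; last first.
  by move=> [t z]; exact: hC.
apply: integrable_RZ; apply/integrable12ltyP.
  by apply/measurable_EFinP; meas.
under eq_integral => t _.
  under eq_integral => z _ do rewrite /= ger0_norm ?addr_ge0 ?sqnorm_ge0//.
  rewrite -EFin_Rintegral; last first.
    by apply: integrable_RD; [exact: integrable_cst|exact: integrable_sqnorm].
  over.
rewrite (integral_cst nu measurableT (_ : R)%:E); apply: lte_mul_pinfty => //.
  by rewrite lee_fin; apply: Rintegral_ge0 => z _; rewrite addr_ge0// sqnorm_ge0.
by rewrite ltey_eq fin_num_measure.
Qed.

Lemma prod_mass : fine (PI setT) = M.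
Proof.
congr fine; rewrite -setXTT product_measure1E// -[RHS]mule1.
by congr (_ * _)%E; exact: gauss_setT.
Qed.

Lemma Rintegral_prod12 (h : T * borelV R N -> R) :
  PI.-integrable setT (EFin \o h) ->
  (forall t, G.-integrable setT (EFin \o (fun z => h (t, z)))) ->
  nu.-integrable setT (EFin \o (fun t => \int[G]_z h (t, z))) /\
  \int[PI]_p h p = \int[nu]_t \int[G]_z h (t, z).
Proof.
move=> hi hi2.
have E : fubini_F G (EFin \o h) = EFin \o (fun t => \int[G]_z h (t, z)).
  by apply/funext => t /=; rewrite (EFin_Rintegral (hi2 t)).
split; first by rewrite -E; exact: integrable_fubini_F.
by rewrite /Rintegral -integral12_prod_meas1// E.
Qed.

Lemma Rintegral_prod21 (h : T * borelV R N -> R) :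
  PI.-integrable setT (EFin \o h) ->
  (forall z, nu.-integrable setT (EFin \o (fun t => h (t, z)))) ->
  G.-integrable setT (EFin \o (fun z => \int[nu]_t h (t, z))) /\
  \int[PI]_p h p = \int[G]_z \int[nu]_t h (t, z).
Proof.
move=> hi hi2.
have E : fubini_G nu (EFin \o h) = EFin \o (fun z => \int[nu]_t h (t, z)).
  by apply/funext => t /=; rewrite (EFin_Rintegral (hi2 t)).
split.
  apply: (integrable_dominated (g := fun z => \int[nu]_t `|h (t, z)|)).
  - by apply/measurable_EFinP; rewrite -/(EFin \o _) -E; exact: measurable_fubini_G hi.
  - have nhi2 z : nu.-integrable setT (EFin \o (fun t => `|h (t, z)|)).
      exact: (integrable_norm (hi2 z)).
    have E' : (fun z => (\int[nu]_t `|h (t, z)|)%:E) = fubini_G nu (EFin \o (fun q => `|h q|)).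
      by apply/funext => z; rewrite (EFin_Rintegral (nhi2 z)).
    have hn := integrable_norm hi.
    apply: integrable_ge0 => [||].
    + by apply/measurable_EFinP; rewrite [X in measurable_fun _ X]E'; exact: measurable_fubini_G hn.
    + by move=> z; apply: Rintegral_ge0.
    + under eq_integral do rewrite (EFin_Rintegral (nhi2 _)).
      have := proj1 (@integrable21ltyP _ _ T (borelV R N) R nu G (EFin \o h) (measurable_int _ hi)) hi.
      by [].
  - by move=> z; apply: le_normr_Rintegral.
by rewrite /Rintegral -integral21_prod_meas1// E.
Qed.

(* Density of the law of r x + s z, z Gaussian, with respect to the Gaussian
   measure, when r ^ 2 + s ^ 2 = 1. *)
Definition mehler (r s : R) (x y : 'rV[R]_N) : R :=
  (s ^+ N)^-1 *
  expR ((2 * r * dot x y - r ^+ 2 * sqnorm x - r ^+ 2 * sqnorm y) / (4 * s ^+ 2)).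

Definition mixture r s (y : 'rV[R]_N) : R := \int[nu]_t mehler r s (X t) y.

Definition rotate r s (p : T * borelV R N) : 'rV[R]_N := r *: X p.1 + s *: (p.2 : 'rV_N).

(** This is the integral of F log F against the Gaussian measure, since [rotate r s] has law F G. On
    the product space the point can be rotated while the density is kept fixed. *)
Definition entropy r s : R := \int[PI]_p ln (mixture r s (rotate r s p)).

Lemma measurable_fstX : measurable_fun setT (fun p : T * borelV R N => (X p.1 : borelV R N)).
Proof. exact: (measurableT_comp mX measurable_fst). Qed.

Lemma measurable_rotate r s : measurable_fun setT (rotate r s : _ -> borelV R N).
Proof. by rewrite /rotate; meas; exact: measurable_fstX. Qed.

Lemma measurable_mehler d' (T' : measurableType d') (D : set T') r s (f g : T' -> 'rV[R]_N) :
  measurable_fun D (f : T' -> borelV R N) -> measurable_fun D (g : T' -> borelV R N) ->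
  measurable_fun D (fun t => mehler r s (f t) (g t)).
Proof. by move=> mf mg; rewrite /mehler; meas. Qed.

Lemma sqnorm_rotate_le r s t z : r ^+ 2 + s ^+ 2 = 1 ->
  sqnorm (rotate r s (t, z)) <= 2 * B + 2 * sqnorm (z : 'rV_N).
Proof.
move=> rs; apply: (le_trans (sqnormD_le _ _)); rewrite !sqnormZ /=.
have := XB t; have := sqnorm_ge0 (z : 'rV_N); have := sqnorm_ge0 (X t).
have := sqr_ge0 r; have := sqr_ge0 s; nra.
Qed.

Section fixed_time.
Variables (r s : R).
Hypotheses (r0 : 0 <= r) (s0 : 0 < s) (rs : r ^+ 2 + s ^+ 2 = 1).
Local Notation p := (mehler r s).
Local Notation F := (mixture r s).
Local Notation Y := (rotate r s).

Let s20 : 0 < s ^+ 2. Proof. by rewrite exprn_gt0. Qed.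
Let sN0 : 0 < (s ^+ N)^-1. Proof. by rewrite invr_gt0 exprn_gt0. Qed.
Let rr0 := sqr_ge0 r.

Lemma mehler_gt0 x y : 0 < p x y.
Proof. by rewrite mulr_gt0 ?expR_gt0. Qed.

(** Uniform in y: completing the square in r y leaves (1 - r^2) |X|^2 = s^2 |X|^2 in the numerator
    of the exponent. *)
Lemma mehler_le t y : p (X t) y <= (s ^+ N)^-1 * expR (B / 4).
Proof.
rewrite ler_pM2l// ler_expR ler_pdivrMr ?mulr_gt0//.
have := sqnorm_ge0 (r *: y - X t); rewrite sqnormB !sqnormZ dotZl (dotC y).
have : s ^+ 2 * sqnorm (X t) <= s ^+ 2 * B by rewrite ler_pM2l.
have -> : s ^+ 2 = 1 - r ^+ 2 by rewrite -rs addrC addKr.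
lra.
Qed.

Lemma mehler_ge t y :
  (s ^+ N)^-1 * expR (- (B + sqnorm y) / (2 * s ^+ 2)) <= p (X t) y.
Proof.
rewrite ler_pM2l// ler_expR.
rewrite (_ : 2 * s ^+ 2 = (4 * s ^+ 2) / 2); last by field.
rewrite invf_div mulrA ler_pM2r ?invr_gt0 ?mulr_gt0//.
have := dot_ge_sqnorm (X t) (r *: y); rewrite dotZr sqnormZ.
have r1 : r ^+ 2 <= 1 by rewrite -rs lerDl ltW.
have := ler_wpM2r (sqnorm_ge0 (X t)) r1; have := ler_wpM2r (sqnorm_ge0 y) r1.
have := XB t; lra.
Qed.

Lemma integrable_mehlerM (g : T -> R) (C : R) y : measurable_fun setT g ->
  (forall t, `|g t| <= C) ->
  nu.-integrable setT (EFin \o (fun t => g t * p (X t) y)).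
Proof.
move=> mg gC; apply: (@integrable_bounded _ _ _ _ _ (C * ((s ^+ N)^-1 * expR (B / 4)))).
  by apply: measurable_funM => //; exact: measurable_mehler.
move=> t; rewrite normrM (gtr0_norm (mehler_gt0 _ _)).
by rewrite ler_pM// ?mehler_le// ltW// mehler_gt0.
Qed.

Lemma integrable_mehler y : nu.-integrable setT (EFin \o (fun t => p (X t) y)).
Proof.
have := @integrable_mehlerM (cst 1) 1 y (@measurable_cst _ _ _ _ _ _).
rewrite /= (_ : (fun t => 1 * p (X t) y) = (fun t => p (X t) y)); last by apply/funext => t; rewrite mul1r.
by apply => t; rewrite normr1.
Qed.

Lemma mixture_le y : F y <= M * ((s ^+ N)^-1 * expR (B / 4)).
Proof.
rewrite mulrC -(RintegralT_cst nu); apply: le_Rintegral => //.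
- exact: integrable_mehler.
- exact: integrable_cst.
- by move=> t _; exact: mehler_le.
Qed.

Lemma mixture_ge y :
  M * ((s ^+ N)^-1 * expR (- (B + sqnorm y) / (2 * s ^+ 2))) <= F y.
Proof.
rewrite mulrC -(RintegralT_cst nu); apply: le_Rintegral => //.
- exact: integrable_cst.
- exact: integrable_mehler.
- by move=> t _; exact: mehler_ge.
Qed.

Lemma mixture_gt0 y : 0 < F y.
Proof. by apply: lt_le_trans (mixture_ge y); rewrite !mulr_gt0// expR_gt0. Qed.

Lemma normr_ln_mixture_le :
  exists C, forall y, `|ln (F y)| <= C * (1 + sqnorm y).
Proof.
pose L := ln (M * (s ^+ N)^-1).
exists (`|L| + (B + 1) / s ^+ 2 + B / 4) => y.
have y0 := sqnorm_ge0 y.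
have Ms0 : 0 < M * (s ^+ N)^-1 by rewrite mulr_gt0.
have u1 : ln (F y) <= L + B / 4.
  rewrite -[X in _ + X]expRK -lnM ?posrE ?expR_gt0// ler_ln ?posrE ?mixture_gt0//.
    by rewrite -mulrA mixture_le.
  by rewrite mulr_gt0// expR_gt0.
have u2 : L + - (B + sqnorm y) / (2 * s ^+ 2) <= ln (F y).
  rewrite -[X in _ + X]expRK -lnM ?posrE ?expR_gt0// ler_ln ?posrE ?mixture_gt0//.
    by rewrite -mulrA mixture_ge.
  by rewrite mulr_gt0// expR_gt0.
have L1 := ler_norm L; have L2 := lerNnormlW (lexx `|L|).
have k0 : 0 < (s ^+ 2)^-1 by rewrite invr_gt0.
have e2 : - (B + sqnorm y) / (2 * s ^+ 2) = - ((B + sqnorm y) * (s ^+ 2)^-1) / 2.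
  by field; exact: lt0r_neq0.
rewrite e2 in u2; move: k0 u2 {e2}; set k := (s ^+ 2)^-1 => k0 u2.
have : 0 <= (`|L| + (B + 1) * k + B / 4) * sqnorm y - sqnorm y * k.
  have -> : (`|L| + (B + 1) * k + B / 4) * sqnorm y - sqnorm y * k =
    (`|L| + B * k + B / 4) * sqnorm y by ring.
  by rewrite mulr_ge0// !addr_ge0// ?mulr_ge0// ltW.
have := mulr_ge0 B0 (ltW k0); have := mulr_ge0 y0 (ltW k0).
have := normr_ge0 L; rewrite ler_norml; set sk := sqnorm y * k; set Bk := B * k.
move: u2; rewrite !mulrDl !mulrDr -/sk -/Bk => *; lra.
Qed.

Lemma measurable_mixture : measurable_fun setT (F : borelV R N -> R).
Proof.
have h := @measurable_fun_fubini_tonelli_G _ _ T (borelV R N) R nu (fun q => (p (X q.1) (q.2 : 'rV_N))%:E).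
apply/measurable_EFinP; rewrite (_ : EFin \o F = fubini_G nu (fun q : T * borelV R N => (p (X q.1) (q.2 : 'rV_N))%:E)); last first.
  by apply/funext => y /=; rewrite /mixture EFin_Rintegral//; exact: integrable_mehler.
apply: h => [|q]; last by rewrite lee_fin ltW// mehler_gt0.
by apply/measurable_EFinP; apply: measurable_mehler => //; exact: measurable_fstX.
Qed.

Lemma mehler_affine t y :
  (s ^+ N)^-1 * expR ((sqnorm y - sqnorm (y - r *: X t) / s ^+ 2) / 4) = p (X t) y.
Proof.
congr (_ * expR _); rewrite sqnormB sqnormZ dotZr (dotC y).
have -> : r ^+ 2 = 1 - s ^+ 2 by rewrite -rs addrK.
by field; exact: lt0r_neq0.
Qed.

(** Given x, the vector y = r x + s z has density [p x y] with respect to the Gaussian measure. *)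
Lemma ge0_integral_rotate (H : T * borelV R N -> \bar R) :
  measurable_fun setT H -> (forall q, 0 <= H q)%E ->
  (\int[PI]_q H (q.1, Y q) = \int[PI]_q (H q * (p (X q.1) (q.2 : 'rV_N))%:E))%E.
Proof.
move=> mH H0.
have m1 : measurable_fun setT (fun q : T * borelV R N => H (q.1, Y q)).
  apply: (measurableT_comp mH); apply/measurable_fun_pair => //.
  exact: measurable_rotate.
have m2 : measurable_fun setT
    (fun q : T * borelV R N => H q * (p (X q.1) (q.2 : 'rV_N))%:E)%E.
  apply: emeasurable_funM => //; apply/measurable_EFinP.
  by apply: measurable_mehler => //; exact: measurable_fstX.
have h2 (q : T * borelV R N) : (0 <= H q * (p (X q.1) (q.2 : 'rV_N))%:E)%E.
  by rewrite mule_ge0// lee_fin ltW// mehler_gt0.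
rewrite (fubini_tonelli1 _ m1 (fun q => H0 _)) (fubini_tonelli1 _ m2 h2).
apply: eq_integral => t _; rewrite /fubini_F.
have mHt := measurableT_comp mH (measurable_pair1 t).
apply: etrans (@ge0_integral_gauss_affine _ N (fun y => H (t, y)) (r *: X t) s s0 mHt (fun y => H0 (t, y))) _.
by apply: eq_integral => y _; rewrite mehler_affine.
Qed.

Lemma integral_rotate (h : T * borelV R N -> R) : measurable_fun setT h ->
  PI.-integrable setT (EFin \o (fun q => h (q.1, Y q : borelV R N))) ->
  PI.-integrable setT (EFin \o (fun q => h q * p (X q.1) (q.2 : 'rV_N))) /\
  \int[PI]_q h (q.1, Y q : borelV R N) = \int[PI]_q (h q * p (X q.1) (q.2 : 'rV_N)).
Proof.
move=> mh hi.
have md : measurable_fun setT (fun q : T * borelV R N => p (X q.1) (q.2 : 'rV_N)).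
  by apply: measurable_mehler => //; exact: measurable_fstX.
have mE : measurable_fun setT (EFin \o h) by exact/measurable_EFinP.
split.
  apply/integrableP; split; first by apply/measurable_EFinP; exact: measurable_funM.
  have /integrableP[_] := hi.
  rewrite (@ge0_integral_rotate (abse \o (EFin \o h)))//; last 2 first.
  - exact: measurableT_comp.
  - by move=> q; exact: abse_ge0.
  move=> h1; rewrite [X in (X < _)%E](_ : _ = \int[PI]_q ((abse \o (EFin \o h)) q * (p (X q.1) (q.2 : 'rV_N))%:E))%E//.
  apply: eq_integral => q _ /=.
  by rewrite normrM EFinM (gtr0_norm (mehler_gt0 _ _)).
rewrite /Rintegral integralE [in RHS]integralE; congr (fine (_ - _)).
- transitivity (\int[PI]_q ((EFin \o h)^\+ (q.1, Y q : borelV R N)))%E.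
    by apply: eq_integral => q _; rewrite ?funeposE ?funenegE.
  rewrite (@ge0_integral_rotate (EFin \o h)^\+%E)//; last exact: measurable_funepos.
  apply: eq_integral => q _; rewrite !funeposE /= -!EFin_max -EFinM; congr EFin.
  by rewrite maxr_pMl ?mul0r// ltW// mehler_gt0.
- transitivity (\int[PI]_q ((EFin \o h)^\- (q.1, Y q : borelV R N)))%E.
    by apply: eq_integral => q _; rewrite ?funeposE ?funenegE.
  rewrite (@ge0_integral_rotate (EFin \o h)^\-%E)//; last exact: measurable_funeneg.
  apply: eq_integral => q _; rewrite !funenegE /= -!EFin_max -EFinM; congr EFin.
  by rewrite maxr_pMl ?mul0r ?mulNr// ltW// mehler_gt0.
Qed.

(** The gradient in y of [ln (mehler r s (X t) y)]. *)
Definition drift t (y : 'rV[R]_N) : 'rV[R]_N := (r / (2 * s ^+ 2)) *: (X t - r *: y).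

(** The gradient of [ln F], written as the mean of the drift given y. That it is a gradient is used
    only through the inequality [ln_mixture_diff]. *)
Definition score (y : 'rV[R]_N) : 'rV[R]_N :=
  \row_i ((F y)^-1 * \int[nu]_t (drift t y 0 i * p (X t) y)).

Let k0 : 0 <= r / (2 * s ^+ 2).
Proof. by rewrite divr_ge0// mulr_ge0// ltW. Qed.

Lemma sqnorm_drift_le t y :
  sqnorm (drift t y) <= (r / (2 * s ^+ 2)) ^+ 2 * (2 * B + 2 * sqnorm y).
Proof.
rewrite sqnormZ ler_wpM2l ?sqr_ge0//; apply: (le_trans (sqnormB_le _ _)).
rewrite sqnormZ; have := XB t; have r1 : r ^+ 2 <= 1 by rewrite -rs lerDl ltW.
by have := ler_wpM2r (sqnorm_ge0 y) r1; lra.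
Qed.

Lemma measurable_drift (y : 'rV[R]_N) :
  measurable_fun setT (fun t => drift t y : borelV R N).
Proof. by rewrite /drift; meas. Qed.

(* [xi] represents the score: conditionally on y, its mean is [score y]. *)
Definition represents_score (y : 'rV[R]_N) (xi : T -> 'rV[R]_N) :=
  [/\ measurable_fun setT (xi : T -> borelV R N), exists C, forall t, sqnorm (xi t) <= C &
  forall i, F y * score y 0 i = \int[nu]_t (xi t 0 i * p (X t) y)].

Lemma drift_represents y : represents_score y (drift ^~ y).
Proof.
split; first exact: measurable_drift.
  by eexists => t; exact: sqnorm_drift_le.
by move=> i; rewrite mxE mulrA mulfV ?mul1r// lt0r_neq0// mixture_gt0.
Qed.

Lemma integrable_dot_mehler y (xi : T -> 'rV[R]_N) C v :
  measurable_fun setT (xi : T -> borelV R N) -> (forall t, sqnorm (xi t) <= C) ->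
  nu.-integrable setT (EFin \o (fun t => dot (xi t) v * p (X t) y)).
Proof.
move=> mxi xiC; apply: (@integrable_mehlerM (fun t => dot (xi t) v) ((C + sqnorm v) / 2)).
  by meas.
by move=> t; apply: (le_trans (normr_dot_le _ _)); have := xiC t; lra.
Qed.

Lemma represents_dot y xi v : represents_score y xi ->
  F y * dot (score y) v = \int[nu]_t (dot (xi t) v * p (X t) y).
Proof.
move=> [mxi [C xiC] h].
have ii i : nu.-integrable setT (EFin \o (fun t => xi t 0 i * p (X t) y)).
  apply: (@integrable_mehlerM (fun t => xi t 0 i) (1 + C)); first exact: measurable_rV_coord.
  by move=> t; apply: (le_trans (coord_le_sqnorm _ _)); rewrite lerD2l.
transitivity (\int[nu]_t \sum_i (v 0 i * (xi t 0 i * p (X t) y))).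
  rewrite Rintegral_sum; last by move=> i; exact: integrable_RZ.
  rewrite dotE mulr_sumr; apply: eq_bigr => i _.
  by rewrite mulrA h RintegralZl// mulrC.
apply: eq_Rintegral => t _; rewrite dotE mulr_suml; apply: eq_bigr => i _.
by rewrite mulrCA mulrA.
Qed.

Lemma integrable_sqnorm_mehler y (xi : T -> 'rV[R]_N) C :
  measurable_fun setT (xi : T -> borelV R N) -> (forall t, sqnorm (xi t) <= C) ->
  nu.-integrable setT (EFin \o (fun t => sqnorm (xi t) * p (X t) y)).
Proof.
move=> mxi xiC; apply: (@integrable_mehlerM (fun t => sqnorm (xi t)) C); first by meas.
by move=> t; rewrite ger0_norm ?sqnorm_ge0.
Qed.

(* Jensen's inequality for the squared norm of a conditional expectation. *)
Lemma sqnorm_score_le y xi : represents_score y xi ->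
  F y * sqnorm (score y) <= \int[nu]_t (sqnorm (xi t) * p (X t) y).
Proof.
move=> hxi; have [mxi [C xiC] _] := hxi.
have i1 := integrable_sqnorm_mehler y mxi xiC.
have i2 := integrable_dot_mehler y (score y) mxi xiC.
have i3 := integrable_mehler y.
have : 0 <= \int[nu]_t (sqnorm (xi t - score y) * p (X t) y).
  by apply: Rintegral_ge0 => t _; rewrite mulr_ge0 ?sqnorm_ge0// ltW// mehler_gt0.
have -> : \int[nu]_t (sqnorm (xi t - score y) * p (X t) y) =
  \int[nu]_t (sqnorm (xi t) * p (X t) y - 2 * (dot (xi t) (score y) * p (X t) y)
              + sqnorm (score y) * p (X t) y).
  by apply: eq_Rintegral => t _; rewrite sqnormB; ring.
rewrite RintegralD//; [|by apply: integrable_RB => //; exact: integrable_RZ|exact: integrable_RZ].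
rewrite RintegralB//; last exact: integrable_RZ.
rewrite (RintegralZl 2 measurableT i2) (RintegralZl (sqnorm (score y)) measurableT i3).
rewrite -(represents_dot (score y) hxi) -/(F y) -/(sqnorm (score y)).
lra.
Qed.

(** Adding r^2 |y|^2 / (4 s^2) to [ln F] gives the logarithm of an integral of exponentials of
    affine functions of y, hence a convex function. This is its tangent inequality at [y2]. *)
Lemma ln_mixture_diff y1 y2 : ln (F y2) - ln (F y1) <=
  dot (score y2) (y2 - y1) + r ^+ 2 / (4 * s ^+ 2) * sqnorm (y2 - y1).
Proof.
set D := y2 - y1; set c := _ * sqnorm D.
(* The mean, given [y2], of the exponent - <drift, D> - c. Jensen's inequality is obtained by
   bounding the exponential from below by its tangent at this value. *)
pose lb := - dot (score y2) D - c.
have hd := drift_represents y2; have [md [C dC] _] := hd.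
have i2 := integrable_dot_mehler y2 D md dC.
have i3 := integrable_mehler y2.
have pE t : p (X t) y1 = p (X t) y2 * expR (- dot (drift t y2) D - c).
  rewrite /mehler -[RHS]mulrA -expRD; congr (_ * expR _).
  rewrite /c /D dotZl dotBl dotZl !dotBr sqnormB -!/(sqnorm _) (dotC y2 y1).
  by field; exact: lt0r_neq0.
have : expR lb * F y2 <= F y1.
  have -> : expR lb * F y2 = \int[nu]_t (expR lb * ((1 - c - lb) * p (X t) y2 -
      dot (drift t y2) D * p (X t) y2)).
    rewrite RintegralZl//; last by apply: integrable_RB => //; exact: integrable_RZ.
    rewrite RintegralB//; last exact: integrable_RZ.
    rewrite RintegralZl// -(represents_dot D hd) -/(F y2) /lb; congr (_ * _); ring.
  apply: le_Rintegral => //; last 2 first.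
  - exact: integrable_mehler.
  - move=> t _; rewrite pE.
    have -> : expR lb * ((1 - c - lb) * p (X t) y2 - dot (drift t y2) D * p (X t) y2) =
      p (X t) y2 * ((1 - c - lb - dot (drift t y2) D) * expR lb) by ring.
    rewrite ler_pM2l ?mehler_gt0//.
    rewrite (_ : - dot (drift t y2) D - c = lb + (- dot (drift t y2) D - c - lb)); last by ring.
    rewrite [X in _ <= X]expRD [leRHS]mulrC ler_pM2r ?expR_gt0//.
    by apply: le_trans (expR_ge1Dx _); rewrite le_eqVlt; apply/orP; left; apply/eqP; ring.
  - by apply: integrable_RZ; apply: integrable_RB => //; exact: integrable_RZ.
rewrite -ler_ln ?posrE ?mulr_gt0 ?expR_gt0 ?mixture_gt0//.
rewrite lnM ?posrE ?expR_gt0 ?mixture_gt0// expRK /lb.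
by rewrite lerBlDr -lerBlDl opprD addrC.
Qed.

(** The bound does not grow with y because <u, v> - |v|^2 <= |u|^2 / 4, with u = X and v = r y. It
    controls the radial part of a rotation step. *)
Lemma dot_score_id_le y : dot (score y) y <= B / (8 * s ^+ 2).
Proof.
have hd := drift_represents y; have [md [C dC] _] := hd.
rewrite -(ler_pM2l (mixture_gt0 y)) (represents_dot y hd) mulrC -RintegralZl//; last exact: integrable_mehler.
apply: le_Rintegral => //.
- exact: integrable_dot_mehler dC.
- by apply: integrable_RZ; exact: integrable_mehler.
move=> t _; rewrite ler_pM2r ?mehler_gt0// dotZl dotBl dotZl -/(sqnorm y).
rewrite -subr_ge0 (_ : _ - _ = (B - 4 * (r * dot (X t) y - r ^+ 2 * sqnorm y)) / (8 * s ^+ 2)); last first.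
  by field; exact: lt0r_neq0.
apply: divr_ge0; last by rewrite mulr_ge0// ltW.
have := sqnorm_ge0 (X t - (2 * r) *: y); rewrite sqnormB sqnormZ dotZr.
have := XB t; rewrite exprMn; lra.
Qed.

Lemma sqnorm_score_bound y :
  sqnorm (score y) <= (r / (2 * s ^+ 2)) ^+ 2 * (2 * B + 2 * sqnorm y).
Proof.
have hd := drift_represents y; have [md [C dC] _] := hd.
rewrite -(ler_pM2l (mixture_gt0 y)); apply: (le_trans (sqnorm_score_le hd)).
rewrite mulrC -RintegralZl//; last exact: integrable_mehler.
apply: le_Rintegral => //.
- exact: integrable_sqnorm_mehler dC.
- by apply: integrable_RZ; exact: integrable_mehler.
by move=> t _; rewrite ler_pM2r ?mehler_gt0// sqnorm_drift_le.
Qed.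

Lemma measurable_drift_prod :
  measurable_fun setT (fun q : T * borelV R N => drift q.1 (q.2 : 'rV_N) : borelV R N).
Proof. by rewrite /drift; meas; exact: measurable_fstX. Qed.

Lemma measurable_score : measurable_fun setT (score : borelV R N -> borelV R N).
Proof.
apply: measurable_fun_rV => i.
under eq_fun do rewrite mxE.
apply: measurable_funM.
  (* As [F] is positive, its inverse is written as exp (- ln F), whose measurability follows by
     composition. *)
  rewrite (_ : (fun y => _) = (fun y => expR (- ln (F y)))); last first.
    by apply/funext => y; rewrite expRN lnK// posrE mixture_gt0.
  apply: measurableT_comp => //; apply: measurable_funN; apply: measurableT_comp => //.
  exact: measurable_mixture.
pose h (q : T * borelV R N) := drift q.1 (q.2 : 'rV_N) 0 i * p (X q.1) (q.2 : 'rV_N).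
have hz z : nu.-integrable setT (EFin \o (fun t => h (t, z))).
  apply: (@integrable_mehlerM (fun t => drift t z 0 i)
    (1 + (r / (2 * s ^+ 2)) ^+ 2 * (2 * B + 2 * sqnorm (z : 'rV_N)))).
    by apply: measurable_rV_coord; exact: measurable_drift.
  by move=> t; apply: (le_trans (coord_le_sqnorm _ _)); rewrite lerD2l sqnorm_drift_le.
suff /Rintegral_prod21[//|/measurable_integrable//] : PI.-integrable setT (EFin \o h).
set k := (r / (2 * s ^+ 2)) ^+ 2; pose K := (s ^+ N)^-1 * expR (B / 4).
apply: (@integrable_prod_quadratic _ ((1 + k * (2 * B) + k * 2) * K)).
  apply: measurable_funM; first by apply: measurable_rV_coord; exact: measurable_drift_prod.
  by apply: measurable_mehler => //; exact: measurable_fstX.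
move=> t z; rewrite normrM (gtr0_norm (mehler_gt0 _ _)) mulrAC.
apply: ler_pM => //; first by rewrite ltW// mehler_gt0.
  apply: (le_trans (coord_le_sqnorm _ _)).
  have := sqnorm_drift_le t z; rewrite -/k => h1.
  have k1 : 0 <= k by rewrite sqr_ge0.
  exact: (quadratic_bound1 k1 B0 (sqnorm_ge0 (z : 'rV_N)) h1).
exact: mehler_le.
Qed.

Lemma measurable_mixture_rotate r' s' :
  measurable_fun setT (fun q => F (rotate r' s' q)).
Proof. exact: (measurableT_comp measurable_mixture (measurable_rotate r' s')). Qed.

Lemma integrable_ln_mixture r' s' : r' ^+ 2 + s' ^+ 2 = 1 ->
  PI.-integrable setT (EFin \o (fun q => ln (F (rotate r' s' q)))).
Proof.
move=> rs'; have [C hC] := normr_ln_mixture_le.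
have C0 : 0 <= C.
  by have := hC 0; rewrite /sqnorm dot0l addr0 mulr1; exact: le_trans.
apply: (@integrable_prod_quadratic _ (C * (1 + 2 * B + 2))).
  by apply: measurableT_comp => //; exact: measurable_mixture_rotate.
move=> t z; apply: (le_trans (hC _)); rewrite -mulrA ler_wpM2l//.
have := sqnorm_rotate_le t z rs'; have := sqnorm_ge0 (z : 'rV_N).
have := mulr_ge0 B0 (sqnorm_ge0 (z : 'rV_N)); lra.
Qed.

(** Given y, the drift has mean [score y], so pairing it with the score amounts to squaring the
    score. *)
Lemma score_drift_energy :
  [/\ PI.-integrable setT (EFin \o (fun q => dot (score (Y q)) (drift q.1 (Y q)))),
   G.-integrable setT (EFin \o (fun y : borelV R N => F y * sqnorm (score y))) &
   \int[PI]_q dot (score (Y q)) (drift q.1 (Y q)) =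
   \int[G]_y (F y * sqnorm (score y))].
Proof.
pose h (q : T * borelV R N) := dot (score q.2) (drift q.1 (q.2 : 'rV_N)).
have ms : measurable_fun setT (fun q : T * borelV R N => score (q.2 : 'rV_N) : borelV R N).
  exact: (measurableT_comp measurable_score measurable_snd).
have mh : measurable_fun setT h by apply: measurable_dot; [exact: ms|exact: measurable_drift_prod].
set k := (r / (2 * s ^+ 2)) ^+ 2.
have k1 : 0 <= k by rewrite sqr_ge0.
have ih : PI.-integrable setT (EFin \o (fun q => h (q.1, Y q : borelV R N))).
  apply: (@integrable_prod_quadratic _ (k * (6 * B + 4))).
    by apply: (measurableT_comp mh); apply/measurable_fun_pair => //; exact: measurable_rotate.
  move=> t z; apply: (le_trans (normr_dot_le _ _)).
  have := sqnorm_score_bound (Y (t, z)); have := sqnorm_drift_le t (Y (t, z)); rewrite -/k /=.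
  have := ler_wpM2l k1 (sqnorm_rotate_le t z rs).
  have z0 := sqnorm_ge0 (z : 'rV_N).
  have := mulr_ge0 k1 B0; have := mulr_ge0 (mulr_ge0 k1 B0) z0; lra.
have [ihp ->] := integral_rotate mh ih.
have hz z : nu.-integrable setT (EFin \o (fun t => h (t, z) * p (X t) z)).
  have [md [C dC] _] := drift_represents z.
  by rewrite /h /=; under [X in EFin \o X]eq_fun do rewrite dotC; exact: integrable_dot_mehler dC.
have [i1 E1] := @Rintegral_prod21 (fun q => h q * p (X q.1) (q.2 : 'rV_N)) ihp hz.
have E2 (y : borelV R N) : \int[nu]_t (h (t, y) * p (X t) y) = F y * sqnorm (score y).
  rewrite /h /sqnorm (represents_dot _ (drift_represents y)).
  by apply: eq_Rintegral => t _; rewrite dotC.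
split => //; first by rewrite -(_ : (fun y : borelV R N => \int[nu]_t (h (t, y) * p (X t) y)) =
    (fun y : borelV R N => F y * sqnorm (score y)))//; apply/funext.
by rewrite E1; apply: eq_Rintegral => y _; exact: E2.
Qed.

End fixed_time.

(** In the application [1%:M - Q] is the tangent projector and the vector is grad F / F + H, where F
    is the product of phi, of [mehler r s _ y] and of the Gaussian density. The normal half of x in
    [a] completes the tangential half coming from the Gaussian density to x / 2. *)
Definition divergence_identity := forall r s (y : 'rV[R]_N) i,
  0 <= r -> 0 < s -> r ^+ 2 + s ^+ 2 = 1 ->
  \int[nu]_t (((r / (2 * s ^+ 2)) *: ((y - r *: X t) *m (1%:M - Q t)) + a t - 2^-1 *: X t) 0 i
     * mehler r s (X t) y) = 0.

(** The single equation Q^T Q = Q makes Q symmetric and idempotent, hence a contraction. *)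
Lemma sqnorm_mulQ_le t (w : 'rV[R]_N) : sqnorm (w *m Q t) <= sqnorm w.
Proof.
have [QQ _] := trQ t.
have Qs : (Q t)^T = Q t by rewrite -QQ trmx_mul trmxK.
have E : sqnorm (w *m Q t) = dot (w *m Q t) w.
  by rewrite {1}/sqnorm dotC dot_trmx -mulmxA Qs -[X in _ *m (X *m _)]Qs QQ dotC.
by have := dot_le_sqnorm (w *m Q t) w; rewrite -E; lra.
Qed.

Section divergence.
Hypothesis div : divergence_identity.
Variables (r s : R).
Hypotheses (r0 : 0 <= r) (s0 : 0 < s) (rs : r ^+ 2 + s ^+ 2 = 1).
Local Notation p := (mehler r s).
Local Notation F := (mixture r s).
Local Notation Y := (rotate r s).
Local Notation J := (\int[nu]_t sqnorm (a t)).

Let xi t (y : 'rV[R]_N) : 'rV[R]_N :=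
  r *: a t - (r ^+ 2 / (2 * s ^+ 2)) *: ((y - r *: X t) *m Q t).

Let measurable_xi y : measurable_fun setT (fun t => xi t y : borelV R N).
Proof. by rewrite /xi; meas. Qed.

Let measurable_xi_prod :
  measurable_fun setT (fun q : T * borelV R N => xi q.1 (q.2 : 'rV_N) : borelV R N).
Proof.
rewrite /xi; meas.
- exact: (measurableT_comp ma measurable_fst).
- exact: measurable_fstX.
- by move=> i j; exact: (measurableT_comp (mQ i j) measurable_fst).
Qed.

Let xi_le t y : sqnorm (xi t y) <= 2 * (r ^+ 2 * A) +
  2 * ((r ^+ 2 / (2 * s ^+ 2)) ^+ 2 * (2 * sqnorm y + 2 * (r ^+ 2 * B))).
Proof.
apply: (le_trans (sqnormB_le _ _)); rewrite !sqnormZ lerD// ler_pM2l// ler_wpM2l ?sqr_ge0//.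
apply: (le_trans (sqnorm_mulQ_le _ _)); apply: (le_trans (sqnormB_le _ _)).
by rewrite sqnormZ lerD2l ler_pM2l// ler_wpM2l ?sqr_ge0.
Qed.

Let represents_xi y : represents_score r s y (xi ^~ y).
Proof.
split; [exact: measurable_xi|by eexists => t; exact: xi_le|move=> i].
have [md [C dC] ->] := drift_represents s0 rs y.
have dC' t : `|drift r s t y 0 i| <= 1 + C by apply: (le_trans (coord_le_sqnorm _ _)); rewrite lerD2l.
have i1 := integrable_mehlerM s0 rs y (measurable_rV_coord i md) dC'.
have := div y i r0 s0 rs; set V := fun t => _; rewrite -[LHS]/(\int[nu]_t V t).
(* Adding [r] times the null integrand to the drift replaces its tangential part by [a]; the
   remaining multiples of X and y cancel because r^2 = 1 - s^2. *)
have xE t : xi t y 0 i * p (X t) y = drift r s t y 0 i * p (X t) y + r * V t.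
  rewrite /V (mulrA r) -mulrDl; congr (_ * _).
  rewrite /xi /drift mulmxBr mulmx1.
  move: ((y - r *: X t) *m Q t) => w; rewrite !mxE.
  have -> : r ^+ 2 = 1 - s ^+ 2 by rewrite -rs addrK.
  have rr : r * r = 1 - s ^+ 2 by rewrite -rs addrK expr2.
  have -> : r * (r / (2 * s ^+ 2) * (y 0 i - r * X t 0 i - w 0 i) + a t 0 i - 2^-1 * X t 0 i) =
    (r * r) / (2 * s ^+ 2) * (y 0 i - w 0 i) - r * (r * r) / (2 * s ^+ 2) * X t 0 i + r * a t 0 i - r * 2^-1 * X t 0 i by ring.
  have -> : r / (2 * s ^+ 2) * (X t 0 i - r * y 0 i) = r / (2 * s ^+ 2) * X t 0 i - (r * r) / (2 * s ^+ 2) * y 0 i by ring.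
  rewrite rr; field; exact: lt0r_neq0.
have i2 : nu.-integrable setT (EFin \o V).
  have mV : measurable_fun setT ((fun t => (r / (2 * s ^+ 2)) *: ((y - r *: X t) *m (1%:M - Q t)) + a t - 2^-1 *: X t) : T -> borelV R N).
    meas => k l; under eq_fun do rewrite !mxE; by meas.
  have [C' hC'] : exists C', forall t, sqnorm ((r / (2 * s ^+ 2)) *: ((y - r *: X t) *m (1%:M - Q t)) + a t - 2^-1 *: X t) <= C'.
    set k := r / (2 * s ^+ 2).
    exists (2 * (2 * (k ^+ 2 * (4 * (2 * sqnorm y + 2 * (r ^+ 2 * B)))) + 2 * A) + 2 * ((2^-1) ^+ 2 * B)) => t.
    apply: (le_trans (sqnormB_le _ _)); rewrite lerD//; last first.
      by rewrite ler_pM2l// sqnormZ ler_wpM2l// sqr_ge0.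
    rewrite ler_pM2l//; apply: (le_trans (sqnormD_le _ _)); rewrite lerD//; last by rewrite ler_pM2l.
    rewrite ler_pM2l// sqnormZ ler_wpM2l ?sqr_ge0// mulmxBr mulmx1.
    have h1 := sqnorm_mulQ_le t (y - r *: X t); have h2 := sqnormB_le (y - r *: X t) ((y - r *: X t) *m Q t).
    have h3 := sqnormB_le y (r *: X t); rewrite sqnormZ in h3.
    have h4 := ler_wpM2l (sqr_ge0 r) (XB t).
    by apply: (le_trans h2); lra.
  have hC2 t : `|((r / (2 * s ^+ 2)) *: ((y - r *: X t) *m (1%:M - Q t)) + a t - 2^-1 *: X t) 0 i| <= 1 + C'.
    by apply: (le_trans (coord_le_sqnorm _ _)); rewrite lerD2l.
  exact: (integrable_mehlerM s0 rs y (measurable_rV_coord i mV) hC2).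
move=> V0; under [RHS]eq_Rintegral do rewrite xE.
by rewrite RintegralD//; [rewrite RintegralZl// V0 mulr0 addr0|exact: integrable_RZ].
Qed.

(** At y = r X + s z the representative [xi] becomes r a - c z Q with c = r^2 / (2 s). The cross
    term has mean 0 in z, and |z Q|^2 has mean at most 2 tr Q = 2 m. *)
Lemma score_energy_le : \int[G]_y (F y * sqnorm (score r s y)) <=
  r ^+ 2 * J + r ^+ 4 * m * M / (2 * s ^+ 2).
Proof.
pose h (q : T * borelV R N) := sqnorm (xi q.1 (q.2 : 'rV_N)).
have mh : measurable_fun setT h by rewrite /h; meas; exact: measurable_xi_prod.
pose c := r ^+ 2 / (2 * s).
have hE t z : h (t, Y (t, z) : borelV R N) =
    r ^+ 2 * sqnorm (a t) - 2 * (r * c) * dot (z : 'rV_N) (a t *m (Q t)^T) + c ^+ 2 * sqnorm ((z : 'rV_N) *m Q t).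
  have -> : h (t, Y (t, z) : borelV R N) = sqnorm (r *: a t - c *: ((z : 'rV_N) *m Q t)).
    have eY : Y (t, z) - r *: X t = s *: (z : 'rV_N) by rewrite /rotate addrAC subrr add0r.
    have ec : r ^+ 2 / (2 * s ^+ 2) * s = c by rewrite /c; field; exact: lt0r_neq0.
    by rewrite -[LHS]/(sqnorm (xi t (Y (t, z)))) /xi eY -scalemxAl scalerA ec.
  by rewrite sqnormB !sqnormZ dotZl dotZr (dotC (a t)) dot_trmx; ring.
have ih : PI.-integrable setT (EFin \o (fun q => h (q.1, Y q : borelV R N))).
  set k := (r ^+ 2 / (2 * s ^+ 2)) ^+ 2.
  have k1 : 0 <= k by rewrite sqr_ge0.
  have A0 (t : T) : 0 <= A := le_trans (sqnorm_ge0 _) (aA t).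
  apply: (@integrable_prod_quadratic _ (2 * (r ^+ 2 * A) + 2 * (k * (2 * (2 * B + 2) + 2 * (r ^+ 2 * B))))).
    by apply: (measurableT_comp mh); apply/measurable_fun_pair => //; exact: measurable_rotate.
  move=> t z; rewrite ger0_norm ?sqnorm_ge0//; apply: (le_trans (xi_le _ _)); rewrite -/k /=.
  exact: (quadratic_bound2 (mulr_ge0 (sqr_ge0 r) (A0 t)) k1 B0 (mulr_ge0 (sqr_ge0 r) B0)
    (sqnorm_ge0 (z : 'rV_N)) (sqnorm_rotate_le t z rs)).
have [ihp E] := integral_rotate s0 rs mh ih.
have hz z : nu.-integrable setT (EFin \o (fun t => h (t, z) * p (X t) z)).
  exact: (integrable_sqnorm_mehler s0 rs z (measurable_xi z) (xi_le ^~ z)).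
have [i1 E1] := @Rintegral_prod21 (fun q => h q * p (X q.1) (q.2 : 'rV_N)) ihp hz.
have [_ iF _] := score_drift_energy s0 rs.
have it t : G.-integrable setT (EFin \o (fun z : borelV R N => h (t, Y (t, z) : borelV R N))).
  under [X in EFin \o X]eq_fun do rewrite hE.
  apply: integrable_RD; last by apply: integrable_RZ; exact: integrable_sqnorm_mulmx.
  by apply: integrable_RB; [exact: integrable_cst|apply: integrable_RZ; exact: integrable_dot].
have [i2 E2] := Rintegral_prod12 ih it.
apply: (@le_trans _ _ (\int[PI]_q h (q.1, Y q : borelV R N))).
  by rewrite E E1; apply: le_Rintegral => // y _; exact: (sqnorm_score_le s0 rs (represents_xi y)).
have ia : nu.-integrable setT (EFin \o (fun t => sqnorm (a t))).
  apply: (@integrable_bounded _ _ _ _ _ A); first by meas.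
  by move=> t; rewrite ger0_norm ?sqnorm_ge0.
apply: (@le_trans _ _ (\int[nu]_t (r ^+ 2 * sqnorm (a t) + c ^+ 2 * (2 * m)))).
  rewrite E2; apply: le_Rintegral => //.
    by apply: integrable_RD; [exact: integrable_RZ|exact: integrable_cst].
  move=> t _; rewrite -[X in X <= _]/(\int[G]_z h (t, Y (t, z) : borelV R N)).
  under eq_Rintegral do rewrite hE.
  rewrite RintegralD//; last 2 first.
  - apply: integrable_RB; first exact: (integrable_cst _ (r ^+ 2 * sqnorm (a t))).
    by apply: integrable_RZ; exact: integrable_dot.
  - by apply: integrable_RZ; exact: integrable_sqnorm_mulmx.
  rewrite RintegralB//; last 2 first.
  - exact: (integrable_cst _ (r ^+ 2 * sqnorm (a t))).
  - by apply: integrable_RZ; exact: integrable_dot.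
  rewrite RintegralT_cst RintegralZl//; last exact: integrable_dot.
  rewrite gauss_mean mulr0 subr0 [fine _]gauss_fineT mulr1 lerD2l.
  rewrite RintegralZl//; last exact: integrable_sqnorm_mulmx.
  rewrite ler_wpM2l ?sqr_ge0//; apply: (le_trans (gauss_sqnorm_mulmx _)).
  by have [-> ->] := trQ t.
rewrite RintegralD//; [|exact: integrable_RZ|exact: integrable_cst].
rewrite RintegralZl// RintegralT_cst lerD2l le_eqVlt; apply/orP; left; apply/eqP.
by rewrite /c; field; exact: lt0r_neq0.
Qed.

End divergence.

Lemma ge0_integral_mixture r s : 0 < s -> r ^+ 2 + s ^+ 2 = 1 ->
  (\int[G]_y (mixture r s (y : 'rV_N))%:E = nu setT)%E.
Proof.
move=> s0 rs.
have mp : measurable_fun setT (fun q : T * borelV R N => (mehler r s (X q.1) (q.2 : 'rV_N))%:E).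
  by apply/measurable_EFinP; apply: measurable_mehler => //; exact: measurable_fstX.
have p0 (q : T * borelV R N) : (0 <= (mehler r s (X q.1) (q.2 : 'rV_N))%:E)%E.
  by rewrite lee_fin ltW// mehler_gt0.
have := @ge0_integral_rotate r s s0 rs (cst 1%E) (@measurable_cst _ _ _ _ _ _) (fun=> lee01).
under [X in _ = X -> _]eq_integral do rewrite mul1e.
rewrite (fubini_tonelli2 _ mp p0) (fubini_tonelli1 _ (@measurable_cst _ _ _ _ _ _) (fun=> lee01)).
rewrite [X in X = _ -> _](_ : _ = \int[nu]_t (cst 1%E t))%E; last first.
  by apply: eq_integral => t _; rewrite /fubini_F integral_cst// mul1e; exact: gauss_setT.
rewrite integral_cst// mul1e => ->.
apply: eq_integral => y _; rewrite /fubini_G /mixture EFin_Rintegral//.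
exact: integrable_mehler.
Qed.

Section step.
Hypothesis div : divergence_identity.
Hypothesis m0 : 0 <= m.
Local Notation J := (\int[nu]_t sqnorm (a t)).
Variables (r1 s1 r2 s2 : R).
Hypotheses (r10 : 0 <= r1) (s10 : 0 < s1) (rs1 : r1 ^+ 2 + s1 ^+ 2 = 1).
Hypotheses (r20 : 0 <= r2) (s20 : 0 < s2) (rs2 : r2 ^+ 2 + s2 ^+ 2 = 1).

(** Gibbs' inequality: ln t <= t - 1 is applied to the quotient of two densities of equal mass. It
    reduces a step to comparing one density at two rotated points, so that the dependence of the
    density on the angle need not be studied. *)
Lemma cross_entropy_le : \int[PI]_q ln (mixture r2 s2 (rotate r1 s1 q)) <= entropy r1 s1.
Proof.
have F1 y := mixture_gt0 s10 rs1 y; have F2 y := mixture_gt0 s20 rs2 y.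
pose h (q : T * borelV R N) := mixture r2 s2 (q.2 : 'rV_N) / mixture r1 s1 (q.2 : 'rV_N).
have h0 q : 0 <= h q by rewrite ltW// divr_gt0.
have mh : measurable_fun setT h.
  rewrite /h (_ : (fun q => _) = (fun q : T * borelV R N => mixture r2 s2 (q.2 : 'rV_N) * expR (- ln (mixture r1 s1 (q.2 : 'rV_N))))); last first.
    by apply/funext => q; rewrite expRN lnK// posrE.
  have m1 : measurable_fun setT (fun q : T * borelV R N => mixture r1 s1 (q.2 : 'rV_N)).
    exact: (measurableT_comp (measurable_mixture s10 rs1) measurable_snd).
  apply: measurable_funM; first exact: (measurableT_comp (measurable_mixture s20 rs2) measurable_snd).
  by apply: measurableT_comp => //; apply: measurable_funN; apply: measurableT_comp.
have mp : measurable_fun setT (fun q : T * borelV R N => mehler r1 s1 (X q.1) (q.2 : 'rV_N)).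
  by apply: measurable_mehler => //; exact: measurable_fstX.
have E : (\int[PI]_q (h (q.1, rotate r1 s1 q : borelV R N))%:E = nu setT)%E.
  rewrite (@ge0_integral_rotate r1 s1 s10 rs1 (EFin \o h))//; last exact/measurable_EFinP.
  rewrite fubini_tonelli2; last 2 first.
  - by apply: emeasurable_funM; exact/measurable_EFinP.
  - by move=> q; rewrite mule_ge0 ?lee_fin// ltW// mehler_gt0.
  rewrite -(@ge0_integral_mixture r2 s2 s20 rs2); apply: eq_integral => y _.
  rewrite /fubini_G /= /h /=.
  rewrite ge0_integralZl//.
  - rewrite -EFin_Rintegral; last exact: integrable_mehler.
    by rewrite -[X in (_ * X%:E)%E]/(mixture r1 s1 y) -EFinM divfK// lt0r_neq0.
  - by apply/measurable_EFinP; exact: measurable_mehler.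
  - by move=> t _; rewrite lee_fin ltW// mehler_gt0.
  - by rewrite lee_fin (h0 (point, y)).
have ih : PI.-integrable setT (EFin \o (fun q => h (q.1, rotate r1 s1 q : borelV R N))).
  apply: integrable_ge0; last by rewrite E ltey_eq fin_num_measure.
    by apply: (measurableT_comp mh); apply/measurable_fun_pair => //; exact: measurable_rotate.
  by move=> q; exact: h0.
have i1 := integrable_ln_mixture s10 rs1 rs1.
have i2 := integrable_ln_mixture s20 rs2 rs1.
have PT := prod_mass.
have -> : entropy r1 s1 = entropy r1 s1 + (\int[PI]_q h (q.1, rotate r1 s1 q : borelV R N) - M).
  by rewrite /Rintegral E subrr addr0.
rewrite -PT.
have icst : PI.-integrable setT (EFin \o cst (1 : R)).
  apply: (@integrable_prod_quadratic _ 1) => //.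
  by move=> t z; rewrite normr1 mul1r lerDl sqnorm_ge0.
have -> : fine (PI setT) = \int[PI]_q cst (1 : R) q by rewrite Rintegral_cst// mul1r.
rewrite -(RintegralB measurableT ih icst) -(RintegralD measurableT i1 (integrable_RB ih icst)).
apply: (le_Rintegral measurableT i2 (integrable_RD i1 (integrable_RB ih icst))).
move=> q _; rewrite /h /= -lerBlDl -ln_div ?posrE//.
have := @le_ln1Dx R (mixture r2 s2 (rotate r1 s1 q) / mixture r1 s1 (rotate r1 s1 q) - 1).
rewrite [1 + _]addrC subrK; apply.
by rewrite ltrBrDl addrN divr_gt0.
Qed.

(** The vector s X - r z is the derivative of [rotate] in the angle. At y = r X + s z it equals (X -
    r y) / s, that is (2 s / r) times the drift, so the energy bound applies. *)
Lemma score_rotate_le :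
  PI.-integrable setT (EFin \o (fun q => dot (score r2 s2 (rotate r2 s2 q)) (s2 *: X q.1 - r2 *: (q.2 : 'rV_N)))) /\
  \int[PI]_q dot (score r2 s2 (rotate r2 s2 q)) (s2 *: X q.1 - r2 *: (q.2 : 'rV_N)) <=
  2 * s2 * r2 * J + r2 ^+ 3 * m * M / s2.
Proof.
have [i1 _ E1] := score_drift_energy s20 rs2.
have := score_energy_le div r20 s20 rs2; rewrite -E1 => le1.
(* The factor 2 s / r excludes r = 0, where the drift and the score vanish. *)
have [r2z|r2n] := eqVneq r2 0.
  have s0 y : score r2 s2 y = 0.
    apply/rowP => i; rewrite mxE [RHS]mxE.
    have d0 t : drift r2 s2 t y 0 i = 0 by rewrite /drift r2z mul0r scale0r mxE.
    under eq_Rintegral do rewrite d0 mul0r.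
    by rewrite /Rintegral integral0_eq// mulr0.
  have -> : (fun q : T * borelV R N => dot (score r2 s2 (rotate r2 s2 q)) (s2 *: X q.1 - r2 *: (q.2 : 'rV_N))) = cst 0.
    by apply/funext => q; rewrite s0 dot0l.
  split.
    by rewrite (_ : _ \o _ = cst 0%E)//; exact: integrable0.
  by rewrite /Rintegral integral0_eq// r2z !mulr0 !mul0r add0r expr0n/= !mul0r.
have r2p : 0 < r2 by rewrite lt0r r2n.
have E q : dot (score r2 s2 (rotate r2 s2 q)) (s2 *: X q.1 - r2 *: (q.2 : 'rV_N)) =
    (2 * s2 / r2) * dot (score r2 s2 (rotate r2 s2 q)) (drift r2 s2 q.1 (rotate r2 s2 q)).
  rewrite -dotZr; congr dot.
  have e : X q.1 - r2 *: rotate r2 s2 q = s2 *: (s2 *: X q.1 - r2 *: (q.2 : 'rV_N)).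
    rewrite /rotate scalerDr scalerBr !scalerA opprD addrA (mulrC s2 r2).
    rewrite -{1}[X q.1]scale1r -scalerBl; congr (_ *: _ - _).
    by rewrite -rs2; ring.
  rewrite /drift e !scalerA.
  by rewrite (_ : _ * s2 = 1) ?scale1r//; field; rewrite r2n lt0r_neq0.
split.
  by under [X in EFin \o X]eq_fun do rewrite E; exact: integrable_RZ.
under eq_Rintegral do rewrite E.
rewrite RintegralZl//.
apply: (@le_trans _ _ (2 * s2 / r2 * (r2 ^+ 2 * J + r2 ^+ 4 * m * M / (2 * s2 ^+ 2)))).
  by rewrite ler_wpM2l// divr_ge0// mulr_ge0// ltW.
rewrite le_eqVlt; apply/orP; left; apply/eqP; field; by rewrite r2n lt0r_neq0.
Qed.

Local Notation c := (r1 * r2 + s1 * s2).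
Local Notation sg := (s1 * r2 - s2 * r1).

(** Here [sg] is the sine and [c] the cosine of the angle between the two positions: the first term
    is a derivative bound, the second an error of second order. *)
Lemma entropy_step : 0 <= sg -> entropy r2 s2 - entropy r1 s1 <=
  sg * (2 * s2 * r2 * J + r2 ^+ 3 * m * M / s2) +
  (1 - c) * (M * B / (8 * s2 ^+ 2) + (B + 2 * N%:R) * M / s2 ^+ 2).
Proof.
move=> sg0.
have c1 : (r2 - r1) ^+ 2 + (s2 - s1) ^+ 2 = 2 * (1 - c).
  transitivity (r1 ^+ 2 + s1 ^+ 2 + (r2 ^+ 2 + s2 ^+ 2) - 2 * c); first by ring.
  by rewrite rs1 rs2; ring.
have c0 : 0 <= 1 - c by have := sqr_ge0 (r2 - r1); have := sqr_ge0 (s2 - s1); lra.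
have s220 : 0 < s2 ^+ 2 by rewrite exprn_gt0.
have [iW leW] := score_rotate_le.
set W := fun q : T * borelV R N => dot (score r2 s2 (rotate r2 s2 q)) (s2 *: X q.1 - r2 *: (q.2 : 'rV_N)) in iW leW.
have i1 := integrable_ln_mixture s20 rs2 rs1.
have i2 := integrable_ln_mixture s20 rs2 rs2.
pose k := 1 / (4 * s2 ^+ 2).
have k0 : 0 <= k by rewrite divr_ge0// mulr_ge0// ltW.
pose U (q : T * borelV R N) := ((1 - c) * (B / (8 * s2 ^+ 2)) + k * (2 * ((r2 - r1) ^+ 2 * B))) + sg * W q +
   k * (2 * (s2 - s1) ^+ 2) * sqnorm (q.2 : 'rV_N).
have iz : PI.-integrable setT (EFin \o (fun q : T * borelV R N => sqnorm (q.2 : 'rV_N))).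
  apply: (@integrable_prod_quadratic _ 1).
    by apply: measurable_sqnorm.
  by move=> t z; rewrite ger0_norm ?sqnorm_ge0// mul1r lerDr.
have ic (x : R) : PI.-integrable setT (EFin \o cst x).
  apply: (@integrable_prod_quadratic _ `|x|) => //.
  by move=> t z; rewrite mulrDr mulr1 lerDl mulr_ge0// sqnorm_ge0.
have iU : PI.-integrable setT (EFin \o U).
  by apply: integrable_RD; [apply: integrable_RD; [exact: ic|exact: integrable_RZ]|exact: integrable_RZ].
have PT := prod_mass.
have zle : \int[PI]_q sqnorm (q.2 : 'rV_N) <= M * (2 * N%:R).
  have [_ ->] := Rintegral_prod12 iz (fun=> @integrable_sqnorm R N).
  have -> : \int[nu]_t \int[G]_z sqnorm ((t, z).2 : 'rV_N) = (\int[G]_z sqnorm (z : 'rV_N)) * M.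
    exact: (RintegralT_cst nu (\int[G]_z sqnorm (z : 'rV_N))).
  by rewrite mulrC ler_wpM2l ?(ltW M0)//; exact: gauss_sqnorm.
have UE : \int[PI]_q U q = ((1 - c) * (B / (8 * s2 ^+ 2)) + k * (2 * ((r2 - r1) ^+ 2 * B))) * M + sg * \int[PI]_q W q +
    k * (2 * (s2 - s1) ^+ 2) * \int[PI]_q sqnorm (q.2 : 'rV_N).
  rewrite RintegralD//; [|by apply: integrable_RD; [exact: ic|exact: integrable_RZ]|exact: integrable_RZ].
  rewrite RintegralD//; [|exact: ic|exact: integrable_RZ].
  by rewrite !RintegralZl// Rintegral_cst// PT.
have pw q : ln (mixture r2 s2 (rotate r2 s2 q)) - ln (mixture r2 s2 (rotate r1 s1 q)) <= U q.
  apply: (le_trans (ln_mixture_diff s20 rs2 _ _)).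
  have -> : rotate r2 s2 q - rotate r1 s1 q = (r2 - r1) *: X q.1 + (s2 - s1) *: (q.2 : 'rV_N).
    by rewrite /rotate !scalerBl opprD addrACA.
  have := sqnormD_le ((r2 - r1) *: X q.1) ((s2 - s1) *: (q.2 : 'rV_N)).
  set D := sqnorm (_ + _); rewrite !sqnormZ => leD.
  (* The displacement is split along the second position and its angular derivative. The radial
     coefficient 1 - c is of second order, and [dot_score_id_le] bounds what it multiplies. *)
  have -> : (r2 - r1) *: X q.1 + (s2 - s1) *: (q.2 : 'rV_N) =
      (1 - c) *: rotate r2 s2 q + sg *: (s2 *: X q.1 - r2 *: (q.2 : 'rV_N)).
    rewrite /rotate !scalerDr !scalerN !scalerA addrACA -scalerDl -scalerBl; congr (_ *: _ + _ *: _).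
      transitivity (r2 - r1 * (r2 ^+ 2 + s2 ^+ 2)); first by rewrite rs2 mulr1.
      ring.
    transitivity (s2 - s1 * (r2 ^+ 2 + s2 ^+ 2)); first by rewrite rs2 mulr1.
    ring.
  rewrite dotDr !dotZr -/(W q) /U.
  have h1 := ler_wpM2l c0 (dot_score_id_le s20 rs2 (rotate r2 s2 q)).
  have r21 : r2 ^+ 2 <= 1 by rewrite -rs2 lerDl ltW.
  have h2 : r2 ^+ 2 / (4 * s2 ^+ 2) * D <= k * D.
    rewrite ler_wpM2r ?sqnorm_ge0// ler_wpM2r// ?invr_ge0 ?mulr_ge0// ltW//.
  have h3 := ler_wpM2l k0 leD.
  have h4 := ler_wpM2l k0 (ler_wpM2l (sqr_ge0 (r2 - r1)) (XB q.1)).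
  by apply: step_arith1; [exact: h1|exact: h2|exact: h3|exact: h4].
(* The cross entropy is inserted, after which the density at the second angle occurs at both points
   and the pointwise bound [pw] applies. *)
have le1 : entropy r2 s2 - entropy r1 s1 <= \int[PI]_q U q.
  apply: (@le_trans _ _ (entropy r2 s2 - \int[PI]_q ln (mixture r2 s2 (rotate r1 s1 q)))).
    by rewrite lerD2l lerN2 cross_entropy_le.
  rewrite -(RintegralB measurableT i2 i1).
  by apply: (le_Rintegral measurableT (integrable_RB i2 i1) iU) => q _; exact: pw.
apply: (le_trans le1); rewrite UE.
have h1 := ler_wpM2l sg0 leW.
have h2 : k * (2 * (s2 - s1) ^+ 2) * \int[PI]_q sqnorm (q.2 : 'rV_N) <=
    k * (2 * (s2 - s1) ^+ 2) * (M * (2 * N%:R)).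
  by rewrite ler_wpM2l// mulr_ge0// mulr_ge0// sqr_ge0.
have h3 : k * (2 * (r2 - r1) ^+ 2) * (B * M) <= k * (2 * (2 * (1 - c))) * (B * M).
  apply: ler_wpM2r; first by rewrite mulr_ge0// ltW.
  by rewrite ler_wpM2l// ler_pM2l// -c1 lerDl sqr_ge0.
have h4 : k * (2 * (s2 - s1) ^+ 2) * (M * (2 * N%:R)) <= k * (2 * (2 * (1 - c))) * (M * (2 * N%:R)).
  apply: ler_wpM2r; first by rewrite !mulr_ge0// ltW.
  by rewrite ler_wpM2l// ler_pM2l// -c1 lerDr sqr_ge0.
have -> : M * B / (8 * s2 ^+ 2) + (B + 2 * N%:R) * M / s2 ^+ 2 =
    B / (8 * s2 ^+ 2) * M + k * 4 * (B * M) + k * 4 * (M * (2 * N%:R)).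
  by rewrite /k; field; exact: lt0r_neq0.
by apply: step_arith2; [exact: h1|exact: h2|exact: h3|exact: h4].
Qed.

End step.

Section conclusion.
Hypothesis div : divergence_identity.
Hypothesis m0 : 0 <= m.
Local Notation J := (\int[nu]_t sqnorm (a t)).

Let J0 : 0 <= J.
Proof. by apply: Rintegral_ge0 => t _; exact: sqnorm_ge0. Qed.

Let Gam r s : R := r ^+ 2 * J - m / 2 * M * (r ^+ 2 + 2 * ln s).

Lemma entropy_gap_step (sm r1 s1 r2 s2 : R) : 0 < sm ->
  0 <= r1 -> sm <= s1 -> r1 ^+ 2 + s1 ^+ 2 = 1 ->
  0 <= r2 -> sm <= s2 -> r2 ^+ 2 + s2 ^+ 2 = 1 ->
  0 <= s1 * r2 - s2 * r1 ->
  entropy r2 s2 - Gam r2 s2 - (entropy r1 s1 - Gam r1 s1) <=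
  (6 * J + m * M * (2 * (1 / sm ^+ 2 + 1 / 2) + 1) +
   (M * B / (8 * sm ^+ 2) + (B + 2 * N%:R) * M / sm ^+ 2)) *
  (1 - (r1 * r2 + s1 * s2)).
Proof.
move=> sm0 r10 sms1 rs1 r20 sms2 rs2 sg0.
have s10 := lt_le_trans sm0 sms1; have s20 := lt_le_trans sm0 sms2.
have mM0 : 0 <= m * M by rewrite mulr_ge0// ltW.
have gap := circle_gap sm0 sms1 sms2 rs1 rs2 J0 mM0.
have step := entropy_step div s10 rs1 r20 s20 rs2 sg0.
have c1 : (r2 - r1) ^+ 2 + (s2 - s1) ^+ 2 = 2 * (1 - (r1 * r2 + s1 * s2)).
  transitivity (r1 ^+ 2 + s1 ^+ 2 + (r2 ^+ 2 + s2 ^+ 2) - 2 * (r1 * r2 + s1 * s2)); first by ring.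
  by rewrite rs1 rs2; ring.
have c0 : 0 <= 1 - (r1 * r2 + s1 * s2).
  by rewrite -(pmulr_rge0 _ (ltr0n R 2)) -c1 addr_ge0// sqr_ge0.
have rest : M * B / (8 * s2 ^+ 2) + (B + 2 * N%:R) * M / s2 ^+ 2 <=
    M * B / (8 * sm ^+ 2) + (B + 2 * N%:R) * M / sm ^+ 2.
  have ss : sm ^+ 2 <= s2 ^+ 2 by rewrite ler_sqr ?nnegrE ?(ltW sm0) ?(ltW s20).
  have MB : 0 <= M * B by rewrite mulr_ge0// ltW.
  apply: lerD; rewrite ler_wpM2l ?mulr_ge0 ?addr_ge0 ?mulr_ge0 ?(ltW M0)//.
    by rewrite lef_pV2 ?posrE ?mulr_gt0 ?exprn_gt0// ler_pM2l.
  by rewrite lef_pV2 ?posrE ?exprn_gt0.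
have h3 := ler_wpM2l c0 rest.
rewrite /Gam lerBlDr; move: (lerD step (lexx (entropy r1 s1))); rewrite subrK => {}step.
exact: (gap_arith step h3 gap).
Qed.

Lemma entropy01 : entropy 0 1 = M * ln M.
Proof.
have F1 y : mixture 0 1 y = M.
  rewrite /mixture; under eq_Rintegral do
    rewrite /mehler !(mulr0, mul0r, expr0n) /= ?mul0r ?subrr ?oppr0 ?mul0r expR0 mulr1 expr1n invr1.
  by rewrite RintegralT_cst mul1r.
rewrite /entropy; under eq_Rintegral do rewrite F1.
rewrite Rintegral_cst// mulrC; congr (_ * _); exact: prod_mass.
Qed.

(* The one-step estimate has an error quadratic in the angle, which vanishes in the
   limit of fine subdivisions of the arc from (0, 1) to (r, s). *)
Lemma entropy_le r s : 0 <= r -> 0 < s -> r ^+ 2 + s ^+ 2 = 1 ->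
  entropy r s <= M * ln M + r ^+ 2 * J - m / 2 * M * (r ^+ 2 + 2 * ln s).
Proof.
move=> r0 s0 rs.
have s1 : s <= 1.
  have : s ^+ 2 <= 1 by rewrite -rs lerDr sqr_ge0.
  by move: s0; rewrite expr2; nra.
pose b := acos s.
have sI : -1 <= s <= 1 by rewrite s1 andbT; lra.
have cb : cos b = s by rewrite /b acosK// in_itv.
have b0 : 0 <= b by rewrite acos_ge0.
have bpi : b <= pi by rewrite acos_lepi.
have sb : sin b = r.
  rewrite /b sin_acos//; apply/eqP.
  by rewrite (_ : 1 - s ^+ 2 = r ^+ 2) ?sqrtr_sqr ?ger0_norm// -rs addrK.
pose f x := entropy (sin x) (cos x) - Gam (sin x) (cos x).
suff : f b <= f 0.
  rewrite /f sin0 cos0 sb cb entropy01 /Gam ln1 expr0n/=; lra.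
set C := (6 * J + m * M * (2 * (1 / s ^+ 2 + 1 / 2) + 1) +
   (M * B / (8 * s ^+ 2) + (B + 2 * N%:R) * M / s ^+ 2)).
have s2 : 0 < s ^+ 2 by rewrite exprn_gt0.
have C0 : 0 <= C.
  have M0' := ltW M0; have i1 : 0 <= 1 / s ^+ 2 by rewrite divr_ge0// ltW.
  rewrite /C !addr_ge0// ?divr_ge0 ?mulr_ge0 ?addr_ge0 ?mulr_ge0 ?addr_ge0//; exact: ltW.
apply: (@telescoping_le _ f b C b0 C0) => x y x0 xy yb.
have y0 := le_trans x0 xy.
have ypi := le_trans yb bpi; have xpi := le_trans xy ypi.
(* The cosine stays above [s] along the arc, so [s] serves as the uniform lower bound of
   [entropy_gap_step]. *)
have mono z : 0 <= z -> z <= b -> s <= cos z.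
  move=> z0; rewrite le_eqVlt => /orP[/eqP ->|zb]; first by rewrite cb.
  by rewrite -cb ltW// ltr_cos ?in_itv/= ?z0 ?b0 ?bpi//= (le_trans (ltW zb)).
have sin0' z : 0 <= z -> z <= b -> 0 <= sin z.
  by move=> z0 zb; rewrite sin_ge0_pi// z0 (le_trans zb).
have := @entropy_gap_step s (sin x) (cos x) (sin y) (cos y) s0 (sin0' _ x0 (le_trans xy yb))
  (mono _ x0 (le_trans xy yb)).
rewrite (addrC (sin x ^+ 2)) cos2Dsin2 => /(_ erefl (sin0' _ y0 yb) (mono _ y0 yb)).
rewrite (addrC (sin y ^+ 2)) cos2Dsin2 => /(_ erefl).
have -> : cos x * sin y - cos y * sin x = sin (y - x) by rewrite sinB; ring.
have -> : sin x * sin y + cos x * cos y = cos (y - x) by rewrite cosB; ring.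
have yx0 : 0 <= y - x by rewrite subr_ge0.
move=> /(_ _) h; apply: (le_trans (h _)).
  by rewrite sin_ge0_pi// yx0/= (le_trans _ ypi)// lerBlDr lerDl.
by rewrite ler_wpM2l// one_sub_cos_le.
Qed.

(* Fatou's lemma as s -> 0; [g] is the logarithm of the density of [nu] with
   respect to the Gaussian measure of the submanifold. *)
Lemma log_density_le (g : T -> R) (Cg C : R) (r_ s_ : nat -> R) :
  measurable_fun setT g -> (forall t, `|g t| <= Cg) ->
  (forall k, [/\ 0 <= r_ k, 0 < s_ k & r_ k ^+ 2 + s_ k ^+ 2 = 1]) ->
  r_ @ \oo --> (1 : R) ->
  (forall k t z, - (C * (1 + sqnorm z)) <=
     ln (mixture (r_ k) (s_ k) (rotate (r_ k) (s_ k) (t, z))) + m * ln (s_ k)) ->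
  (forall t z e, 0 < e -> \forall k \near \oo, g t - sqnorm (z *m Q t) / 4 - e <=
     ln (mixture (r_ k) (s_ k) (rotate (r_ k) (s_ k) (t, z))) + m * ln (s_ k)) ->
  \int[nu]_t g t <= M * ln M + J.
Proof.
move=> mg gC rs r1 low lim.
pose f_ k (q : T * borelV R N) := ln (mixture (r_ k) (s_ k) (rotate (r_ k) (s_ k) q)) + m * ln (s_ k).
pose f (q : T * borelV R N) := g q.1 - sqnorm ((q.2 : 'rV_N) *m Q q.1) / 4.
have ic (x : R) : PI.-integrable setT (EFin \o cst x).
  apply: (@integrable_prod_quadratic _ `|x|) => //.
  by move=> t z; rewrite mulrDr mulr1 lerDl mulr_ge0// sqnorm_ge0.
have PT := prod_mass.
have izQ : PI.-integrable setT (EFin \o (fun q : T * borelV R N => sqnorm ((q.2 : 'rV_N) *m Q q.1))).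
  apply: (@integrable_prod_quadratic _ 1).
    apply: measurable_sqnorm; apply: measurable_rV_mulmx => // i j.
    exact: (measurableT_comp (mQ i j) measurable_fst).
  move=> t z; rewrite ger0_norm ?sqnorm_ge0// mul1r.
  by apply: (le_trans (sqnorm_mulQ_le _ _)); rewrite lerDr.
have ig : PI.-integrable setT (EFin \o (fun q : T * borelV R N => g q.1)).
  apply: (@integrable_prod_quadratic _ Cg); first exact: (measurableT_comp mg measurable_fst).
  move=> t z; apply: (le_trans (gC t)); rewrite mulrDr mulr1 lerDl mulr_ge0 ?sqnorm_ge0//.
  exact: (le_trans _ (gC t)).
have fE : f = (fun q : T * borelV R N => g q.1 - 4^-1 * sqnorm ((q.2 : 'rV_N) *m Q q.1)).
  by apply/funext => q; rewrite /f mulrC.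
have if_ : PI.-integrable setT (EFin \o f).
  by rewrite fE; apply: integrable_RB => //; exact: integrable_RZ.
have ifk k : PI.-integrable setT (EFin \o f_ k).
  have [r0 s0 rs1] := rs k.
  by apply: integrable_RD; [exact: integrable_ln_mixture|exact: ic].
have iK : PI.-integrable setT (EFin \o (fun q : T * borelV R N => C * (1 + sqnorm (q.2 : 'rV_N)))).
  apply: (@integrable_prod_quadratic _ `|C|).
    by apply: measurable_funM => //; apply: measurable_funD => //; exact: measurable_sqnorm.
  by move=> t z; rewrite normrM (ger0_norm (addr_ge0 _ (sqnorm_ge0 _))).
(* The term m M ln s in the entropy bound cancels the integral of [m * ln (s_ k)], so this bound
   stays finite as s tends to 0. *)
pose b_ k := M * ln M + r_ k ^+ 2 * J - m / 2 * M * r_ k ^+ 2.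
have fb k : \int[PI]_q f_ k q <= b_ k.
  have [r0 s0 rs1] := rs k.
  rewrite RintegralD//; [|exact: integrable_ln_mixture|exact: ic].
  rewrite Rintegral_cst// PT -/(entropy _ _); have := entropy_le r0 s0 rs1; rewrite /b_; lra.
have bcvg : b_ @ \oo --> M * ln M + J - m / 2 * M.
  have r2 : (fun k => r_ k ^+ 2) @ \oo --> (1 : R).
    have h : (r_ \* r_) @ \oo --> (1 * 1 : R) by exact: cvgM.
    rewrite mulr1 in h.
    by apply: cvg_trans h; apply: near_eq_cvg; apply: nearW => k /=; rewrite expr2.
  have h : b_ @ \oo --> M * ln M + 1 * J - m / 2 * M * 1.
    exact: (cvgB (cvgD (cvg_cst _) (cvgM r2 (cvg_cst J))) (cvgM (cvg_cst _) r2)).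
  by rewrite mul1r mulr1 in h.
have := @ge0_fatou_real _ _ _ PI f_ f _ b_ _ ifk if_ iK.
move=> h.
have {h}: \int[PI]_q f q <= M * ln M + J - m / 2 * M.
  apply: (h _ _ _ fb bcvg) => [k [t z]|[t z] e e0]; [exact: low|exact: lim].
rewrite fE RintegralB//; last exact: integrable_RZ.
rewrite RintegralZl//.
have izt t : G.-integrable setT (EFin \o (fun z : borelV R N => sqnorm ((z : 'rV_N) *m Q t))).
  exact: integrable_sqnorm_mulmx.
have igt t : G.-integrable setT (EFin \o (fun z : borelV R N => g t)) by exact: integrable_cst.
have [i1 ->] := Rintegral_prod12 ig igt.
have [i2 ->] := Rintegral_prod12 izQ izt.
have -> : \int[nu]_t \int[G]_z g (t, z).1 = \int[nu]_t g t.
  apply: eq_Rintegral => t _; rewrite [LHS](RintegralT_cst G (g t)).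
  by rewrite [fine _]gauss_fineT mulr1.
(* With the factor 1 / 4 this costs at most m M / 2, exactly what the limit of [b_] provides. *)
have : \int[nu]_t \int[G]_z sqnorm ((t, z).2 *m Q (t, z).1 : 'rV_N) <= \int[nu]_t (2 * m).
  apply: le_Rintegral => //; first exact: (integrable_cst nu (2 * m)).
  move=> t _; change (\int[G]_z sqnorm ((z : 'rV_N) *m Q t) <= 2 * m).
  apply: (le_trans (gauss_sqnorm_mulmx (Q t))).
  by have [-> ->] := trQ t.
rewrite RintegralT_cst; set x := \int[nu]_t \int[G]_z _; lra.
Qed.

End conclusion.
End core.

(** * Continuously differentiable functions *)

Section directional.
Context {R : realType} {V W : normedModType R}.

(** Identifies directional derivatives with derivatives of a real variable, to which the chain rule
    and the mean value theorem on the line apply. *)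
Lemma line_quotient (f : V -> W) (w v : V) (s : R) :
  (fun h : R => h^-1 *: (((fun t : R => f (w + t *: v)) \o shift s) (h *: 1) -
     f (w + s *: v))) =
  (fun h => h^-1 *: ((f \o shift (w + s *: v)) (h *: v) - f (w + s *: v))).
Proof.
apply/funext => h /=; congr (_ *: (f _ - _)).
by rewrite -[h%:A]/(h * 1) mulr1 scalerDl addrCA.
Qed.

Lemma is_derive_line (f : V -> W) (w v : V) (s : R) :
  derivable f (w + s *: v) v ->
  is_derive s 1 (fun t : R => f (w + t *: v)) ('D_v f (w + s *: v)).
Proof.
move=> df; apply: DeriveDef; first by move: df; rewrite /derivable -line_quotient.
by rewrite /derive -line_quotient.
Qed.

Lemma is_derive_lineP (f : V -> W) (u v : V) (d : W) :
  is_derive (0 : R) 1 (fun t : R => f (u + t *: v)) d -> is_derive u v f d.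
Proof.
move=> [h1 h2]; have E : u = u + (0 : R) *: v by rewrite scale0r addr0.
apply: DeriveDef; first by move: h1; rewrite /derivable (line_quotient f u v 0) -E.
by rewrite -h2 /derive (line_quotient f u v 0) -E.
Qed.

End directional.

Section chain.
Context {R : realType} {V : normedModType R}.

Lemma is_derive_compR (f : V -> R) (g : R -> R) u v (df dg : R) :
  is_derive u v f df -> is_derive (f u) 1 g dg -> is_derive u v (g \o f) (dg * df).
Proof.
move=> [h1 h2] hg; apply: is_derive_lineP.
have E : u = u + (0 : R) *: v by rewrite scale0r addr0.
have hl : is_derive (0 : R) 1 (fun t => f (u + t *: v)) df.
  by rewrite -h2 {2}E; apply: is_derive_line; rewrite -E.
rewrite {1}E in hg.
exact: (@is_derive1_comp R g (fun t => f (u + t *: v)) 0 dg df hg hl).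
Qed.

Lemma MVT_line (f : V -> R) (w v : V) (h : R) :
  (forall s : R, Num.min 0 h <= s <= Num.max 0 h -> derivable f (w + s *: v) v) ->
  exists s : R, Num.min 0 h <= s <= Num.max 0 h /\
    f (w + h *: v) - f w = h * 'D_v f (w + s *: v).
Proof.
move=> df; pose g (t : R) := f (w + t *: v); pose dg t := 'D_v f (w + t *: v).
have dgP s : Num.min 0 h <= s <= Num.max 0 h -> is_derive s 1 g (dg s).
  by move=> hs; apply: is_derive_line; exact: df.
have cg a b : {subset `[a, b] <= `[Num.min 0 h, Num.max 0 h]} ->
    {within `[a, b], continuous g}.
  move=> ab; apply: derivable_within_continuous => x /ab; rewrite in_itv/= => hx.
  by have [] := dgP _ hx.
have E0 : g 0 = f w by rewrite /g scale0r addr0.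
case: (leP 0 h) => h0.
- have mM : Num.min 0 h = 0 /\ Num.max 0 h = h by rewrite min_l ?max_r.
  have [||c] := @MVT_segment R g dg 0 h h0.
  + by move=> x; rewrite in_itv/= => /andP[x0 xh]; apply: dgP; rewrite !mM.1 !mM.2 !ltW.
  + by apply: cg; rewrite mM.1 mM.2.
  + rewrite in_itv/= => hc; rewrite E0 subr0 => E; exists c.
    by split=> //; rewrite mulrC; exact: E.
- have mM : Num.min 0 h = h /\ Num.max 0 h = 0 by rewrite min_r ?max_l// ltW.
  have [||c] := @MVT_segment R g dg h 0 (ltW h0).
  + by move=> x; rewrite in_itv/= => /andP[x0 xh]; apply: dgP; rewrite !mM.1 !mM.2 !ltW.
  + by apply: cg; rewrite mM.1 mM.2.
  + rewrite in_itv/= => hc; rewrite E0 sub0r => E; exists c.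
    by split=> //; rewrite -opprB E mulrN mulrC opprK.
Qed.

End chain.

Section C1.
Context {R : realType} {n : nat}.
Implicit Types (D : set 'rV[R]_n) (f g : 'rV[R]_n -> R) (u v : 'rV[R]_n).
Local Notation e i := (delta_mx 0 i : 'rV[R]_n).

Definition C1_on D f := forall u, D u -> {for u, continuous f} /\
  forall i, derivable f u (e i) /\ {for u, continuous ('D_(e i) f)}.

Lemma coord_le_norm (v : 'rV[R]_n) i : `|v 0 i| <= `|v|.
Proof.
rewrite [`|v|]/Num.Def.normr/= mx_normrE.
exact: (le_bigmax _ (fun ij : 'I_1 * 'I_n => `|v ij.1 ij.2|) (0, i)).
Qed.

Lemma norm_le_coord (v : 'rV[R]_n) (d : R) : 0 <= d -> (forall i, `|v 0 i| <= d) -> `|v| <= d.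
Proof.
move=> d0 h; rewrite [`|v|]/Num.Def.normr/= mx_normrE.
by apply/bigmax_leP; split=> // -[i j] _ /=; rewrite (ord1 i).
Qed.

Lemma norm_lt_coord (v : 'rV[R]_n) (d : R) : 0 < d -> (forall i, `|v 0 i| < d) -> `|v| < d.
Proof.
move=> d0 h; rewrite [`|v|]/Num.Def.normr/= mx_normrE.
by apply/bigmax_ltP; split=> // -[i j] _ /=; rewrite (ord1 i).
Qed.

Lemma ball_rVE (u v : 'rV[R]_n) d : ball u d v <-> `|u - v| < d.
Proof. by rewrite -ball_normE. Qed.

(** The vertices of a path from u' to u that changes one coordinate at a time. A ball of the sup
    norm that contains both ends contains the whole path. *)
Let mix u u' k : 'rV[R]_n := \row_(i < n) if (i < k)%N then u 0 i else u' 0 i.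

Let mixS u u' (k : 'I_n) : mix u u' k.+1 = mix u u' k + (u - u') 0 k *: e k.
Proof.
apply/rowP => i; rewrite !mxE ltnS eqxx/=.
case: (eqVneq i k) => [->|ik].
  by rewrite ltnn leqnn mulr1 addrCA subrr addr0.
by rewrite mulr0 addr0 leq_eqVlt val_eqE (negPf ik).
Qed.

(** Strict differentiability, by the mean value theorem on each edge of the path [mix]. Both points
    move, as is needed for the injectivity estimates on charts and for second differences. *)
Lemma C1_strict D f u0 : open D -> C1_on D f -> D u0 ->
  forall eps, 0 < eps -> exists2 d, 0 < d &
    forall u u', `|u - u0| < d -> `|u' - u0| < d ->
    `|f u - f u' - \sum_i (u - u') 0 i * 'D_(e i) f u0| <= eps * `|u - u'|.
Proof.
move=> oD cf Du0 eps eps0.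
have n0 : 0 < n.+1%:R :> R by rewrite ltr0n.
have : \forall u \near u0, D u /\ forall i, `|'D_(e i) f u - 'D_(e i) f u0| < eps / n.+1%:R.
  apply: filterI; first exact: open_nbhs_nbhs.
  apply: (@filter_forall _ _ (fun i u => `|'D_(e i) f u - 'D_(e i) f u0| < eps / n.+1%:R) _ (nbhs_filter u0)) => i.
  have [_ /(_ i)[_ ci]] := cf _ Du0.
  have /cvgrPdist_lt/(_ _ (divr_gt0 eps0 n0)) := ci.
  by apply: filterS => u; rewrite distrC.
move=> /nbhs_ballP[d /= d0 dP]; exists d => // u u' ud u'd.
have inD v : `|v - u0| < d -> D v /\ forall i, `|'D_(e i) f v - 'D_(e i) f u0| < eps / n.+1%:R.
  by move=> vd; apply: dP; apply/ball_rVE; rewrite distrC.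
have mix_ball k : forall (s : R) (i : 'I_n), i = k :> nat ->
    Num.min 0 ((u - u') 0 i) <= s <= Num.max 0 ((u - u') 0 i) ->
    `|mix u u' k + s *: e i - u0| < d.
  move=> s i ik hs; apply: norm_lt_coord => // j; rewrite !mxE eqxx/=.
  have hu := le_lt_trans (coord_le_norm _ j) ud.
  have hu' := le_lt_trans (coord_le_norm _ j) u'd.
  rewrite !mxE in hs hu hu'.
  case: (eqVneq j i) => [ji|ji].
    rewrite ji ik ltnn mulr1; rewrite ji in hu hu'.
    move: hs hu hu'; rewrite ge_min le_max; move: (u 0 i) (u' 0 i) (u0 0 i) => a b c.
    rewrite !ltr_norml => /andP[h1 h2] /andP[h3 h4] /andP[h5 h6].
    case/orP: h1 => h1; case/orP: h2 => h2; apply/andP; split; lra.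
  by rewrite mulr0 addr0; case: ifP.
have E : f u - f u' = \sum_(k < n) (f (mix u u' k.+1) - f (mix u u' k)).
  have -> : f u = f (mix u u' n) by congr f; apply/rowP => i; rewrite mxE ltn_ord.
  have -> : f u' = f (mix u u' 0) by congr f; apply/rowP => i; rewrite mxE.
  by rewrite -(big_mkord xpredT (fun k => f (mix u u' k.+1) - f (mix u u' k))) telescope_sumr.
rewrite E -sumrB; apply: le_trans (ler_norm_sum _ _ _) _.
have step (k : 'I_n) : `|f (mix u u' k.+1) - f (mix u u' k) - (u - u') 0 k * 'D_(e k) f u0| <=
    `|u - u'| * (eps / n.+1%:R).
  rewrite mixS; have [|s [hs ->]] := @MVT_line R _ f (mix u u' k) (e k) ((u - u') 0 k).
    move=> s hs; have [Ds _] := inD _ (mix_ball _ _ _ erefl hs).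
    by have [_ /(_ k)[]] := cf _ Ds.
  have [_ /(_ k) h] := inD _ (mix_ball _ _ _ erefl hs).
  by rewrite -mulrBr normrM ler_pM// ?coord_le_norm// ltW.
apply: le_trans (ler_sum _ (fun k _ => step k)) _.
rewrite sumr_const card_ord -mulrnAr mulrC ler_wpM2r// -mulr_natr -mulrA.
by rewrite ger_pMr// mulrC ler_pdivrMr// mul1r ler_nat.
Qed.

(** The chain rule along a curve with velocity [b]. The filter is arbitrary so that it covers limits
    h -> 0 (directional derivatives, changes of chart) as well as sequences (Laplace rescaling,
    difference quotients). *)
Lemma C1_curve D f u0 T (F : set_system T) {FF : Filter F} (tau : T -> 'rV[R]_n)
    (s : T -> R) (b : 'rV[R]_n) : open D -> C1_on D f -> D u0 ->
  tau x @[x --> F] --> u0 -> (s x)^-1 *: (tau x - u0) @[x --> F] --> b ->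
  (s x)^-1 * (f (tau x) - f u0) @[x --> F] --> \sum_i b 0 i * 'D_(e i) f u0.
Proof.
move=> oD cf Du0 ctau cs.
pose q x := (s x)^-1 *: (tau x - u0).
have h1 : \sum_i q x 0 i * 'D_(e i) f u0 @[x --> F] --> \sum_i b 0 i * 'D_(e i) f u0.
  apply: cvg_big => [|i _]; first exact: add_continuous.
  apply: cvgM; last exact: cvg_cst.
  exact: (cvg_comp _ _ cs (@coord_continuous _ _ _ 0 i b)).
rewrite -[X in _ --> X]add0r.
have -> : (fun x => (s x)^-1 * (f (tau x) - f u0)) =
    (fun x => ((s x)^-1 * (f (tau x) - f u0) - \sum_i q x 0 i * 'D_(e i) f u0) +
      \sum_i q x 0 i * 'D_(e i) f u0).
  by apply/funext => x; rewrite subrK.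
apply: cvgD h1; apply/cvgrPdist_le => eps eps0.
have K0 : 0 < `|b| + 1 by rewrite ltr_wpDl.
have [d d0 dP] := C1_strict oD cf Du0 (divr_gt0 eps0 K0).
have b1 : \forall x \near F, `|q x| <= `|b| + 1.
  have /cvgrPdist_le/(_ 1 ltr01) := cs; apply: filterS => x h.
  rewrite -[q x](subrK b) addrC (le_trans (ler_normD _ _))// lerD2l distrC.
  exact: h.
have b2 : \forall x \near F, `|tau x - u0| < d.
  by have /cvgrPdist_lt/(_ d d0) := ctau; apply: filterS => x; rewrite distrC.
apply: filterS2 b1 b2 => x h1 h2; rewrite sub0r normrN.
have := dP _ u0 h2; rewrite subrr normr0 => /(_ d0) h.
have -> : (s x)^-1 * (f (tau x) - f u0) - \sum_i q x 0 i * 'D_(e i) f u0 =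
    (s x)^-1 * (f (tau x) - f u0 - \sum_i (tau x - u0) 0 i * 'D_(e i) f u0).
  rewrite [RHS]mulrBr mulr_sumr; congr (_ - _); apply: eq_bigr => i _.
  by rewrite /q mxE mulrA.
rewrite normrM (le_trans (ler_wpM2l _ h))// mulrCA -normrZ.
rewrite -/(q x) (le_trans (ler_wpM2l _ h1)) ?(divr_ge0 (ltW eps0) (ltW K0))//.
by rewrite divfK// gt_eqF.
Qed.

Lemma C1_derive D f u v : open D -> C1_on D f -> D u ->
  derivable f u v /\ 'D_v f u = \sum_i v 0 i * 'D_(e i) f u.
Proof.
move=> oD cf Du.
have cv : h *: v + u @[h --> (0:R)^'] --> u.
  rewrite -[X in _ --> X]add0r -[in X in _ --> X](scale0r v).
  apply: cvgD; last exact: cvg_cst.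
  by apply: cvgZ; [exact: nbhs_dnbhs|exact: cvg_cst].
have hh : h^-1 * ((f \o shift u) (h *: v) - f u) @[h --> (0:R)^'] -->
    \sum_i v 0 i * 'D_(e i) f u.
  apply: (@C1_curve D f u R (0^') _ (fun h => h *: v + u) id v oD cf Du cv).
  apply: (@cvg_near_cst _ _ v _ (0 : R)^' _); near=> h.
  rewrite addrK scalerA mulVf ?scale1r//.
  by near: h; exact: nbhs_dnbhs_neq.
by split; [exact: (cvgP _ hh)|exact/cvg_lim].
Unshelve. all: by end_near. Qed.

Lemma cvg_rV T (F : set_system T) {FF : Filter F} (f : T -> 'rV[R]_n) (l : 'rV[R]_n) :
  (forall i, f x 0 i @[x --> F] --> l 0 i) -> f x @[x --> F] --> l.
Proof.
move=> h; apply/cvgrPdist_lt => eps eps0.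
have : \forall x \near F, forall i, `|l 0 i - f x 0 i| < eps.
  apply: (@filter_forall _ _ (fun i x => `|l 0 i - f x 0 i| < eps) F) => i.
  by have /cvgrPdist_lt/(_ _ eps0) := h i.
apply: filterS => x hx; apply: norm_lt_coord => // i.
by rewrite !mxE; exact: hx.
Qed.

Lemma C1_onI D f (df : 'I_n -> 'rV[R]_n -> R) : open D ->
  (forall u, D u -> {for u, continuous f}) ->
  (forall u i, D u -> is_derive u (e i) f (df i u)) ->
  (forall u i, D u -> {for u, continuous (df i)}) -> C1_on D f.
Proof.
move=> oD cf hf cdf u Du; split=> [|i]; first exact: cf.
split; first by have [] := hf u i Du.
have E : \near u, df i u = 'D_(e i) f u.
  have : nbhs u D by exact: open_nbhs_nbhs.
  by apply: filterS => v Dv; have [_ ->] := hf v i Dv.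
rewrite /prop_for /continuous_at -(nbhs_singleton E).
exact: (cvg_trans (near_eq_cvg E) (cdf u i Du)).
Qed.

Lemma C1_on_is_derive D f u i : C1_on D f -> D u -> is_derive u (e i) f ('D_(e i) f u).
Proof. by move=> cf Du; apply: DeriveDef => //; have [_ /(_ i)[]] := cf u Du. Qed.

Lemma C1_on_cst D (c : R) : open D -> C1_on D (fun=> c).
Proof.
move=> oD; apply: (@C1_onI _ _ (fun _ _ => 0)) => // u *; exact: cst_continuous.
Qed.

Lemma C1_onD D f g : open D -> C1_on D f -> C1_on D g -> C1_on D (fun u => f u + g u).
Proof.
move=> oD cf cg.
apply: (@C1_onI _ _ (fun i u => 'D_(e i) f u + 'D_(e i) g u)) => // [u Du|u i Du|u i Du].
- exact: (continuousD (proj1 (cf u Du)) (proj1 (cg u Du))).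
- exact: (is_deriveD (C1_on_is_derive i cf Du) (C1_on_is_derive i cg Du)).
- by apply: (continuousD (f := 'D_(e i) f)); [exact: (proj2 (proj2 (cf u Du) i))|
    exact: (proj2 (proj2 (cg u Du) i))].
Qed.

Lemma C1_onM D f g : open D -> C1_on D f -> C1_on D g -> C1_on D (fun u => f u * g u).
Proof.
move=> oD cf cg.
apply: (@C1_onI _ _ (fun i u => f u * 'D_(e i) g u + g u * 'D_(e i) f u)) => // [u Du|u i Du|u i Du].
- exact: (continuousM (proj1 (cf u Du)) (proj1 (cg u Du))).
- exact: (is_deriveM (C1_on_is_derive i cf Du) (C1_on_is_derive i cg Du)).
- have [[c1 /(_ i)[_ c2]] [c3 /(_ i)[_ c4]]] := (cf u Du, cg u Du).
  by apply: (continuousD (f := fun u => f u * 'D_(e i) g u)); apply: continuousM.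
Qed.

Lemma C1_onN D f : open D -> C1_on D f -> C1_on D (fun u => - f u).
Proof.
move=> oD cf; rewrite (_ : (fun _ => _) = (fun u => -1 * f u)).
  exact: (C1_onM oD (C1_on_cst _ oD) cf).
by apply/funext => u; rewrite mulN1r.
Qed.

Lemma C1_onB D f g : open D -> C1_on D f -> C1_on D g -> C1_on D (fun u => f u - g u).
Proof. by move=> oD cf cg; exact: (C1_onD oD cf (C1_onN oD cg)). Qed.

Lemma C1_on_sum D I (r : seq I) (P : pred I) (f : I -> 'rV[R]_n -> R) : open D ->
  (forall k, P k -> C1_on D (f k)) -> C1_on D (fun u => \sum_(k <- r | P k) f k u).
Proof.
move=> oD cf; elim: r => [|k r ih].
  rewrite (_ : (fun _ => _) = fun=> 0); first exact: C1_on_cst.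
  by apply/funext => u; rewrite big_nil.
rewrite (_ : (fun _ => _) = fun u => (if P k then f k u else 0) + \sum_(k <- r | P k) f k u).
  apply: (C1_onD oD) ih; case: (boolP (P k)) => [|_]; [exact: cf|exact: C1_on_cst].
by apply/funext => u; rewrite big_cons; case: (P k); rewrite ?add0r.
Qed.

Lemma C1_on_prod D I (r : seq I) (P : pred I) (f : I -> 'rV[R]_n -> R) : open D ->
  (forall k, P k -> C1_on D (f k)) -> C1_on D (fun u => \prod_(k <- r | P k) f k u).
Proof.
move=> oD cf; elim: r => [|k r ih].
  rewrite (_ : (fun _ => _) = fun=> 1); first exact: C1_on_cst.
  by apply/funext => u; rewrite big_nil.
rewrite (_ : (fun _ => _) = fun u => (if P k then f k u else 1) * \prod_(k <- r | P k) f k u).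
  apply: (C1_onM oD) ih; case: (boolP (P k)) => [|_]; [exact: cf|exact: C1_on_cst].
by apply/funext => u; rewrite big_cons; case: (P k); rewrite ?mul1r.
Qed.

Lemma C1_on_comp D f (g dg : R -> R) : open D -> C1_on D f ->
  (forall u, D u -> is_derive (f u) 1 g (dg (f u))) ->
  (forall u, D u -> {for f u, continuous dg}) -> C1_on D (fun u => g (f u)).
Proof.
move=> oD cf hg cdg.
apply: (@C1_onI _ _ (fun i u => dg (f u) * 'D_(e i) f u)) => // [u Du|u i Du|u i Du].
- apply: (continuous_comp (proj1 (cf u Du))); apply: differentiable_continuous.
  by apply/derivable1_diffP; have [] := hg u Du.
- exact: (is_derive_compR (C1_on_is_derive i cf Du) (hg u Du)).
- apply: (@continuousM _ _ (fun u => dg (f u)) ('D_(e i) f) u); last exact: (proj2 (proj2 (cf u Du) i)).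
  by apply: (continuous_comp (proj1 (cf u Du))); exact: cdg.
Qed.

Lemma C1_on_det D k (A : 'rV[R]_n -> 'M[R]_k) : open D ->
  (forall i j, C1_on D (fun u => A u i j)) -> C1_on D (fun u => \det (A u)).
Proof.
move=> oD cA; apply: (C1_on_sum _ oD) => s _; apply: (C1_onM oD (C1_on_cst _ oD)).
by apply: (C1_on_prod _ oD) => i _; exact: cA.
Qed.

Lemma C1_on_inv D f : open D -> C1_on D f -> (forall u, D u -> f u != 0) ->
  C1_on D (fun u => (f u)^-1).
Proof.
move=> oD cf f0; apply: (@C1_on_comp D f _ (fun x => - x ^- 2)) => // u Du.
- have := @is_deriveV R id (f u) 1 1 (f0 u Du).
  by rewrite scaler1 => h; exact: h.
- apply: continuousN; apply: (@continuous_comp _ _ _ (fun x : R => x ^+ 2) (fun x => x^-1)); first exact: exprn_continuous.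
  by apply: inv_continuous; rewrite expf_neq0// f0.
Qed.

Lemma C1_on_invmx D k (A : 'rV[R]_n -> 'M[R]_k) : open D ->
  (forall i j, C1_on D (fun u => A u i j)) -> (forall u, D u -> \det (A u) != 0) ->
  forall i j, C1_on D (fun u => invmx (A u) i j).
Proof.
move=> oD cA dA i j.
have h : C1_on D (fun u => (\det (A u))^-1 * cofactor (A u) j i).
  apply: (C1_onM oD (C1_on_inv oD (C1_on_det oD cA) dA)).
  apply: (C1_onM oD (C1_on_cst _ oD)).
  apply: (C1_on_det oD) => i' j'; under eq_fun do rewrite !mxE; exact: cA.
have E u : D u -> (\det (A u))^-1 * cofactor (A u) j i = invmx (A u) i j.
  by move=> Du; rewrite /invmx unitmxE unitfE dA// !mxE.
have E' u : D u -> \near u, (\det (A u))^-1 * cofactor (A u) j i = invmx (A u) i j.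
  by move=> Du; have : nbhs u D by [exact: open_nbhs_nbhs]; apply: filterS.
apply: (@C1_onI _ _ (fun l u => 'D_(e l) (fun u => (\det (A u))^-1 * cofactor (A u) j i) u)) => //.
- move=> u Du; rewrite /prop_for /continuous_at -E//.
  exact: (cvg_trans (near_eq_cvg (E' u Du)) (proj1 (h u Du))).
- move=> u l Du; exact: (near_eq_is_derive (E' u Du) (C1_on_is_derive l h Du)).
- by move=> u l Du; exact: (proj2 (proj2 (h u Du) l)).
Qed.

Lemma derive_shift f (c u v : 'rV[R]_n) : derivable f (u + c) v ->
  is_derive u v (fun x => f (x + c)) ('D_v f (u + c)).
Proof.
have E : (fun h : R => h^-1 *: (((fun x => f (x + c)) \o shift u) (h *: v) - f (u + c))) =
    (fun h => h^-1 *: ((f \o shift (u + c)) (h *: v) - f (u + c))).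
  by apply/funext => h /=; rewrite addrA.
by move=> df; apply: DeriveDef; [rewrite /derivable E|rewrite /derive E].
Qed.

(** The mean value theorem in direction i for f (x + h e_j) - f (x), followed by strict
    differentiability of the partial derivative. The second difference is symmetric in i and j,
    whence [derive_comm]. *)
Let second_difference D f i j u eps : open D -> C1_on D f -> C1_on D ('D_(e i) f) ->
  D u -> 0 < eps -> \forall h \near (0 : R)^'+,
  `|f (u + h *: e i + h *: e j) - f (u + h *: e i) - (f (u + h *: e j) - f u)
    - h ^+ 2 * 'D_(e j) ('D_(e i) f) u| <= eps * h ^+ 2.
Proof.
move=> oD cf cdf Du eps0.
have [d d0 dP] := C1_strict oD cdf Du eps0.
have /nbhs_ballP[d' /= d'0 d'D] : nbhs u D by exact: open_nbhs_nbhs.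
pose c := Num.min d d' / 2.
have c0 : 0 < c by rewrite divr_gt0// lt_min d0.
near=> h.
have h0 : 0 < h by [].
have hc : h < c by near: h; exact: nbhs_right_lt.
have le_e (s : R) k : `|s *: e k| <= `|s|.
  apply: norm_le_coord => // l; rewrite !mxE normrM ler_piMr//.
  by case: (_ && _); rewrite ?normr1// normr0.
have near_u s : 0 <= s <= h -> forall t, 0 <= t <= h ->
    `|u + s *: e i + t *: e j - u| < Num.min d d'.
  move=> /andP[s0 sh] t /andP[t0 th]; rewrite -[u + _ + _]addrA [u + (_ + _)]addrC addrK.
  apply: (le_lt_trans (ler_normD _ _)).
  apply: (le_lt_trans (lerD (le_e _ _) (le_e _ _))); rewrite !ger0_norm//.
  by rewrite [ltRHS]splitr ltr_leD ?(le_lt_trans sh)// (le_trans th)// ltW.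
have inD s t : 0 <= s <= h -> 0 <= t <= h -> D (u + s *: e i + t *: e j).
  move=> hs ht; apply: d'D; apply/ball_rVE; rewrite distrC.
  by apply: (lt_le_trans (near_u s hs t ht)); rewrite ge_min lexx orbT.
have hh : 0 <= h <= h by rewrite lexx ltW.
have h00 : (0 : R) <= 0 <= h by rewrite lexx ltW.
have dq s : 0 <= s <= h -> is_derive (u + s *: e i) (e i)
    (fun x => f (x + h *: e j) - f x)
    ('D_(e i) f (u + s *: e i + h *: e j) - 'D_(e i) f (u + s *: e i)).
  move=> hs.
  have D1 := inD s h hs hh; have D2 := inD s 0 hs h00.
  rewrite scale0r addr0 in D2.
  apply: is_deriveB; last exact: (C1_on_is_derive i cf D2).
  by apply: derive_shift; have [_ /(_ i)[]] := cf _ D1.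
have [|s [hs]] := @MVT_line R _ (fun x => f (x + h *: e j) - f x) u (e i) h.
  by move=> s; rewrite min_l ?max_r ?(ltW h0)// => hs; have [] := dq s hs.
rewrite min_l ?max_r ?(ltW h0)// in hs.
have [_ ->] := dq s hs => ->.
have nd t : 0 <= t <= h -> `|u + s *: e i + t *: e j - u| < d.
  by move=> ht; apply: (lt_le_trans (near_u s hs t ht)); rewrite ge_min lexx.
have nd0 := nd 0 h00; rewrite scale0r addr0 in nd0.
have := dP _ _ (nd h hh) nd0.
have -> : u + s *: e i + h *: e j - (u + s *: e i) = h *: e j by rewrite addrC addKr.
rewrite (bigD1 j)//= big1; last first.
  by move=> k kj; rewrite !mxE (negPf kj) andbF mulr0 mul0r.
rewrite !mxE !eqxx mulr1 addr0 => H.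
rewrite expr2 -mulrA -mulrBr normrM (ger0_norm (ltW h0)).
apply: (le_trans (ler_wpM2l (ltW h0) H)); rewrite mulrCA ler_wpM2l ?(ltW eps0)//.
by rewrite ler_wpM2l ?(ltW h0)// (le_trans (le_e _ _))// ger0_norm// ltW.
Unshelve. all: by end_near. Qed.

Lemma derive_comm D f i j u : open D -> C1_on D f -> C1_on D ('D_(e i) f) ->
  C1_on D ('D_(e j) f) -> D u -> 'D_(e j) ('D_(e i) f) u = 'D_(e i) ('D_(e j) f) u.
Proof.
move=> oD cf ci cj Du; apply/eqP; rewrite -subr_eq0 -normr_le0.
apply/ler_addgt0Pr => eps eps0; rewrite add0r.
have eps2 : 0 < eps / 2 by rewrite divr_gt0.
have H1 := @second_difference D f i j u (eps / 2) oD cf ci Du eps2.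
have H2 := @second_difference D f j i u (eps / 2) oD cf cj Du eps2.
have [h [h1 [h2 h0]]] := @filter_ex _ _ (at_right_proper_filter 0) _
  (filterI H1 (filterI H2 (nbhs_right_gt (0 : R)))).
have hh : 0 < h ^+ 2 by rewrite exprn_gt0.
rewrite -(ler_pM2r hh) -{1}(gtr0_norm hh) -normrM.
move: h1 h2; rewrite [u + h *: e j + _]addrAC.
move: (f (u + h *: e i + h *: e j)) (f (u + h *: e i)) (f (u + h *: e j)) => a b' b.
 move: (f u) ('D_(e j) _ u) ('D_(e i) _ u) (h ^+ 2) => c x y z h1 h2.
have -> : (x - y) * z = (a - b - (b' - c) - z * y) - (a - b' - (b - c) - z * x) by ring.
by apply: (le_trans (ler_normB _ _)); lra.
Qed.

Lemma is_derive_prod (I : eqType) (r : seq I) (F : I -> 'rV[R]_n -> R) (dF : I -> R) u v :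
  uniq r -> (forall k, is_derive u v (F k) (dF k)) ->
  is_derive u v (fun x => \prod_(k <- r) F k x)
    (\sum_(k <- r) dF k * \prod_(l <- r | l != k) F l u).
Proof.
move=> + hF; elim: r => [_|k r ih /= /andP[kr ur]].
  rewrite (_ : (fun _ => _) = fun=> 1).
    by rewrite big_nil; exact: is_derive_cst.
  by apply/funext => x; rewrite big_nil.
rewrite (_ : (fun _ => _) = (F k * fun x => \prod_(l <- r) F l x)); last first.
  by apply/funext => x; rewrite big_cons.
have h := is_deriveM (hF k) (ih ur).
apply: (is_derive_eq h); rewrite [RHS]big_cons [in RHS]big_cons eqxx/= addrC; congr (_ + _).
  rewrite /GRing.scale/= mulrC; congr (_ * _); rewrite [LHS]big_seq [RHS]big_seq_cond.
  apply: eq_bigl => l; case: (boolP (l \in r)) => //= lr.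
  by apply/esym; apply: contraNneq kr => <-.
rewrite /GRing.scale/= mulr_sumr; apply: eq_big_seq => l lr.
rewrite big_cons; case: eqVneq => [lk|_]; last by rewrite mulrCA.
by rewrite lk lr in kr.
Qed.

Lemma is_derive_bigsum (I : Type) (r : seq I) (F : I -> 'rV[R]_n -> R) (dF : I -> R) u v :
  (forall k, is_derive u v (F k) (dF k)) ->
  is_derive u v (fun x => \sum_(k <- r) F k x) (\sum_(k <- r) dF k).
Proof.
move=> hF; elim: r => [|k r ih].
  rewrite big_nil (_ : (fun _ => _) = fun=> 0); first exact: is_derive_cst.
  by apply/funext => x; rewrite big_nil.
rewrite big_cons (_ : (fun _ => _) = (F k + fun x => \sum_(l <- r) F l x)); last first.
  by apply/funext => x; rewrite big_cons.
exact: is_deriveD (hF k) ih.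
Qed.

Lemma is_derive_det k (A : 'rV[R]_n -> 'M[R]_k) (dA : 'M[R]_k) u v :
  (forall a b, is_derive u v (fun x => A x a b) (dA a b)) ->
  is_derive u v (fun x => \det (A x)) (\sum_a \sum_b dA a b * cofactor (A u) a b).
Proof.
move=> hA.
(* Row a is replaced by its derivative. Expanding along that row gives the cofactor form of the
   answer, expanding over permutations the product rule. *)
pose B a : 'M[R]_k := \matrix_(c, b) if c == a then dA c b else A u c b.
have E a : \sum_b dA a b * cofactor (A u) a b = \det (B a).
  rewrite (expand_det_row _ a); apply: eq_bigr => b _; rewrite mxE eqxx; congr (_ * _).
  rewrite /cofactor; congr (_ * \det _); apply/matrixP => i j; rewrite !mxE.
  by rewrite eq_sym (negPf (neq_lift a i)).
under eq_bigr do rewrite E.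
have hs (s : 'S_k) : is_derive u v (fun x => (-1) ^+ s * \prod_a A x a (s a))
    ((-1) ^+ s * \sum_a dA a (s a) * \prod_(c | c != a) A u c (s c)).
  have h := is_derive_prod (index_enum_uniq _) (fun a => hA a (s a)).
  exact: (is_deriveZ ((-1) ^+ s) h).
have h := is_derive_bigsum (index_enum _) hs.
apply: (is_derive_eq h); rewrite [RHS](eq_bigr (fun a => \sum_(s : 'S_k) (-1) ^+ s *
    (dA a (s a) * \prod_(c | c != a) A u c (s c)))); last first.
  move=> a _; apply: eq_bigr => s _; congr (_ * _).
  rewrite (bigD1 a)//= mxE eqxx; congr (_ * _); apply: eq_bigr => c ca.
  by rewrite mxE (negPf ca).
by rewrite exchange_big/=; apply: eq_bigr => s _; rewrite mulr_sumr.
Qed.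

End C1.

(** * Geometry of a chart *)

Section tangent_projector.
Context {R : realType}.

(** The Gram-Schmidt process as a recursion on Schur complements. Applied to a Gram matrix, it
    yields an orthonormal basis of a tangent space. *)
Lemma posdef_congruence n (G : 'M[R]_n) : posdef G -> exists A : 'M[R]_n, A *m G *m A^T = 1%:M.
Proof.
elim: n G => [|n IH] G; first by move=> _; exists 0; apply/matrixP => -[].
pose G0 := (G : 'M[R]_(1 + n)); rewrite -[G]/G0 => pG.
have bE : dlsubmx G0 = (ursubmx G0)^T.
  by rewrite trmx_ursub; case: pG => ->.
rewrite -(submxK G0) bE in pG *.
set a := ulsubmx G0 in pG *; set b := ursubmx G0 in pG *; set C := drsubmx G0 in pG *.
have [a0 pC] := posdef_schur pG.
have [A hA] := IH _ pC.
pose al := (Num.sqrt (a 0 0))^-1.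
have al2 : al * al * a 0 0 = 1.
  by rewrite -expr2 exprVn sqr_sqrtr ?ltW// mulVf// gt_eqF.
have aE : a = (a 0 0)%:M by rewrite {1}[a]mx11_scalar.
pose B := (block_mx (al%:M : 'M[R]_1) 0 (- (a 0 0)^-1 *: (A *m b^T)) A : 'M[R]_(1 + n)).
exists (B : 'M[R]_n.+1).
change ((B *m block_mx a b b^T C) *m B^T = 1%:M :> 'M[R]_(1 + n)).
rewrite /B tr_block_mx.
have -> : (block_mx (al%:M : 'M[R]_1) 0 (- (a 0 0)^-1 *: (A *m b^T)) A *m block_mx a b b^T C :
    'M[R]_(1 + n)) = block_mx (al *: a) (al *: b) 0 (A *m (C - (a 0 0)^-1 *: (b^T *m b))).
  rewrite mulmx_block !mul0mx !addr0 !mul_scalar_mx; congr block_mx.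
    rewrite [X in _ *m X + _]aE mul_mx_scalar scalerA mulrN divff ?gt_eqF// scaleN1r addNr//.
  by rewrite mulmxBr -scalemxAl -scalemxAr -mulmxA addrC scaleNr.
rewrite mulmx_block !trmx0 !mulmx0 !mul0mx !addr0 !add0r !tr_scalar_mx.
have -> : (- (a 0 0)^-1 *: (A *m b^T))^T = - (a 0 0)^-1 *: (b *m A^T).
  by rewrite [LHS]linearZ/= trmx_mul trmxK.
rewrite [al *: a *m _]mul_mx_scalar.
rewrite hA; have -> : al *: (al *: a) = 1%:M.
  by rewrite scalerA aE scale_scalar_mx al2.
have -> : al *: a *m (- (a 0 0)^-1 *: (b *m A^T)) + al *: b *m A^T = 0.
  rewrite [X in al *: X *m _]aE scale_scalar_mx mul_scalar_mx scalerA mulrN mulfK ?gt_eqF//.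
  by rewrite -scalemxAl -scalerDl addNr scale0r.
by rewrite -scalar_mx_block.
Qed.

Variables n N : nat.
Implicit Types P E : 'M[R]_(n, N).

(* The rows of [dual_mx P] are the basis of the row space of P dual to the rows of P. *)
Definition dual_mx P : 'M[R]_(n, N) := invmx (P *m P^T) *m P.

(** The orthogonal projector onto the row space of P, acting on row vectors from the right. *)
Definition tproj P : 'M[R]_N := P^T *m dual_mx P.

Lemma posdef_gram P : row_free P -> posdef (P *m P^T).
Proof.
move=> fP; split; first by rewrite trmx_mul trmxK.
move=> v v0; rewrite mulmxA dot_trmx trmxK lt0r; apply/andP; split.
  rewrite -/(sqnorm _) sqnorm_eq0; apply: contraNneq v0 => h.
  by apply/eqP; apply: (row_free_inj fP); rewrite h mul0mx.
exact: sqnorm_ge0.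
Qed.

Lemma det_gram_gt0 P : row_free P -> 0 < \det (P *m P^T).
Proof. by move=> fP; have [] := integral_gauss_quadratic (posdef_gram fP). Qed.

Lemma gram_unit P : row_free P -> P *m P^T \in unitmx.
Proof. by move=> fP; rewrite unitmxE unitfE gt_eqF// det_gram_gt0. Qed.

Lemma dual_mulmx P : row_free P -> dual_mx P *m P^T = 1%:M.
Proof. by move=> fP; rewrite -mulmxA mulVmx// gram_unit. Qed.

Lemma mulmx_dual P : row_free P -> P *m (dual_mx P)^T = 1%:M.
Proof. by move=> fP; rewrite -[LHS]trmxK trmx_mul trmxK dual_mulmx// trmx1. Qed.

Lemma tproj_sym P : (tproj P)^T = tproj P.
Proof. by rewrite /tproj /dual_mx !trmx_mul trmxK trmx_inv trmx_mul trmxK mulmxA. Qed.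

Lemma mulmx_tproj P : row_free P -> P *m tproj P = P.
Proof. by move=> fP; rewrite /tproj mulmxA /dual_mx mulmxA mulmxV ?mul1mx// gram_unit. Qed.

Lemma dual_tproj P : row_free P -> dual_mx P *m tproj P = dual_mx P.
Proof. by move=> fP; rewrite /dual_mx -mulmxA mulmx_tproj. Qed.

Lemma tproj_idem P : row_free P -> tproj P *m tproj P = tproj P.
Proof. by move=> fP; rewrite /tproj -mulmxA -/(tproj P) dual_tproj. Qed.

Lemma tproj_trace P : row_free P -> \tr (tproj P) = n%:R.
Proof. by move=> fP; rewrite /tproj mxtrace_mulC dual_mulmx// mxtrace1. Qed.

Lemma eq_tproj P P' : row_free P -> row_free P' -> P' *m tproj P = P' -> P *m tproj P' = P ->
  tproj P' = tproj P.
Proof.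
move=> fP fP' h h'.
have e1 : tproj P' *m tproj P = tproj P'.
  by rewrite {1}/tproj -mulmxA /dual_mx -mulmxA h.
have e2 : tproj P *m tproj P' = tproj P.
  by rewrite {1}/tproj -mulmxA /dual_mx -mulmxA h'.
by rewrite -e1 -[LHS]trmxK trmx_mul !tproj_sym e2 tproj_sym.
Qed.

Lemma submx_tproj P k (v : 'M[R]_(k, N)) : row_free P -> (v <= P)%MS = (v *m tproj P == v).
Proof.
move=> fP; apply/idP/eqP => [/submxP[D ->]|<-]; first by rewrite -mulmxA mulmx_tproj.
by rewrite /tproj /dual_mx !mulmxA submxMl.
Qed.

Lemma orthonormal_basis P : row_free P -> exists E, E *m E^T = 1%:M /\ (E :=: P)%MS.
Proof.
move=> fP; have [A hA] := posdef_congruence (posdef_gram fP).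
exists (A *m P); split; first by rewrite trmx_mul mulmxA -(mulmxA A) hA.
have uA : A \in unitmx.
  by apply: (proj1 (mulmx1_unit (_ : A *m (P *m P^T *m A^T) = 1%:M))); rewrite mulmxA.
by apply: eqmxMfull; rewrite row_full_unit.
Qed.

Lemma orthonormal_tproj P E : row_free P -> E *m E^T = 1%:M -> (E :=: P)%MS ->
  E^T *m E = tproj P.
Proof.
move=> fP EE EP.
have fE : row_free E.
  by rewrite -row_leq_rank EP; move: fP; rewrite -row_leq_rank.
have <- : tproj E = tproj P.
  apply: eq_tproj => //; apply/eqP; rewrite -submx_tproj//; by rewrite EP.
by rewrite /tproj /dual_mx EE invmx1 mul1mx.
Qed.

(** With row vectors, [kermx T^T] is the orthogonal complement of the row space of T. The lemma
    replaces the projection in [normal_part] by an explicit function of P, which can be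
    differentiated in a chart. *)
Lemma proj_mx_normal P (T : 'M[R]_N) : row_free P -> (T :=: P)%MS ->
  proj_mx (kermx T^T) T = 1%:M - tproj P.
Proof.
move=> fP TP.
have [D hD] : exists D, T = D *m P by apply/submxP; rewrite TP.
have [D' hD'] : exists D, P = D *m T by apply/submxP; rewrite TP.
have dT : (kermx T^T :&: T = 0)%MS.
  apply/eqP; rewrite -submx0; apply/rV_subP => v; rewrite sub_capmx submx0 => /andP[/sub_kermxP vk].
  rewrite TP submx_tproj// => /eqP <-.
  have vP : v *m P^T = 0 by rewrite hD' trmx_mul mulmxA vk mul0mx.
  by rewrite /tproj mulmxA vP mul0mx.
have nk : ((1%:M - tproj P)%R <= kermx T^T)%MS.
  apply/sub_kermxP; rewrite hD trmx_mul mulmxA mulmxBl mul1mx -[tproj P]tproj_sym.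
  by rewrite -trmx_mul mulmx_tproj// subrr mul0mx.
have tT : (tproj P <= T)%MS by rewrite TP submx_tproj// tproj_idem.
rewrite -[LHS]mul1mx -[X in X *m _](subrK (tproj P)) mulmxDl.
by rewrite proj_mx_id// proj_mx_0// addr0.
Qed.

End tangent_projector.

Section chart_calculus.
Context {R : realType} {n : nat}.
Local Notation e i := (delta_mx 0 i : 'rV[R]_n).

Lemma C1_on_coord N (D : set 'rV[R]_n) (f : 'rV[R]_n -> 'rV[R]_N) j : open D ->
  (forall u, D u -> {for u, continuous f}) ->
  (forall u i, D u -> derivable f u (e i)) ->
  (forall u i, D u -> {for u, continuous ('D_(e i) f)}) -> C1_on D (fun u => f u 0 j).
Proof.
move=> oD cf df cdf; apply: (@C1_onI _ _ _ _ (fun i u => 'D_(e i) f u 0 j)) => //.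
- by move=> u Du; exact: (continuous_comp (cf u Du) (@coord_continuous _ _ _ _ _ _)).
- move=> u i Du; have d := df u i Du; apply: DeriveDef.
    by move/derivable_mxP : d; apply.
  by rewrite (derive_mx d) mxE.
- by move=> u i Du; exact: (continuous_comp (cdf u i Du) (@coord_continuous _ _ _ _ _ _)).
Qed.

Lemma derive_coord N (f : 'rV[R]_n -> 'rV[R]_N) u v j : derivable f u v ->
  'D_v (fun x => f x 0 j) u = 'D_v f u 0 j.
Proof. by move=> d; rewrite (derive_mx d) mxE. Qed.

Lemma smooth_on_C1 (D : set 'rV[R]_n) (f : 'rV[R]_n -> R) : open D -> smooth_on D f -> C1_on D f.
Proof.
move=> oD sf u Du; have [c d] := sf [::] u Du; split=> // i.
by split; [exact: d|exact: (sf [:: i] u Du).1].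
Qed.

Lemma smooth_on_coord N (D : set 'rV[R]_n) (f : 'rV[R]_n -> 'rV[R]_N) j :
  open D -> smooth_on D f -> C1_on D (fun u => f u 0 j).
Proof.
move=> oD sf; apply: (@C1_on_coord N D f j oD).
- by move=> u Du; exact: (sf [::] u Du).1.
- by move=> u i Du; exact: (sf [::] u Du).2.
- by move=> u i Du; exact: (sf [:: i] u Du).1.
Qed.

Lemma C1_on_partial N (D : set 'rV[R]_n) (f : 'rV[R]_n -> 'rV[R]_N) i j :
  open D -> smooth_on D f -> C1_on D (fun u => partial_mx f u i j).
Proof.
move=> oD sf.
rewrite (_ : (fun _ => _) = fun u => 'D_(e i) f u 0 j); last by apply/funext => u; rewrite mxE.
apply: (@C1_on_coord N D ('D_(e i) f) j oD).
- by move=> u Du; exact: (sf [:: i] u Du).1.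
- by move=> u k Du; exact: (sf [:: i] u Du).2.
- by move=> u k Du; exact: (sf [:: k; i] u Du).1.
Qed.

Lemma derive_smooth N (D : set 'rV[R]_n) (f : 'rV[R]_n -> 'rV[R]_N) u v :
  open D -> smooth_on D f -> D u -> derivable f u v /\ 'D_v f u = v *m partial_mx f u.
Proof.
move=> oD sf Du.
have d : derivable f u v.
  apply/derivable_mxP => i j; rewrite (ord1 i).
  by have [] := C1_derive v oD (smooth_on_coord j oD sf) Du.
split=> //; apply/rowP => j; rewrite -(derive_coord j d).
have [_ ->] := C1_derive v oD (smooth_on_coord j oD sf) Du.
rewrite [RHS]mxE; apply: eq_bigr => i _; congr (_ * _).
rewrite [RHS]mxE; apply: derive_coord; exact: (sf [::] u Du).2.
Qed.

(** Tangent fields with constant coordinates in a chart are admissible in the definition of the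
    second fundamental form. *)
Lemma smooth_on_sum_partial N (D : set 'rV[R]_n) (f : 'rV[R]_n -> 'rV[R]_N) (al : 'rV[R]_n) :
  open D -> smooth_on D f -> smooth_on D (fun u => al *m partial_mx f u).
Proof.
move=> oD sf.
pose g u := \sum_i al 0 i *: 'D_(e i) f u.
have -> : (fun u => al *m partial_mx f u) = g.
  apply/funext => u; apply/rowP => j; rewrite /g !mxE summxE.
  by apply: eq_bigr => i _; rewrite !mxE.
(* The derivative in direction i inside [g] is taken first; as [iter_partial] is a right fold, its
   index comes last in the sequence. *)
pose h s u := \sum_i al 0 i *: iter_partial (rcons s i) f u.
have nD u : D u -> nbhs u D by move=> Du; exact: open_nbhs_nbhs.
have dh s u v : D u -> (exists k, v = e k) -> is_derive u v (h s)
    (\sum_i al 0 i *: 'D_v (iter_partial (rcons s i) f) u).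
  move=> Du [k ->]; rewrite /h.
  have hi i : is_derive u (e k) (fun u => al 0 i *: iter_partial (rcons s i) f u)
      (al 0 i *: 'D_(e k) (iter_partial (rcons s i) f) u).
    apply: is_deriveZ; apply: DeriveDef => //.
    exact: (sf (rcons s i) u Du).2.
  have := is_derive_sum hi.
  rewrite (_ : (\sum_(i < n) _)%R = (fun u => \sum_i al 0 i *: iter_partial (rcons s i) f u))//.
  by apply/funext => x; rewrite fct_sumE.
have gE s : forall u, D u -> iter_partial s g u = h s u.
  elim: s => [|k s ih] u Du //.
  have E : \near u, iter_partial s g u = h s u by apply: filterS (nD u Du).
  rewrite /= (near_eq_derive _ E).
  by have [_ ->] := dh s u (e k) Du (ex_intro _ k erefl).
move=> s u Du.
have E : \near u, h s u = iter_partial s g u.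
  by apply: filterS (nD u Du) => x Dx; rewrite gE.
split.
  rewrite /prop_for /continuous_at (gE s u Du); apply: (cvg_trans (near_eq_cvg E)).
  apply: cvg_big => [|i _]; first exact: add_continuous.
  apply: cvgZr; exact: (sf (rcons s i) u Du).1.
move=> i; have := dh s u (e i) Du (ex_intro _ i erefl).
by move/(near_eq_is_derive E) => [].
Qed.

End chart_calculus.

(** * Tangent spaces, gradients and curvature in charts *)

Section charts.
Context {R : realType} (n N : nat) (S : set 'rV[R]_N).
Implicit Types (c : chart n S) (u v : 'rV[R]_n) (x : 'rV[R]_N).
Local Notation e i := (delta_mx 0 i : 'rV[R]_n).
Local Notation dom := chart_dom.
Local Notation par := chart_par.
Local Notation nbd := chart_nbd.
Local Notation P c u := (partial_mx (chart_par c) u).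

Lemma chart_parS c u : dom c u -> S (par c u) /\ nbd c (par c u).
Proof.
move=> cu; have : (S `&` nbd c) (par c u) by rewrite -chart_image; exists u.
by case.
Qed.

Lemma chart_coordK c x : S x -> nbd c x -> dom c (chart_coord c x) /\ par c (chart_coord c x) = x.
Proof.
move=> Sx cx; have : (S `&` nbd c) x by [].
by rewrite -chart_image => -[u cu <-]; rewrite chart_parK.
Qed.

Lemma derive_par c u v : dom c u ->
  derivable (par c) u v /\ 'D_v (par c) u = v *m P c u.
Proof. exact: derive_smooth (@chart_dom_open _ _ _ _ c) (@chart_smooth _ _ _ _ c). Qed.

Lemma continuous_par c u : dom c u -> {for u, continuous (par c)}.
Proof. by move=> cu; exact: (@chart_smooth _ _ _ _ c [::] u cu).1. Qed.

(* A linear combination of the coordinates of the parametrization that inverts it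
   to first order at u0. *)
Let straightened c u0 (k : 'I_n) u : R := \sum_j par c u 0 j * (dual_mx (P c u0)) k j.

Let straightened_C1 c u0 k : C1_on (dom c) (straightened c u0 k).
Proof.
have oD := @chart_dom_open _ _ _ _ c.
apply: C1_on_sum => // j _; apply: C1_onM; [exact: oD| |exact: C1_on_cst].
exact: smooth_on_coord oD (@chart_smooth _ _ _ _ c).
Qed.

Let straightened_derive c u0 k i : dom c u0 -> 'D_(e i) (straightened c u0 k) u0 = (i == k)%:R.
Proof.
move=> cu0; have oD := @chart_dom_open _ _ _ _ c.
have h : is_derive u0 (e i) (straightened c u0 k)
    (\sum_j P c u0 i j * (dual_mx (P c u0)) k j).
  apply: is_derive_bigsum => j.
  have hj : is_derive u0 (e i) (fun u => par c u 0 j) (P c u0 i j).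
    have := C1_on_is_derive i (smooth_on_coord j oD (@chart_smooth _ _ _ _ c)) cu0.
    rewrite derive_coord ?mxE//.
    by have [] := derive_par (e i) cu0.
  have := is_deriveM hj (is_derive_cst (dual_mx (P c u0) k j) u0 (e i)).
  move=> h; apply: (is_derive_eq h).
  by rewrite scaler0 add0r /GRing.scale/= mulrC.
have [_ ->] := h.
have /matrixP/(_ i k) := mulmx_dual (@chart_immersion _ _ _ _ c u0 cu0).
rewrite !mxE => <-; apply: eq_bigr => j _; by rewrite !mxE.
Qed.

(** This stands in for the inverse function theorem: continuity of the inverse belongs to [chart],
    and strict differentiability of [straightened], whose differential at [u0] is the identity,
    gives the rate. *)
Lemma chart_inverse_rate c u0 eps : dom c u0 -> 0 < eps -> exists2 d, 0 < d &
  forall u u', `|u - u0| < d -> `|u' - u0| < d ->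
    `|(par c u - par c u') *m (dual_mx (P c u0))^T - (u - u')| <= eps * `|u - u'|.
Proof.
move=> cu0 eps0; have oD := @chart_dom_open _ _ _ _ c.
have h k := C1_strict oD (@straightened_C1 c u0 k) cu0 eps0.
have /fin_all_exists2[dd dd0 ddP] := h.
pose d := \big[Num.min/1]_k dd k.
have d0 : 0 < d by apply/bigmin_gtP.
exists d => // u u' ud u'd; apply: norm_le_coord => [|k]; first by rewrite mulr_ge0// ltW.
have dk : d <= dd k by exact: bigmin_le.
have := ddP k u u' (lt_le_trans ud dk) (lt_le_trans u'd dk).
rewrite (bigD1 k)//= big1 ?addr0; last first.
  by move=> i ik; rewrite straightened_derive// (negPf ik) mulr0.
rewrite straightened_derive// eqxx mulr1 => H; apply: le_trans H.
rewrite !mxE /straightened -sumrB le_eqVlt; apply/orP; left; apply/eqP; congr (`|_ - _|).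
by apply: eq_bigr => j _; rewrite !mxE mulrBl.
Qed.

(* The coordinates in c of a curve of S are differentiable: by injectivity of
   the differential of par c, par c (tau h) - par c u = O(h) forces
   tau h - u = O(h). *)
Lemma transition c c' u u' v : dom c u -> dom c' u' -> par c u = par c' u' ->
  let b := v *m P c' u' *m (dual_mx (P c u))^T in
  forall F : 'rV[R]_N -> R, C1_on (dom c) (F \o par c) ->
    'D_v (F \o par c') u' = 'D_b (F \o par c) u.
Proof.
move=> cu cu' E b F cF; have oD := @chart_dom_open _ _ _ _ c.
have [Sx cx] := chart_parS cu.
pose tau (h : R) := chart_coord c (par c' (h *: v + u')).
have cv : h *: v + u' @[h --> (0 : R)^'] --> u'.
  rewrite -[X in _ --> X]add0r -[in X in _ --> X](scale0r v).
  apply: cvgD; last exact: cvg_cst.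
  by apply: cvgZ; [exact: nbhs_dnbhs|exact: cvg_cst].
have cp : par c' (h *: v + u') @[h --> (0 : R)^'] --> par c u.
  by rewrite E; exact: (cvg_comp _ _ cv (continuous_par cu')).
have nD' : \forall h \near (0 : R)^', dom c' (h *: v + u').
  by apply: cv; apply: open_nbhs_nbhs; split=> //; exact: chart_dom_open.
have nN : \forall h \near (0 : R)^', nbd c (par c' (h *: v + u')).
  by apply: cp; apply: open_nbhs_nbhs; split=> //; exact: chart_nbd_open.
have nS : \forall h \near (0 : R)^', (S `&` nbd c) (par c' (h *: v + u')).
  by apply: filterS2 nD' nN => h /chart_parS[].
have ntau : \forall h \near (0 : R)^', dom c (tau h) /\ par c (tau h) = par c' (h *: v + u').
  by apply: filterS nS => h [Sh Nh]; exact: chart_coordK.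
have ctau : tau h @[h --> (0 : R)^'] --> u.
  have /subspace_continuousP/(_ _ (conj Sx cx)) := @chart_coord_continuous _ _ _ _ c.
  rewrite /from_subspace chart_parK// => cc A /cc/= nA.
  by have {nA} := cp _ nA; apply: filterS2 nS => h Sh /(_ Sh).
pose B := (dual_mx (P c u))^T.
have cy : h^-1 *: ((par c' (h *: v + u') - par c u) *m B) @[h --> (0 : R)^'] --> b.
  have oD' := @chart_dom_open _ _ _ _ c'.
  apply: cvg_rV => k.
  have h1 j : h^-1 * (par c' (h *: v + u') 0 j - par c' u' 0 j) @[h --> (0 : R)^'] -->
      \sum_i v 0 i * 'D_(e i) (fun u => par c' u 0 j) u'.
    apply: (@C1_curve _ _ (dom c') (fun u => par c' u 0 j) u' R ((0 : R)^') _
      (fun h => h *: v + u') id v oD' (smooth_on_coord j oD' (@chart_smooth _ _ _ _ c')) cu' cv).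
    apply: (@cvg_near_cst _ _ v _ (0 : R)^' _); near=> h.
    rewrite addrK scalerA mulVf ?scale1r//.
    by near: h; exact: nbhs_dnbhs_neq.
  have h2 : \sum_j (h^-1 * (par c' (h *: v + u') 0 j - par c' u' 0 j)) * B j k
      @[h --> (0 : R)^'] --> \sum_j (\sum_i v 0 i * 'D_(e i) (fun u => par c' u 0 j) u') * B j k.
    apply: cvg_big => [|j _]; first exact: add_continuous.
    by apply: cvgM; [exact: h1|exact: cvg_cst].
  have -> : (fun h => (h^-1 *: ((par c' (h *: v + u') - par c u) *m B)) 0 k) =
      (fun h => \sum_j (h^-1 * (par c' (h *: v + u') 0 j - par c' u' 0 j)) * B j k).
    apply/funext => h; rewrite !mxE mulr_sumr; apply: eq_bigr => j _.
    by rewrite E !mxE mulrA.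
  have -> : b 0 k = \sum_j (\sum_i v 0 i * 'D_(e i) (fun u => par c' u 0 j) u') * B j k.
    rewrite /b mxE; apply: eq_bigr => j _; congr (_ * _); rewrite mxE.
    apply: eq_bigr => i _; congr (_ * _); rewrite mxE.
    by rewrite derive_coord//; have [] := derive_par (e i) cu'.
  exact: h2.
have cq : h^-1 *: (tau h - u) @[h --> (0 : R)^'] --> b.
  apply/cvgrPdist_le => eps eps0.
  pose K := `|b| + 1.
  have K0 : 0 < K by rewrite ltr_wpDl.
  (* The error |y - q| is at most eps1 |q|, with q itself to be controlled: the bound 1 / 2 first
     gives |q| <= 2 K, then the other bound makes the error at most eps / 2. *)
  pose eps1 := Num.min (1 / 2) (eps / (4 * K)).
  have eps10 : 0 < eps1 by rewrite lt_min !divr_gt0// mulr_gt0.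
  have [d d0 dP] := chart_inverse_rate cu eps10.
  have n1 : \forall h \near (0 : R)^', `|tau h - u| < d.
    by have /cvgrPdist_lt/(_ d d0) := ctau; apply: filterS => h; rewrite distrC.
  have e1 : 0 < Num.min 1 (eps / 2) by rewrite lt_min ltr01 divr_gt0.
  have n2 : \forall h \near (0 : R)^',
      `|b - h^-1 *: ((par c' (h *: v + u') - par c u) *m B)| < Num.min 1 (eps / 2).
    by have /cvgrPdist_lt/(_ _ e1) := cy.
  near=> h.
  have hd : `|tau h - u| < d by near: h.
  have [_ ht] : dom c (tau h) /\ par c (tau h) = par c' (h *: v + u') by near: h.
  have hb : `|b - h^-1 *: ((par c' (h *: v + u') - par c u) *m B)| < Num.min 1 (eps / 2).
    by near: h.
  have := dP (tau h) u hd; rewrite subrr normr0 ht => /(_ d0) H.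
  set y := h^-1 *: ((par c' (h *: v + u') - par c u) *m B) in hb.
  set q := h^-1 *: (tau h - u).
  have {H} : `|y - q| <= eps1 * `|q|.
    rewrite /y /q -scalerBr !normrZ mulrCA ler_wpM2l//.
  move: hb; rewrite lt_min => /andP[hb1 hb2] hyq.
  have hy : `|y| <= K.
    rewrite -[y](subrK b) addrC (le_trans (ler_normD _ _))// lerD2l distrC.
    exact: ltW.
  have e12 : eps1 <= 1 / 2 by rewrite ge_min lexx.
  have e14 : eps1 <= eps / (4 * K) by rewrite ge_min lexx orbT.
  have hq : `|q| <= 2 * K.
    have h1 : `|q| <= `|y| + `|y - q|.
      by rewrite -{1}[q](subKr y) (le_trans (ler_normB _ _)).
    have h2 : eps1 * `|q| <= 1 / 2 * `|q| by rewrite ler_wpM2r.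
    lra.
  have -> : b - q = (b - y) + (y - q) by rewrite addrA subrK.
  apply: (le_trans (ler_normD _ _)).
  have h3 : eps1 * `|q| <= eps / (4 * K) * (2 * K) by rewrite ler_pM// ltW.
  have h4 : eps / (4 * K) * (2 * K) = eps / 2 by field; rewrite gt_eqF.
  rewrite h4 in h3; lra.
have FF : Filter ((0 : R)^') by typeclasses eauto.
have hF := @C1_curve _ _ (dom c) (F \o par c) u R ((0 : R)^') FF tau id b oD cF cu ctau cq.
have [_ ->] := C1_derive b oD cF cu.
apply/cvg_lim => //; apply: (cvg_trans _ hF); apply: near_eq_cvg.
by apply: filterS ntau => h [_ ht] /=; rewrite ht E.
Unshelve. all: by end_near. Qed.

(** [transition], applied to the ambient coordinate functions, expresses each velocity of the second
    chart as a velocity of the first. *)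
Lemma partial_transition c c' u u' : dom c u -> dom c' u' -> par c u = par c' u' ->
  P c' u' *m tproj (P c u) = P c' u'.
Proof.
move=> cu cu' E; have oD := @chart_dom_open _ _ _ _ c.
rewrite /tproj; apply/row_matrixP => i; rewrite !rowE; apply/rowP => j.
have := @transition c c' u u' (e i) cu cu' E (fun x => x 0 j)
  (smooth_on_coord j oD (@chart_smooth _ _ _ _ c)).
rewrite /comp; have [d1 e1] := derive_par (e i) cu'.
rewrite (derive_coord j d1) e1 => ->.
set b := _ *m _^T; have [d2 e2] := derive_par b cu.
rewrite (derive_coord j d2) e2 /b -!mulmxA; congr ((_ *m (_ *m _)) 0 j).
by rewrite /dual_mx !trmx_mul trmx_inv trmx_mul trmxK mulmxA.
Qed.

Lemma tangent_space_eqmx c u : dom c u -> (tangent_space n S (par c u) :=: P c u)%MS.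
Proof.
move=> cu; rewrite /tangent_space; set A := [set _ | _].
have : A (xget 0 A) by apply: (@xgetPex _ 0 A); exists <<P c u>>%MS, c, u.
move=> [c' [u' [cu' E ->]]]; apply/eqmxP; rewrite !genmxE.
have f := @chart_immersion _ _ _ _ c u cu; have f' := @chart_immersion _ _ _ _ c' u' cu'.
rewrite !submx_tproj//; apply/andP; split; apply/eqP.
  exact: partial_transition.
by apply: partial_transition.
Qed.

Definition nproj x : 'M[R]_N := proj_mx (Defs.normal_space n S x) (tangent_space n S x).

Lemma nproj_par c u : dom c u -> nproj (par c u) = 1%:M - tproj (P c u).
Proof.
move=> cu; apply: proj_mx_normal; first exact: chart_immersion.
exact: tangent_space_eqmx.
Qed.

Lemma on_submanifold (Q : 'rV[R]_N -> Prop) : is_submanifold n S ->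
  (forall c u, dom c u -> Q (par c u)) -> forall x, S x -> Q x.
Proof.
move=> sS h x Sx; have [c cx] := sS x Sx.
by have [cu <-] := chart_coordK Sx cx; exact: h.
Qed.

Lemma nproj_sym c u : dom c u -> (nproj (par c u))^T = nproj (par c u).
Proof. by move=> cu; rewrite nproj_par// linearB/= trmx1 tproj_sym. Qed.

Lemma nproj_idem c u : dom c u -> nproj (par c u) *m nproj (par c u) = nproj (par c u).
Proof.
move=> cu; rewrite nproj_par// mulmxBl mul1mx mulmxBr mulmx1.
by rewrite tproj_idem ?subrr ?subr0//; exact: chart_immersion.
Qed.

Lemma partial_nproj c u : dom c u -> P c u *m nproj (par c u) = 0.
Proof.
by move=> cu; rewrite nproj_par// mulmxBr mulmx1 mulmx_tproj ?subrr//; exact: chart_immersion.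
Qed.

Lemma submx_normal c u k (v : 'M[R]_(k, N)) : dom c u ->
  (v <= Defs.normal_space n S (par c u))%MS = (v *m nproj (par c u) == v).
Proof.
move=> cu; have f := @chart_immersion _ _ _ _ c u cu.
have TP := tangent_space_eqmx cu.
rewrite nproj_par// mulmxBr mulmx1 subr_eq -subr_eq0 opprD addrA subrr sub0r oppr_eq0.
have [D hD] : exists D, tangent_space n S (par c u) = D *m P c u by apply/submxP; rewrite TP.
have [D' hD'] : exists D, P c u = D *m tangent_space n S (par c u) by apply/submxP; rewrite TP.
apply/sub_kermxP/eqP => h.
  have vP : v *m (P c u)^T = 0 by rewrite hD' trmx_mul mulmxA h mul0mx.
  by rewrite /tproj mulmxA vP mul0mx.
rewrite hD trmx_mul mulmxA.
have -> : v *m (P c u)^T = v *m tproj (P c u) *m (P c u)^T.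
  by rewrite -mulmxA -[tproj _]tproj_sym -trmx_mul mulmx_tproj.
by rewrite h !mul0mx.
Qed.

Lemma submx_tangent c u k (v : 'M[R]_(k, N)) : dom c u ->
  (v <= tangent_space n S (par c u))%MS = (v *m nproj (par c u) == 0).
Proof.
move=> cu; have f := @chart_immersion _ _ _ _ c u cu.
rewrite tangent_space_eqmx// submx_tproj// nproj_par// mulmxBr mulmx1 subr_eq0.
by rewrite eq_sym.
Qed.

Lemma C1_gram c i j : C1_on (dom c) (fun u => (P c u *m (P c u)^T) i j).
Proof.
have oD := @chart_dom_open _ _ _ _ c; have sm := @chart_smooth _ _ _ _ c.
have -> : (fun u => (P c u *m (P c u)^T) i j) = (fun u => \sum_k P c u i k * P c u j k).
  by apply/funext => u; rewrite mxE; apply: eq_bigr => k _; rewrite [in RHS]mxE !mxE.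
by apply: (C1_on_sum _ oD) => k _; apply: (C1_onM oD); exact: C1_on_partial.
Qed.

Lemma C1_dual c i j : C1_on (dom c) (fun u => dual_mx (P c u) i j).
Proof.
have oD := @chart_dom_open _ _ _ _ c; have sm := @chart_smooth _ _ _ _ c.
have -> : (fun u => dual_mx (P c u) i j) =
    (fun u => \sum_k invmx (P c u *m (P c u)^T) i k * P c u k j).
  by apply/funext => u; rewrite mxE.
apply: (C1_on_sum _ oD) => k _; apply: (C1_onM oD); last exact: C1_on_partial.
apply: (C1_on_invmx oD) => [i' j'|u cu]; first exact: C1_gram.
by rewrite gt_eqF// det_gram_gt0//; exact: chart_immersion.
Qed.

Lemma C1_on_eq (D : set 'rV[R]_n) (f g : 'rV[R]_n -> R) : open D ->
  (forall u, D u -> f u = g u) -> C1_on D f -> C1_on D g.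
Proof.
move=> oD fg cf.
have E u : D u -> \near u, f u = g u.
  by move=> Du; have : nbhs u D by [exact: open_nbhs_nbhs]; apply: filterS.
apply: (@C1_onI _ _ _ _ (fun i u => 'D_(e i) f u) oD) => u.
- move=> Du; rewrite /prop_for /continuous_at -(fg u Du).
  exact: (cvg_trans (near_eq_cvg (E u Du)) (proj1 (cf u Du))).
- by move=> i Du; exact: (near_eq_is_derive (E u Du) (C1_on_is_derive i cf Du)).
- by move=> i Du; exact: (proj2 (proj2 (cf u Du) i)).
Qed.

Lemma C1_nproj c i j : C1_on (dom c) ((fun x => nproj x i j) \o par c).
Proof.
have oD := @chart_dom_open _ _ _ _ c; have sm := @chart_smooth _ _ _ _ c.
apply: (@C1_on_eq _ (fun u => (1%:M : 'M[R]_N) i j - \sum_k P c u k i * dual_mx (P c u) k j) _ oD).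
  move=> u cu /=; rewrite nproj_par// [RHS]mxE; congr (_ + _); rewrite [RHS]mxE; congr (- _).
  by rewrite [RHS]mxE; apply: eq_bigr => k _; rewrite [in RHS]mxE.
apply: (C1_onB oD); first exact: C1_on_cst.
by apply: (C1_on_sum _ oD) => k _; apply: (C1_onM oD); [exact: C1_on_partial|exact: C1_dual].
Qed.

Lemma normal_partE x (v : 'rV[R]_N) : normal_part n S x v = v *m nproj x.
Proof. by []. Qed.

(** The inverse Gram matrix hidden in [dual_mx] raises the index of the differential. The defining
    condition quantifies over all charts at the point, and [transition] reduces each of them to
    [c]. *)
Lemma gradient_par c u (phi : 'rV[R]_N -> R) : dom c u ->
  (forall c', C1_on (dom c') (phi \o par c')) ->
  gradient n S phi (par c u) =
  (\row_i 'D_(e i) (phi \o par c) u) *m dual_mx (P c u).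
Proof.
move=> cu cphi; set d := \row_i _.
have fP := @chart_immersion _ _ _ _ c u cu.
have oD := @chart_dom_open _ _ _ _ c.
have dE b : 'D_b (phi \o par c) u = dot d b.
  have [_ ->] := C1_derive b oD (cphi c) cu.
  by rewrite dotE; apply: eq_bigr => i _; rewrite mxE mulrC.
have dd y b : dot (y *m dual_mx (P c u)) (b *m P c u) = dot y b.
  by rewrite dot_trmx -mulmxA mulmx_dual// mulmx1.
rewrite /gradient; set A := [set _ | _].
(* The defining set is a singleton, which determines the value of [xget]. *)
suff AE (v : 'rV[R]_N) : A v <-> v = d *m dual_mx (P c u).
  by apply/AE; apply: (@xgetPex _ 0 A); exists (d *m dual_mx (P c u)); apply/AE.
split=> [[+ /(_ c u)]|->].
  rewrite tangent_space_eqmx// => /submxP[y yE] h.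
  suff -> : d = y *m (P c u *m (P c u)^T) by rewrite /dual_mx mulmxA mulmxK ?gram_unit.
  apply/rowP => i; have := h (e i) cu erefl.
  have [_ ->] := derive_par (e i) cu; rewrite /d mxE => <-.
  rewrite -rowE /dot yE -mulmxA !mxE; apply: eq_bigr => k _; congr (_ * _).
  by rewrite !mxE; apply: eq_bigr => l _; rewrite !mxE.
split; first by rewrite submx_tangent// -mulmxA /dual_mx -mulmxA partial_nproj ?mulmx0.
move=> c' u' a cu' E.
have [_ ->] := derive_par a cu'.
rewrite (@transition c c' u u' a cu cu' (esym E) phi (cphi c)) dE.
rewrite [X in dot _ X = _](_ : a *m P c' u' = (a *m P c' u' *m (dual_mx (P c u))^T) *m P c u).
  exact: dd.
  rewrite -[LHS]mulmx1 -{1}(partial_transition cu cu' (esym E)) mulmx1 -!mulmxA.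
  congr (_ *m (_ *m _)).
  by rewrite /tproj /dual_mx !trmx_mul trmx_inv !trmx_mul !trmxK mulmxA.
Qed.

Definition dnproj c u b : 'M[R]_N :=
  \matrix_(j, k) 'D_b ((fun x => nproj x j k) \o par c) u.

(* Differentiating Y (1 - Pi) = 0 shows that the normal part of D Y only involves
   the value of Y and the derivative of the tangent projector Pi, hence does not
   depend on the chart. *)
Lemma second_fundamental_form_par c u b w : dom c u -> w *m nproj (par c u) = 0 ->
  second_fundamental_form n S (par c u) (b *m P c u) w = - (w *m dnproj c u b).
Proof.
move=> cu wn.
have fP := @chart_immersion _ _ _ _ c u cu.
have oD := @chart_dom_open _ _ _ _ c.
have key c' u' a (Y : 'rV[R]_n -> 'rV[R]_N) : dom c' u' -> par c' u' = par c u ->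
    smooth_on (dom c') Y ->
    (forall v, dom c' v -> (Y v <= tangent_space n S (par c' v))%MS) ->
    'D_a (par c') u' = b *m P c u -> Y u' = w ->
    'D_a Y u' *m nproj (par c u) = - (w *m dnproj c u b).
  move=> cu' E sY tY; have [_ ->] := derive_par a cu' => aE Yw.
  have oD' := @chart_dom_open _ _ _ _ c'.
  have bE : a *m P c' u' *m (dual_mx (P c u))^T = b by rewrite aE -mulmxA mulmx_dual// mulmx1.
  have [dY _] := derive_smooth a oD' sY cu'.
  apply/rowP => k.
  have h : is_derive u' a (fun v => \sum_j Y v 0 j * nproj (par c' v) j k)
      (\sum_j (Y u' 0 j * dnproj c u b j k + nproj (par c' u') j k * 'D_a Y u' 0 j)).
    apply: is_derive_bigsum => j.
    have h1 : is_derive u' a (fun v => Y v 0 j) ('D_a Y u' 0 j).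
      rewrite -(derive_coord j dY).
      exact: (DeriveDef (proj1 (C1_derive a oD' (smooth_on_coord j oD' sY) cu')) erefl).
    have h2 : is_derive u' a ((fun x => nproj x j k) \o par c') (dnproj c u b j k).
      have tr := @transition c c' u u' a cu cu' (esym E) (fun x => nproj x j k) (@C1_nproj c j k).
      rewrite mxE -bE -tr.
      exact: (DeriveDef (proj1 (C1_derive a oD' (@C1_nproj c' j k) cu')) erefl).
    exact: is_deriveM h1 h2.
  have h0 : is_derive u' a (fun v => \sum_j Y v 0 j * nproj (par c' v) j k) 0.
    have E0 : \near u', 0 = \sum_j Y u' 0 j * nproj (par c' u') j k.
      have : nbhs u' (dom c') by exact: open_nbhs_nbhs.
      apply: filterS => v cv; have := tY v cv; rewrite submx_tangent// => /eqP/rowP/(_ k).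
      by rewrite !mxE => ->.
    exact: (near_eq_is_derive E0 (is_derive_cst 0 u' a)).
  have e0 : \sum_j (Y u' 0 j * dnproj c u b j k + nproj (par c' u') j k * 'D_a Y u' 0 j) = 0.
    by have [_ <-] := h; have [_ ->] := h0.
  rewrite Yw E big_split/= in e0.
  rewrite [LHS]mxE [RHS]mxE [X in - X]mxE; apply/eqP; rewrite -addr_eq0 addrC -[X in _ == X]e0; apply/eqP.
  by congr (_ + _); apply: eq_bigr => j _; rewrite mulrC.
rewrite /second_fundamental_form; set A := [set _ | _].
suff AE z : A z <-> z = - (w *m dnproj c u b).
  by apply/AE; apply: (@xgetPex _ 0 A); exists (- (w *m dnproj c u b)); apply/AE.
split=> [[zn [c' [u' [a [Y [[cu' E] sY tY [aE Yw] hV]]]]]]|->].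
  rewrite -(key c' u' a Y cu' E sY tY aE Yw).
  move: zn; rewrite submx_normal// => /eqP <-.
  apply/rowP => k; have := hV (row k (nproj (par c u))).
  have rn : (row k (nproj (par c u)) <= Defs.normal_space n S (par c u))%MS.
    by rewrite submx_normal// -row_mul nproj_idem.
  move/(_ rn); rewrite !dotE => h.
  have sym i j : nproj (par c u) i j = nproj (par c u) j i.
    by rewrite -[in LHS](nproj_sym cu) mxE.
  rewrite !mxE; have -> : \sum_j z 0 j * nproj (par c u) j k =
      \sum_j z 0 j * row k (nproj (par c u)) 0 j.
    by apply: eq_bigr => j _; rewrite [in RHS]mxE sym.
  by rewrite h; apply: eq_bigr => j _; rewrite mxE sym.
(* Existence: the field with the constant coordinates of [w] in this chart is tangent and takes the
   value [w] at [u]. *)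
pose al := w *m (dual_mx (P c u))^T.
pose Y u := al *m P c u.
have sY : smooth_on (dom c) Y by apply: smooth_on_sum_partial => //; exact: chart_smooth.
have tY v : dom c v -> (Y v <= tangent_space n S (par c v))%MS.
  by move=> cv; rewrite submx_tangent// /Y -mulmxA partial_nproj ?mulmx0.
have Yw : Y u = w.
  rewrite /Y /al -mulmxA.
  have -> : (dual_mx (P c u))^T *m P c u = tproj (P c u).
    by rewrite /tproj /dual_mx !trmx_mul trmx_inv !trmx_mul !trmxK mulmxA.
  by apply/eqP; rewrite -submx_tproj// -tangent_space_eqmx// submx_tangent// wn.
have bE : 'D_b (par c) u = b *m P c u by have [_ ->] := derive_par b cu.
have k := key c u b Y cu erefl sY tY bE Yw; rewrite -k.
split; first by rewrite submx_normal// -mulmxA nproj_idem.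
exists c, u, b, Y; split=> // V; rewrite submx_normal// => /eqP VE.
by rewrite dot_trmx nproj_sym// VE.
Qed.

(** The second fundamental form is bilinear through [dnproj], and E^T E is the tangent projector for
    every orthonormal frame E. The trace over the frame thus becomes a contraction of the coordinate
    basis with its dual basis. *)
Lemma mean_curvature_par c u : dom c u ->
  mean_curvature n S (par c u) =
  - \sum_k row k (dual_mx (P c u)) *m dnproj c u (e k).
Proof.
move=> cu; have fP := @chart_immersion _ _ _ _ c u cu.
have oD := @chart_dom_open _ _ _ _ c.
rewrite /mean_curvature; set E := orthonormal_frame n S (par c u).
have [EE EP] : E *m E^T = 1%:M /\ (E :=: P c u)%MS.
  rewrite /E /orthonormal_frame; set A := [set _ | _].
  have : A (xget 0 A).
    apply: (@xgetPex _ 0 A); have [F [F1 F2]] := orthonormal_basis fP.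
    exists F; split=> //; apply: (eqmx_trans F2); apply: eqmx_sym; exact: tangent_space_eqmx.
  by move=> [h1 h2]; split=> //; apply: (eqmx_trans h2); exact: tangent_space_eqmx.
have EPi := orthonormal_tproj fP EE EP.
have Et : E *m tproj (P c u) = E by apply/eqP; rewrite -submx_tproj// EP.
pose B := (dual_mx (P c u))^T.
have BP : B *m P c u = tproj (P c u).
  by rewrite /B /tproj /dual_mx !trmx_mul trmx_inv !trmx_mul !trmxK mulmxA.
have dlin b : dnproj c u b = \sum_k b 0 k *: dnproj c u (e k).
  apply/matrixP => i j; rewrite mxE summxE.
  have [_ ->] := C1_derive b oD (@C1_nproj c i j) cu.
  by apply: eq_bigr => k _; rewrite !mxE.
have IIE i : second_fundamental_form n S (par c u) (row i E) (row i E) =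
    - \sum_k (E *m B) i k *: (row i E *m dnproj c u (e k)).
  have -> : second_fundamental_form n S (par c u) (row i E) (row i E) =
      second_fundamental_form n S (par c u) ((row i E *m B) *m P c u) (row i E).
    by rewrite -mulmxA BP -row_mul Et.
  rewrite second_fundamental_form_par//; last first.
    by rewrite nproj_par// mulmxBr mulmx1 -row_mul Et subrr.
  rewrite dlin mulmx_sumr; congr (- _); apply: eq_bigr => k _.
  by rewrite -scalemxAr -row_mul mxE.
under eq_bigr do rewrite IIE.
rewrite sumrN exchange_big/=; congr (- _); apply: eq_bigr => k _.
have -> : row k (dual_mx (P c u)) = \sum_i (E *m B) i k *: row i E.
  rewrite -(dual_tproj fP) -EPi mulmxA row_mul.
  have -> : dual_mx (P c u) *m E^T = (E *m B)^T by rewrite trmx_mul /B trmxK.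
  rewrite mulmx_sum_row; apply: eq_bigr => i _; by rewrite !mxE.
by rewrite mulmx_suml; apply: eq_bigr => i _; rewrite scalemxAl.
Qed.

End charts.

(** * Laplace asymptotics on a submanifold *)

Section surface_topology.
Context {R : realType} (n N : nat) (S : set 'rV[R]_N).
Implicit Types (c : chart n S) (x y : 'rV[R]_N).
Local Notation dom := chart_dom.
Local Notation par := chart_par.
Local Notation nbd := chart_nbd.
Local Notation P c u := (partial_mx (chart_par c) u).

Lemma finite_ball_cover (rho : 'rV[R]_N -> R) : compact S ->
  (forall x, S x -> 0 < rho x) -> exists s : seq 'rV[R]_N,
  (forall x, x \in s -> S x) /\ forall y, S y -> exists2 x, x \in s & `|y - x| < rho x.
Proof.
rewrite compact_cover => cS rho0.
have [|y Sy|D DS SD] := cS _ S (fun x => ball x (rho x)).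
- by move=> x Sx; exact: ball_open.
- by exists y => //; exact/ballxx/rho0.
- exists (finmap.enum_fset D); split=> [x xD|y /SD[x xD]].
    by have := DS x xD; rewrite inE.
  by move=> /ball_rVE yx; exists x => //; rewrite distrC.
Qed.

Definition C0_surface (G : 'rV[R]_N -> R) :=
  forall c u, dom c u -> {for u, continuous (G \o par c)}.

Hypothesis sS : is_submanifold n S.

Lemma C0_surface_near G x : C0_surface G -> S x -> forall V, nbhs (G x) V ->
  \forall y \near x, S y -> V (G y).
Proof.
move=> cG Sx V VG; have [c cx] := sS Sx.
have [cu E] := chart_coordK Sx cx.
have /subspace_continuousP/(_ _ (conj Sx cx)) := @chart_coord_continuous _ _ _ _ c.
rewrite /from_subspace => cc.
have {}VG : nbhs ((G \o par c) (chart_coord c x)) V by rewrite /= E.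
have {cc} := cc _ (cG c _ cu V VG).
have nN : \forall y \near x, nbd c y by apply: open_nbhs_nbhs; split=> //; exact: chart_nbd_open.
move=> h; have {}h : \forall y \near x, (S `&` nbd c) y -> V (G (par c (chart_coord c y))) := h.
apply: filterS2 nN h => y Ny + Sy => /(_ (conj Sy Ny)).
by have [_ ->] := chart_coordK Sy Ny.
Qed.

Lemma C0_surface_bounded G : compact S -> C0_surface G ->
  exists2 C, 0 < C & forall x, S x -> `|G x| <= C.
Proof.
move=> cS cG.
have wc : {within S, continuous G}.
  apply/subspace_continuousP => x Sx V VG.
  by have := C0_surface_near cG Sx VG.
have /compact_bounded[M [Mr hM]] := continuous_compact wc cS.
exists (`|M| + 1); first by rewrite ltr_wpDl.
move=> x Sx; apply: (hM (`|M| + 1)); last by exists x.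
by rewrite (le_lt_trans (ler_norm _))// ltrDl.
Qed.

Lemma C0_surface_measurable G : compact S -> C0_surface G ->
  measurable_fun (S : set (borelV R N)) G.
Proof.
move=> cS cG mS; apply: (measurability _ (RGenOpens.measurableE R)) => //.
move=> _ [_ [a [b ->] <-]].
(* Continuity along S makes every point of the preimage interior to [B], so the preimage is the
   trace on S of an open set. *)
pose B := [set y | S y -> `]a, b[%classic (G y)].
have -> : S `&` G @^-1` `]a, b[ = S `&` B°.
  apply/seteqP; split=> y [Sy h]; split=> //; last exact: (interior_subset h).
  apply: (C0_surface_near cG Sy); apply: open_nbhs_nbhs; split=> //.
by apply: measurableI => //; apply: open_borel; exact: open_interior.
Qed.

Lemma closed_borel (A : set 'rV[R]_N) : closed A -> measurable (A : set (borelV R N)).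
Proof.
move=> cA; rewrite -[A]setCK; apply: measurableC; apply: open_borel.
exact: closed_openC.
Qed.

End surface_topology.

Section local_bounds.
Context {R : realType} (n N : nat) (S : set 'rV[R]_N).
Implicit Types (c : chart n S) (x y : 'rV[R]_N) (u v : 'rV[R]_n).
Local Notation dom := chart_dom.
Local Notation par := chart_par.
Local Notation nbd := chart_nbd.
Local Notation P c u := (partial_mx (chart_par c) u).
Local Notation e i := (delta_mx 0 i : 'rV[R]_n).

Definition vdens c u : R := Num.sqrt (\det (gram c u)).

Lemma vdens_gt0 c u : dom c u -> 0 < vdens c u.
Proof. by move=> cu; rewrite sqrtr_gt0 det_gram_gt0//; exact: chart_immersion. Qed.

Lemma C1_vdens c : C1_on (dom c) (vdens c).
Proof.
have oD := @chart_dom_open _ _ _ _ c.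
apply: (@C1_on_comp R n (dom c) (fun u => \det (gram c u)) (@Num.sqrt R) (fun t => (2 * Num.sqrt t)^-1) oD).
- by apply: (C1_on_det oD) => i j; exact: C1_gram.
- by move=> u cu; apply: is_derive1_sqrt; rewrite det_gram_gt0//; exact: chart_immersion.
- move=> u cu.
  apply: (@continuous_comp _ _ _ (fun t : R => 2 * Num.sqrt t) (fun t => t^-1)).
    by apply: continuousM; [exact: cst_continuous|exact: sqrt_continuous].
  by apply: inv_continuous; rewrite mulf_neq0// gt_eqF// vdens_gt0.
Qed.

Lemma norm_mulmx_le k (x : 'rV[R]_N) (B : 'M[R]_(N, k)) :
  `|x *m B| <= `|x| * \sum_i \sum_j `|B i j|.
Proof.
apply: norm_le_coord => [|j]; first by rewrite mulr_ge0// sumr_ge0// => i _; exact: sumr_ge0.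
rewrite mxE mulr_sumr; apply: (le_trans (ler_norm_sum _ _ _)); apply: ler_sum => i _.
rewrite normrM ler_pM ?coord_le_norm//.
by rewrite (bigD1 j)//= lerDl sumr_ge0.
Qed.

(** The lower bound for the parametrization is [chart_inverse_rate] at rate 1 / 2; the upper one is
    strict differentiability of each coordinate at rate 1. *)
Lemma chart_bilipschitz c u0 : dom c u0 -> exists eps K : R, [/\ 0 < eps, 0 < K,
  forall u, `|u - u0| < eps -> dom c u /\ K^-1 <= vdens c u <= K &
  forall u u', `|u - u0| < eps -> `|u' - u0| < eps ->
    `|u - u'| <= K * `|par c u - par c u'| /\ `|par c u - par c u'| <= K * `|u - u'|].
Proof.
move=> cu0; have oD := @chart_dom_open _ _ _ _ c; have sm := @chart_smooth _ _ _ _ c.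
have h2 : 0 < 2^-1 :> R by rewrite invr_gt0.
have [d1 d10 h1] := chart_inverse_rate cu0 h2.
have hj (j : 'I_N) := C1_strict oD (smooth_on_coord j oD sm) cu0 ltr01.
have /fin_all_exists2[dd dd0 ddP] := hj.
pose d2 := \big[Num.min/1]_j dd j.
have d20 : 0 < d2 by apply/bigmin_gtP.
pose w0 := vdens c u0; have w00 : 0 < w0 by exact: vdens_gt0.
have : \forall u \near u0, dom c u /\ `|w0 - vdens c u| < w0 / 2.
  apply: filterI; first exact: open_nbhs_nbhs.
  have := proj1 (C1_vdens cu0) => /cvgrPdist_lt/(_ (w0 / 2)); apply.
  by rewrite divr_gt0.
move=> /nbhs_ballP[d3 /= d30 d3P].
(* The factor 2 absorbs the half of |u - u'| left by the inverse rate; [K] adds up all the constants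
   so as to dominate each of them. *)
pose K1 := 2 * \sum_i \sum_j `|(dual_mx (P c u0))^T i j|.
pose K2 j := 1 + \sum_i `|'D_(e i) (fun u => par c u 0 j) u0|.
have K20 j : 0 <= K2 j by rewrite addr_ge0// sumr_ge0.
pose K := 1 + K1 + \sum_j K2 j + 2 * w0 + 2 / w0.
have K10 : 0 <= K1 by rewrite mulr_ge0// sumr_ge0// => i _; exact: sumr_ge0.
have sK2 : 0 <= \sum_j K2 j by exact: sumr_ge0.
have iw0 : 0 < 2 / w0 by rewrite divr_gt0.
have K0 : 0 < K by rewrite /K; lra.
exists (Num.min d1 (Num.min d2 d3)), K; split=> //.
- by rewrite !lt_min d10 d20.
- move=> u; rewrite !lt_min => /and3P[_ _ ud3].
  have [|cu wu] := d3P u; first by apply/ball_rVE; rewrite distrC.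
  split=> //; have : w0 / 2 <= vdens c u <= 2 * w0.
    by move: wu; rewrite ltr_distl => /andP[a b]; apply/andP; split; lra.
  move=> /andP[a b]; apply/andP; split; last by rewrite (le_trans b)// /K; lra.
  apply: le_trans a; rewrite -[leRHS]invrK lef_pV2 ?posrE ?invr_gt0 ?divr_gt0//.
  by rewrite invf_div /K; lra.
- move=> u u'; rewrite !lt_min => /and3P[ud1 ud2 _] /and3P[u'd1 u'd2 _]; split.
  + have {h1} h1 := h1 u u' ud1 u'd1.
    have h3 := norm_mulmx_le (par c u - par c u') (dual_mx (P c u0))^T.
    set x := _ *m _ in h1 h3.
    have h4 : `|u - u'| <= `|x| + `|x - (u - u')|.
      by rewrite -{1}[u - u'](subKr x) (le_trans (ler_normB _ _)).
    have h5 : `|par c u - par c u'| * K1 <= K * `|par c u - par c u'|.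
      by rewrite mulrC ler_wpM2r// /K; lra.
    rewrite /K1 in h5; lra.
  + apply: norm_le_coord => [|j]; first by rewrite mulr_ge0// ltW.
    have dj : d2 <= dd j by exact: bigmin_le.
    have := ddP j u u' (lt_le_trans ud2 dj) (lt_le_trans u'd2 dj).
    set s := \sum_i _ => h; rewrite !mxE.
    have hs : `|s| <= `|u - u'| * \sum_i `|'D_(e i) (fun u => par c u 0 j) u0|.
      rewrite mulr_sumr (le_trans (ler_norm_sum _ _ _))// ler_sum// => i _.
      by rewrite normrM ler_wpM2r// coord_le_norm.
    have h6 : `|par c u 0 j - par c u' 0 j| <= `|par c u 0 j - par c u' 0 j - s| + `|s|.
      by rewrite -{1}[par c u 0 j - par c u' 0 j](subrK s) ler_normD.
    have h7 : `|u - u'| * K2 j <= K * `|u - u'|.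
      rewrite mulrC ler_wpM2r// /K (bigD1 j)//=.
      have : 0 <= \sum_(i < N | i != j) K2 i by exact: sumr_ge0.
      lra.
    rewrite /K2 mulrDr in h7; lra.
Qed.

Lemma chart_near c x0 eps : S x0 -> nbd c x0 -> 0 < eps -> exists2 rho, 0 < rho &
  forall y, S y -> `|y - x0| < rho -> nbd c y /\ `|chart_coord c y - chart_coord c x0| < eps.
Proof.
move=> Sx cx eps0.
have /subspace_continuousP/(_ _ (conj Sx cx)) := @chart_coord_continuous _ _ _ _ c.
rewrite /from_subspace => /cvgrPdist_lt/(_ _ eps0); rewrite nearE /within/= nearE.
have nN : \forall y \near x0, nbd c y by apply: open_nbhs_nbhs; split=> //; exact: chart_nbd_open.
move/(filterI nN) => /nbhs_ballP[rho /= rho0 h]; exists rho => // y Sy yx.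
have [|Ny H] := h y; first by apply/ball_rVE; rewrite distrC.
by split=> //; rewrite distrC; exact: H.
Qed.

End local_bounds.

Section norms.
Context {R : realType}.

Lemma sqnorm_le_norm N (v : 'rV[R]_N) : sqnorm v <= N%:R * `|v| ^+ 2.
Proof.
rewrite /sqnorm dotE; apply: (@le_trans _ _ (\sum_(i < N) `|v| ^+ 2)).
  by apply: ler_sum => i _; rewrite -expr2 -real_normK ?num_real// ler_sqr ?nnegrE// coord_le_norm.
by rewrite sumr_const card_ord mulr_natl.
Qed.

Lemma norm_le_sqnorm N (v : 'rV[R]_N) : `|v| ^+ 2 <= sqnorm v.
Proof.
have h : `|v| <= Num.sqrt (sqnorm v).
  apply: norm_le_coord => [|i]; first exact: sqrtr_ge0.
  rewrite -sqrtr_sqr ler_wsqrtr// /sqnorm dotE (bigD1 i)//= -expr2 lerDl.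
  by apply: sumr_ge0 => j _; rewrite -expr2 sqr_ge0.
rewrite -[leRHS](@sqr_sqrtr R) ?sqnorm_ge0//.
by rewrite ler_sqr ?nnegrE// sqrtr_ge0.
Qed.

Lemma cvg_sqnorm N T (F : set_system T) {FF : Filter F} (y : T -> 'rV[R]_N) (l : 'rV[R]_N) :
  (forall i, y x 0 i @[x --> F] --> l 0 i) -> sqnorm (y x) @[x --> F] --> sqnorm l.
Proof.
move=> h; rewrite /sqnorm dotE; under eq_fun do rewrite dotE.
apply: cvg_big => [|i _]; first exact: add_continuous.
by apply: cvgM; exact: h.
Qed.

End norms.

Section gauss_integrals.
Context {R : realType} (n : nat).

Lemma integral_gauss_scalar (k : R) : 0 < k -> exists2 C : R, 0 < C &
  (\int[lebesgue_rV n]_v (expR (- (k * sqnorm (v : 'rV_n) / 4)))%:E = C%:E)%E.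
Proof.
move=> k0; have pA : posdef (k%:M : 'M[R]_n).
  split; first by rewrite tr_scalar_mx.
  move=> v v0; rewrite mul_mx_scalar dotZl mulr_gt0// lt0r -/(sqnorm v) sqnorm_eq0 v0.
  exact: sqnorm_ge0.
have [d0 h] := integral_gauss_quadratic pA.
exists (Num.sqrt (4 * pi) ^+ n / Num.sqrt (\det (k%:M : 'M[R]_n))); last first.
  rewrite -h; apply: eq_integral => v _; by rewrite mul_mx_scalar dotZl.
by rewrite divr_gt0// ?exprn_gt0// sqrtr_gt0// mulr_gt0// pi_gt0.
Qed.

(** By Pythagoras, translating v by the coordinates of the tangential part of z leaves the normal
    part of z and the form of the Gram matrix. These are the two factors that appear in the Laplace
    limit. *)
Lemma integral_gauss_immersion N (P : 'M[R]_(n, N)) (z : 'rV[R]_N) : row_free P ->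
  (\int[lebesgue_rV n]_v (expR (- (sqnorm (z - (v : 'rV_n) *m P) / 4)))%:E =
  (Num.sqrt (4 * pi) ^+ n / Num.sqrt (\det (P *m P^T)) *
    expR (- (sqnorm (z *m (1%:M - tproj P)) / 4)))%:E)%E.
Proof.
move=> fP; have [d0 h] := integral_gauss_quadratic (posdef_gram fP).
pose b := z *m (dual_mx P)^T.
have BP : (dual_mx P)^T *m P = tproj P.
  by rewrite /tproj /dual_mx !trmx_mul trmx_inv !trmx_mul !trmxK mulmxA.
have mf (w : 'rV[R]_N) : measurable_fun setT
    (fun v : borelV R n => (expR (- (sqnorm (w - (v : 'rV_n) *m P) / 4)))%:E).
  apply/measurable_EFinP; apply: measurableT_comp => //; apply: measurableT_comp => //.
  apply: measurable_funM => //; apply: measurable_sqnorm; apply: measurable_rVD; first by [].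
  apply: measurable_rVN; apply: measurable_rV_mulmx => // i j.
have h1 := @ge0_integral_affine R n (fun v => (expR (- (sqnorm (z - v *m P) / 4)))%:E) b 1
  ltr01 (mf z) (fun v => ltac:(by rewrite lee_fin expR_ge0)).
rewrite expr1n invr1 mul1e in h1; rewrite -h1.
have orth (v : 'rV[R]_n) : sqnorm (z - (b + 1 *: v) *m P) =
    dot (v *m (P *m P^T)) v + sqnorm (z *m (1%:M - tproj P)).
  rewrite scale1r mulmxDl /b -mulmxA BP opprD addrA.
  have -> : z - z *m tproj P = z *m (1%:M - tproj P) by rewrite mulmxBr mulmx1.
  rewrite sqnormB; have -> : dot (z *m (1%:M - tproj P)) (v *m P) = 0.
    rewrite dot_trmx linearB/= trmx1 tproj_sym -mulmxA mulmxBr mulmx1.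
    by rewrite (mulmx_tproj fP) subrr mulmx0 dot0r.
  by rewrite mulr0 subr0 addrC; congr (_ + _); rewrite mulmxA [RHS]dot_trmx trmxK.
under eq_integral do rewrite orth mulrDl opprD expRD EFinM.
have mm : measurable_fun setT
    (fun v : borelV R n => (expR (- (dot ((v : 'rV_n) *m (P *m P^T)) v / 4)))%:E).
  exact: measurable_expR_dot.
rewrite (@ge0_integralZr _ _ _ (lebesgue_rV n) setT measurableT _ mm); last 2 first.
- by move=> v _; rewrite lee_fin expR_ge0.
- by rewrite lee_fin expR_ge0.
by rewrite h -EFinM.
Qed.

End gauss_integrals.

(** * Laplace's method in one chart *)

Section laplace.
Context {R : realType} (n N : nat) (S : set 'rV[R]_N) (c : chart n S).
Local Notation dom := chart_dom.
Local Notation par := chart_par.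
Local Notation e i := (delta_mx 0 i : 'rV[R]_n).
Local Notation P u := (partial_mx (chart_par c) u).

(** At y = r x0 + s z this is exp (- |y - r x|^2 / (4 s^2)), the concentrating factor of the
    mixture. *)
Definition bell (r s : R) (z x0 x : 'rV[R]_N) : R :=
  expR (- (sqnorm (z - (r / s) *: (x - x0)) / 4)).

Lemma measurable_parE (E : set 'rV[R]_n) : E `<=` dom c -> measurable (E : set (borelV R n)) ->
  measurable_fun (E : set (borelV R n)) (par c : _ -> borelV R N).
Proof.
move=> Ed mE; apply: measurable_fun_rV => j; 
apply: (measurable_funS (open_borel (@chart_dom_open _ _ _ _ c)) Ed).
apply: open_continuous_borel; first exact: chart_dom_open.
move=> u cu; exact: (continuous_comp (continuous_par cu) (@coord_continuous _ _ _ _ _ _)).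
Qed.

Lemma measurable_bell d (T : measurableType d) (D : set T) r s (z x0 : 'rV[R]_N) (x : T -> 'rV[R]_N) :
  measurable_fun D (x : T -> borelV R N) -> measurable_fun D (fun t => bell r s z x0 (x t)).
Proof.
move=> mx; apply: measurableT_comp => //; apply: measurableT_comp => //.
apply: measurable_funM => //; apply: measurable_sqnorm; apply: measurable_rVD => //.
apply: measurable_rVN; apply: measurable_rVZ => //; apply: measurable_rVD => //.
Qed.

Variables (E : set 'rV[R]_n) (q : 'rV[R]_n -> R) (W K : R).
Hypotheses (Ed : E `<=` dom c) (mE : measurable (E : set (borelV R n))).
Hypotheses (mq : measurable_fun (E : set (borelV R n)) q).
Hypotheses (q0 : forall u, E u -> 0 <= q u) (qW : forall u, E u -> q u <= W).
Hypotheses (K0 : 0 < K) (W0 : 0 <= W).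

(** The rate of decay in [g_le]. For y = (r / s) (x - x0), the bound r >= 1 / 2, the Lipschitz bound
    and the passage from sup to Euclidean norm give 2 kap |v|^2 <= |y|^2, and half of it is spent on
    separating z. Using n + 1 avoids a division by 0. *)
Let kap : R := (8 * K ^+ 2 * n.+1%:R)^-1.

Let kap0 : 0 < kap.
Proof. by rewrite invr_gt0 !mulr_gt0// exprn_gt0. Qed.

Let g r s z u0 (v : 'rV[R]_n) : R :=
  if u0 + s *: v \in E then q (u0 + s *: v) * bell r s z (par c u0) (par c (u0 + s *: v)) else 0.

Let g_ge0 r s z u0 v : 0 <= g r s z u0 v.
Proof.
rewrite /g; case: ifPn => //; rewrite inE => Eu.
by rewrite mulr_ge0 ?q0// expR_ge0.
Qed.

Let mg0 r s z u0 : measurable_fun setT (fun u : borelV R n =>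
  if (u : 'rV_n) \in E then q u * bell r s z (par c u0) (par c u) else 0).
Proof.
have h := (measurable_restrictT (fun u : borelV R n => q u * bell r s z (par c u0) (par c u)) mE).1.
apply: h; apply: measurable_funM => //; apply: measurable_bell.
exact: measurable_parE.
Qed.

Lemma laplace_change r s z u0 : 0 < s ->
  ((s ^+ n)^-1%:E * \int[lebesgue_rV n]_(u in E) (q u * bell r s z (par c u0) (par c u))%:E =
  \int[lebesgue_rV n]_v (g r s z u0 v)%:E)%E.
Proof.
move=> s0.
have h := @ge0_integral_affine R n (fun u => (if u \in E then q u * bell r s z (par c u0) (par c u) else 0)%:E) u0 s s0.
rewrite /g h; last 2 first.
- by apply/measurable_EFinP; exact: mg0.
- move=> u; rewrite lee_fin; case: ifPn => //; rewrite inE => Eu.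
  by rewrite mulr_ge0 ?q0// expR_ge0.
congr (_ * _)%E; rewrite integral_mkcond; apply: eq_integral => u _.
by rewrite /patch; case: ifP.
Qed.

Hypothesis lipE : forall u u', E u -> E u' -> `|u - u'| <= K * `|par c u - par c u'|.

Let g_le r s z u0 v : E u0 -> 0 < s -> 1 / 2 <= r ->
  g r s z u0 v <= W * expR (sqnorm z / 4) * expR (- (kap * sqnorm v / 4)).
Proof.
move=> Eu0 s0 r2; rewrite /g; case: ifPn; rewrite ?inE => Eu; last first.
  by rewrite mulr_ge0 ?expR_ge0// mulr_ge0 ?expR_ge0.
rewrite -mulrA ler_pM ?q0 ?qW ?expR_ge0// -expRD ler_expR.
set x := par c _; set x0 := par c u0; set y := (r / s) *: (x - x0).
have h1 : sqnorm y <= 2 * sqnorm (z - y) + 2 * sqnorm z.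
  have := sqnormB_le z (z - y); rewrite subKr => h; lra.
have hs : s * `|v| <= K * `|x - x0|.
  have := lipE Eu Eu0; rewrite addrC addKr normrZ gtr0_norm//.
have h2 : (s * `|v|) ^+ 2 <= K ^+ 2 * `|x - x0| ^+ 2.
  by rewrite -exprMn ler_sqr ?nnegrE// mulr_ge0// ltW.
have h3 := norm_le_sqnorm (x - x0).
have h4 := sqnorm_le_norm v.
have h5 : sqnorm y = r ^+ 2 / s ^+ 2 * sqnorm (x - x0) by rewrite sqnormZ expr_div_n.
have r4 : 1 / 4 <= r ^+ 2.
  have -> : 1 / 4 = (1 / 2) ^+ 2 :> R by field.
  by rewrite ler_sqr ?nnegrE ?(le_trans _ r2)// divr_ge0.
have h6 : kap * sqnorm v <= sqnorm y / 2.
  rewrite /kap mulrC ler_pdivrMr ?mulr_gt0 ?exprn_gt0//.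
  have nn : sqnorm v <= n.+1%:R * `|v| ^+ 2.
    by apply: (le_trans h4); rewrite ler_wpM2r ?sqr_ge0// ler_nat.
  apply: (le_trans nn).
  have -> : sqnorm y / 2 * (8 * K ^+ 2 * n.+1%:R) = n.+1%:R * (4 * K ^+ 2 * sqnorm y) by field.
  rewrite ler_wpM2l// h5.
  have -> : 4 * K ^+ 2 * (r ^+ 2 / s ^+ 2 * sqnorm (x - x0)) =
      (4 * r ^+ 2) * (K ^+ 2 * sqnorm (x - x0)) / s ^+ 2 by field; rewrite gt_eqF.
  rewrite ler_pdivlMr ?exprn_gt0// mulrC -exprMn; apply: (le_trans h2).
  have h7 : K ^+ 2 * `|x - x0| ^+ 2 <= K ^+ 2 * sqnorm (x - x0) by rewrite ler_wpM2l// sqr_ge0.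
  apply: (le_trans h7); apply: ler_peMl; first by rewrite mulr_ge0 ?sqr_ge0 ?sqnorm_ge0.
  by rewrite -ler_pdivrMl// mulr1 -[leLHS]mul1r.
lra.
Qed.

Let mg r s z u0 : measurable_fun setT (fun v : borelV R n => g r s z u0 v).
Proof.
apply: (measurableT_comp (mg0 r s z u0) (_ : measurable_fun setT
  (fun v : borelV R n => (u0 + s *: (v : 'rV_n) : borelV R n)))).
by apply: measurable_rVD => //; exact: measurable_rVZ.
Qed.

Let integrable_bell_bound (C : R) : (lebesgue_rV n).-integrable setT
  (EFin \o (fun v : borelV R n => C * expR (- (kap * sqnorm (v : 'rV_n) / 4)))).
Proof.
have [I I0 IE] := integral_gauss_scalar n kap0.
apply: integrable_RZ; apply: integrable_ge0 => [|v|]; last by rewrite IE ltry.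
  apply: measurableT_comp => //; apply: measurableT_comp => //.
  by apply: measurable_funM => //; apply: measurable_funM => //; exact: measurable_sqnorm.
exact: expR_ge0.
Qed.

(** The constant depends neither on the centre [u0] nor on s: this dominates the outer integral when
    the centre is itself integrated. *)
Lemma laplace_bound : exists2 C : R, 0 <= C & forall r s z u0, E u0 -> 0 < s -> 1 / 2 <= r ->
  ((s ^+ n)^-1%:E * \int[lebesgue_rV n]_(u in E) (q u * bell r s z (par c u0) (par c u))%:E <=
   (expR (sqnorm z / 4) * C)%:E)%E.
Proof.
have [I I0 IE] := integral_gauss_scalar n kap0.
exists (W * I) => [|r s z u0 Eu0 s0 r2]; first by rewrite mulr_ge0// ltW.
rewrite laplace_change//.
apply: (@le_trans _ _ (\int[lebesgue_rV n]_v (W * expR (sqnorm z / 4) *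
    expR (- (kap * sqnorm (v : 'rV_n) / 4)))%:E)%E).
  apply: ge0_le_integral => //.
  - by move=> v _; rewrite lee_fin.
  - by apply/measurable_EFinP; exact: mg.
  - exact: measurable_int (integrable_bell_bound _).
  - by move=> v _; rewrite lee_fin; exact: g_le.
under eq_integral do rewrite EFinM.
rewrite (@ge0_integralZl _ _ _ (lebesgue_rV n) setT measurableT
    (fun v => (expR (- (kap * sqnorm (v : 'rV_n) / 4)))%:E)); last 3 first.
- have := measurable_int _ (integrable_bell_bound 1).
  by rewrite /comp; under eq_fun do rewrite mul1r.
- by move=> v _; rewrite lee_fin expR_ge0.
- by rewrite lee_fin mulr_ge0// expR_ge0.
by rewrite IE -EFinM lee_fin mulrCA mulrA mulrAC mulrC mulrA.
Qed.

(** After the substitution u = u0 + s v the rescaled displacement of par c tends to its differential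
    at v, and the limit integral is [integral_gauss_immersion]. No relation between r and s is
    imposed, so r = 1 is allowed. *)
Lemma laplace_limit u0 z (r_ s_ : nat -> R) : E u0 -> nbhs u0 E -> {for u0, continuous q} ->
  (forall k, 0 < s_ k) -> s_ @ \oo --> (0 : R) ->
  (forall k, 1 / 2 <= r_ k) -> r_ @ \oo --> (1 : R) ->
  ((s_ k ^+ n)^-1%:E * \int[lebesgue_rV n]_(u in E)
      (q u * bell (r_ k) (s_ k) z (par c u0) (par c u))%:E)%E @[k --> \oo] -->
  (q u0 * (Num.sqrt (4 * pi) ^+ n / vdens c u0 *
    expR (- (sqnorm (z *m nproj n S (par c u0)) / 4))))%:E.
Proof.
move=> Eu0 nE cq s0 cs r2 cr.
have cu0 := Ed Eu0; have oD := @chart_dom_open _ _ _ _ c.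
have fP := @chart_immersion _ _ _ _ c u0 cu0.
have -> : (fun k => (s_ k ^+ n)^-1%:E * \int[lebesgue_rV n]_(u in E)
      (q u * bell (r_ k) (s_ k) z (par c u0) (par c u))%:E)%E =
    (fun k => \int[lebesgue_rV n]_v (g (r_ k) (s_ k) z u0 v)%:E)%E.
  by apply/funext => k; rewrite laplace_change.
pose f (v : borelV R n) : R := q u0 * expR (- (sqnorm (z - (v : 'rV_n) *m P u0) / 4)).
have fE : (\int[lebesgue_rV n]_v (f v)%:E)%E =
    (q u0 * (Num.sqrt (4 * pi) ^+ n / vdens c u0 *
    expR (- (sqnorm (z *m nproj n S (par c u0)) / 4))))%:E.
  rewrite EFinM nproj_par// -(integral_gauss_immersion z fP) /f.
  rewrite -(@ge0_integralZl _ _ _ (lebesgue_rV n) setT measurableT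
    (fun v => (expR (- (sqnorm (z - (v : 'rV_n) *m P u0) / 4)))%:E)) ?lee_fin ?q0//.
  apply/measurable_EFinP; apply: measurableT_comp => //; apply: measurableT_comp => //.
  apply: measurable_funM => //; apply: measurable_sqnorm; apply: measurable_rVD => //.
  by apply: measurable_rVN; apply: measurable_rV_mulmx.
have cu v : u0 + s_ k *: v @[k --> \oo] --> u0.
  rewrite -[X in _ --> X]addr0 -[in X in _ --> X](scale0r v).
  by apply: cvgD; [exact: cvg_cst|apply: cvgZ; [exact: cs|exact: cvg_cst]].
have gf v : g (r_ k) (s_ k) z u0 v @[k --> \oo] --> f v.
  have nEv : \forall k \near \oo, u0 + s_ k *: v \in E.
    have h : \forall k \near \oo, E (u0 + s_ k *: v) := cu v _ nE.
    by apply: filterS h => k Ek; rewrite inE.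
  have h : q (u0 + s_ k *: v) * bell (r_ k) (s_ k) z (par c u0) (par c (u0 + s_ k *: v))
      @[k --> \oo] --> f v.
    apply: cvgM; first exact: (cvg_comp _ _ (cu v) cq).
    suff hx : - (sqnorm (z - (r_ k / s_ k) *: (par c (u0 + s_ k *: v) - par c u0)) / 4) @[k --> \oo] -->
        - (sqnorm (z - v *m P u0) / 4).
      exact: (cvg_comp _ _ hx (@continuous_expR R _)).
    apply: cvgN; apply: cvgM; last exact: cvg_cst.
    apply: cvg_sqnorm => i; under eq_fun do rewrite !mxE.
    rewrite !mxE; apply: cvgB; first exact: cvg_cst.
    have h1 : (s_ k)^-1 * (par c (u0 + s_ k *: v) 0 i - par c u0 0 i) @[k --> \oo] -->
        \sum_j v 0 j * 'D_(e j) (fun u => par c u 0 i) u0.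
      apply: (@C1_curve _ _ (dom c) (fun u => par c u 0 i) u0 nat \oo _
        (fun k => u0 + s_ k *: v) s_ v oD (smooth_on_coord i oD (@chart_smooth _ _ _ _ c)) cu0 (cu v)).
      apply: (@cvg_near_cst _ _ v _ \oo _); apply: nearW => k.
      by rewrite addrC addKr scalerA mulVf ?scale1r// gt_eqF.
    have -> : \sum_j v 0 j * P u0 j i = 1 * \sum_j v 0 j * 'D_(e j) (fun u => par c u 0 i) u0.
      rewrite mul1r; apply: eq_bigr => j _; congr (_ * _); rewrite mxE.
      by rewrite derive_coord//; have [] := derive_par (e j) cu0.
    under eq_fun do rewrite -mulrA.
    by apply: cvgM.
  apply: cvg_trans h; apply: near_eq_cvg.
  by apply: filterS nEv => k; rewrite /g => ->.
rewrite -fE.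
have mG k : measurable_fun setT (EFin \o (fun v : borelV R n => g (r_ k) (s_ k) z u0 v)).
  by apply/measurable_EFinP; exact: mg.
have mF : measurable_fun setT (EFin \o f).
  apply/measurable_EFinP; apply: measurable_funM => //.
  apply: measurableT_comp => //; apply: measurableT_comp => //.
  apply: measurable_funM => //; apply: measurable_sqnorm; apply: measurable_rVD => //.
  by apply: measurable_rVN; apply: measurable_rV_mulmx.
have gfE v : (EFin \o g (r_ k) (s_ k) z u0) v @[k --> \oo] --> (EFin \o f) v.
  by apply/fine_cvgP; split; [exact: nearW|exact: gf].
have gle v k : (`|(EFin \o g (r_ k) (s_ k) z u0) v| <=
    (W * expR (sqnorm z / 4) * expR (- (kap * sqnorm v / 4)))%:E)%E.
  by rewrite /= lee_fin ger0_norm//; exact: g_le.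
have [_ _ h] := @dominated_convergence _ (borelV R n) R (lebesgue_rV n) setT measurableT
  (fun k => EFin \o (fun v : borelV R n => g (r_ k) (s_ k) z u0 v)) (EFin \o f) _ mG mF
  (aeW (lebesgue_rV n) (fun (v : borelV R n) _ => gfE v)) (integrable_bell_bound (W * expR (sqnorm z / 4)))
  (aeW (lebesgue_rV n) (fun (v : borelV R n) k _ => gle v k)).
exact: h.
Qed.

End laplace.

Section density_measure.
Context d (T : measurableType d) (R : realType) (mu : {measure set T -> \bar R}).

(* The two proofs are arguments only so that the measure instance can be inferred. *)
Definition density_measure (h : T -> R) of measurable_fun setT h & (forall x, 0 <= h x) :=
  fun A : set T => (\int[mu]_(x in A) (h x)%:E)%E.

Variables (h : T -> R) (mh : measurable_fun setT h) (h0 : forall x, 0 <= h x).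
Let m := density_measure mh h0.

Let m_0 : m set0 = 0%E. Proof. exact: integral_set0. Qed.

Let m_ge0 B : (0 <= m B)%E.
Proof. by apply: integral_ge0 => x _; rewrite lee_fin. Qed.

Let m_sigma_additive : semi_sigma_additive m.
Proof.
apply: semi_sigma_additive_nng_induced => [|x]; last by rewrite lee_fin.
exact/measurable_EFinP.
Qed.

HB.instance Definition _ := isMeasure.Build _ _ _ m m_0 m_ge0 m_sigma_additive.

End density_measure.

(** * Riemannian volume *)

Section chart_measure.
Context {R : realType} (n N : nat) (S : set 'rV[R]_N) (c : chart n S).
Local Notation dom := chart_dom.
Local Notation par := chart_par.
Local Notation nbd := chart_nbd.

(** Total versions of the density and of the parametrization, so that the chart volume becomes an
    image measure; the arbitrary value of [par0] off the domain carries no mass. *)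
Definition dens0 (u : borelV R n) : R := if (u : 'rV_n) \in dom c then vdens c u else 0.
Definition par0 (u : borelV R n) : borelV R N := if (u : 'rV_n) \in dom c then par c u else 0.

Lemma measurable_dom : measurable (dom c : set (borelV R n)).
Proof. by apply: open_borel; exact: chart_dom_open. Qed.

Lemma measurable_vdens : measurable_fun (dom c : set (borelV R n)) (vdens c).
Proof.
apply: open_continuous_borel; first exact: chart_dom_open.
by move=> u cu; exact: (C1_vdens cu).1.
Qed.

Lemma measurable_dens0 : measurable_fun setT dens0.
Proof. have h := (measurable_restrictT (vdens c : borelV R n -> R) measurable_dom).1 measurable_vdens.
exact: h. Qed.

Lemma dens0_ge0 u : 0 <= dens0 u.
Proof. by rewrite /dens0; case: ifP => // _; exact: sqrtr_ge0. Qed.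

Lemma measurable_par0 : measurable_fun setT par0.
Proof.
apply: measurable_fun_rV => j.
have mp : measurable_fun (dom c : set (borelV R n)) (fun u => par c u 0 j).
  apply: measurable_rV_coord; apply: (@measurable_parE _ _ _ _ c (dom c)) => //.
  exact: measurable_dom.
have := (measurable_restrictT (fun u : borelV R n => par c u 0 j) measurable_dom).1 mp.
congr measurable_fun; apply/funext => u; rewrite /patch /par0.
by case: ifP => // _; rewrite mxE.
Qed.

Definition chart_measure :=
  pushforward (density_measure (lebesgue_rV n) measurable_dens0 dens0_ge0) par0.

HB.instance Definition _ := Measure.copy chart_measure
  (measure_function_pushforward__canonical__measure_function_Measure
    (density_measure (lebesgue_rV n) measurable_dens0 dens0_ge0) measurable_par0).

Lemma chart_measureE A : measurable A -> chart_measure A = chart_volume c A.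
Proof.
move=> mA; rewrite /chart_measure /pushforward /density_measure /chart_volume.
rewrite [LHS]integral_mkcond [RHS]integral_mkcond; apply: eq_integral => u _.
rewrite /patch; case: (pselect (dom c u)) => cu.
  have cuE := mem_set cu.
  have -> : (u \in dom c `&` par c @^-1` A) = (u \in par0 @^-1` A).
    by apply/idP/idP; rewrite !inE /= /par0 cuE //; case.
  by rewrite /dens0 cuE.
rewrite (memNset (_ : ~ (dom c `&` par c @^-1` A) u)); last by case.
by rewrite /dens0 (memNset cu); case: ifP.
Qed.

Lemma chart_volumeI A : chart_volume c A = chart_volume c (A `&` nbd c).
Proof.
rewrite /chart_volume; congr (integral _ _ _); apply/seteqP; split=> u [cu Au]; split=> //.
  by split=> //; have [] := chart_parS cu.
by case: Au.
Qed.

Lemma le_chart_volume A B : measurable A -> measurable B -> A `<=` B ->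
  (chart_volume c A <= chart_volume c B)%E.
Proof. by move=> mA mB AB; rewrite -!chart_measureE// le_measure// inE. Qed.

Lemma ge0_integral_chart B (f : 'rV[R]_N -> \bar R) : measurable (B : set (borelV R N)) ->
  measurable_fun (B : set (borelV R N)) f -> (forall y, B y -> 0 <= f y)%E ->
  forall nu : {measure set (borelV R N) -> \bar R},
  (forall A, measurable A -> A `<=` B -> nu A = chart_volume c A) ->
  (\int[nu]_(y in B) f y =
   \int[lebesgue_rV n]_(u in dom c `&` par c @^-1` B) (f (par c u) * (vdens c u)%:E))%E.
Proof.
move=> mB mf f0 nu nuE.
apply: (@ge0_integral_density _ _ (borelV R n) (borelV R N) R (lebesgue_rV n) nu (dom c) (par c) (vdens c) B f) => //.
- exact: measurable_dom.
- by apply: (@measurable_parE _ _ _ _ c (dom c)) => //; exact: measurable_dom.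
- exact: measurable_vdens.
- by move=> u _; exact: sqrtr_ge0.
Qed.

End chart_measure.

Lemma mule_fin_inj (R : realType) (k : R) (x y : \bar R) : k != 0 -> x \is a fin_num ->
  y \is a fin_num -> (k%:E * x = k%:E * y -> x = y)%E.
Proof.
move=> k0; case: x => // x _; case: y => // y _; rewrite -!EFinM => -[] /(mulfI k0) ->//.
Qed.

(** * Comparison of the volumes read in two charts *)

Section small_volume.
Context {R : realType} (n N : nat) (S : set 'rV[R]_N).
Implicit Types (c : chart n S).
Local Notation dom := chart_dom.
Local Notation par := chart_par.
Local Notation nbd := chart_nbd.
Local Notation lam := (lebesgue_rV n).

(** A Gaussian centred at [u0] has a finite integral and is bounded below by a positive constant on
    the ball. *)
Lemma lebesgue_ball_lty (u0 : 'rV[R]_n) (r : R) :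
  (lam ([set u | (`|u - u0| < r)%R] : set (borelV R n)) < +oo)%E.
Proof.
have mB : measurable ([set u | `|u - u0| < r] : set (borelV R n)).
  have -> : [set u | `|u - u0| < r] = ball u0 r.
    by apply/seteqP; split=> u /=; rewrite -ball_normE/= distrC.
  by apply: open_borel; exact: ball_open.
have [I I0 IE] := integral_gauss_scalar n (ltr01 : 0 < 1 :> R).
pose k : R := expR (- (n%:R * r ^+ 2 / 4)).
have k0 : 0 < k by exact: expR_gt0.
have mg : measurable_fun setT (fun v : borelV R n => (expR (- (1 * sqnorm (u0 - v : 'rV_n) / 4)))%:E).
  apply/measurable_EFinP; apply: measurableT_comp => //; apply: measurableT_comp => //.
  apply: measurable_funM => //; apply: measurable_funM => //; apply: measurable_sqnorm.
  by apply: measurable_rVD => //; apply: measurable_rVN.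
have h : (k%:E * lam ([set u | (`|u - u0| < r)%R] : set (borelV R n)) <= I%:E)%E.
  rewrite -IE -(@integral_cst _ _ _ lam _ mB).
  have mf : measurable_fun setT (fun v : borelV R n => (expR (- (1 * sqnorm (v : 'rV_n) / 4)))%:E).
    apply/measurable_EFinP; apply: measurableT_comp => //; apply: measurableT_comp => //.
    by apply: measurable_funM => //; apply: measurable_funM => //; exact: measurable_sqnorm.
  have f0 (v : 'rV[R]_n) : (0 <= (expR (- (1 * sqnorm v / 4)))%:E)%E by rewrite lee_fin expR_ge0.
  have := @ge0_integral_affine R n (fun v => (expR (- (1 * sqnorm v / 4)))%:E) (- u0) 1 ltr01 mf f0.
  rewrite expr1n invr1 mul1e => <-.
  apply: (@le_trans _ _ (\int[lam]_(v in [set u | (`|u - u0| < r)%R])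
      (expR (- (1 * sqnorm (- u0 + 1 *: v : 'rV_n) / 4)))%:E)%E).
    apply: ge0_le_integral => //.
    - by move=> v _; rewrite lee_fin ltW.
    - apply: (measurable_funS measurableT) => //; move: mg; congr measurable_fun.
      by apply/funext => v; rewrite scale1r -sqnormN opprB addrC.
    - move=> v /= vr; rewrite lee_fin ler_expR lerN2 mul1r ler_pM2r ?invr_gt0//.
      rewrite scale1r addrC (le_trans (sqnorm_le_norm _))// ler_wpM2l//.
      by rewrite ler_sqr ?nnegrE ?(ltW vr)// (le_trans _ (ltW vr)).
  apply: ge0_subset_integral => //.
    move: mg; congr measurable_fun.
    by apply/funext => v; rewrite scale1r -sqnormN opprB addrC.
rewrite ltNge leye_eq; apply/negP => /eqP E; move: h; rewrite E.
by rewrite mulry gtr0_sg// mul1e leye_eq.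
Qed.

(** What the Laplace estimates require of the chart over V. By [tame_near] it holds on every V whose
    trace on S lies close enough to a given point, with one constant for all of them. *)
Definition tame c (V : set 'rV[R]_N) (K : R) := [/\ 0 < K,
  forall u, dom c u -> V (par c u) -> vdens c u <= K,
  forall u u', dom c u -> V (par c u) -> dom c u' -> V (par c u') ->
    `|u - u'| <= K * `|par c u - par c u'|,
  exists u0 r, forall u, dom c u -> V (par c u) -> `|u - u0| < r &
  forall x, S x -> V x -> nbd c x].

Lemma tame_near c x0 : S x0 -> nbd c x0 -> exists rho K, [/\ 0 < rho & 
  forall V : set 'rV[R]_N, (forall x, S x -> V x -> `|x - x0| < rho) -> tame c V K].
Proof.
move=> Sx cx; have [cu E] := chart_coordK Sx cx.
have [eps [K [eps0 K0 h1 h2]]] := chart_bilipschitz cu.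
have [rho rho0 hr] := chart_near Sx cx eps0.
exists rho, K; split=> // V Vr.
have hV u : dom c u -> V (par c u) -> `|u - chart_coord c x0| < eps.
  move=> du Vu; have [Su _] := chart_parS du.
  by have [_] := hr _ Su (Vr _ Su Vu); rewrite chart_parK.
split=> //.
- by move=> u du Vu; have [_ /andP[]] := h1 u (hV u du Vu).
- by move=> u u' du Vu du' Vu'; have [] := h2 u u' (hV u du Vu) (hV u' du' Vu').
- by exists (chart_coord c x0), eps.
- by move=> x Sx' Vx; have [] := hr x Sx' (Vr x Sx' Vx).
Qed.

Lemma tame_volume_lty c V K : open V -> tame c V K -> (chart_volume c V < +oo)%E.
Proof.
move=> oV [K0 wK _ [u0 [r hr]] _].
have mD : measurable (dom c `&` par c @^-1` V : set (borelV R n)).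
  apply: (@measurable_parE _ _ _ _ c (dom c)) => //; try exact: measurable_dom.
  exact: open_borel.
apply: (@le_lt_trans _ _ (\int[lam]_(u in dom c `&` par c @^-1` V) K%:E)%E).
  apply: ge0_le_integral => //.
  - apply/measurable_EFinP; apply: (measurable_funS (measurable_dom c)) => //.
    exact: measurable_vdens.
  - by move=> u [du Vu]; rewrite lee_fin; exact: wK.
rewrite integral_cst// lte_mul_pinfty// ?lee_fin ?ltW//.
apply: (le_lt_trans _ (lebesgue_ball_lty u0 r)); apply: le_measure.
- by rewrite inE.
- rewrite inE; have -> : [set u | `|u - u0| < r] = ball u0 r.
    by apply/seteqP; split=> u /=; rewrite -ball_normE/= distrC.
  by apply: open_borel; exact: ball_open.
- by move=> u [du Vu] /=; exact: hr.
Qed.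

Lemma tame_volume_fin c V K : open V -> tame c V K -> chart_volume c V \is a fin_num.
Proof.
move=> oV tc; rewrite ge0_fin_numE; first exact: tame_volume_lty oV tc.
by apply: integral_ge0 => u _; rewrite lee_fin sqrtr_ge0.
Qed.

(* Its limit as s -> 0, computed in either order of integration, compares the volumes
   read in c and c' without the change of variables formula. *)
Definition double_kernel (c c' : chart n S) (V : set 'rV[R]_N) (s : R) : \bar R :=
  (\int[lam]_(u' in dom c' `&` par c' @^-1` V) ((vdens c' u')%:E *
    \int[lam]_(u in dom c `&` par c @^-1` V)
      (vdens c u * bell 1 s 0 (par c' u') (par c u))%:E))%E.

Let densV (c : chart n S) (V : set 'rV[R]_N) (u : borelV R n) : R :=
  if (u : 'rV_n) \in dom c `&` par c @^-1` V then vdens c u else 0.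

Let ker2 (c c' : chart n S) (V : set 'rV[R]_N) (s : R) (p : borelV R n * borelV R n) : R :=
  densV c' V p.1 * (densV c V p.2 * bell 1 s 0 (par0 c' p.1) (par0 c p.2)).

Let measurable_D c V : open V -> measurable (dom c `&` par c @^-1` V : set (borelV R n)).
Proof.
move=> oV; apply: (@measurable_parE _ _ _ _ c (dom c)) => //; try exact: measurable_dom.
exact: open_borel.
Qed.

Let measurable_dV c V : open V -> measurable_fun setT (densV c V).
Proof.
move=> oV; have mD := measurable_D c oV.
have mw : measurable_fun (dom c `&` par c @^-1` V : set (borelV R n)) (vdens c).
  by apply: (measurable_funS (measurable_dom c)) => //; exact: measurable_vdens.
have h := (measurable_restrictT (vdens c : borelV R n -> R) mD).1 mw.
exact: h.
Qed.

Let measurable_ker2 c c' V s : open V -> measurable_fun setT (ker2 c c' V s).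
Proof.
move=> oV; apply: measurable_funM.
  exact: (measurableT_comp (measurable_dV c' oV) measurable_fst).
apply: measurable_funM; first exact: (measurableT_comp (measurable_dV c oV) measurable_snd).
apply: measurableT_comp => //; apply: measurableT_comp => //.
apply: measurable_funM => //; apply: measurable_sqnorm; apply: measurable_rVD => //.
apply: measurable_rVN; apply: measurable_rVZ => //; apply: measurable_rVD.
  exact: (measurableT_comp (measurable_par0 c) measurable_snd).
apply: measurable_rVN; exact: (measurableT_comp (measurable_par0 c') measurable_fst).
Qed.

Let densV_ge0 c V u : 0 <= densV c V u.
Proof. by rewrite /densV; case: ifP => // _; exact: sqrtr_ge0. Qed.

Let ker2_ge0 c c' V s p : 0 <= ker2 c c' V s p.
Proof. by rewrite /ker2 mulr_ge0// mulr_ge0// expR_ge0. Qed.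

Let bell_sym s (x y : 'rV[R]_N) : bell 1 s 0 x y = bell 1 s 0 y x.
Proof. by rewrite /bell !sub0r !sqnormN !sqnormZ -[in LHS]sqnormN opprB. Qed.

Let inner_kernel c c' V s (u' : borelV R n) : \bar R := ((vdens c' u')%:E *
  \int[lam]_(u in dom c `&` par c @^-1` V)
    (vdens c u * bell 1 s 0 (par c' u') (par c u))%:E)%E.

Let ker2_int c c' V s u' : open V -> dom c' u' -> V (par c' u') ->
  (\int[lam]_u (ker2 c c' V s (u', u))%:E)%E = inner_kernel c c' V s u'.
Proof.
move=> oV cu' Vu'; rewrite /inner_kernel /ker2 /=.
have -> : densV c' V u' = vdens c' u'.
  by rewrite /densV (mem_set (_ : (dom c' `&` par c' @^-1` V) u')).
under [LHS]eq_integral do rewrite EFinM.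
rewrite (@ge0_integralZl _ _ _ lam setT measurableT (fun u => (densV c V u * bell 1 s 0 (par0 c' u') (par0 c u))%:E)); last 3 first.
- apply/measurable_EFinP; apply: measurable_funM; first exact: measurable_dV.
  by apply: measurable_bell; exact: measurable_par0.
- by move=> u _; rewrite lee_fin mulr_ge0// expR_ge0.
- by rewrite lee_fin sqrtr_ge0.
apply: (congr1 (mule _)); rewrite [RHS]integral_mkcond; apply: eq_integral => u _.
rewrite /patch /densV /par0 (mem_set cu'); case: ifPn => [|_]; last by rewrite mul0r.
by rewrite inE => -[cu _]; rewrite (mem_set cu).
Qed.

Let double_kernelE c c' V s : open V ->
  double_kernel c c' V s = (\int[lam]_u' \int[lam]_u (ker2 c c' V s (u', u))%:E)%E.
Proof.
move=> oV; rewrite /double_kernel [LHS]integral_mkcond; apply: eq_integral => u' _.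
rewrite /patch; case: ifPn => [|nu']; last first.
  rewrite integral0_eq// => u _; by rewrite /ker2 /densV /= (negPf nu') mul0r.
by rewrite inE => -[cu' Vu']; rewrite ker2_int.
Qed.

Lemma double_kernelC c c' V s : open V -> double_kernel c c' V s = double_kernel c' c V s.
Proof.
move=> oV; rewrite (double_kernelE c c' s oV) (double_kernelE c' c s oV).
have mk : measurable_fun setT (fun p => (ker2 c c' V s p)%:E).
  by apply/measurable_EFinP; exact: measurable_ker2.
have k0 p : (0 <= (ker2 c c' V s p)%:E)%E by rewrite lee_fin.
have h := @fubini_tonelli _ _ (borelV R n) (borelV R n) R lam lam _ mk k0.
apply: (etrans h).
have e x y : ker2 c c' V s (x, y) = ker2 c' c V s (y, x).
  rewrite /ker2 /= bell_sym; move: (densV c' V x) (densV c V y) (bell _ _ _ _ _) => p q b.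
  exact: mulrCA.
apply: eq_integral => u _; apply: eq_integral => u' _.
by rewrite e.
Qed.

(** The density of c inside the inner integral cancels the one produced by Laplace's method, so the
    rescaled inner integral tends to a constant that does not depend on c. The outer integral then
    leaves the volume in c'; exchanging the charts compares both volumes. *)
Lemma double_kernel_limit c c' V K K' : open V -> tame c V K -> tame c' V K' ->
  ((k.+1%:R^-1 ^+ n)^-1%:E * double_kernel c c' V k.+1%:R^-1 @[k --> \oo] -->
   (Num.sqrt (4 * pi) ^+ n)%:E * chart_volume c' V)%E.
Proof.
move=> oV tc tc'; have [K0 wK lipK _ Vc] := tc.
set E := dom c `&` par c @^-1` V; set E' := dom c' `&` par c' @^-1` V.
have mE : measurable (E : set (borelV R n)) by exact: measurable_D.
have mE' : measurable (E' : set (borelV R n)) by exact: measurable_D.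
have Ed : E `<=` dom c by move=> u [].
have mq : measurable_fun (E : set (borelV R n)) (vdens c).
  by apply: (measurable_funS (measurable_dom c)) => //; exact: measurable_vdens.
have q0 u : E u -> 0 <= vdens c u by move=> _; exact: sqrtr_ge0.
have qW u : E u -> vdens c u <= K by move=> [cu Vu]; exact: wK.
have lipE u u' : E u -> E u' -> `|u - u'| <= K * `|par c u - par c u'|.
  by move=> [cu Vu] [cu' Vu']; exact: lipK.
have [C C0 bC] := laplace_bound Ed mE mq q0 qW K0 (ltW K0) lipE.
pose s_ (k : nat) : R := k.+1%:R^-1.
have s0 k : 0 < s_ k by rewrite invr_gt0.
(* The last clause of [tame] makes every point of V seen by c' a point of c, so that it can serve as
   a Laplace centre there. *)
have inE' u' : E' u' -> exists2 u, E u & par c u = par c' u'.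
  move=> [cu' Vu']; have [Su' _] := chart_parS cu'.
  have [cu e] := chart_coordK Su' (Vc _ Su' Vu').
  by exists (chart_coord c (par c' u')) => //; split=> //=; rewrite e.
pose G k (u' : borelV R n) : \bar R := ((s_ k ^+ n)^-1%:E *
  \int[lam]_(u in E) (vdens c u * bell 1 (s_ k) 0 (par c' u') (par c u))%:E)%E.
have one2 : 1 / 2 <= 1 :> R by rewrite ler_pdivrMr// mul1r ler1n.
have GC k u' : E' u' -> (G k u' <= C%:E)%E.
  move=> /inE'[u Eu e]; have := bC 1 (s_ k) 0 u Eu (s0 k) one2.
  by rewrite e /sqnorm dot0l mul0r expR0 mul1r.
have G0 k u' : (0 <= G k u')%E.
  apply: mule_ge0; first by rewrite lee_fin invr_ge0 exprn_ge0// ltW.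
  apply: integral_ge0 => u _.
  by rewrite lee_fin mulr_ge0 ?sqrtr_ge0 ?expR_ge0.
have Glim u' : E' u' -> G k u' @[k --> \oo] --> (Num.sqrt (4 * pi) ^+ n : R)%:E.
  move=> /inE'[u Eu e].
  have nE : nbhs u E.
    apply: filterI; first by apply: open_nbhs_nbhs; split; [exact: chart_dom_open|exact: Ed].
    by apply: (continuous_par (Ed _ Eu)); apply: open_nbhs_nbhs; split=> //; case: Eu.
  have cq : {for u, continuous (vdens c)} := (C1_vdens (Ed _ Eu)).1.
  have c1 : (fun _ : nat => 1 : R) @ \oo --> (1 : R) by exact: cvg_cst.
  have h := @laplace_limit R n N S c E (vdens c) K K Ed mE mq q0 qW K0 (ltW K0) lipE u 0
    (fun=> 1) s_ Eu nE cq s0 (@cvg_harmonic R) (fun=> one2) c1.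
  have w0 : vdens c u != 0 by rewrite gt_eqF// vdens_gt0//; exact: Ed.
  have vE : vdens c u * (Num.sqrt (4 * pi) ^+ n / vdens c u *
    expR (- (sqnorm (0 *m nproj n S (par c u)) / 4))) = Num.sqrt (4 * pi) ^+ n.
    by rewrite mul0mx /sqnorm dot0l mul0r oppr0 expR0 mulr1 mulrC divfK.
  apply: (eq_ind _ (fun l : R => G k u' @[k --> \oo] --> l%:E) _ _ vE).
  by rewrite /G -e.
have mH k : measurable_fun (E' : set (borelV R n)) (inner_kernel c c' V (s_ k)).
  have mk : measurable_fun setT (fun p => (ker2 c c' V (s_ k) p)%:E).
    by apply/measurable_EFinP; exact: measurable_ker2.
  have h : measurable_fun setT (fun u' : borelV R n => (\int[lam]_u (ker2 c c' V (s_ k) (u', u))%:E)%E).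
    apply: (@measurable_fun_fubini_tonelli_F _ _ (borelV R n) (borelV R n) R lam _ mk).
    by move=> p; rewrite lee_fin.
  have := @measurable_funTS _ _ _ _ (E' : set (borelV R n)) _ h.
  by apply: eq_measurable_fun => u'; rewrite inE => -[cu' Vu']; rewrite ker2_int.
pose Gw k (u' : borelV R n) : \bar R := ((s_ k ^+ n)^-1%:E * inner_kernel c c' V (s_ k) u')%E.
have GwE k u' : Gw k u' = ((vdens c' u')%:E * G k u')%E by rewrite /Gw /inner_kernel muleCA.
have H0 k u' : (0 <= inner_kernel c c' V (s_ k) u')%E.
  apply: mule_ge0; first by rewrite lee_fin sqrtr_ge0.
  apply: integral_ge0 => u _.
  by rewrite lee_fin mulr_ge0 ?sqrtr_ge0 ?expR_ge0.
have mGw k : measurable_fun (E' : set (borelV R n)) (Gw k) by exact: measurable_funeM.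
have [K'0 wK' _ [u1 [r1 hr1]] _] := tc'.
have lE' : (lam E' < +oo)%E.
  apply: (le_lt_trans _ (lebesgue_ball_lty u1 r1)); apply: le_measure.
  - by rewrite inE.
  - rewrite inE; have -> : [set u | `|u - u1| < r1] = ball u1 r1.
      by apply/seteqP; split=> u /=; rewrite -ball_normE/= distrC.
    by apply: open_borel; exact: ball_open.
  - by move=> u [du Vu] /=; exact: hr1.
have iC : lam.-integrable E' (EFin \o cst (K' * C)).
  apply/integrableP; split; first by apply/measurable_EFinP; exact: measurable_cst.
  rewrite (_ : (\int[lam]_(x in E') _)%E = (\int[lam]_(x in E') (cst (`|K' * C|)%:E x))%E)//.
  by rewrite integral_cst// lte_mul_pinfty// lee_fin.
have mw' : measurable_fun (E' : set (borelV R n)) (fun u' => (vdens c' u')%:E * (Num.sqrt (4 * pi) ^+ n)%:E)%E.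
  apply: emeasurable_funM => //; apply/measurable_EFinP.
  exact: (measurable_funS (measurable_dom c') (@subIsetl _ _ _) (@measurable_vdens _ _ _ _ c')).
have cvgw u' : E' u' -> Gw k u' @[k --> \oo] --> ((vdens c' u')%:E * (Num.sqrt (4 * pi) ^+ n)%:E)%E.
  move=> Eu'; under eq_fun do rewrite GwE.
  by apply: cvgeZl => //; exact: Glim.
have bw u' k : E' u' -> (`|Gw k u'| <= (K' * C)%:E)%E.
  move=> Eu'; rewrite gee0_abs; last by rewrite GwE mule_ge0// lee_fin sqrtr_ge0.
  rewrite GwE EFinM; apply: lee_pmul => //; rewrite ?lee_fin ?sqrtr_ge0//.
    by apply: wK'; case: Eu'.
  exact: GC.
have [_ _ h] := @dominated_convergence _ (borelV R n) R lam E' mE' Gw _ _ mGw mw'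
  (aeW lam (fun (v : borelV R n) => cvgw v)) iC
  (aeW lam (fun (v : borelV R n) k => @bw v k)).
have E1 k : (\int[lam]_(u' in E') Gw k u' = (s_ k ^+ n)^-1%:E * double_kernel c c' V (s_ k))%E.
  rewrite (@ge0_integralZl _ _ _ lam E' mE' _ (mH k))//.
  by rewrite lee_fin invr_ge0 exprn_ge0// ltW.
have E2 : (\int[lam]_(u' in E') ((vdens c' u')%:E * (Num.sqrt (4 * pi) ^+ n)%:E) =
    (Num.sqrt (4 * pi) ^+ n)%:E * chart_volume c' V)%E.
  rewrite muleC (@ge0_integralZr _ _ _ lam E' mE' (fun u' => (vdens c' u')%:E))//.
  - apply/measurable_EFinP.
    exact: (measurable_funS (measurable_dom c') (@subIsetl _ _ _) (@measurable_vdens _ _ _ _ c')).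
  - by move=> u _; rewrite lee_fin sqrtr_ge0.
rewrite -E2; apply: cvg_trans h; apply: near_eq_cvg; apply: nearW => k /=.
by rewrite -E1.
Qed.

Lemma tame_volume_eq c c' V K K' : open V -> tame c V K -> tame c' V K' ->
  chart_volume c V = chart_volume c' V.
Proof.
move=> oV tc tc'.
have p0 : (0 < Num.sqrt (4 * pi) ^+ n :> R) by rewrite exprn_gt0// sqrtr_gt0 mulr_gt0// pi_gt0.
have h1 := double_kernel_limit oV tc tc'; have h2 := double_kernel_limit oV tc' tc.
have E : (fun k => ((k.+1%:R^-1 ^+ n)^-1%:E * double_kernel c c' V k.+1%:R^-1)%E) =
    (fun k => ((k.+1%:R^-1 ^+ n)^-1%:E * double_kernel c' c V k.+1%:R^-1)%E).
  by apply/funext => k; rewrite double_kernelC.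
rewrite E in h1.
have e : ((Num.sqrt (4 * pi) ^+ n)%:E * chart_volume c' V =
    (Num.sqrt (4 * pi) ^+ n)%:E * chart_volume c V)%E by exact: (cvg_unique _ h1 h2).
move: e.
have fv := tame_volume_fin oV tc; have fv' := tame_volume_fin oV tc'.
by move=> h; rewrite (mule_fin_inj (lt0r_neq0 p0) fv' fv h).
Qed.

End small_volume.

Section volume_consistency.
Context {R : realType} (n N : nat) (S : set 'rV[R]_N).
Implicit Types (c : chart n S).
Local Notation dom := chart_dom.
Local Notation par := chart_par.
Local Notation nbd := chart_nbd.
Local Notation lam := (lebesgue_rV n).
Local Notation vol := (riemannian_volume n S).

Lemma setT_bigcup_cst (T : Type) : \bigcup_(_ : nat) [set: T] = [set: T].
Proof. by apply/seteqP; split=> // x _; exists 0%N. Qed.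

Lemma chart_volume_set0 c : chart_volume c set0 = 0%E.
Proof. by rewrite /chart_volume preimage_set0 setI0 integral_set0. Qed.

(** On open subsets of a small ball both charts are tame and have the same finite volume. Open sets
    are stable under intersection and generate the Borel sets, so the two measures coincide. *)
Lemma chart_volume_eq_near c c' x0 : S x0 -> nbd c x0 -> nbd c' x0 -> exists2 rho, 0 < rho &
  forall A : set (borelV R N), measurable A -> A `<=` ball x0 rho ->
  chart_volume c A = chart_volume c' A.
Proof.
move=> Sx cx cx'; have [r [K [r0 h]]] := tame_near Sx cx.
have [r' [K' [r'0 h']]] := tame_near Sx cx'.
exists (Num.min r r'); first by rewrite lt_min r0.
pose V := ball x0 (Num.min r r').
have oV : open V by exact: ball_open.
have mV : measurable (V : set (borelV R N)) by exact: open_borel.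
have tV W : W `<=` V -> tame c W K /\ tame c' W K'.
  move=> WV; split; [apply: h|apply: h'] => x _ /WV /ball_rVE; rewrite lt_min distrC.
    by move=> /andP[].
  by move=> /andP[].
pose m1 := mrestr (chart_measure c) mV; pose m2 := mrestr (chart_measure c') mV.
have E A : measurable A -> m1 A = m2 A.
  apply: (@measure_unique _ R (borelV R N) (@open 'rV[R]_N) (fun=> setT) erefl
    (@openI _) (fun=> openT) (@setT_bigcup_cst _)).
  - move=> B oB; rewrite /m1 /m2 /mrestr.
    have mBV : measurable (B `&` V : set (borelV R N)) by apply: open_borel; exact: openI.
    have [t t'] := tV (B `&` V) (@subIsetr _ _ _).
    rewrite [LHS](chart_measureE c mBV) [RHS](chart_measureE c' mBV).
    by apply: (tame_volume_eq _ t t'); exact: openI.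
  - move=> _; change (chart_measure c (setT `&` V) < +oo)%E.
    rewrite setTI (chart_measureE c mV).
    by have [t _] := tV V (@subset_refl _ _); exact: (tame_volume_lty oV t).
move=> A mA AV; have := E A mA; rewrite /m1 /m2 /mrestr (setIidl AV).
by rewrite [LHS](chart_measureE c mA) [RHS](chart_measureE c' mA).
Qed.

Definition rat_cube (p : 'rV[rat]_N * rat) : set 'rV[R]_N :=
  [set x | forall i, `|x 0 i - ratr (p.1 0 i)| < ratr p.2].

Lemma measurable_rat_cube p : measurable (rat_cube p : set (borelV R N)).
Proof.
have -> : rat_cube p = \bigcap_(i : 'I_N) ((fun x : borelV R N => (x : 'rV_N) 0 i) @^-1`
    `](ratr (p.1 0 i) - ratr p.2), (ratr (p.1 0 i) + ratr p.2)[).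
  apply/seteqP; split=> x h i.
    by move=> _ /=; rewrite in_itv/= -ltr_distl; exact: h.
  by have := h i I; rewrite /= in_itv/= -ltr_distl.
apply: fin_bigcap_measurable => // i _; rewrite -[X in measurable X]setTI.
by apply: measurable_coord => //; exact: measurable_itv.
Qed.

Lemma rat_cube_in_ball (x : 'rV[R]_N) (e : R) : 0 < e ->
  exists p, rat_cube p x /\ rat_cube p `<=` ball x e.
Proof.
move=> e0; have [r] := @rat_in_itvoo R 0 (e / 2) (divr_gt0 e0 (ltr0Sn _ 1)).
rewrite in_itv/= => /andP[r0 re].
have /all_sig[q qP] (i : 'I_N) : {q : rat | `|x 0 i - ratr q| < ratr r}.
  apply: cid; have [|q] := @rat_in_itvoo R (x 0 i - ratr r) (x 0 i + ratr r).
    by rewrite ltrD2l (lt_trans _ r0)// oppr_lt0.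
  by rewrite in_itv/= => h; exists q; rewrite ltr_distlC.
exists (\row_i q i, r); split=> [i|y /= cy]; first by rewrite mxE.
apply/ball_rVE; apply: norm_lt_coord => // j; rewrite !mxE.
have := cy j; rewrite mxE => {}cy.
rewrite [ltRHS]splitr (le_lt_trans (ler_distD (ratr (q j)) _ _))//.
by rewrite ltrD ?(lt_trans (qP _) re)// distrC (lt_trans cy re).
Qed.

(** The local equality is globalized by countably many rational cubes, made disjoint so that
    countable additivity applies. *)
Lemma chart_volume_eq c c' (A : set (borelV R N)) : measurable A ->
  A `<=` nbd c `&` nbd c' -> chart_volume c A = chart_volume c' A.
Proof.
move=> mA Acc.
pose good (p : 'rV[rat]_N * rat) := forall B : set (borelV R N), measurable B ->
  B `<=` rat_cube p -> chart_volume c B = chart_volume c' B.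
(* Cubes on which the charts do not agree are replaced by the empty set. The others still cover the
   part of [A] in S, which is all that chart volumes see. *)
pose F (j : nat) : set (borelV R N) :=
  if unpickle j is Some p then if `[<good p>] then rat_cube p else set0 else set0.
have mF j : measurable (F j).
  by rewrite /F; case: unpickle => // p; case: asboolP => // _; exact: measurable_rat_cube.
have FA x : S x -> A x -> (\bigcup_j F j) x.
  move=> Sx Ax; have [cx cx'] := Acc x Ax.
  have [rho rho0 h] := chart_volume_eq_near Sx cx cx'.
  have [p [px pb]] := rat_cube_in_ball x rho0.
  have gp : good p by move=> B mB Bp; exact: h _ mB (subset_trans Bp pb).
  by exists (pickle p); first by []; rewrite /F pickleK (asboolT gp).
have FE j (B : set (borelV R N)) : measurable B -> B `<=` F j -> chart_volume c B = chart_volume c' B.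
  rewrite /F => mB; case: unpickle => [p|]; last first.
    by rewrite subset0 => ->; rewrite (chart_volume_set0 c) (chart_volume_set0 c').
  case: asboolP => [gp|_]; first exact: gp.
  by rewrite subset0 => ->; rewrite (chart_volume_set0 c) (chart_volume_set0 c').
pose D j := A `&` seqDU F j.
have mD j : measurable (D j) by apply: measurableI => //; exact: seqDU_measurable.
have tD : trivIset setT D.
  by apply: (trivIset_setIl); exact: trivIset_seqDU.
have AE (d : chart n S) : chart_volume d A = chart_volume d (\bigcup_j D j).
  rewrite /chart_volume; congr (integral _ _ _); rewrite /D -setI_bigcupr -seqDU_bigcup_eq.
  apply/seteqP; split=> u [cu Au]; split=> //; last by case: Au.
  by split=> //; apply: FA => //; have [] := chart_parS cu.
have mUD : measurable (\bigcup_j D j) by exact: bigcupT_measurable.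
rewrite (AE c) (AE c') -(chart_measureE c mUD) -(chart_measureE c' mUD).
rewrite [LHS](measure_semi_bigcup (chart_measure c) mD tD mUD).
rewrite [RHS](measure_semi_bigcup (chart_measure c') mD tD mUD).
apply: eq_eseriesr => j _.
rewrite [LHS](chart_measureE c (mD j)) [RHS](chart_measureE c' (mD j)).
by apply: (FE j) => //; move=> x [_ [Fx _]].
Qed.

(** Whatever charts measure the pieces of a finite family, each piece may be measured in [c]
    instead. Hence no sum exceeds the volume in [c], and the family with one piece attains it. *)
Lemma riemannian_volumeE c (B : set (borelV R N)) : measurable B -> B `<=` nbd c ->
  vol B = chart_volume c B.
Proof.
move=> mB Bc; apply/eqP; rewrite eq_le; apply/andP; split.
  apply: ge_ereal_sup => _ [I [d [A [mA tA AB ->]]]].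
  have mN (b : chart n S) : measurable (nbd b : set (borelV R N)).
    by apply: open_borel; exact: chart_nbd_open.
  apply: (@le_trans _ _ (\sum_i chart_measure c (A i))%E).
    apply: lee_sum => i _; rewrite (chart_volumeI (d i)) (chart_measureE c (mA i)).
    have mAd : measurable (A i `&` nbd (d i)) by exact: measurableI.
    rewrite (@chart_volume_eq (d i) c _ mAd).
      by apply: le_chart_volume => //; exact: subIsetl.
    by move=> x [Ax dx]; split=> //; apply: Bc; exact: (AB i).
  rewrite fsbig_seq ?index_enum_uniq//= -measure_fin_bigcup//=.
  - have mU : measurable (\bigcup_(i in [set` index_enum I]) A i).
      by apply: fin_bigcup_measurable.
    rewrite chart_measureE//; apply: le_chart_volume => //.
    by move=> x [i _ Aix]; exact: (AB i).
  - by apply: sub_trivIset tA.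
apply: ereal_sup_ubound; exists 'I_1, (fun=> c), (fun=> B); split=> //.
- by apply/trivIsetP => i j _ _; rewrite !ord1 eqxx.
- by move=> _.
- by rewrite big_ord1.
Qed.

Lemma ge0_integral_volume c (B : set (borelV R N)) (f : 'rV[R]_N -> \bar R) :
  measurable B -> B `<=` nbd c -> measurable_fun B f -> (forall y, B y -> 0 <= f y)%E ->
  (\int[vol]_(y in B) f y =
   \int[lam]_(u in dom c `&` par c @^-1` B) (f (par c u) * (vdens c u)%:E))%E.
Proof.
move=> mB Bc mf f0; apply: ge0_integral_chart => // A mA AB.
by apply: riemannian_volumeE => //; exact: subset_trans AB Bc.
Qed.

(** * Bounds that are uniform on a compact submanifold *)

Section compact_surface.
Hypotheses (sS : is_submanifold n S) (cS : compact S).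

Lemma measurable_surface : measurable (S : set (borelV R N)).
Proof. by apply: closed_borel; apply: compact_closed. Qed.

Lemma surface_cover (Q : R -> 'rV[R]_N -> Prop) :
  (forall k k' x, 0 < k' -> k' <= k -> Q k x -> Q k' x) ->
  (forall x, S x -> exists rho k, [/\ 0 < rho, 0 < k & forall y, S y -> `|y - x| < rho -> Q k y]) ->
  exists2 k, 0 < k & forall y, S y -> Q k y.
Proof.
move=> mQ hQ.
have {}hQ x : exists rk : R * R, S x -> [/\ 0 < rk.1, 0 < rk.2 &
    forall y, S y -> `|y - x| < rk.1 -> Q rk.2 y].
  by have [/hQ[r [k h]]|nx] := pselect (S x); [exists (r, k)|exists (0, 0)].
have [rk rkP] := choice hQ.
have [x /rkP[]//|s [sS' sP]] := finite_ball_cover (rho := fst \o rk) cS.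
have [k k0 kP] : exists2 k, 0 < k & forall x, x \in s -> k <= (rk x).2.
  elim: s sS' {sP} => [|x s ih] sS'; first by exists 1.
  have [|k k0 kP] := ih; first by move=> y ys; apply: sS'; rewrite inE ys orbT.
  have [_ x0 _] := rkP x (sS' x (mem_head _ _)).
  exists (Num.min k (rk x).2); first by rewrite lt_min k0.
  move=> y; rewrite inE => /orP[/eqP ->|/kP ky]; first by rewrite ge_min lexx orbT.
  by rewrite ge_min ky.
exists k => // y Sy; have [x xs yx] := sP y Sy.
have [_ _ h] := rkP x (sS' x xs).
by apply: (mQ (rk x).2); [|exact: kP|exact: h].
Qed.

(** By scaling, everything reduces to the unit ball. If its measure were 0, so would be that of the
    whole space, against the positive Gaussian integral. *)
Lemma ball_volume : exists2 b : R, 0 < b & forall (u : 'rV[R]_n) (t : R), 0 < t ->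
  ((t ^+ n * b)%:E <= lam (ball u t : set (borelV R n)))%E.
Proof.
have mB u t : measurable (ball u t : set (borelV R n)).
  by apply: open_borel; exact: ball_open.
pose L := lam (ball (0 : 'rV[R]_n) 1 : set (borelV R n)).
have scale (u : 'rV[R]_n) t : 0 < t -> (lam (ball u t : set (borelV R n)) = (t ^+ n)%:E * L)%E.
  move=> t0; have mi : measurable_fun setT (fun v : borelV R n => (\1_(ball u t : set (borelV R n)) v : R)%:E).
    by apply/measurable_EFinP; exact: measurable_indic.
  have i0 (v : 'rV[R]_n) : (0 <= (\1_(ball u t : set (borelV R n)) v : R)%:E)%E by rewrite lee_fin.
  have h := @ge0_integral_affine R n (fun v => (\1_(ball u t : set (borelV R n)) v : R)%:E) u t t0 mi i0.
  have e1 : (\int[lam]_v (\1_(ball u t : set (borelV R n)) v : R)%:E = lam (ball u t : set (borelV R n)))%E.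
    by rewrite integral_indic// setIT.
  have e2 : (\int[lam]_v (\1_(ball u t : set (borelV R n)) (u + t *: v)%R : R)%:E = L)%E.
    rewrite /L -[X in lam X]setIT -integral_indic//; apply: eq_integral => v _.
    rewrite !indicE; congr (_%:R%:E); congr nat_of_bool; apply/idP/idP; rewrite !inE => /ball_rVE H; apply/ball_rVE.
      by move: H; rewrite opprD addrA subrr add0r normrN normrZ gtr0_norm// -ltr_pdivlMl// mulVf ?gt_eqF// sub0r normrN.
    by move: H; rewrite sub0r normrN opprD addrA subrr add0r normrN normrZ gtr0_norm// -ltr_pdivlMl// mulVf ?gt_eqF.
  rewrite e2 e1 in h; rewrite h muleA -EFinM mulfV ?mul1e// gt_eqF// exprn_gt0//.
have L0 : (0 < L)%E.
  rewrite lt0e measure_ge0 andbT; apply/eqP => L0.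
  have lamT : lam (setT : set (borelV R n)) = 0%E.
    have -> : (setT : set (borelV R n)) = \bigcup_k (ball (0 : 'rV[R]_n) k.+1%:R : set (borelV R n)).
      apply/seteqP; split=> // v _.
      exists (Num.truncn `|v : 'rV_n|) => //; apply/ball_rVE; rewrite sub0r normrN.
      exact: truncnS_gt.
    apply/eqP; rewrite -measure_le0; apply: (le_trans (measure_sigma_subadditive lam _ _ (@subset_refl _ _))) => //.
      by apply: bigcupT_measurable.
    have e (k : nat) : lam (ball (0 : 'rV[R]_n) k.+1%:R : set (borelV R n)) = 0%E.
      by rewrite scale// L0 mule0.
    by rewrite eseries0// => k _ _; exact: e.
  have [I I0 IE] := integral_gauss_scalar n (ltr01 : 0 < 1 :> R).
  have : (\int[lam]_v (expR (- (1 * sqnorm (v : 'rV[R]_n) / 4)))%:E = 0)%E.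
    apply: null_set_integral => //.
    apply/measurable_EFinP; apply: measurableT_comp => //; apply: measurableT_comp => //.
    by apply: measurable_funM => //; apply: measurable_funM => //; exact: measurable_sqnorm.
  by rewrite IE => -[] /eqP; rewrite gt_eqF.
have Lfin : (L < +oo)%E.
  have := lebesgue_ball_lty (0 : 'rV[R]_n) 1; congr (lam _ < +oo)%E.
  by apply/seteqP; split=> v /=; rewrite -ball_normE/= distrC.
exists (fine L) => [|u t t0]; first by rewrite fine_gt0// L0.
by rewrite scale// EFinM fineK// ge0_fin_numE ?measure_ge0// ltW.
Qed.

Lemma surface_volume_lty : (vol S < +oo)%E.
Proof.
have mS := measurable_surface.
have hQ x : exists r : R, S x -> 0 < r /\ exists B : set (borelV R N),
    [/\ measurable B, (forall y, S y -> `|y - x| < r -> B y) & (vol B < +oo)%E].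
  have [Sx|nx] := pselect (S x); last by exists 0.
  have [c cx] := sS Sx; have [r [K [r0 h]]] := tame_near Sx cx.
  pose V := ball x r `&` nbd c.
  have oV : open V by apply: openI; [exact: ball_open|exact: chart_nbd_open].
  have tV : tame c V K.
    by apply: h => y _ [/ball_rVE yx _]; rewrite distrC.
  exists r => _; split=> //; exists V.
  have mV : measurable (V : set (borelV R N)) by exact: open_borel.
  split=> //.
    move=> y Sy yx; have [_ _ _ _ hV] : tame c (ball x r) K.
      by apply: h => z _ /ball_rVE; rewrite distrC.
    have By : ball x r y by apply/ball_rVE; rewrite distrC.
    by split=> //; exact: hV.
  rewrite (riemannian_volumeE mV (@subIsetr _ _ _)).
  exact: tame_volume_lty oV tV.
have [rho rhoP] := choice hQ.
have [x Sx|s [sS' sP]] := finite_ball_cover (rho := rho) cS; first by have [] := rhoP x Sx.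
have [B [mB SB Boo]] : exists B : set (borelV R N), [/\ measurable B,
    (forall y, S y -> (exists2 x, x \in s & `|y - x| < rho x) -> B y) & (vol B < +oo)%E].
  elim: s sS' {sP} => [|x s ih] sS'.
    by exists set0; split=> //; [move=> y _ []|rewrite measure0].
  have [|B [mB SB Boo]] := ih; first by move=> y ys; apply: sS'; rewrite inE ys orbT.
  have [_ [C [mC SC Coo]]] := rhoP x (sS' x (mem_head _ _)).
  exists (C `|` B); split; first exact: measurableU.
    move=> y Sy [z]; rewrite inE => /orP[/eqP -> yz|zs yz]; first by left; exact: SC.
    by right; apply: SB => //; exists z.
  by apply: (le_lt_trans (measureU2 _ mC mB)); rewrite lte_add_pinfty.
apply: (le_lt_trans _ Boo); apply: le_measure; rewrite ?inE// => y Sy.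
by apply: SB => //; exact: sP.
Qed.

(** This gives a lower bound of the mixtures uniform in the base point and in s, hence the minorant
    in Fatou's lemma. The integral is restricted to the chart image of a ball of radius proportional
    to s, and compactness makes the constant uniform. *)
Lemma lower_volume : exists2 k : R, 0 < k & forall y, S y -> forall s : R, 0 < s -> s <= 1 ->
  ((k * s ^+ n)%:E <= \int[vol]_(x in S) (expR (- (sqnorm ((x : 'rV_N) - y) / (2 * s ^+ 2))))%:E)%E.
Proof.
have mS := measurable_surface; have [b b0 hb] := ball_volume.
apply: surface_cover => [k k' x k'0 kk' h s s0 s1|x Sx].
  by apply: le_trans (h s s0 s1); rewrite lee_fin ler_wpM2r// exprn_ge0// ltW.
have [c cx] := sS Sx; have [cu0 E0] := chart_coordK Sx cx.
set u0 := chart_coord c x in cu0 E0.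
have [eps [K [eps0 K0 h1 h2]]] := chart_bilipschitz cu0.
have eps2 : 0 < eps / 2 by rewrite divr_gt0.
have [rho rho0 hr] := chart_near Sx cx eps2.
(* A coordinate ball of radius a s about a centre within eps / 2 of [u0] stays in the domain of the
   Lipschitz bounds. There |x - y| <= K s, so the integrand is at least [q]: the exponent is at
   least - N K^2 / 2 and the density at least 1 / K. *)
pose a := Num.min 1 (eps / 2).
have a0 : 0 < a by rewrite lt_min ltr01.
pose q := expR (- (N%:R * K ^+ 2 / 2)) * K^-1.
have q0 : 0 < q by rewrite mulr_gt0 ?expR_gt0// invr_gt0.
exists rho, (q * (a ^+ n * b)); split=> //.
  by apply: mulr_gt0 => //; apply: mulr_gt0 => //; exact: exprn_gt0.
move=> y Sy yx s s0 s1.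
have [cy uy] := hr y Sy yx; have [cu E] := chart_coordK Sy cy.
set u := chart_coord c y in cu E uy.
have mN : measurable (nbd c : set (borelV R N)) by apply: open_borel; exact: chart_nbd_open.
have mB : measurable (S `&` nbd c : set (borelV R N)) by exact: measurableI.
pose f (z : borelV R N) : \bar R := (expR (- (sqnorm ((z : 'rV_N) - y) / (2 * s ^+ 2))))%:E.
have mf : measurable_fun setT f.
  apply/measurable_EFinP; apply: measurableT_comp => //; apply: measurableT_comp => //.
  by apply: measurable_funM => //; apply: measurable_sqnorm; apply: measurable_rVD.
have f0 z : (0 <= f z)%E by rewrite lee_fin expR_ge0.
have as0 : 0 < a * s by rewrite mulr_gt0.
have le1 : a * s <= a by rewrite ger_pMr.
have in_eps v : `|v - u| < a * s -> `|v - u0| < eps.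
  move=> vu; rewrite (le_lt_trans (ler_distD u _ _))// [ltRHS]splitr ltrD//.
  by rewrite (lt_le_trans vu)// (le_trans le1)// ge_min lexx orbT.
have D0 : dom c `&` par c @^-1` (S `&` nbd c) = dom c.
  by apply/seteqP; split=> v; [case|move=> cv; split=> //=; exact: chart_parS].
have mball : measurable (ball u (a * s) : set (borelV R n)) by apply: open_borel; exact: ball_open.
apply: (@le_trans _ _ (\int[vol]_(z in S `&` nbd c) f z)%E); last first.
  by apply: ge0_subset_integral => //; exact: measurable_funTS.
rewrite (@ge0_integral_volume c _ f mB (@subIsetr _ _ _) (measurable_funTS mf) (fun z _ => f0 z)) D0.
have mg : measurable_fun (dom c : set (borelV R n)) (fun v => (f (par c v) * (vdens c v)%:E)%E).
  apply: emeasurable_funM; last by apply/measurable_EFinP; exact: measurable_vdens.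
  apply: (measurableT_comp mf); apply: (@measurable_parE _ _ _ _ c (dom c)) => //.
  exact: measurable_dom.
have bd : ball u (a * s) `<=` dom c.
  move=> v /ball_rVE; rewrite distrC => vu; exact: (h1 v (in_eps v vu)).1.
apply: (@le_trans _ _ (\int[lam]_(v in ball u (a * s)) (f (par c v) * (vdens c v)%:E))%E); last first.
  apply: ge0_subset_integral => //; first exact: measurable_dom.
  by move=> v _; rewrite mule_ge0// lee_fin sqrtr_ge0.
apply: (@le_trans _ _ (\int[lam]_(v in ball u (a * s)) q%:E)%E).
  rewrite integral_cst//.
  apply: (@le_trans _ _ (q%:E * ((a * s) ^+ n * b)%:E)%E).
    by rewrite -EFinM lee_fin exprMn -!mulrA [b * _]mulrC.
  by apply: lee_pmul => //; rewrite ?lee_fin ?(ltW q0)// ?mulr_ge0 ?exprn_ge0 ?(ltW as0) ?(ltW b0)//; exact: hb.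
apply: ge0_le_integral => //.
- by move=> v _; rewrite lee_fin ltW.
- by apply: (measurable_funS (measurable_dom c)).
move=> v /ball_rVE; rewrite distrC => vu.
have [cv /andP[wv _]] := h1 v (in_eps v vu).
rewrite /f -EFinM lee_fin /q ler_pM ?expR_ge0 ?invr_ge0 ?(ltW K0)//.
rewrite ler_expR lerN2.
have [|_ hL] := h2 v u (in_eps v vu); first by rewrite (lt_trans uy)// ltr_pdivrMr// ltr_pMr// ltr1n.
rewrite E in hL.
have hs : `|par c v - y| <= K * s.
  apply: (le_trans hL); rewrite ler_pM2l// (le_trans (ltW vu))// ger_pMl// ge_min lexx//.
have h5 : sqnorm (par c v - y) <= N%:R * (K * s) ^+ 2.
  apply: (le_trans (sqnorm_le_norm _)); rewrite ler_wpM2l//.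
  by rewrite ler_sqr ?nnegrE// mulr_ge0 ?ltW.
have ss0 : 0 < s ^+ 2 by rewrite exprn_gt0.
rewrite ler_pdivrMr ?mulr_gt0//; apply: (le_trans h5).
by rewrite exprMn mulrA; rewrite [leRHS]mulrA divfK.
Qed.

End compact_surface.
End volume_consistency.

(** * The divergence theorem *)

Section chart_divergence.
Context {R : realType} (n N : nat) (S : set 'rV[R]_N).
Implicit Types (c : chart n S).
Local Notation dom := chart_dom.
Local Notation par := chart_par.
Local Notation e i := (delta_mx 0 i : 'rV[R]_n).
Local Notation P c u := (partial_mx (chart_par c) u).
Local Notation B c u := (dual_mx (partial_mx (chart_par c) u)).

Let dP c u l k j := 'D_(e l) (fun v => P c v k j) u.
Let dB c u l i j := 'D_(e l) (fun v => B c v i j) u.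

Let dPE c u l k j : dom c u -> is_derive u (e l) (fun v => P c v k j) (dP c u l k j).
Proof.
move=> cu; apply: C1_on_is_derive cu; apply: C1_on_partial.
  exact: chart_dom_open.
exact: chart_smooth.
Qed.

Let dBE c u l i j : dom c u -> is_derive u (e l) (fun v => B c v i j) (dB c u l i j).
Proof. by move=> cu; exact: C1_on_is_derive (@C1_dual _ _ _ _ c i j) cu. Qed.

Lemma partial_sym c u l k j : dom c u -> dP c u l k j = dP c u k l j.
Proof.
move=> cu; have oD := @chart_dom_open _ _ _ _ c; have sm := @chart_smooth _ _ _ _ c.
have cp := smooth_on_coord j oD sm.
have PE i v : dom c v -> P c v i j = 'D_(e i) (fun v => par c v 0 j) v.
  by move=> cv; rewrite mxE derive_coord//; exact: (sm [::] v cv).2.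
have cD i : C1_on (dom c) ('D_(e i) (fun v => par c v 0 j)).
  by apply: (C1_on_eq oD (PE i)); exact: C1_on_partial.
have dPD i m : dP c u m i j = 'D_(e m) ('D_(e i) (fun v => par c v 0 j)) u.
  apply: near_eq_derive; have : nbhs u (dom c) by exact: open_nbhs_nbhs.
  by apply: filterS => v cv; exact: PE.
by rewrite !dPD (derive_comm oD cp (cD k) (cD l) cu).
Qed.

Let dual_orth c u l i k : dom c u ->
  \sum_j (B c u i j * dP c u l k j + P c u k j * dB c u l i j) = 0.
Proof.
move=> cu; have oD := @chart_dom_open _ _ _ _ c.
have h : is_derive u (e l) (fun v => \sum_j B c v i j * P c v k j)
    (\sum_j (B c u i j * dP c u l k j + P c u k j * dB c u l i j)).
  by apply: is_derive_bigsum => j; exact: is_deriveM (dBE l i j cu) (dPE l k j cu).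
have h0 : is_derive u (e l) (fun v => \sum_j B c v i j * P c v k j) 0.
  apply: (near_eq_is_derive _ (is_derive_cst ((1%:M : 'M[R]_n) i k) u (e l))).
  have : nbhs u (dom c) by exact: open_nbhs_nbhs.
  apply: filterS => v cv; have := dual_mulmx (@chart_immersion _ _ _ _ c v cv).
  move/matrixP/(_ i k) => <-; rewrite mxE; apply: eq_bigr => j _.
  by rewrite [(P c v)^T j k]mxE.
by have [_ <-] := h; have [_ ->] := h0.
Qed.

(** Jacobi's formula for the Gram determinant: the two halves of the derivative of P P^T contribute
    equally, and the factor 2 cancels that of the square root. *)
Lemma derive_vdens c u l : dom c u ->
  'D_(e l) (vdens c) u = vdens c u * \sum_i \sum_j B c u i j * dP c u l i j.
Proof.
move=> cu; have fP := @chart_immersion _ _ _ _ c u cu.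
pose G v := P c v *m (P c v)^T.
have d0 : 0 < \det (G u) := det_gram_gt0 fP.
pose dG : 'M[R]_n := \matrix_(a, b) \sum_j (P c u a j * dP c u l b j + P c u b j * dP c u l a j).
have hG a b : is_derive u (e l) (fun v => G v a b) (dG a b).
  have -> : (fun v => G v a b) = (fun v => \sum_j P c v a j * P c v b j).
    by apply/funext => v; rewrite mxE; apply: eq_bigr => j _; rewrite [in LHS]mxE [in LHS]mxE mxE [in RHS]mxE.
  rewrite mxE; apply: is_derive_bigsum => j.
  exact: is_deriveM (dPE l a j cu) (dPE l b j cu).
have hd := is_derive_det hG.
have hs : is_derive (\det (G u)) 1 (@Num.sqrt R) (2 * Num.sqrt (\det (G u)))^-1.
  exact: is_derive1_sqrt.
have [_ ->] := is_derive_compR hd hs.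
have uG : G u \in unitmx by exact: gram_unit.
have cofE a b : cofactor (G u) a b = \det (G u) * (invmx (G u)) b a.
  by rewrite /invmx uG !mxE mulrA mulfV ?mul1r// gt_eqF.
have sG : (invmx (G u))^T = invmx (G u) by rewrite trmx_inv /G trmx_mul trmxK.
pose T := \sum_i \sum_j B c u i j * dP c u l i j.
have T1 : \sum_a \sum_b (\sum_j P c u a j * dP c u l b j) * (invmx (G u)) b a = T.
  rewrite exchange_big/=; apply: eq_bigr => b _.
  under eq_bigr do rewrite mulr_suml.
  rewrite exchange_big/=; apply: eq_bigr => j _.
  rewrite [B c u b j]mxE mulr_suml; apply: eq_bigr => a _; ring.
have T2 : \sum_a \sum_b (\sum_j P c u b j * dP c u l a j) * (invmx (G u)) b a = T.
  apply: eq_bigr => a _.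
  under eq_bigr do rewrite mulr_suml.
  rewrite exchange_big/=; apply: eq_bigr => j _.
  rewrite [B c u a j]mxE mulr_suml; apply: eq_bigr => b _.
  have sE : invmx (G u) b a = invmx (G u) a b by rewrite -{1}sG mxE.
  by rewrite sE /G; ring.
have -> : \sum_a \sum_b dG a b * cofactor (G u) a b = \det (G u) * (2 * T).
  transitivity (\det (G u) * (T + T)); last by rewrite mulr2n mulrDl mul1r.
  rewrite -{1}T1 -T2 -big_split/= mulr_sumr; apply: eq_bigr => a _.
  rewrite -big_split/= mulr_sumr; apply: eq_bigr => b _.
  rewrite cofE mxE big_split/=; ring.
have s0 : Num.sqrt (\det (G u)) != 0 by rewrite gt_eqF// sqrtr_gt0.
rewrite -/T -[vdens c u]/(Num.sqrt (\det (G u))) -{2}(sqr_sqrtr (ltW d0)).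
by field.
Qed.

(* The tangential part of the left-hand side vanishes by symmetry of the second
   derivatives of par c and Jacobi's formula; its normal part is w H. *)
Lemma divergence_dual c u k : dom c u ->
  \sum_i 'D_(e i) (fun v => vdens c v * B c v i k) u =
  vdens c u * (mean_curvature n S (par c u)) 0 k.
Proof.
move=> cu; have fP := @chart_immersion _ _ _ _ c u cu.
have oD := @chart_dom_open _ _ _ _ c.
pose w := vdens c u; pose dw i := 'D_(e i) (vdens c) u.
pose X : 'rV[R]_N := \row_j \sum_i (w * dB c u i i j + B c u i j * dw i).
have XE j : \sum_i 'D_(e i) (fun v => vdens c v * B c v i j) u = X 0 j.
  rewrite mxE; apply: eq_bigr => i _.
  by have [_ ->] := is_deriveM (C1_on_is_derive i (@C1_vdens _ _ _ _ c) cu) (dBE i i j cu).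
rewrite XE.
have XP : X *m (P c u)^T = 0.
  apply/rowP => l; rewrite [RHS]mxE mxE.
  have -> : \sum_j X 0 j * (P c u)^T j l =
      \sum_i (w * (\sum_j P c u l j * dB c u i i j) + (\sum_j B c u i j * P c u l j) * dw i).
    under eq_bigr do rewrite mxE mulr_suml.
    rewrite exchange_big/=; apply: eq_bigr => i _.
    rewrite mulr_sumr mulr_suml -big_split/=; apply: eq_bigr => j _.
    by rewrite [_^T _ _]mxE; ring.
  have o i : \sum_j P c u l j * dB c u i i j = - \sum_j B c u i j * dP c u l i j.
    have := dual_orth i i l cu; rewrite big_split/= => /eqP; rewrite addrC addr_eq0 => /eqP ->.
    by congr (- _); apply: eq_bigr => j _; rewrite partial_sym.
  have BP i : \sum_j B c u i j * P c u l j = (i == l)%:R.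
    have /matrixP/(_ i l) := dual_mulmx fP; rewrite !mxE => <-.
    by apply: eq_bigr => j _; rewrite [(P c u)^T j l]mxE.
  rewrite big_split/=.
  have -> : \sum_i (\sum_j B c u i j * P c u l j) * dw i = dw l.
    rewrite (bigD1 l)//= BP eqxx mul1r big1 ?addr0// => i il.
    by rewrite BP (negPf il) mul0r.
  rewrite /dw (derive_vdens l cu) -/w mulr_sumr -big_split/= big1// => i _.
  by rewrite o mulrN addrC subrr.
(* Being normal, X is its own normal projection; since B Q vanishes identically, the derivative can
   be moved from B to the projector Q, where it produces H. *)
have XQ : X = X *m nproj n S (par c u).
  by rewrite nproj_par// mulmxBr mulmx1 /tproj mulmxA XP mul0mx subr0.
rewrite {1}XQ mxE mean_curvature_par// mxE summxE mulrN mulr_sumr.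
have BQ i : \sum_j B c u i j * nproj n S (par c u) j k = 0.
  have := dual_tproj fP => /matrixP/(_ i k).
  have -> : \sum_j B c u i j * nproj n S (par c u) j k = (B c u *m nproj n S (par c u)) i k.
    by rewrite mxE.
  by move=> _; rewrite nproj_par// mulmxBr mulmx1 dual_tproj// subrr mxE.
have dQ i : \sum_j dB c u i i j * nproj n S (par c u) j k =
    - (row i (B c u) *m dnproj c u (e i)) 0 k.
  have h : is_derive u (e i) (fun v => \sum_j B c v i j * nproj n S (par c v) j k)
      (\sum_j (B c u i j * dnproj c u (e i) j k + nproj n S (par c u) j k * dB c u i i j)).
    apply: is_derive_bigsum => j.
    have hq : is_derive u (e i) ((fun x => nproj n S x j k) \o par c) (dnproj c u (e i) j k).
      by rewrite mxE; exact: C1_on_is_derive (@C1_nproj _ _ _ _ c j k) cu.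
    exact: is_deriveM (dBE i i j cu) hq.
  have h0 : is_derive u (e i) (fun v => \sum_j B c v i j * nproj n S (par c v) j k) 0.
    apply: (near_eq_is_derive _ (is_derive_cst (0 : R) u (e i))).
    have : nbhs u (dom c) by exact: open_nbhs_nbhs.
    apply: filterS => v cv; have fv := @chart_immersion _ _ _ _ c v cv.
    have /matrixP/(_ i k) : B c v *m nproj n S (par c v) = 0.
      by rewrite nproj_par// mulmxBr mulmx1 dual_tproj// subrr.
    by rewrite !mxE => ->.
  have : \sum_j (B c u i j * dnproj c u (e i) j k + nproj n S (par c u) j k * dB c u i i j) = 0.
    by have [_ <-] := h; have [_ ->] := h0.
  rewrite big_split/= => /eqP; rewrite addrC addr_eq0 => /eqP E.
  transitivity (\sum_j nproj n S (par c u) j k * dB c u i i j).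
    by apply: eq_bigr => j _; rewrite mulrC.
  rewrite E; congr (- _); rewrite mxE; apply: eq_bigr => j _; by rewrite [in RHS]mxE.
transitivity (\sum_i (w * (\sum_j dB c u i i j * nproj n S (par c u) j k) +
    (\sum_j B c u i j * nproj n S (par c u) j k) * dw i)).
  under eq_bigr do rewrite mxE mulr_suml.
  rewrite exchange_big/=; apply: eq_bigr => i _.
  by rewrite mulr_sumr mulr_suml -big_split/=; apply: eq_bigr => j _; ring.
rewrite -sumrN; apply: eq_bigr => i _.
by rewrite BQ mul0r addr0 dQ mulrN.
Qed.

End chart_divergence.

(** * Derivatives of compactly supported functions integrate to zero *)

Section euclidean_divergence.
Context {R : realType} (n : nat).
Local Notation lam := (lebesgue_rV n).
Local Notation e i := (delta_mx 0 i : 'rV[R]_n).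

Lemma measurable_continuousT (f : 'rV[R]_n -> R) : (forall u, {for u, continuous f}) ->
  measurable_fun setT (f : borelV R n -> R).
Proof. by move=> cf; apply: (@open_continuous_borel R n setT f openT) => u _; exact: cf. Qed.

Lemma bounded_support_bound (f : 'rV[R]_n -> R) (r : R) : (forall u, {for u, continuous f}) ->
  (forall u, r <= `|u| -> f u = 0) -> exists2 M, 0 <= M & forall u, `|f u| <= M.
Proof.
move=> cf f0.
have cB : compact (closed_ball_ (fun u => `|u|) (0 : 'rV[R]_n) r).
  apply: bounded_closed_compact; last exact: closed_closed_ball_.
  exists r; split; first exact: num_real.
  by move=> x rx u; rewrite /closed_ball_/= sub0r normrN => /le_trans -> //; exact: ltW.
have cfW : {within closed_ball_ (fun u => `|u|) (0 : 'rV[R]_n) r, continuous f}.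
  by apply: continuous_subspaceT => u; exact: cf.
have /compact_bounded[M [Mr hM]] := continuous_compact cfW cB.
exists (`|M| + 1) => [|u]; first by rewrite addr_ge0.
have [ur|ur] := leP `|u| r; last by rewrite f0 ?normr0 ?addr_ge0// ltW.
apply: (hM (`|M| + 1)); first by rewrite (le_lt_trans (ler_norm _))// ltrDl.
by exists u => //; rewrite /closed_ball_/= sub0r normrN.
Qed.

Lemma integral_translate (f : 'rV[R]_n -> R) (a : 'rV[R]_n) :
  measurable_fun setT (f : borelV R n -> R) ->
  (\int[lam]_u (f (a + (u : 'rV_n)))%:E = \int[lam]_u (f u)%:E)%E.
Proof.
move=> mf; have mE : measurable_fun setT (EFin \o (f : borelV R n -> R)) by exact/measurable_EFinP.
rewrite [LHS]integralE [RHS]integralE; congr (_ - _)%E.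
  have h := @ge0_integral_affine R n (fun u => ((EFin \o f)^\+ u)%E) a 1 ltr01
    (measurable_funepos mE) (fun u => funepos_ge0 _ u).
  rewrite expr1n invr1 mul1e in h; rewrite -h; apply: eq_integral => u _.
  by rewrite !funeposE/= scale1r.
have h := @ge0_integral_affine R n (fun u => ((EFin \o f)^\- u)%E) a 1 ltr01
  (measurable_funeneg mE) (fun u => funeneg_ge0 _ u).
rewrite expr1n invr1 mul1e in h; rewrite -h; apply: eq_integral => u _.
by rewrite !funenegE/= scale1r.
Qed.

(** Difference quotients have integral 0 by translation invariance, and they converge to the
    derivative while remaining dominated. *)
Lemma integral_derive_compact (g : 'rV[R]_n -> R) (r : R) i : C1_on setT g ->
  (forall u, r <= `|u| -> g u = 0) ->
  lam.-integrable setT (EFin \o ('D_(e i) g : borelV R n -> R)) /\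
  (\int[lam]_u ('D_(e i) g u)%:E = 0)%E.
Proof.
move=> cg g0.
have cgc u : {for u, continuous g} by exact: (cg u I).1.
have cD u : {for u, continuous ('D_(e i) g)} by exact: ((cg u I).2 i).2.
have D0 u : r + 1 <= `|u| -> 'D_(e i) g u = 0.
  move=> ur; have : \near u, 0 = g u.
    have : \forall v \near u, `|u - v| < 1 by apply/nbhs_ballP; exists 1 => //= v /ball_rVE.
    apply: filterS => v uv; rewrite g0// -(lerD2r 1) (le_trans ur)//.
    by rewrite -{1}[u](subrK v) addrC (le_trans (ler_normD _ _))// lerD2l ltW.
  by move/(near_eq_derive (e i)) <-; exact: derive_cst.
have [M M0 hM] := bounded_support_bound cD D0.
have [L L0 hL] := bounded_support_bound cgc g0.
(* Increments of length at most 1 keep the supports of all difference quotients in the ball of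
   radius r + 1. *)
pose h_ k : R := k.+1%:R^-1.
have h0 k : 0 < h_ k by rewrite invr_gt0.
have h1 k : h_ k <= 1 by rewrite invf_le1 ?ler1n.
pose q k (u : borelV R n) : R := (h_ k)^-1 * (g (h_ k *: e i + u) - g u).
have qE k u : exists s, q k u = 'D_(e i) g (u + s *: e i).
  have [|s [_ E]] := @MVT_line R _ g u (e i) (h_ k).
    by move=> s _; exact: ((cg _ I).2 i).1.
  by exists s; rewrite /q [_ + u]addrC E mulrA mulVf ?mul1r// gt_eqF.
have e1 : `|e i| <= 1.
  apply: norm_le_coord => // l; rewrite !mxE; case: (_ && _); by rewrite ?normr1// normr0.
have q0 k u : r + 1 <= `|u : 'rV_n| -> q k u = 0.
  move=> ur; rewrite /q g0 ?g0 ?subrr ?mulr0//.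
    by rewrite (le_trans _ ur)// lerDl.
  rewrite -(lerD2r 1) (le_trans ur)//.
  have := ler_normB (h_ k *: e i + u) (h_ k *: e i); rewrite addrC addKr => h.
  rewrite (le_trans h)// lerD2l normrZ gtr0_norm// (le_trans (ler_pM _ _ (h1 k) e1))//.
    by rewrite ltW.
pose B : set (borelV R n) := ball (0 : 'rV[R]_n) (r + 1).
have mB : measurable B by apply: open_borel; exact: ball_open.
have lB : (lam B < +oo)%E.
  have := lebesgue_ball_lty (0 : 'rV[R]_n) (r + 1); congr (lam _ < +oo)%E.
  by apply/seteqP; split=> v /=; rewrite /B -ball_normE/= distrC.
have iB (K : R) : lam.-integrable setT (EFin \o (fun u : borelV R n => K * \1_B u)).
  apply: integrable_RZ; apply: integrable_ge0.
  - exact: measurable_indic.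
  - by move=> u; rewrite indicE.
  - by rewrite integral_indic// setIT.
have dom_by (f : borelV R n -> R) (K : R) : measurable_fun setT f -> (forall u, `|f u| <= K) ->
    (forall u : borelV R n, r + 1 <= `|u : 'rV_n| -> f u = 0) -> lam.-integrable setT (EFin \o f).
  move=> mf fK f0; apply: (integrable_dominated mf (iB K)) => u.
  rewrite indicE; have [ur|ur] := leP (r + 1) `|u : 'rV_n|.
    by rewrite f0// normr0 mulr_ge0// (le_trans _ (fK 0)).
  by rewrite mem_set ?mulr1//; apply/ball_rVE; rewrite sub0r normrN.
have mg := measurable_continuousT cgc; have mD := measurable_continuousT cD.
have mt k : measurable_fun setT (fun u : borelV R n => g (h_ k *: e i + (u : 'rV_n))).
  apply: (measurableT_comp mg (_ : measurable_fun setT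
    (fun u : borelV R n => (h_ k *: e i + (u : 'rV_n) : borelV R n)))).
  exact: measurable_rVD.
have mq k : measurable_fun setT (q k).
  by apply: measurable_funM => //; exact: measurable_funB.
have qM k u : `|q k u| <= M by have [s ->] := qE k u; exact: hM.
have gr1 (u : borelV R n) : r + 1 <= `|u : 'rV_n| -> g u = 0.
  by move=> ur; apply: g0; rewrite (le_trans _ ur)// lerDl.
have ig : lam.-integrable setT (EFin \o (g : borelV R n -> R)) := dom_by _ L mg hL gr1.
have trans k : (\int[lam]_u (g (h_ k *: e i + (u : 'rV_n)))%:E = \int[lam]_u (g u)%:E)%E.
  exact: integral_translate.
have it k : lam.-integrable setT (EFin \o (fun u : borelV R n => g (h_ k *: e i + (u : 'rV_n)))).
  have -> : (fun u : borelV R n => g (h_ k *: e i + (u : 'rV_n))) =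
      (fun u : borelV R n => h_ k * q k u + g u).
    by apply/funext => u; rewrite /q mulrA mulfV ?mul1r ?subrK// gt_eqF.
  exact: (integrable_RD (integrable_RZ _ (dom_by _ M (mq k) (qM k) (q0 k))) ig).
have q_int k : (\int[lam]_u (q k u)%:E = 0)%E.
  have iq := dom_by _ M (mq k) (qM k) (q0 k).
  rewrite -(EFin_Rintegral iq); congr (_%:E).
  rewrite /q RintegralZl//; last exact: integrable_RB.
  rewrite RintegralB// /Rintegral trans subrr mulr0//.
have qD (u : 'rV[R]_n) : q k u @[k --> \oo] --> 'D_(e i) g u.
  have [_ ->] := C1_derive (e i) openT cg (I : [set: 'rV[R]_n] u).
  apply: (@C1_curve _ _ setT g u nat \oo _ (fun k => h_ k *: e i + u) h_ (e i) openT cg I).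
    rewrite -[X in _ --> X]add0r -[in X in _ --> X](scale0r (e i)).
    apply: cvgD; last exact: cvg_cst.
    by apply: cvgZ; [exact: cvg_harmonic|exact: cvg_cst].
  apply: (@cvg_near_cst _ _ (e i) _ \oo _); apply: nearW => k.
  by rewrite addrK scalerA mulVf ?scale1r// gt_eqF.
have qDE (u : borelV R n) : (EFin \o q k) u @[k --> \oo] --> (EFin \o 'D_(e i) g) u.
  by apply/fine_cvgP; split; [exact: nearW|exact: qD].
have bq (u : borelV R n) k : (`|(EFin \o q k) u| <= (EFin \o (fun v : borelV R n => (M * \1_B v)%R)) u)%E.
  rewrite /= lee_fin indicE; have [ur|ur] := leP (r + 1) `|u : 'rV_n|.
    by rewrite q0// normr0 mulr_ge0.
  by rewrite mem_set ?mulr1//; apply/ball_rVE; rewrite sub0r normrN.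
have mqE k : measurable_fun setT (EFin \o q k) by exact/measurable_EFinP.
have mDE : measurable_fun setT (EFin \o ('D_(e i) g : borelV R n -> R)) by exact/measurable_EFinP.
have [iD _ h] := @dominated_convergence _ (borelV R n) R lam setT measurableT
  (fun k => EFin \o q k) _ _ mqE mDE
  (aeW lam (fun (u : borelV R n) _ => qDE u)) (iB M)
  (aeW lam (fun (u : borelV R n) k _ => bq u k)).
split=> //.
have h' : (fun _ : nat => 0 : \bar R) @ \oo --> (\int[lam]_u ('D_(e i) g u)%:E)%E.
  apply: cvg_trans h; apply: near_eq_cvg; apply: nearW => k /=.
  by rewrite q_int.
exact: (cvg_unique _ h' (cvg_cst _)).
Qed.

End euclidean_divergence.

(** * The divergence theorem on a compact submanifold *)

Section surface_divergence.
Context {R : realType} (n N : nat) (S : set 'rV[R]_N).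
Implicit Types (c : chart n S) (F : 'rV[R]_N -> R).
Local Notation dom := chart_dom.
Local Notation par := chart_par.
Local Notation nbd := chart_nbd.
Local Notation e i := (delta_mx 0 i : 'rV[R]_n).
Local Notation P c u := (partial_mx (chart_par c) u).
Local Notation lam := (lebesgue_rV n).
Local Notation vol := (riemannian_volume n S).

Definition C1_surface F := forall c, C1_on (dom c) (F \o par c).

Lemma C1_surface_C0 F : C1_surface F -> C0_surface n S F.
Proof. by move=> cF c u cu; exact: (cF c u cu).1. Qed.

Lemma gradient_coord F c u k : C1_surface F -> dom c u ->
  gradient n S F (par c u) 0 k =
  \sum_i 'D_(e i) (F \o par c) u * dual_mx (P c u) i k.
Proof.
by move=> cF cu; rewrite gradient_par// mxE; apply: eq_bigr => i _; rewrite mxE.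
Qed.

Lemma C0_gradient F k : C1_surface F -> C0_surface n S (fun x => gradient n S F x 0 k).
Proof.
move=> cF c u cu; have oD := @chart_dom_open _ _ _ _ c.
have E : \near u, \sum_i 'D_(e i) (F \o par c) u * dual_mx (P c u) i k =
    gradient n S F (par c u) 0 k.
  have : nbhs u (dom c) by exact: open_nbhs_nbhs.
  by apply: filterS => v cv; rewrite gradient_coord.
rewrite /prop_for /continuous_at /= -(nbhs_singleton E).
apply: (cvg_trans (near_eq_cvg E)).
apply: cvg_big => [|i _]; first exact: add_continuous.
apply: cvgM; first exact: ((cF c u cu).2 i).2.
exact: (@C1_dual _ _ _ _ c i k u cu).1.
Qed.

Lemma C0_mean_curvature k : C0_surface n S (fun x => mean_curvature n S x 0 k).
Proof.
move=> c u cu; have oD := @chart_dom_open _ _ _ _ c.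
have E : \near u, - (\sum_i \sum_j dual_mx (P c u) i j * dnproj c u (e i) j k) =
    mean_curvature n S (par c u) 0 k.
  have : nbhs u (dom c) by exact: open_nbhs_nbhs.
  apply: filterS => v cv; rewrite mean_curvature_par// mxE summxE; congr (- _).
  apply: eq_bigr => i _; rewrite mxE; apply: eq_bigr => j _.
  by rewrite [row _ _ _ _]mxE.
rewrite /prop_for /continuous_at /= -(nbhs_singleton E).
apply: (cvg_trans (near_eq_cvg E)); apply: cvgN.
apply: cvg_big => [|i _]; first exact: add_continuous.
apply: cvg_big => [|j _]; first exact: add_continuous.
apply: cvgM; first exact: (@C1_dual _ _ _ _ c i j u cu).1.
have -> : (fun v => dnproj c v (e i) j k) =
    ('D_(e i) ((fun x => nproj n S x j k) \o par c)) by apply/funext => v; rewrite mxE.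
rewrite mxE; exact: ((@C1_nproj _ _ _ _ c j k u cu).2 i).2.
Qed.

Lemma integral_volume c (B : set (borelV R N)) (f : 'rV[R]_N -> R) :
  measurable B -> B `<=` nbd c -> measurable_fun B f ->
  (\int[vol]_(y in B) (f y)%:E =
   \int[lam]_(u in dom c `&` par c @^-1` B) (f (par c u) * vdens c u)%:E)%E.
Proof.
move=> mB Bc mf; have mE : measurable_fun B (EFin \o f) by exact/measurable_EFinP.
rewrite [LHS]integralE [RHS]integralE; congr (_ - _)%E.
  rewrite (@ge0_integral_volume _ _ _ _ c B ((EFin \o f)^\+)%E mB Bc (measurable_funepos mE) (fun y _ => funepos_ge0 _ y)).
  apply: eq_integral => u _; rewrite !funeposE /= EFinM maxe_pMl ?lee_fin ?sqrtr_ge0//.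
  by rewrite mul0e.
rewrite (@ge0_integral_volume _ _ _ _ c B ((EFin \o f)^\-)%E mB Bc (measurable_funeneg mE) (fun y _ => funeneg_ge0 _ y)).
apply: eq_integral => u _; rewrite !funenegE /= -mulNr EFinM maxe_pMl ?lee_fin ?sqrtr_ge0//.
by rewrite mul0e.
Qed.

(** The intrinsic divergence of the tangential part of F e_k: the tangential part of a constant
    vector has divergence equal to its inner product with H. *)
Definition divergence_density F k (x : 'rV[R]_N) : R :=
  gradient n S F x 0 k + F x * mean_curvature n S x 0 k.

Hypotheses (sS : is_submanifold n S) (cS : compact S).

Lemma C0_divergence_density F k : C1_surface F -> C0_surface n S (divergence_density F k).
Proof.
move=> cF c u cu.
apply: (@continuousD _ _ _ (fun v => gradient n S F (par c v) 0 k)); first exact: C0_gradient.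
by apply: continuousM; [exact: (C1_surface_C0 cF)|exact: C0_mean_curvature].
Qed.

Lemma measurable_divergence_density F k : C1_surface F ->
  measurable_fun (S : set (borelV R N)) (divergence_density F k).
Proof. by move=> cF; exact: (C0_surface_measurable sS cS (C0_divergence_density cF)). Qed.

Lemma divergence_density_par F k c u : C1_surface F -> dom c u ->
  \sum_i 'D_(e i) (fun v => F (par c v) * (vdens c v * dual_mx (P c v) i k)) u =
  divergence_density F k (par c u) * vdens c u.
Proof.
move=> cF cu; have oD := @chart_dom_open _ _ _ _ c.
have cW i : C1_on (dom c) (fun v => vdens c v * dual_mx (P c v) i k).
  by apply: C1_onM => //; [exact: C1_vdens|exact: C1_dual].
have E i : 'D_(e i) (fun v => F (par c v) * (vdens c v * dual_mx (P c v) i k)) u =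
    F (par c u) * 'D_(e i) (fun v => vdens c v * dual_mx (P c v) i k) u +
    (vdens c u * dual_mx (P c u) i k) * 'D_(e i) (F \o par c) u.
  by have [_ ->] := is_deriveM (C1_on_is_derive i (cF c) cu) (C1_on_is_derive i (cW i) cu).
under eq_bigr do rewrite E.
rewrite big_split/= -mulr_sumr divergence_dual// /divergence_density gradient_coord//.
rewrite mulrDl addrC mulr_suml; congr (_ + _); last by rewrite mulrA mulrAC.
by apply: eq_bigr => i _; rewrite mulrC mulrA mulrAC.
Qed.

Lemma local_divergence x0 : S x0 -> exists2 rho, 0 < rho & forall F k, C1_surface F ->
  (forall y, S y -> rho / 2 <= `|y - x0| -> F y = 0) ->
  (\int[vol]_(x in S) (divergence_density F k x)%:E = 0)%E.
Proof.
move=> Sx; have [c cx] := sS Sx; have [cu0 E0] := chart_coordK Sx cx.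
set u0 := chart_coord c x0 in cu0 E0.
have oD := @chart_dom_open _ _ _ _ c.
have [eps [K [eps0 K0 h1 _]]] := chart_bilipschitz cu0.
have eps2 : 0 < eps / 2 by rewrite divr_gt0.
have [rho rho0 hr] := chart_near Sx cx eps2.
exists rho => // F k cF F0.
have mS : measurable (S : set (borelV R N)) by exact: measurable_surface.
pose B : set (borelV R N) := S `&` ball x0 rho.
have mB : measurable B by apply: measurableI => //; apply: open_borel; exact: ball_open.
have Bc : B `<=` nbd c.
  by move=> y [Sy /ball_rVE yx]; have [] := hr y Sy; rewrite // distrC.
(* The hypothesis starts at distance rho / 2, so that F vanishes in a whole neighbourhood of such a
   point and its gradient is 0 too. *)
have D0 y : S y -> ~ ball x0 rho y -> divergence_density F k y = 0.
  move=> Sy nB; have yx : rho <= `|y - x0|.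
    by rewrite leNgt; apply/negP => h; apply: nB; apply/ball_rVE; rewrite distrC.
  have yx2 : rho / 2 < `|y - x0| by rewrite (lt_le_trans _ yx)// ltr_pdivrMr// ltr_pMr// ltr1n.
  have [c' c'y] := sS Sy; have [cu' E'] := chart_coordK Sy c'y.
  set u' := chart_coord c' y in cu' E'.
  rewrite /divergence_density F0 ?(ltW yx2)// mul0r addr0 -E' gradient_coord// big1// => i _.
  suff -> : 'D_(e i) (F \o par c') u' = 0 by rewrite mul0r.
  have nd : \forall v \near u', dom c' v.
    by apply: open_nbhs_nbhs; split=> //; exact: chart_dom_open.
  have d0 : 0 < `|y - x0| - rho / 2 by rewrite subr_gt0.
  have nv : \forall v \near u', `|par c' u' - par c' v| < `|y - x0| - rho / 2.
    by have /cvgrPdist_lt/(_ _ d0) := continuous_par cu'.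
  have E : \near u', 0 = (F \o par c') u'.
    apply: filterS2 nd nv => v cv; rewrite E' => hv /=.
    rewrite F0//; first by have [] := chart_parS cv.
    have := ler_normD (y - par c' v) (par c' v - x0); rewrite addrA subrK => h; lra.
  by rewrite -(near_eq_derive (e i) E); exact: derive_cst.
have mD := measurable_divergence_density k cF.
have mDB : measurable_fun B (divergence_density F k).
  by apply: (measurable_funS mS _ mD); exact: subIsetl.
have -> : (\int[vol]_(x in S) (divergence_density F k x)%:E =
    \int[vol]_(x in B) (divergence_density F k x)%:E)%E.
  rewrite [LHS]integral_mkcond [RHS]integral_mkcond; apply: eq_integral => y _.
  rewrite /patch; case: (pselect (S y)) => Sy; last first.
    by rewrite (memNset Sy) (memNset (_ : ~ B y))//; case.
  rewrite (mem_set Sy); case: (pselect (ball x0 rho y)) => By.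
    by rewrite (mem_set (_ : B y)).
  by rewrite (memNset (_ : ~ B y)) ?D0//; case.
rewrite (integral_volume mB Bc mDB).
(* Extended by zero outside the chart domain. The extension is C^1 because the domain and the open
   set [U], on which it vanishes, cover the space. *)
pose g i (u : 'rV[R]_n) : R :=
  if u \in dom c then F (par c u) * (vdens c u * dual_mx (P c u) i k) else 0.
have g0 i u : eps / 2 <= `|u - u0| -> g i u = 0.
  move=> ue; rewrite /g; case: ifPn => //; rewrite inE => cu.
  have [Su _] := chart_parS cu.
  rewrite F0 ?mul0r// leNgt; apply/negP => h.
  have [|_] := hr _ Su.
    by rewrite (lt_trans h)// ltr_pdivrMr// ltr_pMr// ltr1n.
  by rewrite chart_parK// ltNge ue.
have gd i : C1_on (dom c) (g i).
  apply: (@C1_on_eq _ _ (dom c) (fun u => F (par c u) * (vdens c u * dual_mx (P c u) i k)) _ oD).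
    by move=> u cu; rewrite /g (mem_set cu).
  apply: (C1_onM oD (cF c)); apply: (C1_onM oD); [exact: C1_vdens|exact: C1_dual].
pose U := [set u : 'rV[R]_n | eps / 2 < `|u - u0|].
have oU : open U.
  have -> : U = (fun u : 'rV[R]_n => `|u - u0|) @^-1` [set x | eps / 2 < x] by [].
  apply: open_comp; last exact: open_gt.
  move=> u _; apply: continuous_comp; last exact: norm_continuous.
  by apply: continuousB; [exact: cvg_id|exact: cst_continuous].
have gU i : C1_on U (g i).
  apply: (@C1_on_eq _ _ U (fun=> 0) _ oU); last exact: C1_on_cst.
  by move=> u /= uU; rewrite g0// ltW.
have domU u : dom c u \/ U u.
  have [h|h] := ltP `|u - u0| eps; first by left; exact: (h1 u h).1.
  by right; rewrite /U /= (lt_le_trans _ h)// ltr_pdivrMr// ltr_pMr// ltr1n.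
have gT i : C1_on setT (g i) by move=> u _; have [/gd|/gU] := domU u.
have gz i u : `|u0| + eps / 2 <= `|u| -> g i u = 0.
  move=> h; apply: g0; have := ler_normD (u - u0) u0; rewrite subrK => h'; lra.
have sumE u : \sum_i 'D_(e i) (g i) u =
    if u \in dom c `&` par c @^-1` B then divergence_density F k (par c u) * vdens c u else 0.
  case: (pselect (dom c u)) => cu.
    have -> : \sum_i 'D_(e i) (g i) u = divergence_density F k (par c u) * vdens c u.
      rewrite -divergence_density_par//; apply: eq_bigr => i _; apply: near_eq_derive.
      have : nbhs u (dom c) by exact: open_nbhs_nbhs.
      by apply: filterS => v cv; rewrite /g (mem_set cv).
    case: ifPn => //; rewrite notin_setE => nB; rewrite D0 ?mul0r//.
      by have [] := chart_parS cu.
    by move=> b; apply: nB; split=> //; split=> //; have [] := chart_parS cu.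
  rewrite (memNset (_ : ~ (dom c `&` par c @^-1` B) u)); last by case.
  rewrite big1// => i _; have [//|Uu] := domU u.
  have E : \near u, 0 = g i u.
    have : nbhs u U by exact: open_nbhs_nbhs.
    by apply: filterS => v /ltW; move/(g0 i) => ->.
  by rewrite -(near_eq_derive (e i) E); exact: derive_cst.
have ints i := integral_derive_compact i (gT i) (gz i).
have -> : (\int[lam]_(u in dom c `&` par c @^-1` B)
      (divergence_density F k (par c u) * vdens c u)%:E =
    \int[lam]_u (\sum_i 'D_(e i) (g i) (u : 'rV_n))%:E)%E.
  rewrite [LHS]integral_mkcond; apply: eq_integral => u _.
  by rewrite sumE /patch; case: ifP.
rewrite -(EFin_Rintegral (integrable_Rsum _ (fun i => (ints i).1))).
rewrite (Rintegral_sum _ (fun i => (ints i).1)) big1// => i _.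
by rewrite /Rintegral (ints i).2.
Qed.

Lemma C1_surface_coord j : C1_surface (fun x => x 0 j).
Proof. by move=> c; apply: smooth_on_coord; [exact: chart_dom_open|exact: chart_smooth]. Qed.

Lemma C1_surface_cst (a : R) : C1_surface (fun=> a).
Proof. by move=> c; apply: C1_on_cst; exact: chart_dom_open. Qed.

Lemma C1_surfaceD F G : C1_surface F -> C1_surface G -> C1_surface (fun x => F x + G x).
Proof. by move=> cF cG c; exact: (C1_onD (@chart_dom_open _ _ _ _ c) (cF c) (cG c)). Qed.

Lemma C1_surfaceB F G : C1_surface F -> C1_surface G -> C1_surface (fun x => F x - G x).
Proof. by move=> cF cG c; exact: (C1_onB (@chart_dom_open _ _ _ _ c) (cF c) (cG c)). Qed.

Lemma C1_surfaceM F G : C1_surface F -> C1_surface G -> C1_surface (fun x => F x * G x).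
Proof. by move=> cF cG c; exact: (C1_onM (@chart_dom_open _ _ _ _ c) (cF c) (cG c)). Qed.

Lemma C1_surface_sum (I : Type) (r : seq I) (F : I -> 'rV[R]_N -> R) :
  (forall i, C1_surface (F i)) -> C1_surface (fun x => \sum_(i <- r) F i x).
Proof.
by move=> cF c; apply: (C1_on_sum _ (@chart_dom_open _ _ _ _ c)) => i _; exact: cF.
Qed.

Lemma C1_surface_dot (y : 'rV[R]_N) : C1_surface (fun x => dot x y).
Proof.
have -> : (fun x => dot x y) = (fun x : 'rV[R]_N => \sum_j x 0 j * y 0 j).
  by apply/funext => x; rewrite dotE.
by apply: C1_surface_sum => j; apply: C1_surfaceM; [exact: C1_surface_coord|exact: C1_surface_cst].
Qed.

Lemma C1_surface_sqnorm : C1_surface (fun x => sqnorm x).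
Proof.
have -> : (fun x => sqnorm x) = (fun x : 'rV[R]_N => \sum_j x 0 j * x 0 j).
  by apply/funext => x; rewrite /sqnorm dotE.
by apply: C1_surface_sum => j; apply: C1_surfaceM; exact: C1_surface_coord.
Qed.

Lemma C1_surface_comp F (g dg : R -> R) : C1_surface F ->
  (forall t : R, is_derive t 1 g (dg t)) -> continuous dg -> C1_surface (fun x => g (F x)).
Proof.
move=> cF hg cdg c.
apply: (@C1_on_comp R n (dom c) (F \o par c) g dg (@chart_dom_open _ _ _ _ c) (cF c)).
by move=> u _; exact: cdg.
Qed.

Lemma is_derive_max0_sqr (t : R) : is_derive t 1 (fun t : R => Num.max 0 t ^+ 2) (2 * Num.max 0 t).
Proof.
have [t0|t0|t0] := ltgtP t 0.
- have E : \near t, 0 = Num.max 0 t ^+ 2 :> R.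
    have : nbhs t [set s : R | s < 0] by apply: open_nbhs_nbhs; split=> //; exact: open_lt.
    by apply: filterS => s /= s0; rewrite max_l ?expr0n// ltW.
  rewrite mulr0.
  exact: (near_eq_is_derive E (is_derive_cst (0 : R) t 1)).
- have E : \near t, t ^+ 2 = Num.max 0 t ^+ 2 :> R.
    have : nbhs t [set s : R | 0 < s] by apply: open_nbhs_nbhs; split=> //; exact: open_gt.
    by apply: filterS => s /= s0; rewrite max_r// ltW.
  apply: (near_eq_is_derive E).
  have h := is_deriveM (is_derive_id t (1 : R)) (is_derive_id t (1 : R)).
  have -> : (fun t : R => t ^+ 2) = (id * id) by apply/funext => s; rewrite expr2.
  by apply: (is_derive_eq h); rewrite /GRing.scale/= mulr1 mulr2n mulrDl mul1r.
- rewrite t0 mulr0.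
  have h : (fun h : R => h^-1 *: (((fun t : R => Num.max 0 t ^+ 2) \o shift (0 : R)) (h *: 1) - Num.max 0 0 ^+ 2)) @ (0 : R)^' --> (0 : R).
    apply/cvgrPdist_le => eps eps0; near=> h.
    have h0 : h != 0 by near: h; exact: nbhs_dnbhs_neq.
    have he : `|h| <= eps by near: h; exact: dnbhs0_le.
    rewrite sub0r normrN /= addr0 [h *: 1]mulr1 maxxx expr0n subr0.
    apply: le_trans he; rewrite normrM normfV ler_pdivrMl ?normr_gt0//.
    rewrite -expr2 normrX ler_sqr ?nnegrE//.
    by case: (leP 0 h) => // _; rewrite normr0.
  by apply: DeriveDef; [apply/cvg_ex; exists 0; exact: h|exact/cvg_lim].
Unshelve. all: by end_near. Qed.

(** The square of a positive part is C^1, which is all the regularity that the partition of unity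
    must have. *)
Definition bump (x0 : 'rV[R]_N) (r : R) (x : 'rV[R]_N) : R :=
  Num.max 0 (r ^+ 2 - sqnorm (x - x0)) ^+ 2.

Lemma C1_surface_bump x0 r : C1_surface (bump x0 r).
Proof.
apply: (@C1_surface_comp (fun x => r ^+ 2 - sqnorm (x - x0)) (fun t => Num.max 0 t ^+ 2)
  (fun t => 2 * Num.max 0 t)).
- apply: C1_surfaceB; first exact: C1_surface_cst.
  have -> : (fun x => sqnorm (x - x0)) = (fun x => sqnorm x - 2 * dot x x0 + sqnorm x0).
    by apply/funext => x; rewrite sqnormB.
  apply: C1_surfaceD; last exact: C1_surface_cst.
  apply: C1_surfaceB; first exact: C1_surface_sqnorm.
  by apply: C1_surfaceM; [exact: C1_surface_cst|exact: C1_surface_dot].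
- exact: is_derive_max0_sqr.
- move=> t.
  have h : {for t, continuous (fun s : R => Num.max 0 s)}.
    by apply: continuous_max; [exact: cst_continuous|exact: cvg_id].
  exact: (continuous_comp h (@mulrl_continuous R 2 _)).
Qed.

Lemma bump_ge0 x0 r x : 0 <= bump x0 r x. Proof. exact: sqr_ge0. Qed.

Lemma bump_eq0 x0 r x : 0 <= r -> r <= `|x - x0| -> bump x0 r x = 0.
Proof.
move=> r0 h; rewrite /bump max_l ?expr0n// subr_le0 (le_trans _ (norm_le_sqnorm _))//.
by rewrite ler_sqr ?nnegrE.
Qed.

(** The factor 1 / (N + 1) puts the sup norm ball inside the Euclidean ball where the bump is
    positive. *)
Lemma bump_gt0 x0 r x : 0 < r -> `|x - x0| < r / N.+1%:R -> 0 < bump x0 r x.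
Proof.
move=> r0 h; have N0 : 0 < N.+1%:R :> R by rewrite ltr0n.
have h2 : sqnorm (x - x0) < r ^+ 2.
  apply: (le_lt_trans (sqnorm_le_norm _)).
  apply: (@le_lt_trans _ _ (N.+1%:R * `|x - x0| ^+ 2)).
    by rewrite ler_wpM2r ?sqr_ge0// ler_nat.
  have h3 : `|x - x0| ^+ 2 < (r / N.+1%:R) ^+ 2.
    by rewrite ltr_sqr ?nnegrE// divr_ge0 ?ltW.
  rewrite -ltr_pdivlMl//; apply: (lt_le_trans h3).
  rewrite exprMn [leRHS]mulrC (ler_wpM2l (sqr_ge0 r))// expr2 ler_piMl ?invr_ge0 ?(ltW N0)//.
  by rewrite invf_le1// ler1n.
by rewrite /bump exprn_gt0// lt_max subr_gt0 h2 orbT.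
Qed.

Lemma divergence_density_eq F G k x : C1_surface F -> C1_surface G ->
  (forall y, S y -> F y = G y) -> S x -> divergence_density F k x = divergence_density G k x.
Proof.
move=> cF cG FG Sx; rewrite /divergence_density (FG x Sx); apply: (congr1 (fun t => t + _)).
move: x Sx; apply: (on_submanifold sS) => c u cu; rewrite !gradient_coord//.
apply: eq_bigr => i _; congr (_ * _); apply: near_eq_derive.
have : nbhs u (dom c) by apply: open_nbhs_nbhs; split=> //; exact: chart_dom_open.
by apply: filterS => v cv /=; apply: FG; have [] := chart_parS cv.
Qed.

Lemma divergence_density_sum (I : Type) (r : seq I) (F : I -> 'rV[R]_N -> R) k x :
  (forall i, C1_surface (F i)) -> S x ->
  divergence_density (fun y => \sum_(i <- r) F i y) k x =
  \sum_(i <- r) divergence_density (F i) k x.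
Proof.
move=> cF; move: x; apply: (on_submanifold sS) => c u cu.
rewrite /divergence_density big_split/= -mulr_suml; congr (_ + _).
rewrite gradient_coord//; last exact: C1_surface_sum.
under [RHS]eq_bigr do rewrite gradient_coord//.
rewrite exchange_big/=; apply: eq_bigr => i _; rewrite -mulr_suml; congr (_ * _).
have [_ E] := is_derive_bigsum r (fun j => C1_on_is_derive i (cF j c) cu).
exact: E.
Qed.

(* A C^1 partition of unity reduces this to F supported in one chart, where the
   integrand is a sum of partial derivatives of compactly supported functions. *)
Lemma surface_divergence F k : C1_surface F ->
  vol.-integrable S (EFin \o divergence_density F k) /\
  (\int[vol]_(x in S) (divergence_density F k x)%:E = 0)%E.
Proof.
move=> cF; have mS : measurable (S : set (borelV R N)) by exact: measurable_surface.
have int G : C1_surface G -> vol.-integrable S (EFin \o divergence_density G k).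
  move=> cG; have [C C0 hC] := C0_surface_bounded sS cS (@C0_divergence_density G k cG).
  apply/integrableP; split; first by apply/measurable_EFinP; exact: measurable_divergence_density.
  apply: (@le_lt_trans _ _ (\int[vol]_(x in S) (cst C%:E x))%E).
    apply: ge0_le_integral => //.
    - by apply/measurable_EFinP; apply: measurableT_comp => //; exact: measurable_divergence_density.
  by rewrite integral_cst// lte_mul_pinfty ?lee_fin ?ltW//; exact: surface_volume_lty.
split; first exact: int.
have hQ x : exists r : R, S x -> 0 < r /\ forall F k, C1_surface F ->
    (forall y, S y -> r / 2 <= `|y - x| -> F y = 0) ->
    (\int[vol]_(x in S) (divergence_density F k x)%:E = 0)%E.
  by have [/local_divergence[r r0 h]|nx] := pselect (S x); [exists r|exists 0].
have [rho rhoP] := choice hQ.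
pose r x := rho x / 2.
have r0 x : S x -> 0 < r x by move=> /rhoP[h _]; rewrite divr_gt0.
have [x Sx|s [sS' sP]] := finite_ball_cover (rho := fun x => r x / N.+1%:R) cS.
  by rewrite divr_gt0 ?r0.
pose X y := \sum_(x <- s) bump x (r x) y.
have X0 y : S y -> 0 < X y.
  move=> Sy; have [x xs yx] := sP y Sy.
  rewrite /X (perm_big _ (perm_to_rem xs))/= big_cons ltr_pwDl//.
    by apply: bump_gt0 => //; apply: r0; exact: sS'.
  by apply: sumr_ge0 => z _; exact: bump_ge0.
have cX : C1_surface X by apply: C1_surface_sum => x; exact: C1_surface_bump.
have cXV : C1_surface (fun y => (X y)^-1).
  move=> c; apply: (@C1_on_inv _ _ (dom c) (X \o par c) (@chart_dom_open _ _ _ _ c) (cX c)).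
  by move=> u cu; rewrite /= gt_eqF// X0//; have [] := chart_parS cu.
(* The sum [X] is known to be positive on S only, which is where the decomposition of F is used. *)
pose G x y := bump x (r x) y * (F y * (X y)^-1).
have cG x : C1_surface (G x).
  by apply: C1_surfaceM; [exact: C1_surface_bump|apply: C1_surfaceM].
have FG y : S y -> F y = \sum_(x <- s) G x y.
  by move=> Sy; rewrite /G -mulr_suml -/(X y) mulrCA mulfV ?mulr1// gt_eqF// X0.
have E y : S y -> divergence_density F k y = \sum_(x <- s) divergence_density (G x) k y.
  move=> Sy; rewrite -(divergence_density_sum s k cG Sy).
  exact: (divergence_density_eq k cF (C1_surface_sum s cG) FG Sy).
have E1 : (\int[vol]_(x in S) (divergence_density F k x)%:E =
    \int[vol]_(y in S) (\sum_(x <- s) (divergence_density (G x) k y)%:E))%E.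
  by apply: eq_integral => y; rewrite inE => Sy; rewrite E// sumEFin.
rewrite E1 (integral_sum mS (fun x => int _ (cG x))).
rewrite big_seq big1// => x xs.
have [_ h] := rhoP x (sS' x xs).
apply: (h _ k (cG x)) => y Sy yx; rewrite /G (bump_eq0 (ltW (r0 x (sS' x xs))) yx).
exact: mul0r.
Qed.

End surface_divergence.

(** * The logarithmic Sobolev inequality *)

Section gradient_calculus.
Context {R : realType} (n N : nat) (S : set 'rV[R]_N).
Hypothesis sS : is_submanifold n S.
Implicit Types (F G : 'rV[R]_N -> R).
Local Notation dom := chart_dom.
Local Notation par := chart_par.
Local Notation e i := (delta_mx 0 i : 'rV[R]_n).
Local Notation P c u := (partial_mx (chart_par c) u).
Local Notation grad := (gradient n S).
Local Notation Q := (nproj n S).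

Lemma gradientM F G x : C1_surface n S F -> C1_surface n S G -> S x ->
  grad (fun y => F y * G y) x = F x *: grad G x + G x *: grad F x.
Proof.
move=> cF cG; move: x; apply: (on_submanifold sS) => c u cu.
rewrite (gradient_par cu (C1_surfaceM cF cG)) (gradient_par cu cF) (gradient_par cu cG).
rewrite !scalemxAl -mulmxDl; apply: (congr1 (fun v => v *m _)).
apply/rowP => i; rewrite !mxE.
by have [_ ->] := is_deriveM (C1_on_is_derive i (cF c) cu) (C1_on_is_derive i (cG c) cu).
Qed.

Lemma gradient_comp F (g dg : R -> R) x : C1_surface n S F ->
  (forall t : R, is_derive t 1 g (dg t)) -> continuous dg -> S x ->
  grad (fun y => g (F y)) x = dg (F x) *: grad F x.
Proof.
move=> cF hg cdg; move: x; apply: (on_submanifold sS) => c u cu.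
rewrite (gradient_par cu (C1_surface_comp cF hg cdg)) (gradient_par cu cF).
rewrite !scalemxAl; apply: (congr1 (fun v => v *m _)).
apply/rowP => i; rewrite !mxE.
by have [_ ->] := is_derive_compR (C1_on_is_derive i (cF c) cu) (hg _).
Qed.

Lemma is_derive_par (c : chart n S) u i j : dom c u ->
  is_derive u (e i) (fun v => par c v 0 j) (P c u i j).
Proof.
move=> cu; have oD := @chart_dom_open _ _ _ _ c.
have h := C1_on_is_derive i (smooth_on_coord j oD (@chart_smooth _ _ _ _ c)) cu.
by apply: (is_derive_eq h); rewrite derive_coord ?mxE//; have [] := derive_par (e i) cu.
Qed.

(** As functions of x, the exponents of [mehler] and of the Gaussian density, and their sum, have
    this form. *)
Definition quadratic (k b : R) (v x : 'rV[R]_N) : R := k + (b * sqnorm x + dot x v).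

Lemma C1_surface_quadratic k b v : C1_surface n S (quadratic k b v).
Proof.
apply: C1_surfaceD; first exact: C1_surface_cst.
apply: C1_surfaceD; last exact: C1_surface_dot.
by apply: C1_surfaceM; [exact: C1_surface_cst|exact: C1_surface_sqnorm].
Qed.

Lemma gradient_quadratic k b v x : S x ->
  grad (quadratic k b v) x = ((2 * b) *: x + v) *m (1%:M - Q x).
Proof.
move: x; apply: (on_submanifold sS) => c u cu.
rewrite gradient_par//; last exact: C1_surface_quadratic.
rewrite nproj_par// subKr /tproj mulmxA; apply: (congr1 (fun w => w *m _)).
apply/rowP => i; rewrite mxE [RHS]mxE.
have h : is_derive u (e i) (fun w => k + \sum_j (b * (par c w 0 j * par c w 0 j) + par c w 0 j * v 0 j))
   (0 + \sum_j (b * (par c u 0 j * P c u i j + par c u 0 j * P c u i j) + P c u i j * v 0 j)).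
  apply: is_deriveD; apply: is_derive_bigsum => j; have hj := is_derive_par i j cu.
  apply: is_deriveD.
    by apply: is_deriveZ; apply: (is_derive_eq (is_deriveM hj hj)).
  have h := is_deriveM hj (is_derive_cst (v 0 j) u (e i)).
  by apply: (is_derive_eq h); rewrite scaler0 add0r /GRing.scale/= mulrC.
rewrite (_ : quadratic k b v \o par c =
    (fun w => k + \sum_j (b * (par c w 0 j * par c w 0 j) + par c w 0 j * v 0 j))); last first.
  by apply/funext => w; rewrite /quadratic /sqnorm /= !dotE big_split/= mulr_sumr.
have [_ ->] := h; rewrite add0r; apply: eq_bigr => j _.
by rewrite [((2 * b) *: par c u + v) 0 j]mxE [((2 * b) *: par c u) 0 j]mxE [(P c u)^T j i]mxE; ring.
Qed.

Lemma gradient_tangent F x : (grad F x <= tangent_space n S x)%MS.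
Proof.
rewrite /gradient; set A := [set _ | _].
have [[v Av]|nA] := pselect (exists v, A v); first by case: (xgetPex 0 (ex_intro _ v Av)).
by rewrite xgetPN ?sub0mx// => v Av; apply: nA; exists v.
Qed.

Lemma mean_curvature_normal x : (mean_curvature n S x <= Defs.normal_space n S x)%MS.
Proof.
apply: summx_sub => i _; rewrite /second_fundamental_form; set A := [set _ | _].
have [[v Av]|nA] := pselect (exists v, A v); first by case: (xgetPex 0 (ex_intro _ v Av)).
by rewrite xgetPN ?sub0mx// => v Av; apply: nA; exists v.
Qed.

Lemma dot_tangent_normal x v w : (v <= tangent_space n S x)%MS ->
  (w <= Defs.normal_space n S x)%MS -> dot v w = 0.
Proof.
move=> /submxP[D ->] /sub_kermxP h.
by rewrite dotC /dot trmx_mul mulmxA h mul0mx mxE.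
Qed.

Lemma C0_nproj i j : C0_surface n S (fun x => Q x i j).
Proof. by move=> c u cu; exact: (@C1_nproj _ _ _ _ c i j u cu).1. Qed.

Lemma nproj_trace x : S x -> ((Q x)^T *m Q x = Q x /\ \tr (Q x) = N%:R - n%:R).
Proof.
move: x; apply: (on_submanifold sS) => c u cu; rewrite nproj_sym// nproj_idem//; split=> //.
rewrite nproj_par// linearB/= mxtrace1 tproj_trace//; exact: chart_immersion.
Qed.

End gradient_calculus.

Section integral_density.
Context d (T : measurableType d) (R : realType) (mu nu : {measure set T -> \bar R}).
Variables (D B : set T) (h : T -> R).
Hypotheses (mD : measurable D) (mh : measurable_fun D h) (h0 : forall x, D x -> 0 <= h x).
Hypotheses (mB : measurable B) (nuE : forall A, measurable A -> A `<=` B ->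
  nu A = (\int[mu]_(x in D `&` A) (h x)%:E)%E).

Lemma integral_density (f : T -> R) : measurable_fun B f ->
  (\int[nu]_(x in B) (f x)%:E = \int[mu]_(x in D `&` B) (f x * h x)%:E)%E.
Proof.
move=> mf; have mE : measurable_fun B (EFin \o f) by exact/measurable_EFinP.
have pos := ge0_integral_density mD (measurable_id (D := D)) mh h0 mB nuE.
rewrite [LHS]integralE [RHS]integralE.
rewrite (pos ((EFin \o f)^\+)%E (measurable_funepos mE) (fun y _ => funepos_ge0 _ y)).
rewrite (pos ((EFin \o f)^\-)%E (measurable_funeneg mE) (fun y _ => funeneg_ge0 _ y)).
apply: (congr2 (fun a b => a - b)%E).
  apply: eq_integral => u; rewrite inE => -[Du _]; rewrite !funeposE /= EFinM maxe_pMl ?lee_fin ?h0//.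
  by rewrite mul0e.
apply: eq_integral => u; rewrite inE => -[Du _]; rewrite !funenegE /= -mulNr EFinM maxe_pMl ?lee_fin ?h0//.
by rewrite mul0e.
Qed.

End integral_density.

Section C0_closure.
Context {R : realType} (n N : nat) (S : set 'rV[R]_N).
Implicit Types (F G : 'rV[R]_N -> R).

Lemma C0_surfaceD F G : C0_surface n S F -> C0_surface n S G -> C0_surface n S (fun x => F x + G x).
Proof. by move=> cF cG c u cu; exact: (continuousD (cF c u cu) (cG c u cu)). Qed.

Lemma C0_surfaceM F G : C0_surface n S F -> C0_surface n S G -> C0_surface n S (fun x => F x * G x).
Proof. by move=> cF cG c u cu; exact: (continuousM (cF c u cu) (cG c u cu)). Qed.

Lemma C0_surface_cst (a : R) : C0_surface n S (fun=> a).
Proof. by move=> c u cu; exact: cst_continuous. Qed.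

Lemma C0_surface_sum (I : Type) (r : seq I) (F : I -> 'rV[R]_N -> R) :
  (forall i, C0_surface n S (F i)) -> C0_surface n S (fun x => \sum_(i <- r) F i x).
Proof.
move=> cF; elim: r => [|i r ih].
  by under eq_fun do rewrite big_nil; exact: C0_surface_cst.
by under eq_fun do rewrite big_cons; exact: C0_surfaceD.
Qed.

Lemma C0_surface_comp F (g : R -> R) : C0_surface n S F -> continuous g ->
  C0_surface n S (fun x => g (F x)).
Proof. by move=> cF cg c u cu; apply: (continuous_comp (cF c u cu)); exact: cg. Qed.

Lemma C0_surface_coord j : C0_surface n S (fun x => x 0 j).
Proof. exact/C1_surface_C0/C1_surface_coord. Qed.

Lemma C0_surface_sqnorm (f : 'rV[R]_N -> 'rV[R]_N) : (forall j, C0_surface n S (fun x => f x 0 j)) ->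
  C0_surface n S (fun x => sqnorm (f x)).
Proof.
move=> cf; have -> : (fun x => sqnorm (f x)) = (fun x => \sum_j f x 0 j * f x 0 j).
  by apply/funext => x; rewrite /sqnorm dotE.
by apply: C0_surface_sum => j; exact: C0_surfaceM.
Qed.

Lemma C0_surface_mulmx (f : 'rV[R]_N -> 'rV[R]_N) (A : 'rV[R]_N -> 'M[R]_N) j :
  (forall j, C0_surface n S (fun x => f x 0 j)) -> (forall i j, C0_surface n S (fun x => A x i j)) ->
  C0_surface n S (fun x => (f x *m A x) 0 j).
Proof.
move=> cf cA; have -> : (fun x => (f x *m A x) 0 j) = (fun x => \sum_i f x 0 i * A x i j).
  by apply/funext => x; rewrite mxE.
by apply: C0_surface_sum => i; exact: C0_surfaceM.
Qed.

Lemma C0_surfaceV F : C0_surface n S F -> (forall x, S x -> F x != 0) ->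
  C0_surface n S (fun x => (F x)^-1).
Proof.
move=> cF F0 c u cu; apply: (@continuousV _ _ (F \o chart_par c)); last exact: cF.
by apply: F0; have [] := chart_parS cu.
Qed.

Hypotheses (sS : is_submanifold n S) (cS : compact S).

Lemma C0_surface_integrable F : C0_surface n S F -> (riemannian_volume n S).-integrable S (EFin \o F).
Proof.
move=> cF; have [C C0 hC] := C0_surface_bounded sS cS cF.
have mF := C0_surface_measurable sS cS cF.
have mS : measurable (S : set (borelV R N)) := measurable_surface cS.
apply/integrableP; split; first by apply/measurable_EFinP; exact: mF.
apply: (@le_lt_trans _ _ (\int[riemannian_volume n S]_(x in S) (cst C%:E x))%E).
  apply: ge0_le_integral => //.
  by apply/measurable_EFinP; apply: measurableT_comp => //; exact: mF.
by rewrite integral_cst// lte_mul_pinfty ?lee_fin ?ltW//; exact: surface_volume_lty.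
Qed.

End C0_closure.

(** * Gaussian mixtures over the submanifold *)

Section gaussian_laplace.
Context {R : realType} (n N : nat) (S : set 'rV[R]_N) (phi : 'rV[R]_N -> R) (p0 : 'rV[R]_N).
Hypotheses (sS : is_submanifold n S) (cS : compact S).
Hypotheses (cphi : C1_surface n S phi) (phi0 : forall x, S x -> 0 < phi x) (Sp0 : S p0).
Local Notation vol := (riemannian_volume n S).
Local Notation gd := (@gaussian_density R n N).
Local Notation Q := (nproj n S).
Local Notation c0 := ((4 * pi : R) `^ (- (n%:R / 2))).

(* The core estimate is about total functions: points off S are sent to p0. *)
Definition retract (t : borelV R N) : borelV R N := if (t : 'rV_N) \in S then t else p0.

Lemma retractS t : S (retract t).
Proof. by rewrite /retract; case: ifPn => //; rewrite inE. Qed.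

Lemma retractE t : S t -> retract t = t.
Proof. by move=> St; rewrite /retract mem_set. Qed.

Lemma measurable_retract (G : 'rV[R]_N -> R) : measurable_fun (S : set (borelV R N)) G ->
  measurable_fun setT (fun t => G (retract t)).
Proof.
move=> mG; have mS : measurable (S : set (borelV R N)) := measurable_surface cS.
rewrite -(setUv S); apply/measurable_funU => //; first exact: measurableC.
split.
  by apply: eq_measurable_fun mG => t; rewrite inE => St; rewrite retractE.
apply: (@eq_measurable_fun _ _ _ _ _ (cst (G p0))) => [t|]; last exact: measurable_cst.
by rewrite inE => St; rewrite /retract memNset.
Qed.

Definition weight (x : 'rV[R]_N) : R := phi x * gd x.

Lemma C0_phi : C0_surface n S phi. Proof. exact: C1_surface_C0. Qed.

Lemma C0_expR F : C0_surface n S F -> C0_surface n S (fun x => expR (F x)).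
Proof. by move=> cF; apply: (C0_surface_comp cF); exact: continuous_expR. Qed.

Lemma C0_weight : C0_surface n S weight.
Proof.
apply: C0_surfaceM; first exact: C0_phi.
apply: C0_surfaceM; first exact: C0_surface_cst.
apply: C0_expR; have -> : (fun x : 'rV[R]_N => - (sqnorm x / 4)) = (fun x => -4^-1 * sqnorm x).
  by apply/funext => x; rewrite mulNr mulrC.
apply: C0_surfaceM; first exact: C0_surface_cst.
by apply: C0_surface_sqnorm => j; exact: C0_surface_coord.
Qed.

Lemma c0_gt0 : 0 < c0. Proof. by rewrite powR_gt0// mulr_gt0// pi_gt0. Qed.

Lemma c0_sqrt : c0 * Num.sqrt (4 * pi) ^+ n = 1.
Proof.
have p4 : 0 < 4 * pi :> R by rewrite mulr_gt0// pi_gt0.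
rewrite -powR12_sqrt ?(ltW p4)// -powR_mulrn ?powR_ge0// -powRrM powRN.
by rewrite [2^-1 * _]mulrC mulVf// gt_eqF// powR_gt0.
Qed.

Lemma weight_gt0 x : S x -> 0 < weight x.
Proof. by move=> Sx; rewrite !mulr_gt0 ?phi0 ?expR_gt0 ?c0_gt0. Qed.

Variable nu : {finite_measure set (borelV R N) -> \bar R}.
Hypothesis nuE : forall A : set (borelV R N), measurable A ->
  nu A = (\int[vol]_(x in S `&` A) (weight x)%:E)%E.

Lemma integral_nu G : C0_surface n S G ->
  (\int[nu]_t G (retract t))%:E = (\int[vol]_(x in S) (G x * weight x)%:E)%E.
Proof.
move=> cG; have mS : measurable (S : set (borelV R N)) := measurable_surface cS.
have mG := C0_surface_measurable sS cS cG.
have h : (\int[nu]_t (G (retract t))%:E = \int[vol]_(x in S) (G x * weight x)%:E)%E.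
  rewrite (@integral_density _ (borelV R N) R vol nu S setT weight mS
    (C0_surface_measurable sS cS C0_weight) (fun x Sx => ltW (weight_gt0 Sx)) measurableT
    (fun A mA _ => nuE mA) _ (measurable_retract mG)) setIT.
  by apply: eq_integral => x; rewrite inE => Sx; rewrite retractE.
rewrite /Rintegral h fineK//; apply: integrable_fin_num => //.
exact: (C0_surface_integrable sS cS (C0_surfaceM cG C0_weight)).
Qed.

(** Used at scale 1 for the positivity of the mass of [nu], and at scale s for the mixtures. *)
Lemma volume_lower : exists2 k : R, 0 < k & forall (f : 'rV[R]_N -> R) (a : R) y s,
  measurable_fun (S : set (borelV R N)) f -> 0 <= a -> S y -> 0 < s -> s <= 1 ->
  (forall x, S x -> a * expR (- (sqnorm (x - y) / (2 * s ^+ 2))) <= f x) ->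
  ((a * (k * s ^+ n))%:E <= \int[vol]_(x in S) (f x)%:E)%E.
Proof.
have [k k0 hk] := lower_volume sS cS; exists k => // f a y s mf a0 Sy s0 s1 h.
have mS : measurable (S : set (borelV R N)) := measurable_surface cS.
have me : measurable_fun setT (fun x : borelV R N => expR (- (sqnorm ((x : 'rV_N) - y) / (2 * s ^+ 2)))).
  apply: measurableT_comp => //; apply: measurableT_comp => //.
  by apply: measurable_funM => //; apply: measurable_sqnorm; apply: measurable_rVD.
apply: (@le_trans _ _ (a%:E * \int[vol]_(x in S) (expR (- (sqnorm ((x : 'rV_N) - y) / (2 * s ^+ 2))))%:E)%E).
  by rewrite EFinM lee_wpmul2l ?lee_fin//; exact: hk.
rewrite -ge0_integralZl_EFin//; last by apply/measurable_EFinP; exact: measurable_funTS.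
apply: ge0_le_integral => //.
- by move=> x _; rewrite mule_ge0// lee_fin// expR_ge0.
- by apply: measurable_funeM; apply/measurable_EFinP; exact: measurable_funTS.
- by apply/measurable_EFinP.
Qed.

Lemma C0_lower F : C0_surface n S F -> (forall x, S x -> 0 < F x) ->
  exists2 a : R, 0 < a & forall x, S x -> a <= F x.
Proof.
move=> cF F0; have [C C0 hC] := C0_surface_bounded sS cS (C0_surfaceV cF (fun x Sx => lt0r_neq0 (F0 x Sx))).
exists C^-1; first by rewrite invr_gt0.
move=> x Sx; have := hC x Sx; rewrite ger0_norm ?invr_ge0 ?(ltW (F0 _ Sx))// => h.
by rewrite -[F x]invrK lef_pV2// posrE ?invr_gt0 ?F0.
Qed.

Lemma nu_gt0 : 0 < fine (nu setT).
Proof.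
have [k k0 hk] := volume_lower; have [a a0 ha] := C0_lower C0_weight weight_gt0.
have mw := C0_surface_measurable sS cS C0_weight.
have h : ((a * (k * 1 ^+ n))%:E <= nu setT)%E.
  rewrite nuE// setIT; apply: (hk weight a p0 1 mw (ltW a0) Sp0 ltr01 (lexx 1)) => x Sx.
  rewrite (le_trans _ (ha x Sx))// ler_piMr ?(ltW a0)// -expR0 ler_expR oppr_le0.
  by rewrite divr_ge0 ?sqnorm_ge0.
apply: (@lt_le_trans _ _ (a * (k * 1 ^+ n))); first by rewrite expr1n mulr1 mulr_gt0.
by rewrite -lee_fin fineK// fin_num_measure.
Qed.

Local Notation grad := (gradient n S).
Local Notation H := (mean_curvature n S).

Definition eta (x : 'rV[R]_N) : 'rV[R]_N := (phi x)^-1 *: grad phi x.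
Definition zeta (x : 'rV[R]_N) : 'rV[R]_N := H x + 2^-1 *: (x *m Q x).
Definition gaussian_drift (x : 'rV[R]_N) : 'rV[R]_N := eta x + zeta x.

Lemma C0_eta j : C0_surface n S (fun x => eta x 0 j).
Proof.
have -> : (fun x => eta x 0 j) = (fun x => (phi x)^-1 * grad phi x 0 j).
  by apply/funext => x; rewrite mxE.
apply: C0_surfaceM; last exact: C0_gradient.
by apply: (C0_surfaceV C0_phi) => x Sx; rewrite lt0r_neq0// phi0.
Qed.

Lemma C0_zeta j : C0_surface n S (fun x => zeta x 0 j).
Proof.
have -> : (fun x => zeta x 0 j) = (fun x => H x 0 j + 2^-1 * (x *m Q x) 0 j).
  by apply/funext => x; rewrite [LHS]mxE [X in _ + X = _]mxE.
apply: C0_surfaceD; first exact: C0_mean_curvature.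
apply: C0_surfaceM; first exact: C0_surface_cst.
apply: C0_surface_mulmx => [k|i k]; first exact: C0_surface_coord.
exact: C0_nproj.
Qed.

Lemma C0_gaussian_drift j : C0_surface n S (fun x => gaussian_drift x 0 j).
Proof.
have -> : (fun x => gaussian_drift x 0 j) = (fun x => eta x 0 j + zeta x 0 j).
  by apply/funext => x; rewrite mxE.
by apply: C0_surfaceD; [exact: C0_eta|exact: C0_zeta].
Qed.

Lemma sqnorm_gaussian_drift x : sqnorm (gaussian_drift x) = sqnorm (eta x) + sqnorm (zeta x).
Proof.
rewrite sqnormD (@dot_tangent_normal _ n _ S x) ?mulr0 ?addr0//.
  by apply: scalemx_sub; exact: gradient_tangent.
apply: addmx_sub; first exact: mean_curvature_normal.
apply: scalemx_sub; rewrite -normal_partE; exact: proj_mx_sub.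
Qed.

Lemma mehler_weight r s x y : 0 < s -> r ^+ 2 + s ^+ 2 = 1 ->
  mehler r s x y * gd x = (c0 / s ^+ N) *
    (expR (sqnorm y / 4) * (expR (- (sqnorm x / 4)) * expR (- (sqnorm (y - r *: x) / (4 * s ^+ 2))))).
Proof.
move=> s0 rs; rewrite /mehler /gaussian_density.
rewrite mulrACA -!expRD [X in X * _ = _]mulrC; apply: (congr1 (fun t => _ * expR t)).
rewrite sqnormB sqnormZ dotZr (dotC y x).
have -> : r ^+ 2 = 1 - s ^+ 2 by rewrite -rs addrK.
by field; rewrite gt_eqF.
Qed.

Lemma C0_mehler r s y : C0_surface n S (fun x => mehler r s x y).
Proof.
apply: C0_surfaceM; first exact: C0_surface_cst.
apply: C0_expR.
have -> : (fun x => (2 * r * dot x y - r ^+ 2 * sqnorm x - r ^+ 2 * sqnorm y) / (4 * s ^+ 2)) =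
   quadratic (- (r ^+ 2 * sqnorm y) / (4 * s ^+ 2)) (- r ^+ 2 / (4 * s ^+ 2)) ((2 * r / (4 * s ^+ 2)) *: y).
  by apply/funext => x; rewrite /quadratic dotZr; ring.
exact/C1_surface_C0/C1_surface_quadratic.
Qed.

Lemma C1_surface_expR F : C1_surface n S F -> C1_surface n S (fun x => expR (F x)).
Proof. by move=> cF; apply: (C1_surface_comp cF); exact: continuous_expR. Qed.

(** The divergence theorem is applied to the product F of phi, of [mehler r s _ y] and of the
    Gaussian density, written as phi times the exponential of a quadratic function so that its
    gradient is explicit. *)
Lemma gaussian_drift_divergence : divergence_identity nu retract
  (fun t => gaussian_drift (retract t)) (fun t => Q (retract t)).
Proof.
move=> r s y i r0 s0 rs.
pose G x := ((r / (2 * s ^+ 2)) *: ((y - r *: x) *m (1%:M - Q x)) +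
  gaussian_drift x - 2^-1 *: x) 0 i * mehler r s x y.
have GE x : G x = ((r / (2 * s ^+ 2)) * (((y - r *: x) *m (1%:M - Q x)) 0 i) +
  gaussian_drift x 0 i + - 2^-1 * x 0 i) * mehler r s x y.
  rewrite /G; apply: (congr1 (fun t => t * _)).
  by rewrite [LHS]mxE [X in X + _ = _]mxE [X in _ + X = _]mxE mulNr [X in _ - X = _]mxE [X in X + _ + _ = _]mxE.
have cG : C0_surface n S G.
  rewrite (funext GE); apply: C0_surfaceM; last exact: C0_mehler.
  apply: C0_surfaceD; last by apply: C0_surfaceM; [exact: C0_surface_cst|exact: C0_surface_coord].
  apply: C0_surfaceD; last exact: C0_gaussian_drift.
  apply: C0_surfaceM; first exact: C0_surface_cst.
  apply: C0_surface_mulmx => [j|j k].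
    have -> : (fun x : 'rV[R]_N => (y - r *: x) 0 j) = (fun x => y 0 j + - r * x 0 j).
      by apply/funext => x; rewrite !mxE mulNr.
    apply: C0_surfaceD; first exact: C0_surface_cst.
    by apply: C0_surfaceM; [exact: C0_surface_cst|exact: C0_surface_coord].
  have -> : (fun x : 'rV[R]_N => (1%:M - Q x) j k) = (fun x => (1%:M : 'M[R]_N) j k + - 1 * Q x j k).
    by apply/funext => x; rewrite [LHS]mxE [X in _ + X = _]mxE mulN1r.
  apply: C0_surfaceD; first exact: C0_surface_cst.
  by apply: C0_surfaceM; [exact: C0_surface_cst|exact: C0_nproj].
apply: EFin_inj; rewrite (integral_nu cG).
(* The coefficients of |x|^2 and x in the sum of both exponents; [k] absorbs the constant prefactor
   as a logarithm. *)
pose b := - (4^-1 + r ^+ 2 / (4 * s ^+ 2)); pose v := (2 * r / (4 * s ^+ 2)) *: y.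
pose k := ln (c0 / s ^+ N * expR (- (r ^+ 2 * sqnorm y) / (4 * s ^+ 2))).
have kE : expR k = c0 / s ^+ N * expR (- (r ^+ 2 * sqnorm y) / (4 * s ^+ 2)).
  by rewrite lnK// posrE mulr_gt0 ?expR_gt0// divr_gt0 ?exprn_gt0// c0_gt0.
pose L := quadratic k b v.
have cL : C1_surface n S L := @C1_surface_quadratic R n N S k b v.
have cE := C1_surface_expR cL.
pose F x := phi x * expR (L x).
have cF : C1_surface n S F := C1_surfaceM cphi cE.
have LE x : mehler r s x y * gd x = expR (L x).
  rewrite /L /quadratic expRD kE /mehler /gaussian_density.
  rewrite mulrACA -expRD [X in X * _ = _]mulrC -[RHS]mulrA -[in RHS]expRD.
  apply: (congr1 (fun t => _ * expR t)); rewrite /b /v dotZr; field.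
  by rewrite gt_eqF.
have [_ E0] := surface_divergence sS cS i cF; apply: (eq_trans _ E0).
apply: eq_integral => x; rewrite inE => Sx; apply: congr1.
rewrite /divergence_density /F (gradientM sS cphi cE Sx).
rewrite (gradient_comp sS cL (fun t => is_derive_expR t) (@continuous_expR R) Sx) (gradient_quadratic sS k b v Sx).
have -> : weight x = phi x * gd x by [].
have -> : G x * (phi x * gd x) = phi x *
    (((r / (2 * s ^+ 2)) *: ((y - r *: x) *m (1%:M - Q x)) + gaussian_drift x - 2^-1 *: x) 0 i * expR (L x)).
  by rewrite -LE mulrCA -(mulrA _ (mehler r s x y)).
have p0' : phi x != 0 by rewrite lt0r_neq0// phi0.
have -> : grad phi x = phi x *: eta x by rewrite scalerA mulfV// scale1r.
have -> : (2 * b) *: x + v = (r / (2 * s ^+ 2)) *: (y - r *: x) - 2^-1 *: x.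
  by apply/rowP => j; rewrite /b /v !mxE; field; rewrite gt_eqF.
set w := y - r *: x; clearbody w.
rewrite mulmxBl -scalemxAl.
set A := (_ *: (w *m _)).
have -> : (2^-1 *: x) *m (1%:M - Q x) = 2^-1 *: x - 2^-1 *: (x *m Q x).
  by rewrite mulmxBr mulmx1 -scalemxAl.
set B := 2^-1 *: (x *m Q x); set x2 := 2^-1 *: x.
have -> : gaussian_drift x = eta x + (H x + B) by [].
clearbody A B x2.
have E1 : (A + (eta x + (H x + B)) - x2) 0 i = A 0 i + (eta x 0 i + (H x 0 i + B 0 i)) - x2 0 i.
  by rewrite !mxE.
have E2 : (phi x *: (expR (L x) *: (A - (x2 - B))) + expR (L x) *: (phi x *: eta x)) 0 i =
  phi x * (expR (L x) * (A 0 i - (x2 0 i - B 0 i))) + expR (L x) * (phi x * eta x 0 i).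
  by rewrite !mxE.
by rewrite E1 E2; ring.
Qed.

Definition kern r s (z x0 x : 'rV[R]_N) : R := phi x * expR (- (sqnorm x / 4)) * bell r s z x0 x.

Lemma C0_amplitude : C0_surface n S (fun x => phi x * expR (- (sqnorm x / 4))).
Proof.
apply: C0_surfaceM; first exact: C0_phi.
apply: C0_expR; have -> : (fun x : 'rV[R]_N => - (sqnorm x / 4)) = (fun x => -4^-1 * sqnorm x).
  by apply/funext => x; rewrite mulNr mulrC.
apply: C0_surfaceM; first exact: C0_surface_cst.
by apply: C0_surface_sqnorm => j; exact: C0_surface_coord.
Qed.

Lemma C0_kern r s z x0 : C0_surface n S (kern r s z x0).
Proof.
apply: C0_surfaceM; first exact: C0_amplitude.
apply: C0_expR; have -> : (fun x : 'rV[R]_N => - (sqnorm (z - (r / s) *: (x - x0)) / 4)) =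
    (fun x => -4^-1 * sqnorm (z - (r / s) *: (x - x0))).
  by apply/funext => x; rewrite mulNr mulrC.
apply: C0_surfaceM; first exact: C0_surface_cst.
apply: C0_surface_sqnorm => j.
have -> : (fun x : 'rV[R]_N => (z - (r / s) *: (x - x0)) 0 j) = (fun x => (z 0 j + r / s * x0 0 j) + - (r / s) * x 0 j).
  by apply/funext => x; rewrite !mxE; ring.
apply: C0_surfaceD; first exact: C0_surface_cst.
by apply: C0_surfaceM; [exact: C0_surface_cst|exact: C0_surface_coord].
Qed.

Lemma kern_ge0 r s z x0 x : S x -> 0 <= kern r s z x0 x.
Proof. by move=> Sx; rewrite !mulr_ge0 ?expR_ge0// ltW// phi0. Qed.

(** The factor s^(N - n) compensates the growth of the density of a measure on an n-dimensional set
    smoothed at scale s in R^N; on logarithms it is the term m ln s of [log_density_le]. *)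
Definition scaled_mixture r s x0 z : R :=
  mixture nu retract r s (r *: x0 + s *: z) * (s ^+ N / s ^+ n).

Lemma scaled_mixtureE r s x0 z : 0 < s -> r ^+ 2 + s ^+ 2 = 1 ->
  (scaled_mixture r s x0 z)%:E = ((c0 * expR (sqnorm (r *: x0 + s *: z) / 4))%:E *
    ((s ^+ n)^-1%:E * \int[vol]_(x in S) (kern r s z x0 x)%:E))%E.
Proof.
move=> s0 rs; rewrite /scaled_mixture /mixture; set y := r *: x0 + s *: z.
have mS : measurable (S : set (borelV R N)) := measurable_surface cS.
rewrite EFinM (integral_nu (@C0_mehler r s y)).
have E : (\int[vol]_(x in S) (mehler r s x y * weight x)%:E =
   (c0 / s ^+ N * expR (sqnorm y / 4))%:E * \int[vol]_(x in S) (kern r s z x0 x)%:E)%E.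
  rewrite -integralZl//; last exact: (C0_surface_integrable sS cS (@C0_kern r s z x0)).
  apply: eq_integral => x _; rewrite -EFinM; apply: congr1.
  rewrite /weight mulrCA mehler_weight// /kern /bell.
  have -> : y - r *: x = s *: (z - (r / s) *: (x - x0)).
    by apply/rowP => i; rewrite /y !mxE; field; rewrite gt_eqF.
  rewrite sqnormZ; set B := sqnorm (z - _).
  have -> : s ^+ 2 * B / (4 * s ^+ 2) = B / 4 by field; rewrite gt_eqF.
  by ring.
rewrite E muleC !muleA -!EFinM; apply: (congr1 (fun t => t%:E * _)%E).
have sN : s ^+ N != 0 by rewrite expf_neq0// gt_eqF.
have sn : s ^+ n != 0 by rewrite expf_neq0// gt_eqF.
by field; rewrite sN sn.
Qed.

Lemma ln_scaled_mixture r s x0 z : 0 < s -> 0 < scaled_mixture r s x0 z ->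
  ln (mixture nu retract r s (r *: x0 + s *: z)) + (N%:R - n%:R) * ln s = ln (scaled_mixture r s x0 z).
Proof.
move=> s0; rewrite /scaled_mixture; set F := mixture _ _ _ _ _ => D0.
have sN : 0 < s ^+ N by exact: exprn_gt0.
have sn : 0 < s ^+ n by exact: exprn_gt0.
have F0 : 0 < F by move: D0; rewrite pmulr_lgt0// divr_gt0.
rewrite lnM ?posrE ?divr_gt0// ln_div ?posrE// !lnXn//.
rewrite -(mulr_natl _ N) -(mulr_natl _ n); ring.
Qed.

(** The logarithm of this bound is the integrable quadratic minorant that Fatou's lemma asks for. *)
Lemma scaled_mixture_lower : exists2 k : R, 0 < k & forall r s x0 z, 0 <= r -> 0 < s ->
  r ^+ 2 + s ^+ 2 = 1 -> S x0 -> k * expR (- (sqnorm z / 2)) <= scaled_mixture r s x0 z.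
Proof.
have [k k0 hk] := volume_lower.
have [a a0 ha] := C0_lower C0_amplitude (fun x Sx => mulr_gt0 (phi0 Sx) (expR_gt0 _)).
exists (c0 * (a * k)); first by rewrite !mulr_gt0// c0_gt0.
move=> r s x0 z r0 s0 rs Sx.
have sn : 0 < s ^+ n by exact: exprn_gt0.
have s1 : s <= 1.
  by rewrite -(@ler_sqr R) ?nnegrE ?(ltW s0)// expr1n -rs lerDr sqr_ge0.
have r1 : r ^+ 2 <= 1 by rewrite -rs lerDl sqr_ge0.
have aE0 : 0 <= a * expR (- (sqnorm z / 2)) by rewrite mulr_ge0 ?expR_ge0// ltW.
have h := hk (kern r s z x0) _ x0 s (C0_surface_measurable sS cS (@C0_kern r s z x0)) aE0 Sx s0 s1.
rewrite -lee_fin scaled_mixtureE//.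
have {}h := h _.
apply: (@le_trans _ _ ((c0 * expR (sqnorm (r *: x0 + s *: z) / 4))%:E *
    ((s ^+ n)^-1%:E * (a * expR (- (sqnorm z / 2)) * (k * s ^+ n))%:E))%E); last first.
  apply: lee_wpmul2l; first by rewrite lee_fin mulr_ge0 ?expR_ge0// ltW// c0_gt0.
  apply: lee_wpmul2l; first by rewrite lee_fin invr_ge0 ltW.
  apply: h => x Sx'; rewrite /kern -mulrA; apply: ler_pM; rewrite ?(ltW a0) ?mulr_ge0 ?expR_ge0//.
    exact: ha.
  rewrite -expRD ler_expR.
  (* Separating z from x doubles the exponents: this is where 2 s^2 in [lower_volume] and |z|^2 / 2
     come from. *)
  have := sqnormB_le z ((r / s) *: (x - x0)); rewrite sqnormZ.
  have : (r / s) ^+ 2 * sqnorm (x - x0) <= sqnorm (x - x0) / s ^+ 2.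
    rewrite expr_div_n mulrAC ler_wpM2r ?invr_ge0 ?sqr_ge0// ler_piMl ?sqnorm_ge0//.
  have -> : sqnorm (x - x0) / (2 * s ^+ 2) = sqnorm (x - x0) / s ^+ 2 / 2.
    by field; rewrite gt_eqF.
  by move=> h1 h2; lra.
rewrite -!EFinM lee_fin.
have -> : c0 * expR (sqnorm (r *: x0 + s *: z) / 4) * ((s ^+ n)^-1 * (a * expR (- (sqnorm z / 2)) * (k * s ^+ n))) =
  expR (sqnorm (r *: x0 + s *: z) / 4) * (c0 * (a * k) * expR (- (sqnorm z / 2))).
  by field; rewrite gt_eqF.
apply: ler_peMl; first by rewrite !mulr_ge0 ?expR_ge0 ?(ltW c0_gt0) ?(ltW a0) ?(ltW k0).
by rewrite -expR0 ler_expR divr_ge0 ?sqnorm_ge0.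
Qed.

(** Fatou's lemma needs only a lower limit. As the kernel is nonnegative, the part of S outside a
    small piece of one chart is dropped, and Laplace's method is applied to that piece. *)
Lemma scaled_mixture_limit x0 z (r_ s_ : nat -> R) (l : R) : S x0 ->
  (forall k, 0 < s_ k) -> (forall k, r_ k ^+ 2 + s_ k ^+ 2 = 1) -> (forall k, 1 / 2 <= r_ k) ->
  s_ @ \oo --> (0 : R) -> r_ @ \oo --> (1 : R) ->
  l < phi x0 * expR (- (sqnorm (z *m Q x0) / 4)) ->
  \forall k \near \oo, l <= scaled_mixture (r_ k) (s_ k) x0 z.
Proof.
move=> Sx s0 rs r2 sl rl ll; have [c cx] := sS Sx.
have mS : measurable (S : set (borelV R N)) := measurable_surface cS.
have [cu0 E0] := chart_coordK Sx cx; set u0 := chart_coord c x0 in cu0 E0.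
have [rho [K [rho0 ht]]] := tame_near Sx cx.
pose V : set 'rV[R]_N := ball x0 rho.
have [|K0 wK lipK _ Vc] := ht V; first by move=> x _ /ball_rVE; rewrite distrC.
have mV : measurable (V : set (borelV R N)) by apply: open_borel; exact: ball_open.
pose B : set (borelV R N) := S `&` V.
have mB : measurable B by exact: measurableI.
have Bc : B `<=` chart_nbd c by move=> x [Sx' Vx]; exact: Vc.
pose E : set (borelV R n) := chart_dom c `&` chart_par c @^-1` B.
have mE : measurable E.
  by apply: (@measurable_parE _ _ _ _ c (chart_dom c)) => //; exact: measurable_dom.
pose A x := phi x * expR (- (sqnorm x / 4)).
have [W W0 hW] := C0_surface_bounded sS cS C0_amplitude.
pose q u := A (chart_par c u) * vdens c u.
have A0 x : S x -> 0 <= A x by move=> Sx'; rewrite mulr_ge0 ?expR_ge0// ltW// phi0.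
have cq u : E u -> {for u, continuous q}.
  by move=> [cu _]; exact: (continuousM (C0_amplitude cu) (C1_vdens cu).1).
have mq : measurable_fun E q.
  apply: (@measurable_funS _ _ (borelV R n) _ (chart_dom c)) => //; first exact: measurable_dom.
    by move=> u [].
  apply: open_continuous_borel => [|u cu]; first exact: chart_dom_open.
  exact: (continuousM (C0_amplitude cu) (C1_vdens cu).1).
have Ed : E `<=` chart_dom c by move=> u [].
have q0 u : E u -> 0 <= q u.
  by move=> [cu [Su _]]; rewrite mulr_ge0 ?A0// sqrtr_ge0.
have qW u : E u -> q u <= W * K.
  move=> [cu [Su Vu]]; apply: ler_pM; rewrite ?A0 ?sqrtr_ge0 ?wK//.
  exact: le_trans (ler_norm _) (hW _ Su).
have lipE u u' : E u -> E u' -> `|u - u'| <= K * `|chart_par c u - chart_par c u'|.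
  by move=> [cu [_ Vu]] [cu' [_ Vu']]; exact: lipK.
have Vx0 : V x0 by exact: ballxx.
have Eu0 : E u0 by split=> //=; rewrite E0.
have nE : nbhs u0 E.
  have nd : nbhs u0 (chart_dom c) by apply: open_nbhs_nbhs; split=> //; exact: chart_dom_open.
  have nV : nbhs u0 (chart_par c @^-1` V).
    by apply: (continuous_par cu0); rewrite E0; apply: open_nbhs_nbhs; split=> //; exact: ball_open.
  by apply: filterS2 nd nV => u cu Vu; split=> //; split=> //; have [] := chart_parS cu.
have lim := @laplace_limit R n N S c E q (W * K) K Ed mE mq q0 qW K0 (ltW (mulr_gt0 W0 K0)) lipE u0 z r_ s_
  Eu0 nE (cq u0 Eu0) s0 sl r2 rl.
set J := (fun k => _) in lim.
have JE k : (J k <= (s_ k ^+ n)^-1%:E * \int[vol]_(x in S) (kern (r_ k) (s_ k) z x0 x)%:E)%E.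
  apply: lee_wpmul2l; first by rewrite lee_fin invr_ge0 exprn_ge0// ltW.
  have mk := C0_surface_measurable sS cS (@C0_kern (r_ k) (s_ k) z x0).
  have mkB : measurable_fun B (EFin \o kern (r_ k) (s_ k) z x0).
    by apply/measurable_EFinP; apply: (measurable_funS mS _ mk) => x [].
  apply: (@le_trans _ _ (\int[vol]_(x in B) (kern (r_ k) (s_ k) z x0 x)%:E)%E); last first.
    apply: ge0_subset_integral => //; first exact/measurable_EFinP.
    - by move=> x Sx'; rewrite lee_fin kern_ge0.
    - by move=> x [].
  rewrite (ge0_integral_volume mB Bc mkB); last by move=> x [Sx' _]; rewrite lee_fin kern_ge0.
  rewrite le_eqVlt; apply/orP; left; apply/eqP; apply: eq_integral => u _.
  by rewrite /= -EFinM /q /kern -/(A _) E0 mulrAC.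
have lE : q u0 * (Num.sqrt (4 * pi) ^+ n / vdens c u0 *
    expR (- (sqnorm (z *m Q (chart_par c u0)) / 4))) =
    A x0 * (Num.sqrt (4 * pi) ^+ n * expR (- (sqnorm (z *m Q x0) / 4))).
  rewrite /q E0; have w0 : vdens c u0 != 0 by rewrite gt_eqF// vdens_gt0.
  by field.
have {}lim : J k @[k --> \oo] --> (A x0 * (Num.sqrt (4 * pi) ^+ n * expR (- (sqnorm (z *m Q x0) / 4))))%:E.
  by rewrite -lE; exact: lim.
have [fJ limJ] := (fine_cvgP _ _).1 lim.
pose g k := c0 * expR (sqnorm (r_ k *: x0 + s_ k *: z) / 4).
have cg : g @ \oo --> c0 * expR (sqnorm x0 / 4).
  apply: cvgM; first exact: cvg_cst.
  have h : sqnorm (r_ k *: x0 + s_ k *: z) / 4 @[k --> \oo] --> sqnorm x0 / 4.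
    apply: cvgM; last exact: cvg_cst.
    apply: cvg_sqnorm.
    move=> i; have -> : (fun k => (r_ k *: x0 + s_ k *: z) 0 i) = (fun k => r_ k * x0 0 i + s_ k * z 0 i).
      by apply/funext => k; rewrite !mxE.
    have h1 : r_ k * x0 0 i + s_ k * z 0 i @[k --> \oo] --> 1 * x0 0 i + 0 * z 0 i.
      by apply: cvgD; (apply: cvgM; [exact: rl || exact: sl|exact: cvg_cst]).
    have e1 : 1 * x0 0 i + 0 * z 0 i = x0 0 i by ring.
    exact: (eq_ind _ (fun l : R => r_ k * x0 0 i + s_ k * z 0 i @[k --> \oo] --> l) h1 _ e1).
  exact: (continuous_cvg _ (@continuous_expR R _) h).
have limE : c0 * expR (sqnorm x0 / 4) * (A x0 * (Num.sqrt (4 * pi) ^+ n * expR (- (sqnorm (z *m Q x0) / 4)))) =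
   phi x0 * expR (- (sqnorm (z *m Q x0) / 4)).
  rewrite /A; transitivity ((c0 * Num.sqrt (4 * pi) ^+ n) * (expR (sqnorm x0 / 4) * expR (- (sqnorm x0 / 4))) *
    (phi x0 * expR (- (sqnorm (z *m Q x0) / 4)))); first by ring.
  by rewrite c0_sqrt -expRD subrr expR0 !mul1r.
have gJ : g k * fine (J k) @[k --> \oo] --> phi x0 * expR (- (sqnorm (z *m Q x0) / 4)).
  by rewrite -limE; exact: (cvgM cg limJ).
have ev : \forall k \near \oo, l < g k * fine (J k) by exact: (cvgr_gt _ gJ).
apply: filterS2 fJ ev => k fk hk.
have DE := scaled_mixtureE x0 z (s0 k) (rs k).
rewrite -lee_fin DE; apply: (@le_trans _ _ ((g k)%:E * J k)%E).
  by rewrite -(fineK fk) -EFinM lee_fin; exact: ltW.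
have g0 : (0 <= (g k)%:E)%E by rewrite lee_fin (mulr_ge0 (ltW c0_gt0) (expR_ge0 _)).
exact: (lee_wpmul2l g0 (JE k)).
Qed.

(** Every integrand of the theorem has a factor phi, which turns the Gaussian measure into [nu]; in
    particular |grad phi|^2 / phi is |eta|^2 phi. *)
Lemma integral_gaussian G G' : C0_surface n S G' -> (forall x, S x -> G x = G' x * phi x) ->
  \int[gaussian_measure n S]_(x in S) G x = \int[nu]_t G' (retract t).
Proof.
move=> cG GE; have mS : measurable (S : set (borelV R N)) := measurable_surface cS.
have mG : measurable_fun (S : set (borelV R N)) G.
  apply: eq_measurable_fun (C0_surface_measurable sS cS (C0_surfaceM cG C0_phi)) => x.
  by rewrite inE => /GE ->.
have mgd : measurable_fun (S : set (borelV R N)) gd.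
  apply: eq_measurable_fun (C0_surface_measurable sS cS
    (C0_surfaceM C0_weight (C0_surfaceV C0_phi (fun x Sx => lt0r_neq0 (phi0 Sx))))) => x.
  by rewrite inE => Sx; rewrite /weight mulrAC mulfV ?mul1r// lt0r_neq0// phi0.
have gdE (A : set (borelV R N)) : measurable A -> A `<=` S ->
    gaussian_measure n S A = (\int[vol]_(x in S `&` A) (gd x)%:E)%E.
  by move=> _ AS; rewrite setIidr.
have gd0 x : S x -> 0 <= gd x by move=> _; rewrite mulr_ge0 ?expR_ge0// ltW// c0_gt0.
apply: EFin_inj; rewrite (integral_nu cG) /Rintegral.
have E : (\int[gaussian_measure n S]_(x in S) (G x)%:E =
    \int[vol]_(x in S) (G' x * weight x)%:E)%E.
  rewrite (@integral_density _ (borelV R N) R vol (gaussian_measure n S) S S gd mS mgd gd0 mS gdE G mG) setIid.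
  by apply: eq_integral => x; rewrite inE => Sx; rewrite GE// -mulrA.
rewrite E fineK//; apply: integrable_fin_num => //.
exact: (C0_surface_integrable sS cS (C0_surfaceM cG C0_weight)).
Qed.

End gaussian_laplace.

Theorem corollary2 (R : realType) (n m : nat) (S : set 'rV[R]_(n + m))
    (phi : 'rV[R]_(n + m) -> R) :
  (0 < n)%N -> (0 < m)%N ->
  is_submanifold n S -> compact S ->
  smooth_on_submanifold n S phi -> (forall x, S x -> 0 < phi x) ->
  let gamma := gaussian_measure n S in
  \int[gamma]_(x in S) (phi x * ln (phi x))
  - \int[gamma]_(x in S) (sqnorm (gradient n S phi x) / phi x)
  - \int[gamma]_(x in S)
      (phi x * sqnorm (mean_curvature n S x + 2^-1 *: normal_part n S x x))
  <= (\int[gamma]_(x in S) phi x) * ln (\int[gamma]_(x in S) phi x).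
Proof.
move=> n0 m0 sS cS sphi phi0; cbv zeta; set gamma := gaussian_measure n S.
(* A base point is needed to define [retract]; for empty S all the integrals are 0. *)
have [[p0 Sp0]|noS] := pselect (exists p, S p); last first.
  have -> : S = set0 by apply/seteqP; split=> // x Sx; apply: noS; exists x.
  by rewrite !Rintegral_set0 !subr0 mul0r.
have cphi : C1_surface n S phi.
  by move=> c; apply: smooth_on_C1; [exact: chart_dom_open|exact: sphi].
have mS : measurable (S : set (borelV R (n + m))) := measurable_surface cS.
have cW := C0_weight cphi.
have mW := C0_surface_measurable sS cS cW.
(* The measure phi gamma is built on the ambient space, hence this density is extended by zero off
   S. *)
pose h (t : borelV R (n + m)) : R := if (t : 'rV_(n + m)) \in S then weight n phi t else 0.
have h0 t : 0 <= h t.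
  by rewrite /h; case: ifPn => //; rewrite inE => St; rewrite ltW// (weight_gt0 n phi0).
have mh : measurable_fun setT h.
  rewrite -(setUv S); apply/measurable_funU => //; first exact: measurableC.
  split; first by apply: eq_measurable_fun mW => t; rewrite /h => ->.
  apply: (@eq_measurable_fun _ _ _ _ _ (cst (0 : R))) => [t|]; last exact: measurable_cst.
  by rewrite inE => St; rewrite /h memNset.
pose nu0 := density_measure (riemannian_volume n S) mh h0.
have nu0E (A : set (borelV R (n + m))) : measurable A ->
    nu0 A = (\int[riemannian_volume n S]_(x in S `&` A) (weight n phi x)%:E)%E.
  move=> mA; rewrite /nu0 /density_measure [LHS]integral_mkcond [RHS]integral_mkcond.
  apply: eq_integral => x _; rewrite /patch /h in_setI.
  by case: (x \in S); case: (x \in A).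
have fin : fin_num_fun nu0.
  move=> A mA; rewrite nu0E//; apply: integrable_fin_num; first exact: measurableI.
  apply: (integrableS mS) (C0_surface_integrable sS cS cW) => //; exact: measurableI.
pose F := @Measure_isFinite.Build _ _ _ nu0 fin.
pose nu : {finite_measure set (borelV R (n + m)) -> \bar R} := HB.pack nu0 F.
have nuE (A : set (borelV R (n + m))) : measurable A ->
    nu A = (\int[riemannian_volume n S]_(x in S `&` A) (weight n phi x)%:E)%E by exact: nu0E.

pose N := (n + m)%N.
pose X : borelV R N -> 'rV[R]_N := retract S p0.
have XS t : S (X t) := retractS Sp0 t.
pose a t : 'rV[R]_N := gaussian_drift n S phi (X t).
pose Q t : 'M[R]_N := nproj n S (X t).
have mre G : C0_surface n S G -> measurable_fun setT (fun t => G (X t)).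
  by move=> cG; exact: (measurable_retract p0 cS (C0_surface_measurable sS cS cG)).
have mX : measurable_fun setT (X : borelV R N -> borelV R N).
  by apply: measurable_fun_rV => i; apply: (mre (fun x => x 0 i)); exact: C0_surface_coord.
have ma : measurable_fun setT (a : borelV R N -> borelV R N).
  by apply: measurable_fun_rV => i; apply: (mre (fun x => gaussian_drift n S phi x 0 i)); exact: C0_gaussian_drift.
have mQ i j : measurable_fun setT (fun t => Q t i j).
  by apply: (mre (fun x => nproj n S x i j)); exact: C0_nproj.
have csq (f : 'rV[R]_N -> 'rV[R]_N) : (forall j, C0_surface n S (fun x => f x 0 j)) ->
    exists2 B, 0 < B & forall x, S x -> sqnorm (f x) <= B.
  move=> cf; have [B B0 hB] := C0_surface_bounded sS cS (C0_surface_sqnorm cf).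
  by exists B => // x Sx; exact: le_trans (ler_norm _) (hB x Sx).
have [B B0 hB] := csq id (@C0_surface_coord R n N S).
have [A _ hA] := csq (gaussian_drift n S phi) (C0_gaussian_drift cphi phi0).
have trQ t : (Q t)^T *m Q t = Q t /\ \tr (Q t) = N%:R - n%:R := nproj_trace sS (XS t).
have nN : 0 <= N%:R - n%:R :> R by rewrite subr_ge0 ler_nat leq_addr.
have M0 := nu_gt0 sS cS cphi phi0 Sp0 nuE.
have div := gaussian_drift_divergence p0 sS cS cphi phi0 nuE.
have [C1 C10 hC1] := C0_surface_bounded sS cS (C0_phi cphi).
have [k1 k10 hk1] := C0_lower sS cS (C0_phi cphi) phi0.
pose g t := ln (phi (X t)).
have mg : measurable_fun setT g.
  by apply: measurableT_comp; [exact: measurable_ln|exact: (mre _ (C0_phi cphi))].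
have gC t : `|g t| <= C1 + k1^-1.
  (* The bound ln t < t is applied to phi and to its inverse, phi lying between k1 and C1. *)
  have p0' := phi0 _ (XS t); rewrite ler_norml; apply/andP; split.
    rewrite lerNl -lnV ?posrE// ltW// (lt_le_trans (ln_sublinear _)) ?invr_gt0//.
    by rewrite -[leLHS]add0r lerD ?(ltW C10)// lef_pV2 ?posrE// hk1.
  rewrite ltW// (lt_le_trans (ln_sublinear p0'))// -[leLHS]addr0 lerD ?invr_ge0 ?(ltW k10)//.
  exact: le_trans (ler_norm _) (hC1 _ (XS t)).
(* Starting at 1 / 2 gives s^2 <= 1 / 4, hence r >= 1 / 2 as Laplace's method requires. *)
pose s_ (k : nat) : R := k.+2%:R^-1.
pose r_ (k : nat) : R := Num.sqrt (1 - s_ k ^+ 2).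
have s0 k : 0 < s_ k by rewrite invr_gt0.
have s2 k : s_ k ^+ 2 <= 4^-1.
  rewrite exprVn lef_pV2 ?posrE ?exprn_gt0// -natrX ler_nat.
  by rewrite (@leq_exp2r 2 k.+2 2).
have s1 k : 0 <= 1 - s_ k ^+ 2 by rewrite subr_ge0 (le_trans (s2 k))// invf_le1// ler1n.
have rs k : r_ k ^+ 2 + s_ k ^+ 2 = 1 by rewrite sqr_sqrtr// subrK.
have r2 k : 1 / 2 <= r_ k.
  rewrite -(@ler_sqr R) ?nnegrE ?sqrtr_ge0// sqr_sqrtr//.
  by have := s2 k; lra.
have sl : s_ @ \oo --> (0 : R).
  by have := @cvg_harmonic R; rewrite -cvg_shiftS.
have rl : r_ @ \oo --> (1 : R).
  rewrite -[X in _ --> X]sqrtr1; apply: (continuous_cvg _ (@sqrt_continuous R 1)).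
  rewrite -[X in _ --> X]subr0; apply: cvgB; first exact: cvg_cst.
  by rewrite -(mulr0 (0 : R)); apply: cvgM.
have [k2 k20 hk2] := scaled_mixture_lower p0 sS cS cphi phi0 nuE.
have D0 k t z : 0 < scaled_mixture n S p0 nu (r_ k) (s_ k) (X t) z.
  apply: (lt_le_trans _ (hk2 _ _ _ z (sqrtr_ge0 _) (s0 k) (rs k) (XS t))).
  by rewrite mulr_gt0 ?expR_gt0.
have lnD k t z := ln_scaled_mixture (s0 k) (D0 k t z).
have main := @log_density_le R _ (borelV R N) nu N (N%:R - n%:R) X a Q B A mX ma mQ
  (fun t => hB _ (XS t)) (fun t => hA _ (XS t)) trQ (ltW B0) M0 div nN g (C1 + k1^-1) (`|ln k2| + 2^-1)
  r_ s_ mg gC (fun k => And3 (sqrtr_ge0 _) (s0 k) (rs k)) rl.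
have low k t (z : 'rV[R]_N) : - ((`|ln k2| + 2^-1) * (1 + sqnorm z)) <=
    ln (mixture nu X (r_ k) (s_ k) (rotate X (r_ k) (s_ k) (t, z))) + (N%:R - n%:R) * ln (s_ k).
  rewrite /rotate lnD; have Dl := hk2 _ _ _ z (sqrtr_ge0 _) (s0 k) (rs k) (XS t).
  have kz : 0 < k2 * expR (- (sqnorm z / 2)) by rewrite mulr_gt0 ?expR_gt0.
  have : ln (k2 * expR (- (sqnorm z / 2))) <= ln (scaled_mixture n S p0 nu (r_ k) (s_ k) (X t) z).
    by rewrite ler_ln ?posrE.
  apply: le_trans; rewrite lnM ?posrE ?expR_gt0// expRK.
  have h1 : - `|ln k2| <= ln k2 by rewrite lerNl -normrN ler_norm.
  have h2 := mulr_ge0 (normr_ge0 (ln k2)) (sqnorm_ge0 z).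
  have h3 := sqnorm_ge0 z; rewrite mulrDr mulr1 mulrDl.
  clear -h1 h2 h3; lra.
have lim t (z : 'rV[R]_N) (eps : R) : 0 < eps -> \forall k \near \oo,
    g t - sqnorm (z *m Q t) / 4 - eps <=
    ln (mixture nu X (r_ k) (s_ k) (rotate X (r_ k) (s_ k) (t, z))) + (N%:R - n%:R) * ln (s_ k).
  move=> eps0.
  (* The slack eps puts the value strictly below the limit, so that the mixtures eventually exceed
     it. *)
  have lt_l : expR (g t - sqnorm (z *m Q t) / 4 - eps) < phi (X t) * expR (- (sqnorm (z *m nproj n S (X t)) / 4)).
    rewrite -[phi (X t)]lnK ?posrE ?phi0// -expRD ltr_expR /g /Q.
    clear -eps0; lra.
  have ev := scaled_mixture_limit p0 sS cS cphi phi0 nuE (XS t) s0 rs r2 sl rl lt_l.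
  apply: filterS ev => k hk; rewrite /rotate lnD -[leLHS]expRK.
  by rewrite ler_ln ?posrE ?expR_gt0.
have {main} := main low lim.
have cln : C0_surface n S (fun x => ln (phi x)).
  move=> c u cu; apply: (continuous_comp (C0_phi cphi cu)); apply: continuous_ln.
  by apply: phi0; have [] := chart_parS cu.
have intE := integral_gaussian p0 sS cS cphi phi0 nuE.
rewrite (intE _ (fun x => ln (phi x)) cln); last by move=> x _; exact: mulrC.
rewrite (intE _ (fun x => sqnorm (eta n S phi x)) (C0_surface_sqnorm (C0_eta cphi phi0))); last first.
  move=> x Sx; rewrite /eta sqnormZ; field; exact: lt0r_neq0 (phi0 x Sx).
rewrite (intE _ (fun x => sqnorm (zeta n S x)) (C0_surface_sqnorm (@C0_zeta R n N S))); last first.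
  by move=> x Sx; rewrite /zeta normal_partE mulrC.
rewrite (intE _ (fun=> 1) (@C0_surface_cst R n N S 1)); last by move=> x _; rewrite mul1r.
rewrite RintegralT_cst mul1r.
have isq (f : 'rV[R]_N -> 'rV[R]_N) : (forall j, C0_surface n S (fun x => f x 0 j)) ->
    nu.-integrable setT (EFin \o (fun t => sqnorm (f (X t)))).
  move=> cf; have [b _ hb] := csq f cf.
  apply: (@integrable_bounded _ _ _ nu _ b); first exact: (mre _ (C0_surface_sqnorm cf)).
  by move=> t; rewrite ger0_norm ?sqnorm_ge0// hb.
have -> : \int[nu]_t sqnorm (a t) =
    \int[nu]_t sqnorm (eta n S phi (X t)) + \int[nu]_t sqnorm (zeta n S (X t)).
  rewrite -RintegralD//; last 2 first.
  - exact: (isq _ (C0_eta cphi phi0)).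
  - exact: (isq _ (@C0_zeta R n N S)).
  by apply: eq_Rintegral => t _; exact: sqnorm_gaussian_drift.
by move=> h'; rewrite -addrA -opprD lerBlDr.
Qed.
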